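(* On a suitable probability space $(\Omega,\mathcal A,\mathbb P)$, there exist two sequences $\{\mathcal B_N^{+}(v):0\le v\le 1\}$ and $\{\mathcal B_N^{-}(v):0\le v\le 1\}$, $N=1,2,\ldots$, of Brownian bridges satisfying the distributional identities (as processes in $0\le v\le 1$, for each choice of sign $\pm$) $$\mathcal B_N^{\pm}(H_m(v))\stackrel{d}{=}\mathcal B_N^{\pm}(H_m(v))-8(2m+1)\frac{(2m-1)!}{2m((m-1)!)^2}(v(1-v))^m\int_0^1\mathcal B_N^{\pm}(H_m(s))\,ds,$$ and such that, as $N\to\infty$, $$\sup_{0\le v\le 1}\Big|\gamma_{N;n_1,n_2}(v)-\Big\{\mathcal B_N^{+}(H_m(v))-4(2m+1)\frac{(2m-1)!}{2m((m-1)!)^2}\big(1+\sqrt{R_{N,m}}\big)(v(1-v))^m\int_0^1\mathcal B_N^{+}(H_m(s))\,ds\Big\}\Big|=O_{\mathbb P}\big(N^{-1/4}(\log N)^{1/2}\big)$$ and $$\sup_{0\le v\le 1}\Big|\gamma_{N;n_1,n_2}(v)-\Big\{\mathcal B_N^{-}(H_m(v))-4(2m+1)\frac{(2m-1)!}{2m((m-1)!)^2}\big(1-\sqrt{R_{N,m}}\big)(v(1-v))^m\int_0^1\mathcal B_N^{-}(H_m(s))\,ds\Big\}\Big|=O_{\mathbb P}\big(N^{-1/4}(\log N)^{1/2}\big),$$ where $$R_{N,m}=1-\frac{m}{2m+1}\Big[\frac{N+1}{N+1+P}+\frac{N+1}{N+1+Q}\Big]=1-\frac{m}{2m+1}\B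ig[\frac{N+1}{N_1+1}+\frac{N+1}{N_2+1}\Big].$$
   Context: Fix an integer $m\ge1$. Let $\{X_n:n\ge1\}$ and $\{Y_n:n\ge1\}$ be two independent sequences of i.i.d. random variables, uniform on $(0,1)$. Let $X_{1,n_1}<\dots<X_{n_1,n_1}$ and $Y_{1,n_2}<\dots<Y_{n_2,n_2}$ be the order statistics of $X_1,\dots,X_{n_1}$ and $Y_1,\dots,Y_{n_2}$, and put $X_{0,n_1}=Y_{0,n_2}=0$, $X_{n_1+1,n_1}=Y_{n_2+1,n_2}=1$. Put $N_1=\lfloor (n_1+1)/m\rfloor-1$ and $N_2=\lfloor (n_2+1)/m\rfloor-1$. For each integer $N\ge1$, the sample sizes $n_1=n_1(N)$, $n_2=n_2(N)$ are such that $N\le N_1\wedge N_2$; set $P=P(N)=N_1-N\ge0$ and $Q=Q(N)=N_2-N\ge0$. Standing assumption: as $N\to\infty$, $P/(N+1)\to c\in[0,\infty]$ and $Q/(N+1)\to d\in[0,\infty]$. Choose indices $0\le i_0<\dots<i_N\le n_1-m+1$ and $0\le j_0<\dots<j_N\le n_2-m+1$ with $i_{k+1}-i_k\ge m$ and $j_{k+1}-j_k\ge m$ for $0\le k\le N-1$ (the indices may depend on $N,n_1,n_2$). The disjoint $m$-spacings are $S^{(m)}_{k,N;X}=X_{i_k+m,n_1}-X_{i_k,n_1}$ and $S^{(m)}_{k,N;Y}=Y_{j_k+m,n_2}-Y_{j_k,n_2}$, $0\le k\le N$, and their ratios are $$R_{k;n_1,n_2}=\frac{(N_1+1)S^{(m)}_{k,N;X}}{(N_1+1)S^{(m)}_{k,N;X}+(N_2+1)S^{(m)}_{k,N;Y}}.$$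 Let $H_{N;n_1,n_2}(x)=\frac1{N+1}\sum_{k=0}^N 1_{\{R_{k;n_1,n_2}\le x\}}$, let $H_m(x)=\frac{(2m-1)!}{((m-1)!)^2}\int_0^x t^{m-1}(1-t)^{m-1}dt$ ($0\le x\le1$) be the distribution function of the Beta$(m,m)$ law, and set $$\gamma_{N;n_1,n_2}(x)=(N+1)^{1/2}\big(H_{N;n_1,n_2}(x)-H_m(x)\big),\quad 0\le x\le1.$$ ''On a suitable probability space'' means that the $X_n,Y_n$ may be realized on a (possibly different or enlarged) probability space which also carries the asserted objects. A Brownian bridge is a centered Gaussian process $B$ on $[0,1]$ with continuous paths and $\mathbb E(B(u)B(v))=u\wedge v-uv$. $O_{\mathbb P}(\cdot)$ denotes boundedness in probability after division by the indicated rate. *)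

(* Defs.v *)
From HB Require Import structures.
From mathcomp Require Import all_boot all_order all_algebra.
From mathcomp Require Import all_classical all_reals all_analysis.

Set Implicit Arguments.
Unset Strict Implicit.
Unset Printing Implicit Defensive.

Import Order.TTheory GRing.Theory Num.Theory.
Import numFieldNormedType.Exports.

Local Open Scope classical_set_scope.
Local Open Scope ring_scope.

Section spacings.
Context {R : realType}.
Implicit Types (x y : nat -> R) (m n k N : nat).

(* The samples are indexed from 0: [x n] stands for the observation of rank
   [n + 1], so that a sample of size [n] is [x 0, ..., x (n - 1)].
   [order_stat x n k] is X_{k,n} for 0 <= k <= n + 1, with X_{0,n} = 0 and
   X_{n+1,n} = 1 (the default value of [nth]). *)
Definition order_stat x n k : R := nth 1 (0 :: sort <=%R (mkseq x n)) k.

Definition m_spacing m x n k : R := order_stat x n (k + m) - order_stat x n k.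

(* N_1 and N_2, as functions of n_1 and n_2. The predecessor is truncated at 0,
   but [1 <= N <= nblocks m n] excludes the case n + 1 < m. *)
Definition nblocks m n : nat := (n.+1 %/ m).-1.

(* P(N) and Q(N); the subtraction is only used when [N <= nblocks m n]. *)
Definition excess m n N : nat := nblocks m n - N.

(* 0 <= i_0 < ... < i_N <= n - m + 1, with consecutive gaps at least m. *)
Definition admissible m n N (i : nat -> nat) : Prop :=
  (forall k, (k < N)%N -> (i k < i k.+1)%N /\ (i k + m <= i k.+1)%N) /\
  (i N + m <= n.+1)%N.

Definition spacing_ratio m n1 n2 x y (i j : nat) : R :=
  let sx := (nblocks m n1).+1%:R * m_spacing m x n1 i in
  let sy := (nblocks m n2).+1%:R * m_spacing m y n2 j in
  sx / (sx + sy).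

Definition ratio_edf m n1 n2 N (i j : nat -> nat) x y (v : R) : R :=
  (N.+1%:R)^-1 *
  \sum_(k < N.+1) (spacing_ratio m n1 n2 x y (i k) (j k) <= v)%R%:R.

(* (2m-1)! / ((m-1)!)^2 *)
Definition beta_const m : R := ((2 * m).-1)`!%:R / ((m.-1)`!%:R) ^+ 2.

Definition Hbeta m (v : R) : R :=
  beta_const m *
  \int[lebesgue_measure]_(t in `[0, v]) (t ^+ m.-1 * (1 - t) ^+ m.-1).

Definition gamma_process m n1 n2 N (i j : nat -> nat) x y (v : R) : R :=
  Num.sqrt N.+1%:R * (ratio_edf m n1 n2 N i j x y v - Hbeta m v).

(* R_{N,m}; see [Rcoef_nblocks] for its second expression. *)
Definition Rcoef m n1 n2 N : R :=
  1 - m%:R / (2 * m + 1)%:R *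
      (N.+1%:R / (N.+1 + excess m n1 N)%:R +
       N.+1%:R / (N.+1 + excess m n2 N)%:R).

Lemma Rcoef_nblocks m n1 n2 N :
  (N <= nblocks m n1)%N -> (N <= nblocks m n2)%N ->
  Rcoef m n1 n2 N =
  1 - m%:R / (2 * m + 1)%:R *
      (N.+1%:R / (nblocks m n1).+1%:R + N.+1%:R / (nblocks m n2).+1%:R).
Proof. by move=> h1 h2; rewrite /Rcoef /excess !addSn !subnKC. Qed.

End spacings.

Section processes.
Context d (Omega : measurableType d) {R : realType} (P : probability Omega R).

Definition mutually_independent (X : nat -> {RV P >-> R}) : Prop :=
  forall (s : seq nat) (A : nat -> set R), uniq s ->
    (forall n, measurable (A n)) ->
    P (\bigcap_(n in [set` s]) (X n @^-1` A n)) =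
    (\prod_(n <- s) P (X n @^-1` A n))%E.

Definition iid_uniform01 (X : nat -> {RV P >-> R}) : Prop :=
  mutually_independent X /\
  forall n (A : set R), measurable A ->
    distribution P (X n) A = uniform_prob (@ltr01 R) A.

Definition sigma_of_sequence (X : nat -> {RV P >-> R}) : set (set Omega) :=
  <<s \bigcup_n preimage_set_system setT (X n) measurable >>.

Definition independent_sequences (X Y : nat -> {RV P >-> R}) : Prop :=
  forall A B, sigma_of_sequence X A -> sigma_of_sequence Y B ->
    P (A `&` B) = (P A * P B)%E.

(* Degenerate normal laws are Dirac masses; [normal_prob m 0] is not. *)
Definition gaussian_law (nu : set R -> \bar R) : Prop :=
  (exists mu : R, forall A, measurable A -> nu A = \d_mu A) \/
  (exists mu sigma : R, 0 < sigma /\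
    forall A, measurable A -> nu A = normal_prob mu sigma A).

(* A process indexed by [0, 1] is a function of type [R -> Omega -> R], of
   which only the values at times in [0, 1] matter. *)
Definition gaussian_process (B : R -> Omega -> R) : Prop :=
  forall n (t a : 'I_n -> R), (forall k, t k \in `[0, 1]) ->
    gaussian_law (pushforward P (fun w => \sum_(k < n) a k * B (t k) w)).

Definition brownian_bridge (B : R -> Omega -> R) : Prop :=
  [/\ forall u : R, u \in `[0, 1] -> measurable_fun setT (B u),
      forall w, {within `[0, 1], continuous (fun u => B u w)},
      gaussian_process B,
      forall u : R, u \in `[0, 1] -> ('E_P[B u] = 0)%E &
      forall u v : R, u \in `[0, 1] -> v \in `[0, 1] ->
        ('E_P[(fun w => B u w * B v w)%R] = (Num.min u v - u * v)%:E)%E].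

(* The sigma-algebra on paths generated by the evaluations at times in [0, 1]:
   the law of a process on [0, 1] is its image measure on this sigma-algebra. *)
Definition path_events : set (set (R -> R)) :=
  <<s \bigcup_(u in `[0, 1])
        preimage_set_system setT (fun f : R -> R => f u) measurable >>.

Definition eq_in_law (U V : R -> Omega -> R) : Prop :=
  forall E, path_events E ->
    P [set w | E (fun v => U v w)] = P [set w | E (fun v => V v w)].

(* B(H_m(v)) *)
Definition time_changed m (B : R -> Omega -> R) (v : R) (w : Omega) : R :=
  B (Hbeta m v) w.

(* B(H_m(v)) - a (2m+1) (2m-1)!/(2m ((m-1)!)^2) (v(1-v))^m int_0^1 B(H_m(s)) ds *)
Definition corrected m (a : R) (B : R -> Omega -> R) (v : R) (w : Omega) : R :=
  time_changed m B v w -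
  a * (2 * m + 1)%:R * (((2 * m).-1)`!%:R / ((2 * m)%:R * (m.-1)`!%:R ^+ 2)) *
  (v * (1 - v)) ^+ m *
  \int[lebesgue_measure]_(s in `[0, 1]) time_changed m B s w.

Definition sup_dist01 (U V : R -> Omega -> R) (w : Omega) : \bar R :=
  ereal_sup [set `|U v w - V v w|%:E | v in `[0, 1]].

(* Z_N = O_P(r_N). The event {|Z_N| > K r_N} is bounded through a measurable
   superset, i.e. in outer probability, so that no measurability of Z_N has to
   be presupposed; when Z_N is measurable this is P(|Z_N| > K r_N) <= eps. *)
Definition bigO_P (Z : nat -> Omega -> \bar R) (r : nat -> R) : Prop :=
  forall eps : R, 0 < eps -> exists K : R, \forall N \near \oo,
    exists A : set Omega,
      [/\ measurable A,
          [set w | ((K * r N)%:E < `|Z N w|)%E] `<=` A &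
          (P A <= eps%:E)%E].

End processes.

(* N^{-1/4} (log N)^{1/2} *)
Definition rate {R : realType} (N : nat) : R :=
  N%:R `^ (- 4^-1) * Num.sqrt (ln N%:R).

(* Main.v *)
Require Import Defs.
From HB Require Import structures.
From mathcomp Require Import all_boot all_order all_algebra.
From mathcomp Require Import all_classical all_reals all_analysis.
From mathcomp Require Import ring lra zify.
From mathcomp Require Import measurable_realfun.

(* The spacings of a uniform sample are exponential variables divided by their sum.
   Hence a ratio of disjoint m-spacings is, up to a common odds factor r close to 1,
   V_k = G_k / (G_k + G'_k), where the V_k are i.i.d. Beta(m, m), independent of the
   S_k = G_k + G'_k. So gamma_N(v) is the empirical process of the H_m(V_k) at H_m(v)
   plus a multiple of (v(1-v))^m sqrt(N) (r - 1), and sqrt(N) (r - 1) is, up to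
   O(N^{-1/2}), a combination of the integral of that empirical process and of a sum
   which is nearly normal given the V_k. The order statistics of the H_m(V_k) come in
   turn from exponential variables; the quantile transform maps their sums over about
   sqrt(N) blocks to normal variables, the coefficients of a Brownian bridge. Finally
   the integral of the bridge is exchanged with a fresh normal variable, and a rotation
   of its normalized value and of the normal variable of the second sum gives the
   integrals of the two bridges, whence the weights 1 + sqrt R and 1 - sqrt R. *)

Set Implicit Arguments.
Unset Strict Implicit.
Unset Printing Implicit Defensive.

Import Order.TTheory GRing.Theory Num.Theory.
Import numFieldNormedType.Exports.

Local Open Scope classical_set_scope.
Local Open Scope ring_scope.

Local Notation mtype := measurableType.
Local Notation measT := (measurable_fun setT).
Local Notation mcomp := measurableT_comp.
Local Notation measM := measurable_funM.
Local Notation measB := measurable_funB.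
Local Notation measD := measurable_funD.
Local Notation measX := measurable_funX.
Local Notation emeasM := emeasurable_funM.
Local Notation meas_pair := measurable_fun_pair.
Local Notation meas_ind h := (mcomp _ (measurable_indic h)).
Local Notation measE := measurable_EFinP.
Local Notation cont_meas := continuous_measurable_fun.
Local Notation prob := probability.
Local Notation sqrt := Num.sqrt.

(** Let g be the fresh normal variable that takes the place of the normalized integral. The process
    corrected with coefficient 4 x is [bridge_core] minus (1 - x) [rho] [sig] g. So coefficient 8
    reflects g, which preserves the law, and x = 1 + sqrt R, x = 1 - sqrt R give g the weights sqrt
    R and - sqrt R; R compares the variance of what gamma_N contains besides [bridge_core] with that
    of the integral direction of a bridge. The statement couples gamma_N and its bridges for each N
    separately, so one space with two uniform samples, some exponentials and a normal variable
    carries everything, and each claim about laws says that an explicit map is measure preserving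
    ([mp]). About sqrt N blocks of about sqrt N exponentials balance two errors: the oscillation
    inside a block, of order N^(1/4) (log N)^(1/2), and the sum of sqrt N centered residuals of
    bounded variance, of order N^(1/4). The second sum has weights depending on the V_k; about
    N^(1/4) cells make them constant on cells up to N^(-1/4). *)

Lemma le_of_eq d (T : porderType d) (x y : T) : x = y -> (x <= y)%O.
Proof. by move=> ->. Qed.

Lemma normD_le (R : realType) (x y a b : R) :
  `|x| <= a -> `|y| <= b -> `|x + y| <= a + b.
Proof. by move=> h1 h2; apply: (le_trans (ler_normD _ _)); exact: lerD. Qed.

Lemma sqr_normr (R : realType) (x : R) : `|x| ^+ 2 = x ^+ 2.
Proof. exact: real_normK (num_real x). Qed.

(** * Measure-preserving maps between probability spaces *)

Section measure_preserving.
Context {R : realType}.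

Definition prodP d1 d2 (T1 : mtype d1) (T2 : mtype d2) (P1 : prob T1 R) (P2 : prob T2 R) : prob (T1
 * T2)%type R := (P1 \x P2)%E.

(** Laws, joint laws and independence (through product measures) are all phrased in this form
    because it composes: a long construction is a chain of such maps. *)
Definition mp d d' (T : mtype d) (T' : mtype d') (P : prob T R) (Q : prob T' R) (f : T -> T') : Prop
 := measT f /\ forall A, measurable A -> P (f @^-1` A) = Q A.

Definition law d d' (T : mtype d) (T' : mtype d') (P : prob T R) (f : T -> T') (mf : measT f) : prob
 T' R := distribution P (HB.pack_for {mfun T >-> T'} f (isMeasurableFun.Build _ _ _ _ f mf)).

Lemma mp_law d d' (T : mtype d) (T' : mtype d') (P : prob T R) (f : T -> T') (mf : measT f) : mp P
 (law P mf) f.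
Proof. by split. Qed.

Lemma meas_preim d d' (T : mtype d) (T' : mtype d') (f : T -> T') A : measT f -> measurable A ->
 measurable (f @^-1` A).
Proof. by move=> mf mA; rewrite -[_ @^-1` _]setTI; exact: mf. Qed.

Lemma mp_comp d d' d'' (T : mtype d) (T' : mtype d') (T'' : mtype d'') (P : prob T R) (Q : prob T'
 R) (Q' : prob T'' R) (f : T -> T') (g : T' -> T'') : mp P Q f -> mp Q Q' g -> mp P Q' (g \o f).
Proof.
move=> [mf PQ] [mg QQ']; split; first exact: mcomp.
by move=> A mA; rewrite comp_preimage PQ ?QQ'//; exact: meas_preim.
Qed.

(** Serves when [f] is a transformation with known image law: the law of [g] is read off from
    [g \o f], typically a simplification to a projection or the identity, without computing
    preimages under [g]. *)
Lemma mp_cancel d d' d'' (T : mtype d) (T' : mtype d') (T'' : mtype d'') (P : prob T R) (Q : prob T'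
 R) (Q' : prob T'' R) (f : T -> T') (g : T' -> T'') : measT g -> mp P Q f -> mp P Q' (g \o f) -> mp
 Q Q' g.
Proof.
move=> mg [mf PQ] [mgf PQ']; split => // A mA.
by rewrite -PQ ?PQ'//; exact: meas_preim.
Qed.

Lemma mp_id d (T : mtype d) (P : prob T R) : mp P P id.
Proof. by split. Qed.

Lemma mp_eqfun d d' (T : mtype d) (T' : mtype d') (P : prob T R) (Q : prob T' R) (f g : T -> T') : f
 =1 g -> mp P Q f -> mp P Q g.
Proof. by move=> /funext ->. Qed.

Lemma mp_ae d d' (T : mtype d) (T' : mtype d') (P : prob T R) (Q : prob T' R) (f g : T -> T') (Z :
 set T) : measT g -> measurable Z -> P Z = 0%E -> (forall x, ~ Z x -> f x = g x) -> mp P Q f -> mp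
 P Q g.
Proof.
move=> mg mZ PZ fg [mf PQ]; split=> // A mA; rewrite -PQ//.
have mgA := meas_preim mg mA.
have mfA := meas_preim mf mA.
have E (h : T -> T') : measT h -> P (h @^-1` A) = P (h @^-1` A `\` Z).
 move=> mh; have mhA := meas_preim mh mA.
 have PhZ : P (h @^-1` A `&` Z) = 0%E.
  apply/eqP; rewrite eq_le measure_ge0 andbT -PZ.
  by apply: le_measure; rewrite ?inE//; exact: measurableI.
 rewrite -[RHS]add0e -PhZ -measureU.
 - by rewrite setUIDK.
 - exact: measurableI.
 - exact: measurableD.
 - by rewrite -subset0 => x [[_ Zx] [_ nZx]].
rewrite (E f)// (E g)//; congr (P _); apply/seteqP.
by split=> x [/= h nZ]; split => //=; [rewrite fg|rewrite -fg].
Qed.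

Lemma mp_ge0_integral d d' (T : mtype d) (T' : mtype d') (P : prob T R) (Q : prob T' R) (f : T ->
 T') (g : T' -> \bar R) : mp P Q f -> measT g -> (forall y, (0 <= g y)%E) -> (\int[Q]_y g y =
 \int[P]_x g (f x))%E.
Proof.
move=> [mf PQ] mg g0.
have -> : (\int[Q]_y g y = \int[law P mf]_y g y)%E.
 by apply: eq_measure_integral => A mA _; first [exact: PQ|exact/esym/PQ].
by rewrite /law ge0_integral_distribution.
Qed.

Lemma finite_measure_unique d (T : mtype d) (G : set (set T)) (m1 m2 : {measure set T -> \bar R}) :
 d.-measurable = <<s G >> -> setI_closed G -> G setT -> (m1 setT < +oo)%E -> (forall A, G A -> m1 A
 = m2 A) -> forall A, measurable A -> m1 A = m2 A.
Proof.
move=> GE GI GT m1T m12 A mA.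
apply: (@measure_unique _ _ _ G (fun=> setT)) => //.
by rewrite bigcup_const.
Qed.

Lemma mp_intro d d' (T : mtype d) (T' : mtype d') (P : prob T R) (Q : prob T' R) (f : T -> T') (G :
 set (set T')) : d'.-measurable = <<s G >> -> setI_closed G -> G setT -> measT f -> (forall A, G A
 -> P (f @^-1` A) = Q A) -> mp P Q f.
Proof.
move=> GE GI GT mf PQ; split => // A mA.
rewrite -[LHS]/(law P mf A).
apply: (finite_measure_unique GE) => //.
exact: (le_lt_trans (probability_le1 (law P mf) measurableT) (ltry 1)).
Qed.

End measure_preserving.

(** * Product probabilities *)

Section product_probability.
Context {R : realType} d1 d2 (T1 : mtype d1) (T2 : mtype d2).
Context (P1 : prob T1 R) (P2 : prob T2 R).
Local Open Scope ereal_scope.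

Lemma prodPX A B : measurable A -> measurable B -> prodP P1 P2 (A `*` B) = P1 A * P2 B.
Proof. exact: product_measure1E. Qed.

Lemma prodPE E : prodP P1 P2 E = \int[P1]_x P2 [set y | E (x, y)].
Proof.
rewrite [LHS]/(\int[P1]_x _); apply: eq_integral => x _ /=; congr (P2 _).
by rewrite /xsection/=; apply/seteqP; split => y /=; rewrite in_setE.
Qed.

Lemma prodP_ge0_integral (f : T1 * T2 -> \bar R) : measT f -> (forall z, 0 <= f z) -> \int[prodP P1
 P2]_z f z = \int[P1]_x \int[P2]_y f (x, y).
Proof. by move=> mf f0; rewrite [LHS]fubini_tonelli1. Qed.

Lemma meas_pairl (x : T1) : measT (fun y : T2 => (x, y)).
Proof. exact: pair1_measurable. Qed.

Lemma mp_fst : mp (prodP P1 P2) P1 fst.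
Proof.
split; first exact: measurable_fst.
move=> A mA; rewrite (_ : fst @^-1` A = A `*` setT); last first.
 by apply/seteqP; split=> -[x y] //= [].
by rewrite prodPX// probability_setT mule1.
Qed.

Lemma mp_snd : mp (prodP P1 P2) P2 snd.
Proof.
split; first exact: measurable_snd.
move=> A mA; rewrite (_ : snd @^-1` A = setT `*` A); last first.
 by apply/seteqP; split=> -[x y] //= [].
by rewrite prodPX// probability_setT mul1e.
Qed.

End product_probability.

(** * Joint laws and independence *)

Section mp_product.
Context {R : realType}.

Lemma mp_pairX d d1 d2 (T : mtype d) (T1 : mtype d1) (T2 : mtype d2) (P : prob T R) (Q1 : prob T1 R)
 (Q2 : prob T2 R) (f : T -> T1 * T2) : measT f -> (forall A B, measurable A -> measurable B -> P (f
 @^-1` (A `*` B)) = (Q1 A * Q2 B)%E) -> mp P (prodP Q1 Q2) f.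
Proof.
move=> mf H; split=> // A mA; apply/esym.
by apply: (product_measure_unique (m' := law P mf)).
Qed.

(** Uniqueness of finite measures on a pi-system extends the product formula in one coordinate while
    the other is fixed ([key]); using it once for each coordinate goes from generators to all
    rectangles. *)
Lemma mp_pair d d1 d2 (T : mtype d) (T1 : mtype d1) (T2 : mtype d2) (P : prob T R) (Q1 : prob T1 R)
 (Q2 : prob T2 R) (f1 : T -> T1) (f2 : T -> T2) G1 G2 : d1.-measurable = <<s G1 >> -> setI_closed
 G1 -> G1 setT -> d2.-measurable = <<s G2 >> -> setI_closed G2 -> G2 setT -> measT f1 -> measT f2
 -> (forall A B, G1 A -> G2 B -> P (f1 @^-1` A `&` f2 @^-1` B) = (Q1 A * Q2 B)%E) -> mp P (prodP Q1
 Q2) (fun x => (f1 x, f2 x)).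
Proof.
move=> G1E G1I G1T G2E G2I G2T mf1 mf2 H.
have G1m A : G1 A -> measurable A by move=> GA; rewrite G1E; exact: sub_gen_smallest.
have G2m A : G2 A -> measurable A by move=> GA; rewrite G2E; exact: sub_gen_smallest.
have key d' d'' (T' : mtype d') (T'' : mtype d'') (Q' : prob T' R) (Q'' : prob T'' R) (g' : T -> T')
 (g'' : T -> T'') G A : measT g' -> measT g'' -> d''.-measurable = <<s G >> -> setI_closed G -> G
 setT -> measurable A -> (forall B, G B -> P (g' @^-1` A `&` g'' @^-1` B) = (Q' A * Q'' B)%E) ->
 (forall B, measurable B -> P (g' @^-1` A `&` g'' @^-1` B) = (Q' A * Q'' B)%E).
 move=> mg' mg'' GE GI GT mA HG B mB.
 have mgA := meas_preim mg' mA.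
 have QA0 : (0 <= fine (Q' A))%R by rewrite fine_ge0.
 pose Pr : {measure set T -> \bar R} := mrestr P mgA.
 pose n0 : {measure set T'' -> \bar R} := pushforward Pr g''.
 pose n1 := n0 mg''.
 pose n2 : {measure set T'' -> \bar R} := mscale (NngNum QA0) Q''.
 have n12 C : G C -> n1 C = n2 C.
  move=> GC; transitivity (Q' A * Q'' C)%E.
   by rewrite -(HG _ GC) setIC.
  by rewrite /n2 /= /mscale/= fineK// fin_num_measure.
 have n1T : (n1 setT < +oo)%E.
  rewrite [X in (X < _)%E]/(P (g'' @^-1` setT `&` g' @^-1` A)).
  apply: (le_lt_trans (probability_le1 P _) (ltry 1)).
  by apply: measurableI => //; rewrite preimage_setT.
 have E := finite_measure_unique GE GI GT n1T n12 mB.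
 transitivity (n1 B); first by rewrite setIC.
 by rewrite E /n2 /= /mscale/= fineK// fin_num_measure.
apply: mp_pairX; first exact: meas_pair.
move=> A B mA mB; rewrite -[_ @^-1` _]/(f1 @^-1` A `&` f2 @^-1` B).
rewrite setIC muleC.
apply: (key _ _ _ _ _ _ _ _ G1) => // A' GA'.
rewrite setIC muleC; apply: (key _ _ _ _ _ _ _ _ G2) => //.
 exact: G1m.
by move=> B' GB'; exact: H.
Qed.

Lemma meas_setIclosed d (T : mtype d) : setI_closed (d.-measurable : set (set T)).
Proof. by move=> A B; exact: measurableI. Qed.

Lemma meas_genE d (T : mtype d) : (d.-measurable : set (set T)) = <<s d.-measurable >>.
Proof. by rewrite sigma_algebra_id//; exact: sigma_algebra_measurable. Qed.

(** Fubini: if the law of [f (x, _)] is the same for all [x], then [f] is independent of the first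
    coordinate. In this way a normalization that depends on the V_k still yields a normal variable
    independent of them. *)
Lemma mp_fiber d1 d2 d3 (T1 : mtype d1) (T2 : mtype d2) (T3 : mtype d3) (P1 : prob T1 R) (P2 : prob
 T2 R) (Q : prob T3 R) (f : T1 * T2 -> T3) : measT f -> (forall x, mp P2 Q (fun y => f (x, y))) ->
 mp (prodP P1 P2) (prodP P1 Q) (fun p => (p.1, f p)).
Proof.
move=> mf H; apply: mp_pairX.
 by apply: meas_pair => //; exact: measurable_fst.
move=> A B mA mB; rewrite prodPE.
rewrite (eq_integral (fun x => (Q B * (\1_A x)%:E)%E)); last first.
 move=> x _; have [xA|xA] := boolP (x \in A); rewrite indicE.
  rewrite xA mule1 -(H x).2//; congr (P2 _); apply/seteqP.
  by split=> [y [_]//|y By]; split => //; rewrite inE in xA.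
 rewrite (negbTE xA) mule0 [X in P2 X](_ : _ = set0) ?measure0//.
 by apply/seteqP; split => // y [/= Ax _]; rewrite notin_setE in xA.
rewrite ge0_integralZl//; last exact: mcomp.
by rewrite integral_indic// setIT muleC.
Qed.

Lemma mp_prod d1 d2 d3 d4 (T1 : mtype d1) (T2 : mtype d2) (T3 : mtype d3) (T4 : mtype d4) (P1 : prob
 T1 R) (P2 : prob T2 R) (Q1 : prob T3 R) (Q2 : prob T4 R) f g : mp P1 Q1 f -> mp P2 Q2 g -> mp
 (prodP P1 P2) (prodP Q1 Q2) (fun p => (f p.1, g p.2)).
Proof.
move=> [mf Hf] [mg Hg]; apply: mp_pairX.
 by apply: meas_pair; apply: mcomp => //.
move=> A B mA mB; rewrite -Hf// -Hg//.
rewrite -[_ @^-1` _]/((f @^-1` A) `*` (g @^-1` B)).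
by rewrite prodPX//; exact: meas_preim.
Qed.

Lemma mp_swap d1 d2 (T1 : mtype d1) (T2 : mtype d2) (P1 : prob T1 R) (P2 : prob T2 R) : mp (prodP P1
 P2) (prodP P2 P1) (fun p => (p.2, p.1)).
Proof.
apply: mp_pairX.
 by apply: meas_pair; [exact: measurable_snd|exact: measurable_fst].
move=> A B mA mB; rewrite (_ : _ @^-1` _ = B `*` A); last first.
 by apply/seteqP; split=> -[x y] [].
by rewrite prodPX// muleC.
Qed.

Section mp_assoc.
Context d1 d2 d3 (T1 : mtype d1) (T2 : mtype d2) (T3 : mtype d3).
Context (P1 : prob T1 R) (P2 : prob T2 R) (P3 : prob T3 R).

Lemma mp_assoc : mp (prodP P1 (prodP P2 P3)) (prodP (prodP P1 P2) P3) (fun p => ((p.1, p.2.1),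
 p.2.2)).
Proof.
pose G := [set C : set (T1 * T2) | exists A B, [/\ measurable A, measurable B & C = A `*` B]].
apply: (@mp_pair _ _ _ _ _ _ _ _ _ (fun p : T1 * (T2 * T3) => (p.1, p.2.1)) (fun p => p.2.2) G
 measurable) => //.
- rewrite measurable_prod_measurableType; congr (<<s _ >>).
 apply/seteqP; split => [_ [A mA [B mB <-]]|_ [A [B [mA mB ->]]]].
  by exists A, B.
 by exists A => //; exists B.
- move=> _ _ [A [B [mA mB ->]]] [A' [B' [mA' mB' ->]]].
 by exists (A `&` A'), (B `&` B'); rewrite setXI; split => //; exact: measurableI.
- by exists setT, setT; rewrite setXTT.
- exact: meas_genE.
- exact: meas_setIclosed.
- by apply: meas_pair => //; exact: mcomp.
- by apply: mcomp => //; exact: mcomp.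
- move=> _ C [A [B [mA mB ->]]] mC.
 rewrite (_ : _ `&` _ = A `*` (B `*` C)).
  by rewrite prodPX//; [rewrite !prodPX// muleA|exact: measurableX].
 by apply/seteqP; split=> -[x [y z]] /=; [move=> [[]]|move=> [? []]].
Qed.

Lemma mp_assocV : mp (prodP (prodP P1 P2) P3) (prodP P1 (prodP P2 P3)) (fun p => (p.1.1, (p.1.2,
 p.2))).
Proof.
apply: (mp_cancel _ mp_assoc).
 apply: meas_pair; first exact: mcomp.
 by apply: meas_pair; [exact: mcomp|].
by apply: (mp_eqfun _ (mp_id _)) => -[x [y z]].
Qed.

End mp_assoc.

Lemma mp_swap12 d1 d2 d3 (T1 : mtype d1) (T2 : mtype d2) (T3 : mtype d3) (P1 : prob T1 R) (P2 : prob
 T2 R) (P3 : prob T3 R) : mp (prodP P1 (prodP P2 P3)) (prodP P2 (prodP P1 P3)) (fun p => (p.2.1,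
 (p.1, p.2.2))).
Proof.
have := mp_comp (mp_comp (mp_assoc P1 P2 P3) (mp_prod (mp_swap P1 P2) (mp_id P3))) (mp_assocV P2 P1
 P3).
exact: mp_eqfun.
Qed.

Lemma mp_interchange d1 d2 d3 d4 (T1 : mtype d1) (T2 : mtype d2) (T3 : mtype d3) (T4 : mtype d4) (P1
 : prob T1 R) (P2 : prob T2 R) (P3 : prob T3 R) (P4 : prob T4 R) : mp (prodP (prodP P1 P2) (prodP
 P3 P4)) (prodP (prodP P1 P3) (prodP P2 P4)) (fun p => ((p.1.1, p.2.1), (p.1.2, p.2.2))).
Proof.
have := mp_comp (mp_comp (mp_assocV P1 P2 (prodP P3 P4)) (mp_prod (mp_id P1) (mp_swap12 P2 P3 P4)))
 (mp_assoc P1 P3 (prodP P2 P4)).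
exact: mp_eqfun.
Qed.

End mp_product.

(** * The space of real sequences and its product measures *)

Section sequence_space.
Context {R : realType}.
Notation RM := (measurableTypeR R).

Definition coord_events : set (set (nat -> R)) := [set A | exists n (B : set RM), measurable B /\ A
 = [set s | B (s n)]].

Definition rseq := g_sigma_algebraType coord_events.

Lemma meas_coord n : measurable_fun [set: rseq] (fun s : rseq => (s n : R)).
Proof.
move=> _ B mB; rewrite setTI; apply: sub_gen_smallest.
by exists n, B.
Qed.

Lemma meas_rseq d (T : mtype d) (f : T -> rseq) : (forall n, measurable_fun [set: T] (fun x => (f x
 n : R))) -> measurable_fun [set: T] f.
Proof.
move=> mf; apply: (@measurability _ _ T rseq setT f coord_events) => //.
by move=> _ [_ [n [B [mB ->]]] <-]; exact: mf.
Qed.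

Definition rects : set (set rseq) := [set A | exists n (B : nat -> set RM), (forall i, measurable (B
 i)) /\ A = [set s | forall i, (i < n)%N -> B i (s i)]].

Lemma meas_rects A : rects A -> measurable A.
Proof.
move=> [n [B [mB ->]]].
rewrite (_ : [set s | _] = \bigcap_(i in [set i | (i < n)%N]) [set s : rseq | B i (s i)]).
 apply: bigcap_measurableType => // i _; apply: sub_gen_smallest.
 by exists i, (B i).
by apply/seteqP; split => s /=.
Qed.

Lemma rects_gen : (measurable : set (set rseq)) = <<s rects >>.
Proof.
apply/seteqP; split.
 apply: smallest_sub; first exact: smallest_sigma_algebra.
 move=> _ [n [B [mB ->]]]; apply: sub_gen_smallest.
 exists n.+1, (fun i => if i == n then B else setT); split.
  by move=> i; case: ifP.
 apply/seteqP; split=> [s Bs i|s /= /(_ n (ltnSn n))]; last by rewrite eqxx.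
 by case: eqP => // ->.
apply: smallest_sub; first exact: sigma_algebra_measurable.
exact: meas_rects.
Qed.

Lemma rects_setI : setI_closed rects.
Proof.
move=> _ _ [n [B [mB ->]]] [n' [B' [mB' ->]]].
exists (maxn n n'), (fun i => (if (i < n)%N then B i else setT) `&` (if (i < n')%N then B' i else
 setT)); split.
 by move=> i; apply: measurableI; case: ifP.
apply/seteqP; split => [s [h h'] i _|s h].
 by split; case: ifP => // ?; [exact: h|exact: h'].
split => i ilt; have /h[] : (i < maxn n n')%N by rewrite leq_max ilt ?orbT.
 by rewrite ilt.
by rewrite ilt.
Qed.

Lemma rects_setT : rects setT.
Proof. by exists 0%N, (fun=> setT); split => //; apply/seteqP; split. Qed.

(** The infinite power of [mu], characterized by its values on finite boxes. It enters as a
    hypothesis in this section; existence is [exists_pow]. *)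
Definition is_pow (mu : prob RM R) (Q : prob rseq R) := forall n (B : nat -> set RM), (forall i,
 measurable (B i)) -> (Q [set s | forall i, (i < n)%N -> B i (s i)] = \prod_(i < n) mu (B i))%E.

Lemma mp_pow d (T : mtype d) (P : prob T R) (Q : prob rseq R) mu (f : T -> rseq) : is_pow mu Q ->
 (forall n, measurable_fun [set: T] (fun x => (f x n : R))) -> (forall n (B : nat -> set RM),
 (forall i, measurable (B i)) -> (P [set x | forall i, (i < n)%N -> B i (f x i)] = \prod_(i < n) mu
 (B i))%E) -> mp P Q f.
Proof.
move=> HQ mf H; apply: (mp_intro rects_gen rects_setI rects_setT).
 exact: meas_rseq.
by move=> _ [n [B [mB ->]]]; rewrite HQ// -H.
Qed.

Lemma is_pow_law d (T : mtype d) (P : prob T R) (mu : prob RM R) (f : T -> rseq) (mf :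
 measurable_fun [set: T] f) : (forall n (B : nat -> set RM), (forall i, measurable (B i)) -> (P
 [set x | forall i, (i < n)%N -> B i (f x i)] = \prod_(i < n) mu (B i))%E) -> is_pow mu (law P mf).
Proof. by []. Qed.

Definition scons (x : R) (s : nat -> R) (n : nat) : R := if n is k.+1 then s k else x.

Lemma meas_scons : measurable_fun [set: RM * rseq] (fun p => scons p.1 p.2 : rseq).
Proof.
apply: meas_rseq => -[|n] /=; first exact: measurable_fst.
exact: (mcomp (meas_coord n) measurable_snd).
Qed.

Lemma mp_cons mu Q : is_pow mu Q -> mp (prodP mu Q) Q (fun p => scons p.1 p.2 : rseq).
Proof.
move=> HQ; apply: (mp_pow HQ) => [n|].
 have := meas_scons => /(mcomp (meas_coord n)); exact.
move=> [|n] B mB.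
 rewrite big_ord0 (_ : [set x | _] = setT) ?probability_setT//.
 by apply/seteqP; split.
rewrite big_ord_recl -(HQ n (fun i => B i.+1)); last by move=> i; exact: mB.
rewrite (_ : [set x | _] = B 0%N `*` [set s : rseq | forall i, (i < n)%N -> B i.+1 (s i)]).
 rewrite prodPX; [by []|exact: mB|apply: meas_rects].
 by exists n, (fun i => B i.+1).
apply/seteqP; split => [[x s] /= h|[x s] /= [Bx Bs] [|i] //=].
 by split; [exact: (h 0%N)|move=> i ilt; exact: (h i.+1)].
by rewrite ltnS; exact: Bs.
Qed.

Lemma pow_seq mu Q (s : seq nat) (B : nat -> set RM) : is_pow mu Q -> uniq s -> (forall i,
 measurable (B i)) -> (Q [set x : rseq | forall i, i \in s -> B i (x i)] = \prod_(i <- s) mu (B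
 i))%E.
Proof.
move=> HQ us mB.
pose n := (\max_(i <- s) i).+1.
have sn i : i \in s -> (i < n)%N.
 by move=> si; rewrite ltnS; exact: leq_bigmax_seq.
rewrite (_ : [set x | _] = [set x : rseq | forall i, (i < n)%N -> (if i \in s then B i else setT) (x
 i)]).
 rewrite (HQ n (fun i => if i \in s then B i else setT)); last first.
  by move=> i; case: ifP.
 rewrite -(big_mkord xpredT (fun i => mu (if i \in s then B i else setT))).
 rewrite (bigID (mem s))/= [X in (_ * X)%E]big1 ?mule1; last first.
  by move=> i /negbTE ->; exact: probability_setT.
 rewrite -big_filter (eq_big_seq (fun i => mu (B i))); last first.
  by move=> i; rewrite mem_filter => /andP[->].
 apply: perm_big; apply: uniq_perm => //.
  by rewrite filter_uniq// iota_uniq.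
 move=> i; rewrite mem_filter mem_index_iota leq0n/=.
 by case: (boolP (i \in s)) => //= /sn ->.
apply/seteqP; split => [x h i ilt|x h i si].
 by case: ifPn => // /h.
by have := h i (sn i si); rewrite si.
Qed.

Let big_iota_ord n (F : nat -> \bar R) : (\prod_(i <- iota 0 n) F i = \prod_(i < n) F i)%E.
Proof. by rewrite -(big_mkord xpredT F) /index_iota subn0. Qed.

Lemma mp_reindex mu Q (a : nat -> nat) : is_pow mu Q -> injective a -> mp Q Q (fun s => s \o a :
 rseq).
Proof.
move=> HQ ainj; apply: (mp_pow HQ) => [n|n B mB].
 exact: meas_coord.
have [B' B'E] : exists B' : nat -> set RM, (forall i, measurable (B' i)) /\ forall i, B' (a i) = B
 i.
 exists (fun j => if pselect (exists i, a i = j) is left e then B (projT1 (cid e)) else setT);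
  split.
  by move=> i; case: pselect.
 by move=> i; case: pselect => [e|[]]; [case: cid => k /= /ainj ->|exists i].
rewrite (_ : [set x | _] = [set x : rseq | forall i, i \in map a (iota 0 n) -> B' i (x i)]).
 rewrite (pow_seq HQ); [|by rewrite map_inj_uniq// iota_uniq|by case: B'E].
 rewrite big_map big_iota_ord.
 by apply: eq_bigr => i _; rewrite B'E.2.
apply/seteqP; split => [x h i /mapP[k]|x h i ilt].
 by rewrite mem_iota add0n => /= /h Bk ->; rewrite B'E.2.
have := h (a i); rewrite B'E.2; apply; apply: map_f.
by rewrite mem_iota.
Qed.

(** As the ranges are disjoint, one family [B'] of constraints prescribes both boxes at once, and
    the cylinder formula factors into the two products. *)
Lemma mp_split mu Q (a b : nat -> nat) : is_pow mu Q -> injective a -> injective b -> (forall i j, a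
 i <> b j) -> mp Q (prodP Q Q) (fun s => (s \o a : rseq, s \o b : rseq)).
Proof.
move=> HQ ainj binj ab.
have mr c : measT (fun s : rseq => s \o c : rseq).
 by apply: meas_rseq => n; exact: meas_coord.
apply: (mp_pair rects_gen rects_setI rects_setT rects_gen rects_setI rects_setT) => //.
move=> _ _ [n1 [B1 [mB1 ->]]] [n2 [B2 [mB2 ->]]]; rewrite !HQ//.
have [B' [B'm B'a B'b]] : exists B' : nat -> set RM, [/\ forall i, measurable (B' i), forall i, B'
 (a i) = B1 i & forall i, B' (b i) = B2 i].
 exists (fun j => if pselect (exists i, a i = j) is left e then B1 (projT1 (cid e)) else if pselect
  (exists i, b i = j) is left e then B2 (projT1 (cid e)) else setT); split.
 - by move=> i; case: pselect => // ?; case: pselect.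
 - by move=> i; case: pselect => [e|[]]; [case: cid => k /= /ainj ->|exists i].
 - move=> i; case: pselect => [[k kE]|_]; first by have := ab k i.
  by case: pselect => [e|[]]; [case: cid => k /= /binj ->|exists i].
pose s := map a (iota 0 n1) ++ map b (iota 0 n2).
rewrite (_ : _ `&` _ = [set x : rseq | forall i, i \in s -> B' i (x i)]).
 rewrite (pow_seq HQ)//.
  rewrite big_cat !big_map !big_iota_ord.
  by congr (_ * _)%E; apply: eq_bigr => i _; rewrite (B'a, B'b).
 rewrite cat_uniq !map_inj_uniq// !iota_uniq andbT/=.
 by apply/hasPn => _ /mapP[j _ ->]; apply/negP => /mapP[i _ /esym]; exact: ab.
apply/seteqP; split => [x [/= h1 h2] i|x h].
 rewrite mem_cat => /orP[] /mapP[k]; rewrite mem_iota add0n => /=.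
  by move=> /h1 h -> /=; rewrite B'a.
 by move=> /h2 h -> /=; rewrite B'b.
split => /= i ilt.
 rewrite -B'a; apply: h; rewrite mem_cat; apply/orP; left.
 by apply: map_f; rewrite mem_iota.
rewrite -B'b; apply: h; rewrite mem_cat; apply/orP; right.
by apply: map_f; rewrite mem_iota.
Qed.

Lemma meas_reindex (a : nat -> nat) : measT (fun s : rseq => (fun l => s (a l)) : rseq).
Proof. by apply: meas_rseq => n; exact: meas_coord. Qed.

(** The bijection (i, l) -> 2^i (2 l + 1) - 1. Row 0 is the set of even numbers and row i + 1 is the
    copy of row i inside the odd numbers, which suits an induction that splits off the even
    indices. *)
Definition row_code (i l : nat) : nat := (2 ^ i * l.*2.+1).-1.

Lemma row_code0 l : row_code 0 l = l.*2.
Proof. by rewrite /row_code expn0 mul1n. Qed.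

Lemma row_codeS i l : row_code i.+1 l = (row_code i l).*2.+1.
Proof.
rewrite /row_code expnS -mulnA mul2n.
case: (2 ^ i * l.*2.+1)%N (muln_gt0 (2 ^ i) l.*2.+1) => [|k] //.
by rewrite expn_gt0.
Qed.

(** The even indices carry row 0 and the odd ones a copy of all the remaining rows. [mp_split] makes
    the two parts independent, and the induction hypothesis applies to the odd part. *)
Lemma rows_cylinder mu nu Q (f : nat -> rseq -> RM) n (B : nat -> set RM) : is_pow mu Q -> (forall
 i, mp Q nu (f i)) -> (forall i, measurable (B i)) -> (Q [set s | forall i, (i < n)%N -> B i (f i
 (fun l => s (row_code i l)))] = \prod_(i < n) nu (B i))%E.
Proof.
move=> HQ Hf mB.
elim: n f B Hf mB => [|n IH] f B Hf mB.
 rewrite big_ord0 (_ : [set x | _] = setT) ?probability_setT//.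
 by apply/seteqP; split.
pose E := [set s : rseq | forall i, (i < n)%N -> B i.+1 (f i.+1 (fun l => s (row_code i l)))].
have mE : measurable E.
 rewrite (_ : E = \bigcap_(i in [set i | (i < n)%N]) ((fun s : rseq => f i.+1 (fun l => s (row_code
  i l))) @^-1` (B i.+1))).
  apply: bigcap_measurableType => // i _; apply: meas_preim => //.
  exact: (mcomp (Hf i.+1).1 (meas_reindex (row_code i))).
 by apply/seteqP; split.
have mF : measurable (f 0%N @^-1` B 0%N).
 by apply: meas_preim => //; exact: (Hf 0%N).1.
have [mS HS] : mp Q (prodP Q Q) (fun s => (s \o double : rseq, s \o (fun k => k.*2.+1) : rseq)).
 apply: (mp_split HQ); [exact: double_inj|by move=> i j [/double_inj]|].
 by move=> i j /(congr1 odd); rewrite /= !odd_double.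
rewrite big_ord_recl -(IH (fun i => f i.+1) (fun i => B i.+1))//.
transitivity (Q (f 0%N @^-1` B 0%N) * Q E)%E; last first.
 by congr (_ * _)%E; exact: ((Hf 0%N).2 _ (mB 0%N)).
rewrite -prodPX// -HS//; last first.
 exact: measurableX.
congr (Q _); apply/seteqP; split => [s h|s [h1 h2] [|i] //=].
 split => /=.
  have := h 0%N isT; congr (B _ (f _ _)).
  by apply/funext => l; rewrite row_code0.
 move=> i ilt; have := h i.+1 ilt; congr (B _ (f _ _)).
 by apply/funext => l; rewrite row_codeS.
- move=> _; move: h1; congr (B _ (f _ _)).
 by apply/funext => l /=; rewrite row_code0.
- move=> ilt; have := h2 i ilt; congr (B _ (f _ _)).
 by apply/funext => l /=; rewrite row_codeS.
Qed.

Lemma mp_map mu nu Q Q' (f : RM -> RM) : is_pow mu Q -> is_pow nu Q' -> mp mu nu f -> mp Q Q' (fun s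
 => (fun i => f (s i)) : rseq).
Proof.
move=> HQ HQ' [mf Hf]; apply: (mp_pow HQ') => [n|n B mB].
 by apply: mcomp => //; exact: meas_coord.
have mfB i : measurable (f @^-1` B i) by exact: meas_preim.
by rewrite (HQ n (fun i => f @^-1` B i))//; apply: eq_bigr => i _; rewrite Hf.
Qed.

(** Peeling off the first pair with [mp_cons] reduces the cylinder formula to one use of the
    two-dimensional law. The lemma later turns two gamma sequences into independent sequences of
    ratios and of sums. *)
Lemma mp_zip mu1 mu2 nu1 nu2 Q1 Q2 Q3 Q4 (f : RM * RM -> RM * RM) : is_pow mu1 Q1 -> is_pow mu2 Q2
 -> is_pow nu1 Q3 -> is_pow nu2 Q4 -> mp (prodP mu1 mu2) (prodP nu1 nu2) f -> mp (prodP Q1 Q2)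
 (prodP Q3 Q4) (fun p => ((fun k => (f (p.1 k, p.2 k)).1) : rseq, (fun k => (f (p.1 k, p.2 k)).2) :
 rseq)).
Proof.
move=> H1 H2 H3 H4 [mf Hf].
have mk k : measT (fun p : rseq * rseq => f (p.1 k, p.2 k)).
 apply: mcomp => //.
 apply: meas_pair.
  exact: (mcomp (meas_coord k) measurable_fst).
 exact: (mcomp (meas_coord k) measurable_snd).
apply: (mp_pair rects_gen rects_setI rects_setT rects_gen rects_setI rects_setT).
- by apply: meas_rseq => n; apply: mcomp.
- by apply: meas_rseq => n; apply: mcomp.
move=> _ _ [n1 [B1 [mB1 ->]]] [n2 [B2 [mB2 ->]]].
pose n := maxn n1 n2.
(* Both boxes are padded with trivial constraints to a common length, so that a single induction
   treats them together. *)
pose C1 i := if (i < n1)%N then B1 i else setT.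
pose C2 i := if (i < n2)%N then B2 i else setT.
have mC1 i : measurable (C1 i) by rewrite /C1; case: ifP.
have mC2 i : measurable (C2 i) by rewrite /C2; case: ifP.
have E1 : [set s : rseq | forall i, (i < n1)%N -> B1 i (s i)] = [set s : rseq | forall i, (i < n)%N
 -> C1 i (s i)].
 apply/seteqP; split => s h i ilt; first by rewrite /C1; case: ifP => // /h.
 have := h i; rewrite /C1 ilt; apply; rewrite leq_max ilt//.
have E2 : [set s : rseq | forall i, (i < n2)%N -> B2 i (s i)] = [set s : rseq | forall i, (i < n)%N
 -> C2 i (s i)].
 apply/seteqP; split => s h i ilt; first by rewrite /C2; case: ifP => // /h.
 by have := h i; rewrite /C2 ilt; apply; rewrite leq_max ilt orbT.
rewrite E1 E2 H3// H4// => {E1 E2}.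
move: n C1 C2 mC1 mC2 => {n1 n2 B1 B2 mB1 mB2} n C1 C2 mC1 mC2.
pose E k (D1 D2 : nat -> set RM) := [set p : rseq * rseq | forall i, (i < k)%N -> D1 i (f (p.1 i,
 p.2 i)).1 /\ D2 i (f (p.1 i, p.2 i)).2].
have mE k D1 D2 : (forall i, measurable (D1 i)) -> (forall i, measurable (D2 i)) -> measurable (E k
 D1 D2).
 move=> mD1 mD2; rewrite (_ : E k D1 D2 = \bigcap_(i in [set i | (i < k)%N]) (fun p : rseq * rseq
  => f (p.1 i, p.2 i)) @^-1` ((D1 i) `*` (D2 i))).
  apply: bigcap_measurableType => // i _; apply: meas_preim => //.
  exact: measurableX.
 by apply/seteqP; split.
rewrite (_ : _ `&` _ = E n C1 C2); last first.
 by apply/seteqP; split => [p [h1 h2] i ilt|p h]; [split; [exact: h1|exact: h2]|split => i /h[]].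
elim: n C1 C2 mC1 mC2 => [|n IH] C1 C2 mC1 mC2.
 rewrite !big_ord0 mule1 (_ : E _ _ _ = setT) ?probability_setT//.
 by apply/seteqP; split.
rewrite !big_ord_recl muleACA -(IH (fun i => C1 i.+1) (fun i => C2 i.+1))//.
rewrite -prodPX// -Hf; last exact: measurableX.
have M := mp_interchange mu1 Q1 mu2 Q2.
have M2 := mp_prod (mp_cons H1) (mp_cons H2).
rewrite -prodPX//; [|by apply: meas_preim => //; exact: measurableX|exact: mE].
rewrite -M2.2; last exact: mE.
rewrite -M.2; last first.
 apply: measurableX; last exact: mE.
 by apply: meas_preim => //; exact: measurableX.
congr (prodP _ _ _); apply/seteqP; split => [[[x s] [y t]] h|[[x s] [y t]]].
 by split => [|i ilt]; [exact: (h 0%N)|exact: (h i.+1)].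
by move=> [h1 h2] [|i] ilt; [exact: h1|exact: h2].
Qed.

End sequence_space.

(** * Quantiles, binary digits and existence of infinite products *)

Section real_laws.
Context {R : realType}.
Notation RM := (measurableTypeR R).
Notation leb := (@lebesgue_measure R).

Lemma mp_cdf d (T : mtype d) (P : prob T R) (Q : prob RM R) (f : T -> RM) : measT f -> (forall x :
 R, P [set w | f w <= x] = Q `]-oo, x]%classic) -> mp P Q f.
Proof.
move=> mf H.
pose G : set (set RM) := [set A | A = setT \/ exists x : R, A = `]-oo, x]%classic].
apply: (@mp_intro _ _ _ _ _ _ _ _ G).
- rewrite RGenOInfty.measurableE; apply/seteqP; split.
  apply: smallest_sub; first exact: smallest_sigma_algebra.
  move=> _ [x ->]; rewrite -setCitvl.
  apply: (@sigma_algebraC _ G `]-oo, x]).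
  by apply: sub_gen_smallest; right; exists x.
 rewrite -RGenOInfty.measurableE; apply: smallest_sub.
  exact: sigma_algebra_measurable.
 by move=> _ [->|[x ->]].
- move=> A B [->|[x ->]]; first by rewrite setTI.
 move=> [->|[y ->]]; first by rewrite setIT; right; exists x.
 right; exists (Num.min x y); apply/seteqP; split => z /=; rewrite !in_itv/=.
  by move=> [zx zy]; rewrite le_min zx zy.
 by rewrite le_min => /andP.
- by left.
- by [].
- move=> A [->|[x ->]]; first by rewrite preimage_setT !probability_setT.
 by rewrite -H; congr (P _); apply/seteqP; split => w /=; rewrite in_itv.
Qed.

Lemma meas_le_fun d (T : mtype d) (f g : T -> R) : measT (f : T -> RM) -> measT (g : T -> RM) ->
 measurable [set x | (f x <= g x)%R].
Proof.
move=> mf mg; rewrite (_ : [set _ | _] = (fun x => g x - f x : RM) @^-1` `[0, +oo[%classic).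
 by apply: meas_preim; [exact: measB|exact: measurable_itv].
by apply/seteqP; split=> x /=; rewrite in_itv/= andbT subr_ge0.
Qed.

Lemma lebesgue_affine (a b : R) (A : set RM) : 0 < a -> measurable A -> leb [set x : R | A (a * x +
 b)] = (a^-1%:E * leb A)%E.
Proof.
move=> a0 mA.
have mf : measT ((fun x : R => a * x + b) : RM -> RM).
 by apply: measD => //; apply: measM.
have ai0 : 0 <= a^-1 by rewrite invr_ge0 ltW.
pose m0 : {measure set RM -> \bar R} := pushforward leb ((fun x : R => a * x + b) : RM -> RM).
pose m1 : {measure set RM -> \bar R} := mscale (NngNum (ltW a0)) (m0 mf).
have H : leb A = m1 A.
 apply: lebesgue_measure_unique => // _ [[u v] _ <-] /=.
 rewrite /m1 /= /mscale/= /pushforward.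
 rewrite (_ : _ @^-1` _ = `](u - b) / a, (v - b) / a]%classic).
  rewrite !lebesgue_measure_itv/= !lte_fin ltr_pM2r ?invr_gt0// ltrD2r.
  case: ifP => _; last by rewrite mule0.
  by rewrite -!EFinD -EFinM; congr EFin; field; rewrite gt_eqF.
 apply/seteqP; split => x /=; rewrite !in_itv/= ltr_pdivrMr// ler_pdivlMr//; by rewrite ltrBlDr
  lerBrDr mulrC.
rewrite H /m1 /= /mscale/= muleA -EFinM mulVf ?gt_eqF// mul1e.
by [].
Qed.

Definition unif : prob RM R := uniform_prob (@ltr01 R).

Lemma unifE A : measurable A -> unif A = leb (A `&` `[0, 1]).
Proof.
move=> mA; rewrite -[LHS]/(\int[leb]_(x in A) (uniform_pdf 0 1 x)%:E)%E.
rewrite integral_uniform_pdf.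
rewrite (eq_integral (cst 1%E)); last first.
 move=> x; rewrite inE/= in_itv/= => -[_ x01].
 by rewrite /uniform_pdf x01 subr0 invr1.
by rewrite integral_cst ?mul1e//; exact: measurableI.
Qed.

Lemma unif_itv01 A : measurable A -> unif A = leb (A `&` `[0, 1[).
Proof.
move=> mA; rewrite unifE//.
have [m0 m1] : measurable (A `&` `[0%R, 1%R[) /\ measurable (A `&` [set 1%R]).
 by split; apply: measurableI.
rewrite (_ : A `&` `[0, 1] = (A `&` `[0, 1[) `|` (A `&` [set 1%R])); last first.
 rewrite -setIUr; congr (_ `&` _); apply/seteqP; split => x /=; rewrite !in_itv/=.
  by case: (ltgtP x 1); [left|rewrite andbF|right].
 by move=> [/andP[-> /ltW]//|->]; rewrite ler01 lexx.
rewrite measureU//; last first.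
 rewrite -subset0 => x [[_]]; rewrite /= in_itv/= => /andP[_ x1] [_ /= xE].
 by rewrite xE ltxx in x1.
rewrite [X in (_ + X)%E](_ : _ = 0%E) ?adde0//; apply/eqP.
rewrite eq_le measure_ge0 andbT -(lebesgue_measure_set1 (1%R : R)).
by apply: le_measure; rewrite ?inE.
Qed.

Lemma unif_null (A : set RM) : measurable A -> (forall x, `[0, 1[%classic x -> ~ A x) -> unif A =
 0%E.
Proof.
move=> mA H; rewrite unif_itv01// (_ : _ `&` _ = set0) ?measure0//.
by rewrite -subset0 => x [Ax /H].
Qed.

Lemma unif_ray (x : R) : 0 <= x <= 1 -> unif `]-oo, x]%classic = x%:E.
Proof.
move=> /andP[x0 x1]; rewrite unifE// (_ : _ `&` _ = `[0, x]%classic).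
 by rewrite lebesgue_measure_itv/= lte_fin; case: ltgtP x0 => // [|<-]; rewrite ?oppr0 ?adde0//
  sube0.
apply/seteqP; split=> y /=; rewrite !in_itv/=; first by move=> [? /andP[->]].
by move=> /andP[-> yx]; rewrite yx (le_trans yx).
Qed.

Definition cdfR (mu : prob RM R) (x : R) : R := fine (mu `]-oo, x]%classic).

Lemma cdfRE mu x : (cdfR mu x)%:E = mu `]-oo, x]%classic.
Proof. by rewrite /cdfR fineK// fin_num_measure. Qed.

Lemma cdfR_ge0 mu x : 0 <= cdfR mu x.
Proof. by rewrite fine_ge0. Qed.

Lemma cdfR_le1 mu x : cdfR mu x <= 1.
Proof. by rewrite -lee_fin cdfRE probability_le1. Qed.

Lemma cdfR_nd mu x y : x <= y -> cdfR mu x <= cdfR mu y.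
Proof.
by move=> xy; rewrite -lee_fin !cdfRE le_measure ?inE//; exact: subitvPr.
Qed.

Let idRM : {mfun RM >-> R} := HB.pack_for {mfun RM >-> R} (idfun : RM -> R) (@isMeasurableFun.Build
 _ _ _ _ (idfun : RM -> R) (@measurable_id _ _ setT)).

Lemma cdfR_y mu : cdfR mu x @[x --> +oo] --> (1 : R).
Proof.
have := @cvg_cdfy1 _ _ _ mu idRM.
by move=> /fine_cvg.
Qed.

Lemma cdfR_Ny mu : cdfR mu x @[x --> -oo] --> (0 : R).
Proof.
have := @cvg_cdfNy0 _ _ _ mu idRM.
by move=> /fine_cvg.
Qed.

Lemma cdfR_right mu x : cdfR mu y @[y --> x^'+] --> cdfR mu x.
Proof.
have := @cdf_right_continuous _ _ _ mu idRM x.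
move=> H; have : @cdf _ _ _ mu idRM y @[y --> x^'+] --> (cdfR mu x)%:E.
 by rewrite cdfRE; exact: H.
by move=> /fine_cvg.
Qed.

(** On the open unit interval this is the adjoint of the distribution function ([quantile_le]). The
    value 0 elsewhere affects only a null set of levels. *)
Definition quantile mu (u : R) : R := if 0 < u < 1 then inf [set x | u <= cdfR mu x] else 0.

Lemma quantile_le mu u x : 0 < u < 1 -> (quantile mu u <= x) = (u <= cdfR mu x).
Proof.
move=> /andP[u0 u1]; rewrite /quantile u0 u1/=.
set S := [set x | _].
have [y Sy] : S !=set0.
 have /cvgrPdist_lt/(_ (1 - u)) := @cdfR_y mu.
 rewrite subr_gt0 => /(_ u1) [M [_ /(_ (M + 1))]].
 rewrite ltrDl ltr01 => /(_ isT) H; exists (M + 1); rewrite /S/=.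
 move: H; rewrite ger0_norm ?subr_ge0 ?cdfR_le1// => H.
 by rewrite ltW//; rewrite ltrBlDr addrC -ltrBlDr opprB addrCA subrr addr0 in H.
have [l Sl] : has_lbound S.
 have /cvgrPdist_lt/(_ u u0) [M [_ /(_ (M - 1))]] := @cdfR_Ny mu.
 rewrite ltrBlDr ltrDl ltr01 => /(_ isT) H; exists (M - 1) => z; rewrite /S/= => uz.
 rewrite leNgt; apply/negP => zM; have := le_trans uz (cdfR_nd mu (ltW zM)).
 by rewrite leNgt; move: H; rewrite sub0r normrN ger0_norm ?cdfR_ge0// => ->.
have hS : has_inf S by split; [exists y|exists l].
apply/idP/idP => [h|ux]; last by apply: ge_inf => //; exists l.
(* The infimum is attained: the inequality holds at all points to the right of x, hence at x by
   right continuity. *)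
apply: (@closed_cvg _ _ (x^'+) _ (cdfR mu) (fun z => u <= z) _ _ (cdfR mu x)).
- exact: closed_ge.
- near=> z; have hz : inf S < z.
  by apply: le_lt_trans h _; near: z; exact: nbhs_right_gt.
 have [w Sw wz] := inf_lt (ex_intro _ y Sy) hz.
 by apply: le_trans Sw _; apply: cdfR_nd; exact: ltW.
- exact: cdfR_right.
Unshelve. all: by end_near. Qed.

Lemma meas_quantile mu : measT (quantile mu : RM -> RM).
Proof.
apply: (measurability _ (RGenOInfty.measurableE R)) => _ [_ [x ->] <-].
rewrite setTI (_ : _ @^-1` _ = (`]0, 1[%classic `&` `]cdfR mu x, +oo[%classic) `|` (~` `]0,
 1[%classic `&` (if 0 > x then setT else set0))).
 apply: measurableU; apply: measurableI => //; first exact: measurableC.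
 by case: ifP.
apply/seteqP; split => u /=; rewrite !in_itv/= !andbT.
 have [u01|u01] := boolP (0 < u < 1).
  by rewrite ltNge quantile_le// -ltNge => h; left.
 by rewrite /quantile (negbTE u01) => ->; right.
move=> [[u01 h]|[/negP u01]]; first by rewrite ltNge quantile_le// -ltNge.
by rewrite /quantile (negbTE u01); case: ifP.
Qed.

Lemma mp_quantile mu : mp unif mu (quantile mu).
Proof.
apply: mp_cdf; first exact: meas_quantile.
move=> x; rewrite -cdfRE.
have E : unif `]0, 1[%classic = 1%E.
 rewrite unif_itv01// (_ : _ `&` _ = `]0, 1[%classic).
  by rewrite lebesgue_measure_itv/= lte_fin ltr01 oppr0 adde0.
 apply/seteqP; split=> y /=; rewrite !in_itv/=; first by case.
 by move=> /andP[y0 y1]; rewrite y0 y1 ltW.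
have eq01 (A B : set RM) : measurable A -> measurable B -> A `&` `]0, 1[%classic = B `&` `]0,
 1[%classic -> unif A = unif B.
 move=> mA mB AB.
 have K (C : set RM) : measurable C -> unif C = unif (C `&` `]0, 1[%classic).
  move=> mC; have mC' : measurable (~` (C : set RM)) by exact: measurableC.
  have -> : unif C = unif ((C `&` `]0, 1[%classic) `|` (C `\` `]0, 1[%classic)).
   by rewrite setUIDK.
  rewrite measureU; last 3 first.
  - exact: measurableI.
  - exact: measurableD.
  - by rewrite -subset0 => z [[_ Z] [_ nZ]].
  rewrite [X in (_ + X)%E](_ : _ = 0%E) ?adde0; last first.
   apply/eqP; rewrite eq_le measure_ge0 andbT.
   have : unif (~` `]0, 1[%classic) = 0%E.
    rewrite probability_setC//.
    by rewrite E subee.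
   move=> <-; apply: le_measure; rewrite ?inE//; first [exact: measurableD|exact: measurableC|by
    move=> z []].
  by [].
 by rewrite K// AB -K.
have mE : measurable [set w : RM | quantile mu w <= x].
 have := meas_quantile mu measurableT (@measurable_itv R `]-oo, x]).
 by rewrite setTI (_ : _ @^-1` _ = [set w | quantile mu w <= x]).
rewrite (eq01 _ `]-oo, cdfR mu x]%classic) ?unif_ray ?cdfR_ge0 ?cdfR_le1//.
apply/seteqP; split => u /= []; rewrite !in_itv/= => h u01; split => //.
 by rewrite -quantile_le.
by rewrite quantile_le.
Qed.


(** One step of the binary expansion: the first digit and the rescaled remainder. Under the uniform
    law the two are independent and the remainder is uniform again, so the step can be iterated. *)
Definition doubling (w : RM) : RM * RM := if w < 2^-1 then (0, 2 * w) else (1, 2 * w - 1).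

Lemma meas_doubling : measT doubling.
Proof.
apply: measurable_fun_ifT.
- exact: measurable_fun_ltr.
- by apply: meas_pair => //; apply: measM.
- apply: meas_pair => //.
 by apply: measB => //; apply: measM.
Qed.

Definition bit_law : prob RM R := law unif (mcomp measurable_fst meas_doubling).

Let unif_half (B : set RM) b : measurable B -> (b = 0 \/ b = 1) -> unif [set w : RM | b / 2 <= w <
 (b + 1) / 2 /\ B (2 * w - b)] = ((2^-1)%:E * unif B)%E.
Proof.
move=> mB bE.
have mB1 : measurable (B `&` `[0, 1[) by exact: measurableI.
have mC : measurable [set w : RM | b / 2 <= w < (b + 1) / 2 /\ B (2 * w - b)].
 rewrite (_ : [set w | _] = `[b / 2, (b + 1) / 2[ `&` ((fun w : RM => (2 * w - b : RM)) @^-1` B)).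
  apply: measurableI => //; apply: meas_preim => //.
  by apply: measB => //; apply: measM.
 by apply/seteqP; split => w /=; rewrite in_itv.
rewrite !unif_itv01// -(lebesgue_affine (- b) _ mB1)//.
congr (leb _); apply/seteqP; split => w /=; rewrite !in_itv/=.
 move=> [[/andP[h1 h2] ?] _]; split=> //; apply/andP; split; lra.
move=> [Bw /andP[h1 h2]]; split; last by case: bE => bE; apply/andP; split; lra.
by split => //; apply/andP; split; lra.
Qed.

Lemma mp_doubling : mp unif (prodP bit_law unif) doubling.
Proof.
apply: mp_pairX; first exact: meas_doubling.
move=> A B mA mB.
have key (C : set RM) : measurable C -> unif (doubling @^-1` (A `*` C)) = (((2^-1)%:E * (\1_A (0 :
 R))%:E + (2^-1)%:E * (\1_A (1 : R))%:E) * unif C)%E.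
 move=> {B}mB; move: C mB => B mB.
 have E b : (b = 0 \/ b = 1) -> unif [set w : RM | A b /\ (b / 2 <= w < (b + 1) / 2 /\ B (2 * w -
  b))] = ((2^-1)%:E * (\1_A b)%:E * unif B)%E.
  move=> bE; have [bA|bA] := boolP (b \in A); rewrite indicE.
   rewrite bA mule1 -(unif_half mB bE); congr (unif _).
   by apply/seteqP; split => [w []//|w]; rewrite inE in bA.
  rewrite (negbTE bA) mule0 mul0e (_ : [set w | _] = set0) ?measure0//.
  by rewrite -subset0 => w [bA' _]; rewrite notin_setE in bA.
 have mD b : measurable [set w : RM | A b /\ (b / 2 <= w < (b + 1) / 2 /\ B (2 * w - b))].
  rewrite (_ : [set w | _] = (if b \in A then setT else set0) `&` (`[b / 2, (b + 1) / 2[ `&` ((fun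
   w : RM => (2 * w - b : RM)) @^-1` B))).
   apply: measurableI; first by case: ifP.
   apply: measurableI => //; apply: meas_preim => //.
   by apply: measB => //; apply: measM.
  apply/seteqP; split => w /=; rewrite in_itv/=.
   by move=> [bA h]; rewrite (mem_set bA).
  by case: ifPn => [|_ []//]; rewrite inE => ? [].
 rewrite ge0_muleDl ?mule_ge0 ?lee_fin// -!E; [|by right|by left].
 rewrite -measureU; [|exact: mD|exact: mD|].
  have mU : measurable ([set w : RM | A 0 /\ (0 / 2 <= w < (0 + 1) / 2 /\ B (2 * w - 0))] `|` [set
   w : RM | A 1 /\ (1 / 2 <= w < (1 + 1) / 2 /\ B (2 * w - 1))]) by exact: measurableU.
  have mF : measurable (doubling @^-1` (A `*` B)).
   apply: meas_preim; first exact: meas_doubling.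
   exact: measurableX.
  rewrite unif_itv01// [RHS]unif_itv01//; congr (leb _).
  apply/seteqP; split => w /=; rewrite in_itv/= /doubling.
   move=> [+ /andP[w0 w1]]; case: ifPn => [h|]; last rewrite -leNgt => h.
    move=> [/= A0 Bw]; split; last by rewrite w0 w1.
    left; split => //; rewrite subr0; split => //; apply/andP; split; lra.
   move=> [/= A0 Bw]; split; last by rewrite w0 w1.
   by right; split => //; split => //; apply/andP; split; lra.
  move=> [h /andP[w0 w1]]; split; last by rewrite w0 w1.
  case: h => -[Ab [/andP[h1 h2] Bw]].
   have -> : w < 2^-1 by lra.
   by split => //=; rewrite subr0 in Bw.
  by have -> : (w < 2^-1) = false by apply/negbTE; rewrite -leNgt; lra.
 rewrite -subset0 => w /= [[_ [/andP[_ h1] _]] [_ [/andP[h2 _] _]]]; lra.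
rewrite key//; congr (_ * _)%E.
have := key setT measurableT; rewrite probability_setT mule1 => <-.
by rewrite /bit_law /law/= ; congr (unif _); apply/seteqP; split => [w []|w].
Qed.

Definition bits (w : R) (n : nat) : R := (doubling (iter n (fun x => (doubling x).2) w)).1.

Lemma meas_bits : measT (bits : RM -> rseq).
Proof.
apply: meas_rseq => n.
apply: (mcomp measurable_fst).
apply: (mcomp meas_doubling).
elim: n => [|n IH]; first exact: measurable_id.
apply: (mcomp measurable_snd).
exact: (mcomp meas_doubling IH).
Qed.

Lemma is_pow_bits : is_pow bit_law (law unif meas_bits).
Proof.
apply: is_pow_law => n; elim: n => [|n IH] B mB.
 rewrite big_ord0 (_ : [set x | _] = setT) ?probability_setT//.
 by apply/seteqP; split.
rewrite big_ord_recl -(IH (fun i => B i.+1)); last by move=> i; exact: mB.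
have mE : measurable [set x : RM | forall i, (i < n)%N -> B i.+1 (bits x i)].
 have /meas_rects mr : rects [set s : rseq | forall i, (i < n)%N -> B i.+1 (s i)].
  by exists n, (fun i => B i.+1).
 exact: (meas_preim meas_bits mr).
rewrite -prodPX// -mp_doubling.2; last exact: measurableX.
congr (unif _); apply/seteqP; split => [w h|w [h1 h2] [|i] ilt //].
 split; first exact: (h 0%N).
 by move=> i ilt; have := h i.+1 ilt; rewrite /bits iterSr.
by have := h2 i ilt; rewrite /bits iterSr.
Qed.

(** Every term other than 1 counts as the digit 0, so that the series in [of_bits] converges for all
    real sequences and its sum is measurable on the whole space. *)
Definition clip_bit (x : R) : R := if x == 1 then 1 else 0.

Definition of_bits_n (s : nat -> R) (n : nat) : R := \sum_(k < n) clip_bit (s k) * 2^-1 ^+ k.+1.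

Definition of_bits (s : nat -> R) : R := limn (of_bits_n s).

Lemma is_cvg_of_bits s : cvgn (of_bits_n s).
Proof.
have c01 x : 0 <= clip_bit x <= 1 by rewrite /clip_bit; case: ifP; rewrite ?lexx ?ler01.
have H n : of_bits_n s n <= 1 - 2^-1 ^+ n.
 elim: n => [|n IH]; first by rewrite /of_bits_n big_ord0 expr0 subrr.
 rewrite /of_bits_n big_ord_recr/= -/(of_bits_n s n).
 have /andP[_ c1] := c01 (s n).
 have : clip_bit (s n) * 2^-1 ^+ n.+1 <= 2^-1 ^+ n.+1.
  by rewrite ler_piMl// exprn_ge0.
 rewrite exprS; lra.
apply: nondecreasing_is_cvgn.
 apply/nondecreasing_seqP => n; rewrite /of_bits_n big_ord_recr/= lerDl.
 by rewrite mulr_ge0// ?exprn_ge0//; case/andP: (c01 (s n)).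
exists 1 => _ [n _ <-]; apply: (le_trans (H n)).
by rewrite lerBlDr lerDl exprn_ge0.
Qed.

Lemma meas_of_bits : measT (of_bits : rseq -> RM).
Proof.
suff : measurable_fun [set: rseq] (of_bits : rseq -> R) by [].
apply: (measurable_fun_cvg (h := fun n (s : rseq) => of_bits_n s n)).
 move=> n; apply: measurable_sum => k; apply: measM => //.
 apply: measurable_fun_ifT => //.
 by apply: measurable_fun_eqr => //; exact: meas_coord.
by move=> s _; exact: is_cvg_of_bits.
Qed.

Lemma bitsK w : 0 <= w < 1 -> of_bits (bits w) = w.
Proof.
move=> w01; pose t n := iter n (fun x => (doubling x).2) w.
have t01 n : 0 <= t n < 1.
 elim: n => [//|n]; rewrite /t iterS -/(t n) /doubling => /andP[h1 h2].
 by case: ifPn => [h|]; [|rewrite -leNgt => h]; apply/andP; split => /=; lra.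
(* Invariant of the expansion: what the first n digits miss is the n-th remainder, scaled by
   2^(-n). *)
have E n : of_bits_n (bits w) n = w - 2^-1 ^+ n * t n.
 elim: n => [|n IH]; first by rewrite /of_bits_n big_ord0 expr0 mul1r subrr.
 rewrite /of_bits_n big_ord_recr/= -/(of_bits_n _ n) IH.
 rewrite /bits -/(t n) exprSr /doubling.
 have /andP[h1 h2] := t01 n.
 case: ifPn => [h|]; [|rewrite -leNgt => h] => /=; rewrite /clip_bit.
  by rewrite eq_sym oner_eq0 mul0r addr0; field.
 by rewrite eqxx; field.
apply/cvg_lim => //.
rewrite (_ : of_bits_n (bits w) = fun n => w - 2^-1 ^+ n * t n); last exact/funext.
rewrite -[X in _ --> X]subr0; apply: cvgB; first exact: cvg_cst.
apply: (squeeze_cvgr (f := cst 0) (h := fun n => 2^-1 ^+ n)).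
- near=> n; have /andP[h1 h2] := t01 n.
 rewrite /= mulr_ge0 ?exprn_ge0//= ler_piMr ?exprn_ge0//; exact: ltW.
- exact: cvg_cst.
- by apply: cvg_expr; rewrite ger0_norm//; lra.
Unshelve. all: by end_near. Qed.

Lemma mp_of_bits : mp (law unif meas_bits) unif of_bits.
Proof.
apply: (mp_cancel meas_of_bits (mp_law unif meas_bits)).
apply: (@mp_ae R _ _ RM RM unif unif id (of_bits \o bits) (~` `[0, 1[%classic)); last exact: mp_id.
- exact: (mcomp meas_of_bits meas_bits).
- exact: measurableC.
- by apply: unif_null => [|x x01]; [exact: measurableC|apply].
- move=> x /contrapT; rewrite /= in_itv/= => x01.
 by rewrite bitsK.
Qed.

(** The digits of one uniform variable are i.i.d. bits. The rows of [row_code] cut them into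
    infinitely many independent digit sequences; each is reassembled into a uniform variable and
    sent to [mu] by the quantile function. *)
Lemma exists_pow (mu : prob RM R) : exists Q, is_pow mu Q.
Proof.
pose Q0 := law unif meas_bits.
have mf : measT ((fun s : rseq => (fun i => quantile mu (of_bits (fun l => s (row_code i l))))) :
 rseq -> rseq).
 apply: meas_rseq => i.
 apply: (mcomp (meas_quantile mu)).
 exact: (mcomp meas_of_bits (meas_reindex (row_code i))).
exists (law Q0 mf); apply: is_pow_law => n B mB.
have := @rows_cylinder R bit_law mu Q0 (fun=> quantile mu \o of_bits) n B is_pow_bits _ mB; apply.
by move=> _; exact: mp_comp mp_of_bits (mp_quantile mu).
Qed.

Definition pow (mu : prob RM R) : prob rseq R := projT1 (cid (exists_pow mu)).

Lemma powP mu : is_pow mu (pow mu).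
Proof. by rewrite /pow; case: cid. Qed.

End real_laws.

(** * Gamma and beta densities *)

Section densities.
Import HBNNSimple.
Context {R : realType}.
Notation RM := (measurableTypeR R).
Notation leb := (@lebesgue_measure R).

Lemma ge0_integral_affine (g : RM -> \bar R) (a b : R) : 0 < a -> measT g -> (forall x, (0 <= g
 x)%E) -> (\int[leb]_x g (a * x + b)%R = (a^-1)%:E * \int[leb]_x g x)%E.
Proof.
move=> a0 mg g0.
have mf : measT ((fun x : R => a * x + b) : RM -> RM).
 by apply: measD => //; apply: measM.
have ai0 : 0 <= a^-1 by rewrite invr_ge0 ltW.
have := @ge0_integral_pushforward _ _ _ _ _ _ mf leb setT g measurableT mg (fun y _ => g0 y).
rewrite preimage_setT => <-.
rewrite -[X in (X * _)%E]/((NngNum ai0)%:num%:E) -ge0_integral_mscale//.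
by apply: eq_measure_integral => A mA _; exact: lebesgue_affine.
Qed.

Lemma ge0_integral_oppr (g : RM -> \bar R) : measT g -> (forall x, (0 <= g x)%E) -> (\int[leb]_x g
 (- x)%R = \int[leb]_x g x)%E.
Proof.
move=> mg g0.
have mf : measT ((fun x : R => - x) : RM -> RM).
 by apply: measurable_funN.
have := @ge0_integral_pushforward _ _ _ _ _ _ mf leb setT g measurableT mg (fun y _ => g0 y).
rewrite preimage_setT => <-.
by apply: eq_measure_integral => A mA _; exact: lebesgue_measureN.
Qed.

Definition has_pdf (mu : prob RM R) (f : R -> R) := [/\ measurable_fun [set: RM] (f : RM -> R),
 forall x, 0 <= f x & forall A, measurable A -> mu A = (\int[leb]_(x in A) (f x)%:E)%E].

Lemma pdf_indic mu f A : has_pdf mu f -> measurable A -> mu A = (\int[leb]_x ((\1_A x)%:E * (f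
 x)%:E))%E.
Proof.
move=> [mf f0 H] mA; rewrite H// integral_mkcond.
apply: eq_integral => x _; rewrite patchE indicE.
by case: ifPn; rewrite ?mul1e// mul0e.
Qed.

Lemma pdf_integral mu f (g : RM -> \bar R) : has_pdf mu f -> measT g -> (forall x, (0 <= g x)%E) ->
 (\int[mu]_x g x = \int[leb]_x (g x * (f x)%:E))%E.
Proof.
move=> muf mg g0; have [mf f0 _] := muf.
have mf' : measurable_fun [set: RM] (fun x : RM => (f x)%:E).
 exact: mcomp.
pose g_ := nnsfun_approx measurableT mg.
have cvg_g x : (g_ n x)%:E @[n --> \oo] --> g x.
 by apply: cvg_nnsfun_approx => // *; exact: g0.
have mg_ n : measurable_fun [set: RM] (EFin \o g_ n).
 exact/measE/measurable_funP.
transitivity (limn (fun n => \int[mu]_x (g_ n x)%:E))%E.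
 rewrite -monotone_convergence//.
 - by apply: eq_integral => y _; apply/esym/cvg_lim => //; exact: cvg_g.
 - by move=> n y _; rewrite lee_fin.
 - by move=> y _ m n mn; rewrite lee_fin; exact/lefP/nd_nnsfun_approx.
transitivity (limn (fun n => \int[leb]_x ((g_ n x)%:E * (f x)%:E)))%E; last first.
 rewrite -monotone_convergence//.
 - apply: eq_integral => y _; apply/cvg_lim => //.
  by apply: cvgeZr => //; exact: cvg_g.
 - by move=> n; apply: emeasM; [exact: mg_|exact: mf'].
 - by move=> n y _; rewrite mule_ge0// lee_fin.
 - move=> y _ m n mn; apply: lee_wpmul2r; first by rewrite lee_fin.
  by rewrite lee_fin; exact/lefP/nd_nnsfun_approx.
congr (limn _); apply/funext => n.
transitivity (\sum_(k \in range (g_ n)) \int[mu]_x (k * \1_(g_ n @^-1` [set k]) x)%:E)%E.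
 under eq_integral do rewrite fimfunE -fsumEFin//.
 rewrite ge0_integral_fsum//.
 - by move=> y; exact/measE/measM.
 - by move=> y x _; rewrite nnfun_muleindic_ge0.
transitivity (\sum_(k \in range (g_ n)) \int[leb]_x ((k * \1_(g_ n @^-1` [set k]) x)%:E * (f
 x)%:E))%E; last first.
 rewrite -ge0_integral_fsum//.
 - apply: eq_integral => x _; rewrite -ge0_mule_fsuml; last first.
   by move=> k; rewrite nnfun_muleindic_ge0.
  by rewrite fsumEFin// -fimfunE.
 - move=> r; apply: emeasM => //.
  exact/measE/measM.
 - by move=> r x _; rewrite mule_ge0 ?lee_fin//; exact: nnfun_muleindic_ge0.
apply: eq_fsbigr => r _; have [r0|r0] := ltP r 0.
 rewrite preimage_nnfun0// !integral0_eq// => x _; by rewrite indic0/= mulr0 ?mul0e.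
rewrite integralZl_indic_nnsfun// integral_indic// setIT.
transitivity (r%:E * (\int[leb]_x ((\1_(g_ n @^-1` [set r]) x)%:E * (f x)%:E)))%E.
 by congr (_ * _)%E; apply: pdf_indic.
rewrite -ge0_integralZl//; last 2 first.
- by apply: emeasM => //; exact/measE.
- by move=> x _; rewrite mule_ge0// lee_fin.
by apply: eq_integral => x _; rewrite muleA EFinM.
Qed.

Lemma has_pdf_law d (T : mtype d) (P : prob T R) (f : T -> RM) (Q : prob RM R) h : mp P Q f ->
 (forall A, measurable A -> P (f @^-1` A) = (\int[leb]_x ((\1_A x)%:E * (h x)%:E))%E) ->
 measurable_fun [set: RM] (h : RM -> R) -> (forall x, 0 <= h x) -> has_pdf Q h.
Proof.
move=> [_ PQ] H mh h0; split => // A mA; rewrite -PQ// H// [RHS]integral_mkcond.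
apply: eq_integral => x _; rewrite patchE indicE.
by case: ifPn; rewrite ?mul1e// mul0e.
Qed.

Lemma meas_inv d (T : mtype d) (f : T -> R) : measT f -> measT (fun x => (f x)^-1).
Proof.
(* Writing 1/x as x (x^2)^(-1) reduces inversion to a power function of a nonnegative number; at x =
   0 both sides are 0. *)
move=> mf; rewrite (_ : (fun x => _) = fun x => f x * (f x ^+ 2) `^ (-1)).
 apply: measM => //.
 have m := measurable_powR (-1 : R).
 by apply: (mcomp m); exact: measX.
apply/funext => x; rewrite powR_inv1 ?sqr_ge0//.
have [->|x0] := eqVneq (f x) 0; first by rewrite mul0r invr0.
by field.
Qed.

Lemma measurable_div d (T : mtype d) (f g : T -> R) : measT f -> measT g -> measT (fun x => f x / g
 x).
Proof. by move=> mf mg; apply: measM => //; exact: meas_inv. Qed.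

(** The gamma density of shape k + 1 and scale 1. With the shift every natural number is admissible
    and [gpdf 0] is exponential. *)
Definition gpdf (k : nat) (x : R) : R := if 0 < x then x ^+ k * expR (- x) / k`!%:R else 0.

(** The density of the Beta(a + 1, b + 1) law, with the same shift. For m = a + 1 the law of the
    theorem is that of [bpdf a a]. *)
Definition bpdf (a b : nat) (v : R) : R := if 0 < v < 1 then (a + b).+1`!%:R / (a`!%:R * b`!%:R) *
 (v ^+ a * (1 - v) ^+ b) else 0.

Lemma gpdf_ge0 k x : 0 <= gpdf k x.
Proof.
rewrite /gpdf; case: ifP => // x0.
by rewrite !mulr_ge0// ?exprn_ge0 ?expR_ge0 ?invr_ge0// ltW.
Qed.

Lemma bpdf_ge0 a b x : 0 <= bpdf a b x.
Proof.
rewrite /bpdf; case: ifP => // /andP[x0 x1].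
rewrite !mulr_ge0 ?exprn_ge0 ?invr_ge0 ?mulr_ge0 ?subr_ge0//; exact: ltW.
Qed.

Lemma meas_gpdf k : measurable_fun [set: RM] (gpdf k : RM -> R).
Proof.
apply: measurable_fun_ifT => //; first exact: measurable_fun_ltr.
apply: measM => //; apply: measM => //.
exact: mcomp.
Qed.

Lemma meas_bpdf a b : measurable_fun [set: RM] (bpdf a b : RM -> R).
Proof.
apply: measurable_fun_ifT => //.
 by apply: measurable_and; exact: measurable_fun_ltr.
apply: measM => //; apply: measM => //.
by apply: measX; apply: measB.
Qed.

Lemma gpdf_bpdf a b v s : 0 < s -> s * (gpdf a (s * v) * gpdf b (s - s * v)) = bpdf a b v * gpdf (a
 + b).+1 s.
Proof.
move=> s0; rewrite /gpdf /bpdf s0 pmulr_rgt0// subr_gt0.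
have -> : (s * v < s) = (v < 1) by rewrite -{2}(mulr1 s) ltr_pM2l.
case: ifP => v0; case: ifP => v1 /=; rewrite ?mul0r ?mulr0//.
have -> : s - s * v = s * (1 - v) by ring.
have -> : expR (- s) = expR (- (s * v)) * expR (- (s * (1 - v))).
 by rewrite -expRD; congr expR; ring.
rewrite !exprMn exprS exprD.
have h n : n`!%:R != 0 :> R by rewrite pnatr_eq0 -lt0n fact_gt0.
by field; rewrite !h.
Qed.

Definition expP : prob RM R.
Proof. refine (@exponential_prob R 1); exact: ltr01. Defined.

Lemma expP_pdf : has_pdf expP (gpdf 0).
Proof.
split; [exact: meas_gpdf|exact: gpdf_ge0|move=> A mA].
rewrite -[LHS]/(\int[leb]_(x in A) (exponential_pdf 1 x)%:E)%E.
apply: ge0_ae_eq_integral => //.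
- apply/measE; apply: measurable_funTS.
 exact: measurable_exponential_pdf.
- apply/measE; apply: measurable_funTS; exact: meas_gpdf.
- by move=> x _; rewrite lee_fin exponential_pdf_ge0.
- by move=> x _; rewrite lee_fin gpdf_ge0.
exists [set 0]; split; [exact: measurable_set1|exact: lebesgue_measure_set1|].
move=> x /= H; apply: contrapT => x0; apply: H => _.
congr EFin; rewrite /gpdf; have [x1|x1|x1] := ltgtP 0 x; last by case: x0.
 by rewrite exponential_pdfE ?ltW// mul1r mulN1r expr0 mul1r fact0 divr1.
by rewrite lt0_exponential_pdf.
Qed.

Section beta_gamma.
Variables (a b : nat) (mu nu : prob RM R).
Hypotheses (mu_pdf : has_pdf mu (gpdf a)) (nu_pdf : has_pdf nu (gpdf b)).

Let mgpdf k : measT (fun x : RM => (gpdf k x)%:E).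
Proof. exact: (mcomp _ (meas_gpdf k)). Qed.

Let meas_div : measT (fun p : RM * RM => (p.1 / p.2 : RM)).
Proof. by apply: measurable_div. Qed.

(** The change of variables (x, y) -> (x / (x + y), x + y) is made one variable at a time: y is
    replaced by s = x + y at fixed x, the order of integration is exchanged, and x = s v is
    substituted at fixed s. Only affine substitutions on the line occur. *)
Lemma beta_gamma_integral (F : RM * RM -> \bar R) : measT F -> (forall z, (0 <= F z)%E) ->
 (\int[prodP mu nu]_z F (z.1 / (z.1 + z.2), z.1 + z.2)%R = \int[leb]_s \int[leb]_v (F (v, s) *
 ((bpdf a b v)%:E * (gpdf (a + b).+1 s)%:E)))%E.
Proof.
move=> mF F0.
have madd : measT (fun p : RM * RM => (p.1 + p.2 : RM)).
 exact: measD.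
have mG : measT (fun z : RM * RM => F (z.1 / (z.1 + z.2), z.1 + z.2)).
 apply: (mcomp mF); apply: meas_pair => //.
 by apply: measurable_div.
rewrite prodP_ge0_integral//.
rewrite (pdf_integral mu_pdf); last 2 first.
- have H := @measurable_fun_fubini_tonelli_F _ _ RM RM R nu _ mG (fun z => F0 _).
 exact: H.
- by move=> x; apply: integral_ge0.
have -> : (\int[leb]_x (\int[nu]_y F (x / (x + y), x + y)%R * (gpdf a x)%:E) = \int[leb]_x
 \int[leb]_s (F (x / s, s)%R * ((gpdf a x)%:E * (gpdf b (s - x))%:E)))%E.
 apply: eq_integral => x _; rewrite (pdf_integral nu_pdf)//; last first.
  exact: (mcomp mG (meas_pairl x)).
 rewrite muleC -ge0_integralZl//; last 3 first.
 - apply: emeasM => //.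
  exact: (mcomp mG (meas_pairl x)).
 - by move=> y _; rewrite mule_ge0// lee_fin gpdf_ge0.
 - by rewrite lee_fin gpdf_ge0.
 pose h (s : RM) := (F (x / s, s)%R * ((gpdf a x)%:E * (gpdf b (s - x))%:E))%E.
 have mh : measT h.
  apply: emeasM.
   apply: (mcomp mF); apply: meas_pair => //.
   exact: (mcomp meas_div (meas_pairl x)).
  apply: emeasM => //.
  apply: (mcomp (mgpdf b)); exact: measB.
 have h0 s : (0 <= h s)%E by rewrite /h !mule_ge0// lee_fin gpdf_ge0.
 have := @ge0_integral_affine h 1 x ltr01 mh h0.
 rewrite invr1 mul1e => <-; apply: eq_integral => y _; rewrite /h mul1r addrK.
 by rewrite (addrC y) muleCA.
pose k (z : RM * RM) := (F (z.1 / z.2, z.2)%R * ((gpdf a z.1)%:E * (gpdf b (z.2 - z.1))%:E))%E.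
have mk : measT k.
 apply: emeasM.
  apply: (mcomp mF); exact: meas_pair.
 apply: emeasM; first exact: (mcomp (mgpdf a)).
 by apply: (mcomp (mgpdf b)); exact: measB.
have k0 z : (0 <= k z)%E by rewrite /k !mule_ge0// lee_fin gpdf_ge0.
rewrite (@fubini_tonelli _ _ RM RM R leb leb k mk k0).
apply: eq_integral => s _; rewrite /k/=.
have [s0|s0] := ltP 0 s; last first.
 rewrite !integral0_eq// => x _.
  by rewrite /gpdf ltNge s0/= !mule0.
 rewrite /gpdf; case: ifPn => x0; case: ifPn => sx; rewrite ?mul0e ?mule0//.
 by move: sx; rewrite subr_gt0 => xs; move: (lt_trans x0 xs); rewrite ltNge s0.
pose h (x : RM) := (F (x / s, s)%R * ((gpdf a x)%:E * (gpdf b (s - x))%:E))%E.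
have mh : measT h.
 exact: (mcomp mk (@pair2_measurable _ _ RM RM s)).
have h0 x : (0 <= h x)%E by exact: (k0 (x, s)).
rewrite -/(\int[leb]_x h x)%E.
have := @ge0_integral_affine h s 0 s0 mh h0.
move/(congr1 (fun z => s%:E * z)%E); rewrite muleA -EFinM divff ?gt_eqF// mul1e.
move=> <-; rewrite -ge0_integralZl//; last by rewrite lee_fin ltW.
 apply: eq_integral => v _; rewrite /h addr0 mulrAC divff ?gt_eqF// mul1r.
 by rewrite muleCA -!EFinM gpdf_bpdf.
by apply: (mcomp mh); apply: measD => //; exact: measM.
Qed.

Let meas_ratio : measT (fun z : RM * RM => (z.1 / (z.1 + z.2) : RM)).
Proof.
by apply: measurable_div => //; exact: measD.
Qed.

Let meas_sum : measT (fun z : RM * RM => (z.1 + z.2 : RM)).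
Proof. exact: measD. Qed.

Let meas_rs : measT (fun z : RM * RM => (z.1 / (z.1 + z.2) : RM, z.1 + z.2 : RM)).
Proof. by apply: meas_pair; [exact: meas_ratio|exact: meas_sum]. Qed.

Lemma beta_gamma_rect A B : measurable A -> measurable B -> prodP mu nu ((fun z : RM * RM => (z.1 /
 (z.1 + z.2) : RM, z.1 + z.2 : RM)) @^-1` (A `*` B)) = ((\int[leb]_v ((\1_A v)%:E * (bpdf a b
 v)%:E)) * (\int[leb]_s ((\1_B s)%:E * (gpdf (a + b).+1 s)%:E)))%E.
Proof.
move=> mA mB.
have mAB : measurable (A `*` B) by exact: measurableX.
transitivity (\int[prodP mu nu]_z (\1_(A `*` B) (z.1 / (z.1 + z.2) : RM, z.1 + z.2 : RM)%R)%:E)%E.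
 have mE := meas_preim meas_rs mAB.
 by rewrite -[LHS]/(prodP mu nu _) -[in LHS](setIT (_ @^-1` _)) -integral_indic.
rewrite (@beta_gamma_integral (fun z => (\1_(A `*` B) z)%:E)) //; last first.
 exact: (meas_ind mAB).
have mb : measT (fun v : RM => (bpdf a b v)%:E).
 exact: (mcomp _ (meas_bpdf a b)).
have m1 C : measurable C -> measT (fun v : RM => (\1_C v : R)%:E).
 by move=> mC; exact: (meas_ind mC).
have mAb : measT (fun v : RM => (\1_A v)%:E * (bpdf a b v)%:E)%E.
 by apply: emeasM => //; exact: m1.
have mBg : measT (fun s : RM => (\1_B s)%:E * (gpdf (a + b).+1 s)%:E)%E.
 by apply: emeasM => //; exact: m1.
have Ab0 v : (0 <= (\1_A v)%:E * (bpdf a b v)%:E)%E.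
 by rewrite mule_ge0// lee_fin ?bpdf_ge0.
have Bg0 s : (0 <= (\1_B s)%:E * (gpdf (a + b).+1 s)%:E)%E.
 by rewrite mule_ge0// lee_fin ?gpdf_ge0.
rewrite muleC -ge0_integralZr//; last by apply: integral_ge0.
apply: eq_integral => s _; rewrite -ge0_integralZl//.
apply: eq_integral => v _.
rewrite (_ : (\1_(A `*` B) (v, s))%:E = ((\1_A v)%:E * (\1_B s)%:E)%E); last first.
 rewrite -EFinM !indicE -natrM mulnb; congr ((nat_of_bool _)%:R%:E).
 by rewrite in_setX.
rewrite -!EFinM; congr EFin; ring.
Qed.

Definition bet : prob RM R := law (prodP mu nu) meas_ratio.

Definition gsum : prob RM R := law (prodP mu nu) meas_sum.

Lemma beta_gamma_total : ((\int[leb]_v (bpdf a b v)%:E) * (\int[leb]_s (gpdf (a + b).+1 s)%:E) =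
 1)%E.
Proof.
have := beta_gamma_rect measurableT measurableT.
rewrite setXTT preimage_setT probability_setT => ->.
by congr (_ * _)%E; apply: eq_integral => x _; rewrite indicT mul1e.
Qed.

(** [beta_gamma_rect] only gives the product of the two densities, so each marginal is identified
    once the other density has integral 1. The circle is opened by [integral_bpdf_n0], where one
    exponent vanishes: it yields all gamma densities by induction, and these normalize all beta
    densities. *)
Lemma bet_pdf_ex : has_pdf gsum (gpdf (a + b).+1) -> has_pdf bet (bpdf a b).
Proof.
move=> hg; apply: (has_pdf_law (mp_law (prodP mu nu) meas_ratio)).
- move=> A mA; have := beta_gamma_rect mA measurableT.
 rewrite (_ : _ @^-1` _ = (fun z : RM * RM => z.1 / (z.1 + z.2)) @^-1` A).
  by rewrite -(pdf_indic hg)// probability_setT mule1.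
 by apply/seteqP; split => z //= [].
- exact: meas_bpdf.
- exact: bpdf_ge0.
Qed.

Lemma gsum_pdf_ex : (\int[leb]_v (bpdf a b v)%:E = 1)%E -> has_pdf gsum (gpdf (a + b).+1).
Proof.
move=> hb; apply: (has_pdf_law (mp_law (prodP mu nu) meas_sum)).
- move=> B mB; have := beta_gamma_rect measurableT mB.
 rewrite (_ : _ @^-1` _ = (fun z : RM * RM => z.1 + z.2) @^-1` B).
  move=> ->; rewrite (_ : (\int[leb]_v (_ * _))%E = 1%E) ?mul1e// -hb.
  by apply: eq_integral => x _; rewrite indicT mul1e.
 by apply/seteqP; split => z //= [].
- exact: meas_gpdf.
- exact: gpdf_ge0.
Qed.


End beta_gamma.

Lemma integral_bpdf_n0 k : (\int[leb]_v (bpdf k 0 v)%:E = 1)%E.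
Proof.
pose F := (@GRing.exp R ^~ k.+1).
transitivity (\int[leb]_(v in `]0%R, 1%R[) (k.+1%:R * v ^+ k)%:E)%E.
 rewrite [RHS]integral_mkcond; apply: eq_integral => v _.
 rewrite patchE /bpdf addn0 mem_setE in_itv/=; case: ifP => // _.
 congr EFin; rewrite fact0 mulr1 expr0 mulr1 factS natrM.
 by rewrite mulfK// pnatr_eq0 -lt0n fact_gt0.
transitivity (\int[leb]_(v in `[0%R, 1%R]) (k.+1%:R * v ^+ k)%:E)%E.
 rewrite [RHS]integral_itv_bndoo//; apply/measE.
 by apply: measurable_funTS; apply: measM.
rewrite (continuous_FTC2 (F := F)) ?ltr01//.
- by rewrite /F expr1n expr0n/= sube0.
- apply: continuous_subspaceT => x; apply: cvgM; first exact: cvg_cst.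
 exact: exprn_continuous.
- split.
 + by move=> x _; exact: exprn_derivable.
 + apply: cvg_at_right_filter; exact: exprn_continuous.
 + apply: cvg_at_left_filter; exact: exprn_continuous.
- by move=> x _; rewrite exp_derive1.
Qed.

(** Defined as an iterated sum of exponentials, hence of shape k + 1; [gam 0] is the exponential law
    by computation. *)
Fixpoint gam (k : nat) : prob RM R := if k is k'.+1 then gsum (gam k') expP else expP.

Lemma gam_pdf k : has_pdf (gam k) (gpdf k).
Proof.
elim: k => [|k IH]; first exact: expP_pdf.
by have := gsum_pdf_ex IH expP_pdf (integral_bpdf_n0 k); rewrite addn0.
Qed.

Definition betP a b : prob RM R := bet (gam a) (gam b).

Lemma integral_gpdf k : (\int[leb]_v (gpdf k v)%:E = 1)%E.
Proof.
have [_ _ /(_ setT measurableT)] := gam_pdf k.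
by rewrite probability_setT.
Qed.

Lemma integral_bpdf a b : (\int[leb]_v (bpdf a b v)%:E = 1)%E.
Proof.
by have := beta_gamma_total (gam_pdf a) (gam_pdf b); rewrite integral_gpdf mule1.
Qed.

Lemma mp_gam_add a b : mp (prodP (gam a) (gam b)) (gam (a + b).+1) (fun z : RM * RM => z.1 + z.2 :
 RM).
Proof.
have h := gsum_pdf_ex (gam_pdf a) (gam_pdf b) (integral_bpdf a b).
have [m H] := mp_law (prodP (gam a) (gam b)) (measD measurable_fst measurable_snd).
split=> // A mA; have := pdf_indic h mA; rewrite -(pdf_indic (gam_pdf _) mA).
by move=> <-.
Qed.

Lemma betP_pdf a b : has_pdf (betP a b) (bpdf a b).
Proof.
apply: bet_pdf_ex; [exact: gam_pdf|exact: gam_pdf|].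
exact: (gsum_pdf_ex (gam_pdf a) (gam_pdf b) (integral_bpdf a b)).
Qed.

Lemma mp_beta_gamma a b : mp (prodP (gam a) (gam b)) (prodP (betP a b) (gam (a + b).+1)) (fun z : RM
 * RM => (z.1 / (z.1 + z.2) : RM, z.1 + z.2 : RM)).
Proof.
apply: mp_pairX.
 apply: meas_pair; last exact: measD.
 by apply: measurable_div => //; exact: measD.
move=> A B mA mB; rewrite (beta_gamma_rect (gam_pdf a) (gam_pdf b))//.
by rewrite (pdf_indic (betP_pdf a b) mA) (pdf_indic (gam_pdf _) mB).
Qed.

Lemma gam_pos k : gam k `]-oo, 0]%classic = 0%E.
Proof.
rewrite (pdf_indic (gam_pdf k))// integral0_eq// => x _.
rewrite indicE mem_setE in_itv/= /gpdf; case: leP => _; rewrite ?mul0e//.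
by rewrite mule0.
Qed.

(** This map inverts that of [mp_beta_gamma] as soon as both gamma variables are positive; the
    exceptional set [Z] is null by [gam_pos]. *)
Lemma mp_gamma_beta a b : mp (prodP (betP a b) (gam (a + b).+1)) (prodP (gam a) (gam b)) (fun z : RM
 * RM => (z.1 * z.2 : RM, (1 - z.1) * z.2 : RM)).
Proof.
have mg : measT (fun z : RM * RM => (z.1 * z.2 : RM, (1 - z.1) * z.2 : RM)).
 apply: meas_pair; apply: measM => //.
 exact: measB.
apply: (mp_cancel mg (mp_beta_gamma a b)).
pose Z := (`]-oo, 0]%classic : set RM) `*` (setT : set RM) `|` (setT : set RM) `*` (`]-oo,
 0]%classic : set RM).
have mZ : measurable Z by apply: measurableU; exact: measurableX.
apply: (@mp_ae R _ _ _ _ _ _ id _ Z); [| | | |exact: mp_id].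
- apply: (mcomp mg); exact: (mp_beta_gamma a b).1.
- exact: mZ.
- apply/eqP; rewrite eq_le measure_ge0 andbT.
 have E1 : prodP (gam a) (gam b) ((`]-oo, 0]%classic : set RM) `*` setT) = 0%E.
  by rewrite prodPX// gam_pos mul0e.
 have E2 : prodP (gam a) (gam b) (setT `*` (`]-oo, 0]%classic : set RM)) = 0%E.
  by rewrite prodPX// gam_pos mule0.
 rewrite -[leRHS]adde0 -{1}E1 -E2.
 by apply: measureU2; exact: measurableX.
- move=> -[x y] nZ /=.
 have x0 : 0 < x by rewrite ltNge; apply/negP => h; apply: nZ; left; split; rewrite //= in_itv.
 have y0 : 0 < y by rewrite ltNge; apply/negP => h; apply: nZ; right; split; rewrite //= in_itv.
 by congr pair; field; rewrite gt_eqF// addr_gt0.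
Qed.

Lemma gpdf_moment k x : x * gpdf k x = k.+1%:R * gpdf k.+1 x.
Proof.
rewrite /gpdf; case: ifP => x0; rewrite ?mulr0// factS natrM exprS.
by field; rewrite pnatr_eq0 -lt0n fact_gt0 addrC natr1 pnatr_eq0.
Qed.

Lemma integral_gam_abs k : (\int[gam k]_x `|x|%:E = k.+1%:R%:E)%E.
Proof.
rewrite (pdf_integral (gam_pdf k))//; last exact: mcomp.
rewrite -[RHS]mule1 -(integral_gpdf k.+1) -ge0_integralZl//.
- apply: eq_integral => x _; rewrite -!EFinM -gpdf_moment; congr EFin.
 rewrite /gpdf; case: ifP; rewrite ?mulr0// => x0.
 by rewrite gtr0_norm.
- exact: (mcomp _ (meas_gpdf k.+1)).
- by move=> x _; rewrite lee_fin gpdf_ge0.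
Qed.

Lemma integral_gam_sqr k : (\int[gam k]_x (x ^+ 2)%:E = (k.+1%:R * k.+2%:R)%:E)%E.
Proof.
rewrite (pdf_integral (gam_pdf k))//; last 2 first.
- by apply: mcomp => //; exact: measX.
- by move=> x; rewrite lee_fin sqr_ge0.
rewrite -[RHS]mule1 -(integral_gpdf k.+2) -ge0_integralZl//.
- apply: eq_integral => x _; rewrite -!EFinM; congr EFin.
 by rewrite expr2 -mulrA gpdf_moment mulrCA gpdf_moment; ring.
- exact: (mcomp _ (meas_gpdf k.+2)).
- by move=> x _; rewrite lee_fin gpdf_ge0.
Qed.

Lemma expP_mgf (l : R) : l < 1 -> (\int[expP]_x (expR (l * x))%:E = (1 - l)^-1%:E)%E.
Proof.
move=> l1; rewrite (pdf_integral expP_pdf)//; last first.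
 by apply: mcomp => //; apply: mcomp.
have l0 : 0 < 1 - l by rewrite subr_gt0.
have := @ge0_integral_affine (fun x => (gpdf 0 x)%:E) (1 - l) 0 l0 (mcomp _ (meas_gpdf 0)).
rewrite integral_gpdf mule1 => <- //; last first.
 by move=> x; rewrite lee_fin gpdf_ge0.
apply: eq_integral => x _; rewrite -EFinM addr0 /gpdf pmulr_rgt0//.
case: ifP; rewrite ?mulr0// => x0; congr EFin.
by rewrite !expr0 !mul1r mulrA -expRD; congr (expR _ / _); ring.
Qed.

End densities.

(** * The Gaussian measure: translations, reflections and linear forms *)

Section gaussian.
Context {R : realType}.
Notation RM := (measurableTypeR R).
Notation leb := (@lebesgue_measure R).

Definition gauss : prob RM R := normal_prob 0 1.

Lemma normal_has_pdf (s : R) : has_pdf (normal_prob 0 s) (normal_pdf 0 s).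
Proof.
split; [exact: measurable_normal_pdf|exact: normal_pdf_ge0|by []].
Qed.

Lemma normal_pdf01 (x : R) : normal_pdf 0 1 x = normal_peak 1 * expR (- (x ^+ 2 / 2)).
Proof.
rewrite normal_pdfE ?oner_eq0// /normal_fun subr0 expr1n.
by rewrite mulNr.
Qed.

Lemma meas_expRl d (T : mtype d) (f : T -> R) : measT f -> measT (fun x => (expR (f x))%:E).
Proof. by move=> mf; apply: mcomp => //; apply: mcomp. Qed.

Lemma cameron_martin1 (g : RM -> \bar R) (a : R) : measT g -> (forall x, (0 <= g x)%E) ->
 (\int[gauss]_z g (z + a)%R = \int[gauss]_z (g z * (expR (a * z - a ^+ 2 / 2))%:E))%E.
Proof.
move=> mg g0.
have ma : measT (fun z : RM => (z + a : RM)) by exact: measD.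
rewrite (pdf_integral (normal_has_pdf 1)); [|exact: (mcomp mg)|by []].
rewrite (pdf_integral (normal_has_pdf 1)); last 2 first.
- apply: emeasM => //; apply: meas_expRl.
 by apply: measB => //; exact: measM.
- by move=> x; rewrite mule_ge0// lee_fin expR_ge0.
pose h (z : RM) := (g z * (normal_pdf 0 1 (z - a))%:E)%E.
have mh : measT h.
 apply: emeasM => //; apply: mcomp => //.
 by apply: (mcomp (measurable_normal_pdf 0 1)); exact: measB.
have h0 z : (0 <= h z)%E by rewrite mule_ge0// lee_fin normal_pdf_ge0.
have := ge0_integral_affine a ltr01 mh h0; rewrite invr1 mul1e => E.
transitivity (\int[leb]_x h (1 * x + a)%R)%E.
 by apply: eq_integral => z _; rewrite /h mul1r addrK.
rewrite E; apply: eq_integral => z _; rewrite /h -muleA -EFinM; congr (_ * _%:E)%E.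
by rewrite !normal_pdf01 mulrCA -expRD; congr (_ * expR _); field.
Qed.

Lemma gauss_mgf (a : R) : (\int[gauss]_z (expR (a * z))%:E = (expR (a ^+ 2 / 2))%:E)%E.
Proof.
have := @cameron_martin1 (cst 1%E) a (measurable_cst _) (fun=> lee01).
rewrite (_ : (\int[gauss]_z cst 1%E (z + a)%R)%E = 1%E); last first.
 by rewrite (integral_cst _ measurableT) mul1e; exact: probability_setT.
move=> E.
rewrite -[RHS]mule1 E -ge0_integralZl//.
- apply: eq_integral => z _; rewrite mul1e -EFinM -expRD.
 by congr (expR _)%:E; ring.
- under eq_fun do rewrite mul1e.
 by apply: meas_expRl; apply: measB => //; exact: measM.
- by move=> x _; rewrite mul1e lee_fin expR_ge0.
Qed.

Lemma mp_gauss_opp : mp gauss gauss (fun z : RM => (- z : RM)).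
Proof.
have mo : measT (fun z : RM => (- z : RM)) by apply: measurable_funN.
split => // A mA.
have mA' := meas_preim mo mA.
rewrite (pdf_indic (normal_has_pdf 1) mA) (pdf_indic (normal_has_pdf 1) mA').
pose h x := ((\1_A x)%:E * (normal_pdf 0 1 x)%:E)%E.
have mh : measurable_fun [set: RM] h.
 apply: emeasM; first exact: (meas_ind mA).
 exact: (mcomp _ (measurable_normal_pdf 0 1)).
have h0 x : (0 <= h x)%E by rewrite mule_ge0// lee_fin// normal_pdf_ge0.
transitivity (\int[leb]_x h (- x)%R)%E; last exact: ge0_integral_oppr.
by apply: eq_integral => x _; rewrite /h !normal_pdf01 sqrrN.
Qed.

Lemma mp_gauss_scale (s : R) : 0 < s -> mp gauss (normal_prob 0 s) (fun z : RM => (s * z : RM)).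
Proof.
move=> s0.
have mo : measT (fun z : RM => (s * z : RM)) by exact: measM.
split => // A mA.
have mA' := meas_preim mo mA.
rewrite (pdf_indic (normal_has_pdf s) mA) (pdf_indic (normal_has_pdf 1) mA').
pose h x := ((\1_A x)%:E * (normal_pdf 0 s x)%:E)%E.
have mh : measurable_fun [set: RM] h.
 apply: emeasM; first exact: (meas_ind mA).
 exact: (mcomp _ (measurable_normal_pdf 0 s)).
have h0 x : (0 <= h x)%E by rewrite mule_ge0// lee_fin// normal_pdf_ge0.
have E := ge0_integral_affine 0 s0 mh h0.
transitivity (s%:E * (\int[leb]_x h (s * x + 0)%R))%E; last first.
 by rewrite E muleA -EFinM divff ?gt_eqF// mul1e.
have mh' : measT (fun x : RM => h (s * x + 0)).
 by apply: (mcomp mh); apply: measD.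
rewrite -ge0_integralZl//; last by rewrite lee_fin ltW.
apply: eq_integral => v _; rewrite /h addr0 muleCA; congr (_ * _)%E.
rewrite -EFinM !normal_pdfE ?gt_eqF// /normal_fun !subr0 expr1n.
rewrite mulrA; congr ((_ * expR _)%:E); last by field; rewrite gt_eqF.
rewrite /normal_peak expr1n -!mulrnAr mul1r sqrtrM ?sqr_ge0//.
rewrite sqrtr_sqr gtr0_norm// invfM mulrA divff ?gt_eqF// mul1r.
reflexivity.
Qed.

Definition shift_upto n (c : nat -> R) (t : R) (z : nat -> R) (i : nat) : R := if (i < n)%N then z i
 + t * c i else z i.

Definition lincomb n (c z : nat -> R) : R := \sum_(i < n) c i * z i.

Lemma meas_lincomb n c : measT (lincomb n c : rseq -> RM).
Proof.
apply: measurable_sum => i; apply: measM => //.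
exact: meas_coord.
Qed.

Lemma meas_shift n c : measT (fun p : RM * rseq => (shift_upto n c p.1 p.2 : rseq)).
Proof.
apply: meas_rseq => i; rewrite /shift_upto.
have m : measT (fun p : RM * rseq => p.2 i : R).
 exact: (mcomp (meas_coord i) measurable_snd).
case: (i < n)%N; last exact: m.
by apply: measD => //; exact: measM.
Qed.

Lemma meas_shift_comp d (T : mtype d) n c (f : T -> RM) (g : T -> rseq) : measT f -> measT g ->
 measT (fun x => (shift_upto n c (f x) (g x) : rseq)).
Proof.
by move=> mf mg; exact: (mcomp (meas_shift n c) (meas_pair mf mg)).
Qed.

Lemma meas_shift1 n c t : measT (fun z : rseq => (shift_upto n c t z : rseq)).
Proof.
exact: (mcomp (meas_shift n c) (meas_pairl t)).
Qed.

(** One application of [cameron_martin1] for each shifted coordinate. Translations are the only tool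
    used for Gaussian sequences: the reflection below is a product of translations, so no linear
    change of variables in n dimensions is made. *)
Lemma cameron_martin n (c : nat -> R) t (g : rseq -> \bar R) : measT g -> (forall x, (0 <= g x)%E)
 -> (\int[pow gauss]_z g (shift_upto n c t z) = \int[pow gauss]_z (g z * (expR (t * lincomb n c z -
 t ^+ 2 * (\sum_(i < n) c i ^+ 2) / 2))%:E))%E.
Proof.
elim: n c g => [|n IH] c g mg g0.
 apply: eq_integral => z _; rewrite /lincomb !big_ord0 mulr0 mulr0 mul0r subrr.
 by rewrite expR0 mule1.
pose c' i := c i.+1.
have mexp k (b : nat -> R) u : measT (fun z : rseq => (expR (t * lincomb k b z - u))%:E).
 apply: meas_expRl; apply: measB => //.
 by apply: measM => //; exact: meas_lincomb.
have mc := mp_cons (powP gauss).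
rewrite (mp_ge0_integral mc); last 2 first.
- exact: (mcomp mg (meas_shift1 n.+1 c t)).
- by move=> y; exact: g0.
rewrite (mp_ge0_integral mc); last 2 first.
- by apply: emeasM.
- by move=> y; rewrite mule_ge0// lee_fin expR_ge0.
have mg1 := mcomp mg mc.1.
rewrite !prodP_ge0_integral; last 4 first.
- exact: (mcomp (emeasM mg (mexp n.+1 c _)) mc.1).
- by move=> y; rewrite mule_ge0// lee_fin expR_ge0.
- exact: (mcomp (mcomp mg (meas_shift1 n.+1 c t)) mc.1).
- by move=> y; exact: g0.
pose E' (z : nat -> R) := (expR (t * lincomb n c' z - t ^+ 2 * (\sum_(i < n) c' i ^+ 2) / 2)%R)%:E.
have mE' : measurable_fun [set: rseq] E' by exact: mexp.
pose h (x : RM) := (\int[pow gauss]_s (g (scons x s) * E' s))%E.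
have mhh : measT (fun p : RM * rseq => g (scons p.1 p.2) * E' p.2)%E.
 apply: emeasM => //.
 exact: (mcomp mE' measurable_snd).
have hh0 (p : RM * rseq) : (0 <= g (scons p.1 p.2) * E' p.2)%E.
 by rewrite mule_ge0// lee_fin expR_ge0.
have mh : measT h.
 exact: (@measurable_fun_fubini_tonelli_F _ _ RM rseq R (pow gauss) _ mhh hh0).
have h0 x : (0 <= h x)%E by apply: integral_ge0 => s _; exact: (hh0 (x, s)).
transitivity (\int[gauss]_x h (x + t * c 0%N)%R)%E.
 apply: eq_integral => x _ /=.
 have mgx : measT (fun s : rseq => g (scons (x + t * c 0%N) s)).
  exact: (mcomp mg1 (meas_pairl _)).
 rewrite /h -(IH c' (fun s => g (scons (x + t * c 0%N) s)) mgx (fun=> g0 _)).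
 apply: eq_integral => s _; congr g; apply/funext => -[|i] //=.
rewrite cameron_martin1//; apply: eq_integral => x _ /=.
rewrite /h muleC -ge0_integralZl ?lee_fin ?expR_ge0//; last 2 first.
- exact: (mcomp mhh (meas_pairl x)).
- by move=> s _; exact: (hh0 (x, s)).
apply: eq_integral => s _; rewrite muleCA; congr (_ * _)%E.
rewrite -EFinM -expRD /lincomb !big_ord_recl/=; congr (expR _)%:E.
have -> : \sum_(i < n) c (bump 0 i) * scons x s (bump 0 i) = \sum_(i < n) c' i * s i by [].
have -> : \sum_(i < n) c (bump 0 i) ^+ 2 = \sum_(i < n) c' i ^+ 2 by [].
by field.
Qed.

(* Reflection exchanging the unit vectors (c, 0) and (0, 1) of R^n x R. *)
Definition swap_dir n (c : nat -> R) (p : rseq * RM) : rseq * RM := (shift_upto n c (p.2 - lincomb n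
 c p.1) p.1, lincomb n c p.1).

Lemma meas_swap_dir n c : measT (swap_dir n c).
Proof.
have ml : measT (fun p : rseq * RM => lincomb n c p.1 : RM).
 exact: (mcomp (meas_lincomb n c) measurable_fst).
apply: meas_pair; last exact: ml.
by apply: meas_shift_comp => //; exact: measB.
Qed.

Lemma mp_swap_dir n (c : nat -> R) : \sum_(i < n) c i ^+ 2 = 1 -> mp (prodP (pow gauss) gauss)
 (prodP (pow gauss) gauss) (swap_dir n c).
Proof.
move=> c1; pose s := lincomb n c.
have ms : measT (s : rseq -> RM) := meas_lincomb n c.
have sshift t z : s (shift_upto n c t z) = s z + t.
 rewrite /s /lincomb /shift_upto -[in RHS](mulr1 t) -c1 mulr_sumr -big_split/=.
 by apply: eq_bigr => i _; rewrite ltn_ord; ring.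
split=> [|A mA]; first exact: meas_swap_dir.
have mA' := meas_preim (meas_swap_dir n c) mA.
pose F p : \bar R := (\1_A p)%:E.
have mF : measT F by exact: (meas_ind mA).
have F0 p : (0 <= F p)%E by rewrite lee_fin.
rewrite -[LHS]/(prodP _ _ _) -[in LHS](setIT (_ @^-1` _)) -integral_indic//.
rewrite -[in RHS](setIT A) -integral_indic//.
rewrite -[LHS]/(\int[prodP (pow gauss) gauss]_p F (swap_dir n c p))%E.
rewrite -[RHS]/(\int[prodP (pow gauss) gauss]_p F p)%E.
clearbody F.
transitivity (\int[pow gauss]_z \int[gauss]_y F (swap_dir n c (z, y)))%E.
 exact: (prodP_ge0_integral _ _ (mcomp mF (meas_swap_dir n c)) (fun p => F0 _)).
transitivity (\int[pow gauss]_z \int[gauss]_y F (z, y))%E; last first.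
 by apply/esym; exact: (prodP_ge0_integral _ _ mF F0).
have me d (T : mtype d) (f g : T -> RM) : measT f -> measT g -> measT (fun x => (expR (f x * g x - f
 x ^+ 2 / 2))%:E).
 move=> mf mg; apply: meas_expRl; apply: measB.
  exact: measM.
 by apply: measM => //; exact: measX.
(* Three translations produce the reflection: y by - s(z) at fixed z, then z by y along c at fixed
   y, then y by s(z) at fixed z. The density left by the first two is absorbed by the third, and the
   symmetry of the normal law corrects the sign of y. *)
pose K (z : rseq) (y : RM) := (F (shift_upto n c y z, s z) * (expR (- s z * y - (- s z) ^+ 2 /
 2)%R)%:E)%E.
have ms1 : measT (fun p : rseq * RM => s p.1 : RM).
 exact: (mcomp ms measurable_fst).
have mK : measT (fun p : rseq * RM => K p.1 p.2).
 apply: emeasM.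
  apply: (mcomp mF); apply: meas_pair => //.
  exact: meas_shift_comp.
 by apply: me => //; exact: measurable_funN.
have K0 z y : (0 <= K z y)%E by rewrite mule_ge0// lee_fin expR_ge0.
transitivity (\int[pow gauss]_z \int[gauss]_y K z y)%E.
 apply: eq_integral => z _.
 rewrite -[RHS](@cameron_martin1 (fun y => F (shift_upto n c y z, s z)) (- s z))//.
 apply: (mcomp mF); apply: meas_pair => //.
 exact: meas_shift_comp.
rewrite (@fubini_tonelli _ _ rseq RM R (pow gauss) gauss _ mK (fun p => K0 _ _)).
pose L (z : rseq) (y : RM) := (F (z, (s z - y)%R) * (expR (s z * y - s z ^+ 2 / 2)%R)%:E)%E.
have mL : measT (fun p : rseq * RM => L p.1 p.2).
 apply: emeasM; last exact: me.
 apply: (mcomp mF); apply: meas_pair => //.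
 exact: measB.
have L0 z y : (0 <= L z y)%E by rewrite mule_ge0// lee_fin expR_ge0.
transitivity (\int[gauss]_y \int[pow gauss]_z L z y)%E.
 apply: eq_integral => y _ /=.
 pose g (w : rseq) := (F (w, (s w - y)%R) * (expR (- (s w - y) * y - (- (s w - y)) ^+ 2 /
  2)%R)%:E)%E.
 have mg : measT g.
  have msy : measT (fun w : rseq => (s w - y : RM)).
   exact: measB.
  apply: emeasM; last by apply: me => //; exact: measurable_funN.
  by apply: (mcomp mF); exact: meas_pair.
 have g0 w : (0 <= g w)%E by rewrite mule_ge0// lee_fin expR_ge0.
 transitivity (\int[pow gauss]_z g (shift_upto n c y z))%E.
  by apply: eq_integral => z _; rewrite /K /g sshift addrK.
 rewrite cameron_martin// c1; apply: eq_integral => z _.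
 rewrite /g /L -muleA -EFinM -expRD; congr (_ * (expR _)%:E)%E.
 by rewrite -/(s z); field.
rewrite -(@fubini_tonelli _ _ rseq RM R (pow gauss) gauss _ mL (fun p => L0 _ _)).
apply: eq_integral => z _ /=.
have mzy : measT (fun y : RM => (s z - y : RM)).
 exact: measB.
rewrite -[LHS](@cameron_martin1 (fun y => F (z, (s z - y)%R)) (s z))//; last first.
 by apply: (mcomp mF); exact: meas_pair.
rewrite [RHS](mp_ge0_integral mp_gauss_opp)//; last first.
 exact: (mcomp mF (meas_pairl z)).
by apply: eq_integral => y _; congr (F (_, _)); ring.
Qed.

(** A unit linear form is the second coordinate of the reflection [swap_dir], and that coordinate is
    standard normal. *)
Lemma mp_lincomb n (c : nat -> R) : \sum_(i < n) c i ^+ 2 = 1 -> mp (pow gauss) gauss (lincomb n c).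
Proof.
move=> c1; apply: (mp_cancel (meas_lincomb n c) (mp_fst (pow gauss) gauss)).
exact: (mp_eqfun _ (mp_comp (mp_swap_dir c1) (mp_snd (pow gauss) gauss))).
Qed.

End gaussian.

(** * Derivatives and the fundamental theorem of calculus *)

Section derivatives.
Context {R : realType}.
Implicit Types (f g : R -> R) (x a b c : R).

Lemma drv_cst c x : is_derive x 1 (fun=> c : R) 0.
Proof. exact: is_derive_cst. Qed.

Lemma drv_id x : is_derive x 1 (fun y : R => y) 1.
Proof. exact: is_derive_id. Qed.

Lemma drvD f g x a b : is_derive x 1 f a -> is_derive x 1 g b -> is_derive x 1 (fun y => f y + g y)
 (a + b).
Proof. by move=> hf hg; exact: (is_deriveD hf hg). Qed.

Lemma drvN f x a : is_derive x 1 f a -> is_derive x 1 (fun y => - f y) (- a).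
Proof. by move=> hf; exact: (is_deriveN hf). Qed.

Lemma drvB f g x a b : is_derive x 1 f a -> is_derive x 1 g b -> is_derive x 1 (fun y => f y - g y)
 (a - b).
Proof. by move=> hf hg; apply: drvD => //; exact: drvN. Qed.

Lemma drvM f g x a b : is_derive x 1 f a -> is_derive x 1 g b -> is_derive x 1 (fun y => f y * g y)
 (f x * b + g x * a).
Proof. by move=> hf hg; exact: (is_deriveM hf hg). Qed.

Lemma drvZ f x a c : is_derive x 1 f a -> is_derive x 1 (fun y => c * f y) (c * a).
Proof.
move=> hf; have := drvM (drv_cst c x) hf; rewrite mulr0 addr0; exact.
Qed.

Lemma drvX f n x a : is_derive x 1 f a -> is_derive x 1 (fun y => f y ^+ n) (n%:R * f x ^+ n.-1 *
 a).
Proof.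
move=> hf; have := is_deriveX n hf.
by rewrite (_ : f ^+ n = fun y => f y ^+ n)//; apply/funext => y; rewrite fctE.
Qed.

Lemma drv_exp f x a : is_derive x 1 f a -> is_derive x 1 (fun y => expR (f y)) (expR (f x) * a).
Proof. by move=> hf; exact: (is_derive1_comp (is_derive_expR (f x)) hf). Qed.

Lemma drv_continuous f x a : is_derive x 1 f a -> {for x, continuous f}.
Proof.
by move=> hf; apply: differentiable_continuous; apply/derivable1_diffP; case: hf.
Qed.

Lemma drv_eq f x a b : is_derive x 1 f a -> a = b -> is_derive x 1 f b.
Proof. by move=> h <-. Qed.

Lemma FTC_cc (F f : R -> R) a b : a <= b -> (forall x, a <= x <= b -> is_derive x 1 F (f x)) ->
 (forall x, a <= x <= b -> {for x, continuous f}) -> (\int[lebesgue_measure]_(x in `[a, b]) (f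
 x)%:E = (F b - F a)%:E)%E.
Proof.
rewrite le_eqVlt => /predU1P[<- _ _|ab dF cf].
 by rewrite subrr set_itv1 integral_set1.
have [la lb] : a <= a <= b /\ a <= b <= b by rewrite !lexx ltW.
rewrite (continuous_FTC2 (F := F)) ?EFinB//.
- apply: continuous_in_subspaceT => x; rewrite inE/= in_itv/= => h.
 exact: cf.
- split.
 + move=> x; rewrite in_itv/= => /andP[ax xb].
  by have [] := dF x (etrans (congr2 _ (ltW ax) (ltW xb)) erefl).
 + by apply: cvg_at_right_filter; exact: (drv_continuous (dF a la)).
 + by apply: cvg_at_left_filter; exact: (drv_continuous (dF b lb)).
- move=> x; rewrite in_itv/= => /andP[ax xb]; rewrite derive1E.
 by have [] := dF x (etrans (congr2 _ (ltW ax) (ltW xb)) erefl).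
Qed.

Lemma drv_nondecreasing (F f : R -> R) a b : a <= b -> (forall x, a <= x <= b -> is_derive x 1 F (f
 x)) -> (forall x, a < x < b -> 0 <= f x) -> F a <= F b.
Proof.
move=> ab dF f0; have dF' x : x \in `]a, b[ -> is_derive x 1 F (f x).
 by rewrite in_itv/= => /andP[ax xb]; apply: dF; rewrite !ltW.
apply: (@ger0_derive1_le_cc R F a b).
- by move=> x /dF' [].
- move=> x xab; rewrite derive1E; have [_ ->] := dF' _ xab.
 by apply: f0; move: xab; rewrite in_itv.
- apply: continuous_in_subspaceT => x; rewrite inE/= in_itv/= => h.
 exact: (drv_continuous (dF x h)).
- by rewrite in_itv/= lexx.
- by rewrite in_itv/= lexx andbT.
- by [].
Qed.

End derivatives.

(** * Distribution functions of laws with a density *)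

Section cdf_density.
Context {R : realType}.
Notation RM := (measurableTypeR R).
Notation leb := (@lebesgue_measure R).
Implicit Types (mu : prob RM R) (f : R -> R).

Lemma cdfR_sub mu (x y : R) : x <= y -> (cdfR mu y - cdfR mu x)%:E = mu `]x, y]%classic.
Proof.
move=> xy; have : mu `]-oo, y]%classic = (mu `]-oo, x]%classic + mu `]x, y]%classic)%E.
 rewrite -measureU//; last first.
  rewrite -subset0 => z [/=]; rewrite !in_itv/= => zx /andP[xz _].
  by move: (lt_le_trans xz zx); rewrite ltxx.
 congr (mu _); apply/seteqP; split => z /=; rewrite !in_itv/=.
  by case: (leP z x) => zx; [left|right].
 by case=> [zx|/andP[]//]; exact: le_trans xy.
rewrite -!cdfRE EFinB => ->; rewrite addeAC subee ?add0e//.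
Qed.

Lemma cdfR_sub_pdf mu f (x y : R) : has_pdf mu f -> x <= y -> (cdfR mu y - cdfR mu x)%:E =
 (\int[leb]_(t in `[x, y]) (f t)%:E)%E.
Proof.
move=> hf xy; rewrite cdfR_sub//; have [mf _ ->//] := hf.
rewrite integral_itv_obnd_cbnd//.
by apply: measurable_funTS; exact: (mcomp _ mf).
Qed.

Lemma cdfR_sub_le mu f (g G : R -> R) (x y : R) : has_pdf mu f -> x <= y -> (forall t, x <= t <= y
 -> is_derive t 1 G (g t)) -> (forall t, x <= t <= y -> {for t, continuous g}) -> (forall t, x <= t
 <= y -> f t <= g t) -> cdfR mu y - cdfR mu x <= G y - G x.
Proof.
move=> hf xy dG cg fg; rewrite -lee_fin (cdfR_sub_pdf hf xy) -(FTC_cc xy dG cg).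
have [mf f0 _] := hf.
apply: ge0_le_integral => //.
- by move=> t _; rewrite lee_fin.
- by apply: measurable_funTS; exact: (mcomp _ mf).
- apply/measE; apply: subspace_continuous_measurable_fun => //.
 apply: continuous_in_subspaceT => t; rewrite inE/= in_itv/= => h.
 exact: cg.
Qed.

Lemma cdfR_sub_ge mu f (g G : R -> R) (x y : R) : has_pdf mu f -> x <= y -> (forall t, x <= t <= y
 -> is_derive t 1 G (g t)) -> (forall t, x <= t <= y -> {for t, continuous g}) -> (forall t, x <= t
 <= y -> 0 <= g t <= f t) -> G y - G x <= cdfR mu y - cdfR mu x.
Proof.
move=> hf xy dG cg fg; rewrite -lee_fin (cdfR_sub_pdf hf xy) -(FTC_cc xy dG cg).
have [mf f0 _] := hf.
apply: ge0_le_integral => //.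
- by move=> t; rewrite /= in_itv/= => h; rewrite lee_fin; case/andP: (fg _ h).
- apply/measE; apply: subspace_continuous_measurable_fun => //.
 apply: continuous_in_subspaceT => t; rewrite inE/= in_itv/= => h.
 exact: cg.
- by apply: measurable_funTS; exact: (mcomp _ mf).
- by move=> t; rewrite /= in_itv/= => h; rewrite lee_fin; case/andP: (fg _ h).
Qed.

Lemma cdfR_continuous mu f (C : R) : has_pdf mu f -> (forall x, f x <= C) -> continuous (cdfR mu).
Proof.
move=> hf fC.
have L x y : x <= y -> cdfR mu y - cdfR mu x <= C * y - C * x.
 move=> xy; apply: (cdfR_sub_le (g := fun=> C) (G := fun t => C * t) hf xy) => //.
 - by move=> t _; apply: drv_eq (drvZ C (drv_id t)) _; rewrite mulr1.
 - by move=> t _; exact: cvg_cst.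
have C0 : 0 <= C by have [_ f0 _] := hf; exact: le_trans (f0 0) (fC 0).
move=> x; apply/cvgrPdist_le => e e0; near=> y.
have H : `|cdfR mu x - cdfR mu y| <= C * `|x - y|.
 have [xy|yx] := leP x y.
  rewrite distrC (distrC x) !ger0_norm ?subr_ge0 ?cdfR_nd// mulrBr; exact: L.
 rewrite !ger0_norm ?subr_ge0 ?cdfR_nd ?(ltW yx)// mulrBr; exact/L/ltW.
apply: (le_trans H); apply: (@le_trans _ _ ((C + 1) * `|x - y|)).
 by rewrite ler_wpM2r// lerDl.
rewrite mulrC -ler_pdivlMr ?ltr_wpDl//.
near: y; apply: cvgr_dist_le; last by rewrite divr_gt0// ltr_wpDl.
exact: cvg_id.
Unshelve. all: by end_near. Qed.

(** It suffices to test on the quantile of a uniform variable, and there F(Q(u)) = u: if F(Q(u)) >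
    u, continuity would give a point to the left of Q(u) where F is still above u. *)
Lemma mp_cdfR mu : continuous (cdfR mu) -> mp mu unif (cdfR mu : RM -> RM).
Proof.
move=> cF.
have mF : measT (cdfR mu : RM -> RM).
 exact: cont_meas.
apply: (mp_cancel mF (mp_quantile mu)).
apply: (@mp_ae R _ _ RM RM unif unif id _ (~` `]0, 1[%classic)).
- exact: (mcomp mF (meas_quantile mu)).
- exact: measurableC.
- rewrite probability_setC//; rewrite unif_itv01// (_ : _ `&` _ = `]0, 1[%classic).
  by rewrite lebesgue_measure_itv/= lte_fin ltr01 oppr0 adde0 subee.
 apply/seteqP; split=> y /=; rewrite !in_itv/=; first by case.
 by move=> /andP[y0 y1]; rewrite y0 y1 ltW.
- move=> u /contrapT; rewrite /= in_itv/= => u01.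
 apply/eqP; rewrite eq_le; apply/andP; split; first by rewrite -quantile_le.
 rewrite leNgt; apply/negP => uF.
 have : \forall y \near (quantile mu u)^'-, u < cdfR mu y.
  apply: (cvgr_gt (cdfR mu (quantile mu u))) => //.
  by apply: cvg_at_left_filter; exact: cF.
 move=> [e /= e0 /(_ (quantile mu u - e / 2))].
 rewrite /= opprB addrCA subrr addr0 gtr0_norm ?divr_gt0//.
 rewrite ltr_pdivrMr// ltr_pMr// ltr1n gtrDl oppr_lt0 divr_gt0//.
 move=> /(_ isT isT)/ltW; rewrite -quantile_le// lerDl oppr_ge0.
 by rewrite leNgt divr_gt0.
- exact: mp_id.
Qed.

End cdf_density.

(** * Comparison of gamma laws with the normal law *)

Section gamma_normal.
Context {R : realType}.
Notation RM := (measurableTypeR R).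
Notation leb := (@lebesgue_measure R).
Implicit Types (mu : prob RM R) (f u v U V : R -> R) (x y z w : R) (k : nat).

Lemma cdfR_derive mu f x : has_pdf mu f -> {for x, continuous f} -> is_derive x 1 (cdfR mu) (f x).
Proof.
move=> [mf f0 muE] cf.
have -> : cdfR mu = fun y => (\int[leb]_(t in [set` `]-oo, y]]) (f t))%R.
 by apply/funext => y; rewrite /cdfR muE.
have x1 : x < x + 1 by rewrite ltrDl.
have [] := @continuous_FTC1 R f (BInfty R true) x (x + 1) x1 _ _ cf.
- apply/integrableP; split.
  by apply: measurable_funTS; exact: (mcomp _ mf).
 under eq_integral => t _ do rewrite /= ger0_norm//.
 by rewrite -muE// -ge0_fin_numE ?fin_num_measure.
- by rewrite ltNyr.
- by rewrite derive1E => dF EF; apply: DeriveDef.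
Qed.

(** The condition on the densities makes U - V first increase and then decrease. It is nonnegative
    in the limit at both ends, hence everywhere. Two distribution functions can so be compared
    through the monotonicity of the ratio of their densities. *)
Lemma single_crossing (I : set R) U V u v : (forall x y, x <= y -> I x -> I y) -> (forall x, I x ->
 is_derive x 1 U (u x)) -> (forall x, I x -> is_derive x 1 V (v x)) -> (forall x y, I x -> x <= y
 -> v y <= u y -> v x <= u x) -> (forall e z, 0 < e -> I z -> exists w, [/\ I w, w <= z & - e <= U
 w - V w]) -> (forall e z, 0 < e -> exists w, z <= w /\ - e <= U w - V w) -> forall z, I z -> V z
 <= U z.
Proof.
move=> Iu dU dV cross limL limR z Iz.
have dD x : I x -> is_derive x 1 (fun x => U x - V x) (u x - v x).
 by move=> Ix; apply: drvB; [exact: dU|exact: dV].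
rewrite -subr_ge0; apply/ler_addgt0Pr => e e0; rewrite -lerBlDr sub0r.
have [vu|uv] := leP (v z) (u z).
 have [w [Iw wz]] := limL e z e0 Iz; move=> /le_trans; apply.
 apply: (@drv_nondecreasing R (fun x => U x - V x) (fun x => u x - v x) w z wz).
  by move=> x /andP[wx _]; apply: dD; exact: Iu wx Iw.
 move=> x /andP[wx xz]; rewrite subr_ge0.
 by apply: cross vu; [exact: Iu (ltW wx) Iw|exact: ltW].
have [w [zw]] := limR e z e0; move=> /le_trans; apply.
rewrite -[leLHS]opprK -[leRHS]opprK lerN2.
apply: (@drv_nondecreasing R (fun x => - (U x - V x)) (fun x => - (u x - v x)) z w zw).
 by move=> x /andP[zx _]; apply: drvN; apply: dD; exact: Iu zx Iz.
move=> x /andP[zx xw]; rewrite oppr_ge0 subr_le0 leNgt; apply/negP => ux.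
by have := cross z x Iz (ltW zx) (ltW ux); rewrite leNgt uv.
Qed.

Lemma expR_ge_pow k x : 0 <= x -> x ^+ k / k`!%:R <= expR x.
Proof.
elim: k x => [|k IH] x x0; first by rewrite expr0 fact0 divr1 -expR0 ler_expR.
rewrite -subr_ge0; apply: (@le_trans _ _ (expR 0 - 0 ^+ k.+1 / k.+1`!%:R)).
 by rewrite expR0 expr0n mul0r subr0.
apply: (@drv_nondecreasing R (fun x => expR x - x ^+ k.+1 / k.+1`!%:R) (fun x => expR x - x ^+ k /
 k`!%:R) 0 x x0).
 move=> t _; apply: drvB.
 rewrite (_ : (fun y => _) = fun y => (k.+1`!%:R)^-1 * y ^+ k.+1); last first.
  by apply/funext => y; rewrite mulrC.
 apply: drv_eq (drvZ _ (drvX _ (drv_id t))) _ => /=.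
 rewrite factS natrM mulr1; field.
 by rewrite addrC natr1 !pnatr_eq0 -!lt0n fact_gt0.
by move=> t /andP[/ltW t0 _]; rewrite subr_ge0 IH.
Qed.

Lemma gpdf_le1 k x : gpdf k x <= 1.
Proof.
rewrite /gpdf; case: ifP => // x0.
rewrite mulrAC -[leRHS](expRxMexpNx_1 x).
by rewrite ler_wpM2r ?expR_ge0// expR_ge_pow// ltW.
Qed.

Lemma gam_cdf_continuous k : continuous (cdfR (@gam R k)).
Proof. exact: cdfR_continuous (gam_pdf k) (gpdf_le1 k). Qed.

Lemma gam_cdf0 k : cdfR (@gam R k) 0 = 0.
Proof. by rewrite /cdfR gam_pos. Qed.

Lemma gam_cdf_derive k x : 0 < x -> is_derive x 1 (cdfR (@gam R k)) (gpdf k x).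
Proof.
move=> x0; apply: cdfR_derive (gam_pdf k) _.
have G : gpdf k x = x ^+ k * expR (- x) * (k`!%:R)^-1 by rewrite /gpdf x0.
change (gpdf k t @[t --> x] --> gpdf k x); rewrite G.
have C := drv_continuous (drvM (drvM (drvX k (drv_id x)) (drv_exp (drvN (drv_id x)))) (drv_cst
 (k`!%:R)^-1 x)).
apply: cvg_trans C; apply: near_eq_cvg; near=> t; rewrite /gpdf ifT//.
by near: t; exact: lt_nbhsr.
Unshelve. all: by end_near. Qed.

Lemma gam_cdf_le k x : 0 <= x -> cdfR (@gam R k) x <= x.
Proof.
move=> x0; have := cdfR_sub_le (g := fun=> 1) (G := id) (gam_pdf k) x0.
rewrite gam_cdf0 !subr0; apply.
- by move=> t _; exact: cvg_cst.
- by move=> t _; exact: gpdf_le1.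
Qed.

Definition Phi : R -> R := cdfR (@gauss R).

Lemma Phi_derive x : is_derive x 1 Phi (normal_pdf 0 1 x).
Proof.
apply: cdfR_derive (normal_has_pdf 1) _.
rewrite (_ : normal_pdf 0 1 = fun x => normal_peak 1 * expR (- (x ^+ 2 / 2))); last first.
 by apply/funext => y; exact: normal_pdf01.
exact: (drv_continuous (drvZ _ (drv_exp (drvN (drvM (drvX 2 (drv_id x)) (drv_cst 2^-1 x)))))).
Qed.

Lemma Phi_lt x y : x < y -> Phi x < Phi y.
Proof.
move=> xy; set c := normal_peak 1 * expR (- ((`|x| + `|y|) ^+ 2 / 2)) : R.
have c0 : 0 < c by rewrite mulr_gt0 ?expR_gt0// normal_peak_gt0.
rewrite -subr_gt0; apply: (@lt_le_trans _ _ (c * y - c * x)).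
 by rewrite -mulrBr mulr_gt0// subr_gt0.
apply: (cdfR_sub_ge (g := fun=> c) (G := fun t => c * t) (normal_has_pdf 1) (ltW xy)).
- by move=> t _; apply: drv_eq (drvZ _ (drv_id t)) _; rewrite mulr1.
- by move=> t _; exact: cvg_cst.
move=> t /andP[xt ty]; rewrite ltW//= normal_pdf01 ler_wpM2l//.
 by rewrite ltW// normal_peak_gt0.
rewrite ler_expR lerN2 ler_wpM2r// -[leLHS]real_normK ?num_real//.
rewrite lerXn2r ?nnegrE ?addr_ge0// ler_norml.
have := ler_norm y; have := ler_norm (- x); rewrite normrN.
have := normr_ge0 x; have := normr_ge0 y; lra.
Qed.

Lemma Phi_gt0 x : 0 < Phi x.
Proof. by apply: (@le_lt_trans _ _ (Phi (x - 1))); [exact: cdfR_ge0|rewrite Phi_lt// gtrBl]. Qed.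

Lemma Phi_lt1 x : Phi x < 1.
Proof. by apply: (@lt_le_trans _ _ (Phi (x + 1))); [rewrite Phi_lt// ltrDl|exact: cdfR_le1]. Qed.

Lemma Phi_small e z : 0 < e -> exists w, w <= z /\ Phi w <= e.
Proof.
move=> e0; have := cdfR_Ny (@gauss R) => /cvgrPdist_le/(_ _ e0) [M [_ HM]].
exists (Num.min z (M - 1)); split; first by rewrite ge_min lexx.
have := HM (Num.min z (M - 1)); rewrite sub0r normrN ger0_norm ?cdfR_ge0//; apply.
by rewrite gt_min ltrBlDr ltrDl ltr01 orbT.
Qed.

Lemma cdfR_large mu e z : 0 < e -> exists w, z <= w /\ 1 - e <= cdfR mu w.
Proof.
move=> e0; have := cdfR_y mu => /cvgrPdist_le/(_ _ e0) [M [_ HM]].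
exists (Num.max z (M + 1)); split; first by rewrite le_max lexx.
have := HM (Num.max z (M + 1)); rewrite ger0_norm ?subr_ge0 ?cdfR_le1//.
move=> H; rewrite lerBlDr addrC -lerBlDr; apply: H.
by rewrite lt_max ltrDl ltr01 orbT.
Qed.

Definition gz k (x : R) : R := quantile (@gauss R) (cdfR (@gam R k) x).

Lemma mp_gz k : mp (@gam R k) (@gauss R) (gz k).
Proof.
exact: mp_comp (mp_cdfR (@gam_cdf_continuous k)) (mp_quantile _).
Qed.

(** In the scale x = (k + 1) exp(z / q) the ratio of the gamma density to the normal one is C
    exp(E(z)), with E'(z) = q - q exp(z / q) + z <= 0 by convexity of the exponential. So the
    densities cross once. *)
Lemma gam_cdf_ge_Phi k z (q := sqrt k.+1%:R) : Phi z <= cdfR (@gam R k) (k.+1%:R * expR (z / q)).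
Proof.
have q0 : 0 < q by rewrite sqrtr_gt0 ltr0n.
have qq : q ^+ 2 = k.+1%:R by rewrite sqr_sqrtr// ler0n.
pose a z : R := k.+1%:R * expR (z / q).
have a0 t : 0 < a t by rewrite mulr_gt0 ?expR_gt0// ltr0n.
pose E t : R := q * t - a t + t ^+ 2 / 2.
pose C : R := q ^+ (2 * k + 1) / k`!%:R.
have C0 : 0 < C by rewrite divr_gt0 ?exprn_gt0// ltr0n fact_gt0.
have pE t : gpdf k (a t) * (a t / q) = C * expR (E t) * expR (- (t ^+ 2 / 2)).
 rewrite /gpdf a0 -[RHS]mulrA -expRD /E.
 rewrite (_ : q * t - _ + _ - _ = k.+1%:R * (t / q) + (- a t)); last first.
  by rewrite -qq; field; rewrite gt_eqF.
 rewrite expRD expRM_natl /C {1 3}/a exprMn addn1 [q ^+ _]exprS exprM (exprSr (expR _)).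
 rewrite -qq; field.
 by rewrite pnatr_eq0 -lt0n fact_gt0 gt_eqF.
have dE x y : x <= y -> E y <= E x.
 move=> xy; rewrite -[leLHS]opprK -[leRHS]opprK lerN2.
 apply: (@drv_nondecreasing R (fun t => - E t) (fun t => - (q - q * expR (t / q) + t)) x y xy).
  move=> t _; apply: drvN; apply: drvD.
   apply: drvB; first by apply: drv_eq (drvZ q (drv_id t)) _; rewrite mulr1.
   apply: drv_eq (drvZ _ (drv_exp (drvM (drv_id t) (drv_cst q^-1 t)))) _.
   by rewrite -qq /=; field; rewrite gt_eqF.
  apply: drv_eq (drvM (drvX 2 (drv_id t)) (drv_cst 2^-1 t)) _ => /=.
  by rewrite expr1; field.
 move=> t _; rewrite oppr_ge0.
 have := expR_ge1Dx (t / q); rewrite -(ler_pM2l q0) mulrDr mulr1 mulrCA divff ?gt_eqF//.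
 lra.
apply: (@single_crossing setT (fun t => cdfR (gam k) (a t)) Phi (fun t => gpdf k (a t) * (a t / q))
 (normal_pdf 0 1)) => //.
- move=> t _; apply: (@is_derive1_comp R (cdfR (gam k)) a); first exact: gam_cdf_derive.
 apply: drv_eq (drvZ _ (drv_exp (drvM (drv_id t) (drv_cst q^-1 t)))) _.
 by rewrite /a mulr0 add0r mulr1 mulrA.
- by move=> t _; exact: Phi_derive.
- move=> x y _ xy; rewrite !pE !normal_pdf01 !ler_pM2r ?expR_gt0// => /le_trans; apply.
 by rewrite ler_pM2l// ler_expR dE.
- move=> e t e0 _; have [w [wt Pw]] := Phi_small t e0; exists w; split => //.
 rewrite lerBrDr; apply: le_trans (cdfR_ge0 _ _); lra.
- move=> e t e0; have [w [_ Pw]] := cdfR_large (gam k) (0 : R) e0.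
 exists (Num.max t (q * w)); split; first by rewrite le_max lexx.
 have H : cdfR (gam k) w <= cdfR (gam k) (a (Num.max t (q * w))).
  apply: cdfR_nd; apply: (@le_trans _ _ (1 * expR w)).
   by rewrite mul1r; apply: le_trans (expR_ge1Dx w); rewrite lerDr.
  apply: ler_pM; rewrite ?expR_ge0// ?ler1n// ler_expR ler_pdivlMr// mulrC.
  by rewrite le_max lexx orbT.
 have := Phi_lt1 (Num.max t (q * w)); lra.
Qed.

(** In the scale x = w^2 with w = s + z / 2 the ratio of the densities is a constant times w^(2k+1)
    exp(w^2 - 4 s w). The choice s^2 = k + 1/2 makes its derivative a nonnegative multiple of the
    square (w - s)^2, so the ratio is nondecreasing. *)
Lemma gam_cdf_le_Phi k z (s := sqrt (k%:R + 2^-1)) : - (2 * s) < z -> cdfR (@gam R k) ((s + z / 2)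
 ^+ 2) <= Phi z.
Proof.
have s20 : (0 : R) < k%:R + 2^-1 by rewrite ltr_wpDl// ler0n.
have s0 : 0 < s by rewrite sqrtr_gt0.
have ss : s ^+ 2 = k%:R + 2^-1 by rewrite sqr_sqrtr// ltW.
pose a z : R := s + z / 2.
pose r w : R := w ^+ (2 * k).+1 * expR (w ^+ 2 - 4 * s * w).
pose C : R := expR (2 * s ^+ 2) / k`!%:R.
have C0 : 0 < C by rewrite divr_gt0 ?expR_gt0// ltr0n fact_gt0.
have pE t : 0 < a t -> gpdf k (a t ^+ 2) * a t = C * r (a t) * expR (- (t ^+ 2 / 2)).
 move=> a0; rewrite /gpdf exprn_gt0// /C /r.
 have -> : - a t ^+ 2 = 2 * s ^+ 2 + (a t ^+ 2 - 4 * s * a t) + - (t ^+ 2 / 2).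
  by rewrite /a; field.
 by rewrite !expRD -exprM [a t ^+ (2 * k).+1]exprS; field; rewrite pnatr_eq0 -lt0n fact_gt0.
have dr x y : 0 < x -> x <= y -> r x <= r y.
 move=> x0 xy; apply: (@drv_nondecreasing R r (fun w => w ^+ (2 * k) * expR (w ^+ 2 - 4 * s * w) *
  (2 * (w - s) ^+ 2)) x y xy).
  move=> t _; rewrite /r.
  apply: drv_eq (drvM (drvX _ (drv_id t)) (drv_exp (drvB (drvX 2 (drv_id t)) (drvZ (4 * s) (drv_id
   t))))) _ => /=.
  have -> : (2 * k).+1%:R = 2 * k%:R + 1 :> R by rewrite -natr1 natrM.
  rewrite !mulr1 expr1 [t ^+ (2 * k).+1]exprSr.
  have -> : k%:R = s ^+ 2 - 2^-1 by rewrite ss addrK.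
  by field.
 move=> t /andP[xt _]; apply: mulr_ge0; last by rewrite mulr_ge0 ?sqr_ge0.
 by rewrite mulr_ge0 ?expR_ge0// exprn_ge0// ltW// (lt_trans x0).
have aP t : - (2 * s) < t -> 0 < a t by rewrite /a; lra.
move=> hz.
apply: (@single_crossing [set t | - (2 * s) < t] Phi (fun t => cdfR (gam k) (a t ^+ 2)) (normal_pdf
 0 1) (fun t => gpdf k (a t ^+ 2) * a t)) => //.
- by move=> x y xy /= /lt_le_trans; apply.
- by move=> t _; exact: Phi_derive.
- move=> t /= /aP at0.
 apply: drv_eq (@is_derive1_comp R (cdfR (gam k)) (fun t => a t ^+ 2) _ _ _ (gam_cdf_derive k
  (exprn_gt0 2 at0)) (drvX 2 (drvD (drv_cst s t) (drvM (drv_id t) (drv_cst 2^-1 t))))) _.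
 by rewrite expr1 -/(a t) mulr0 !add0r mulr1; field.
- move=> x y /= /[dup] hx /aP ax xy; have ay : 0 < a y by apply: lt_le_trans ax _; rewrite /a; lra.
 rewrite !pE// !normal_pdf01 !ler_pM2r ?expR_gt0//; apply: le_trans.
 by rewrite ler_pM2l// dr// /a; lra.
- move=> e t e0 /= ht.
 (* The point w with s + w / 2 = d: since d <= 1 and d <= e, the gamma distribution function at d^2
    is at most d^2 <= e; d <= a(t) puts the point to the left of t. *)
 pose d := Num.min 1 (Num.min e (a t)).
 have d0 : 0 < d by rewrite !lt_min ltr01 e0 aP.
 exists (2 * (d - s)); split; first by lra.
  have : d <= a t by rewrite !ge_min lexx !orbT.
  by rewrite /a; lra.
 have -> : a (2 * (d - s)) = d by rewrite /a; field.
 have := Phi_gt0 (2 * (d - s)); have := gam_cdf_le k (ltW (exprn_gt0 2 d0)).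
 have : d ^+ 2 <= e.
  rewrite expr2; apply: (@le_trans _ _ (1 * e)); last by rewrite mul1r.
  by apply: ler_pM; rewrite ?(ltW d0)// ge_min ?lexx// ge_min lexx orbT.
 lra.
- move=> e t e0; have [w [tw Pw]] := cdfR_large (@gauss R) t e0.
 exists w; split => //; have := cdfR_le1 (@gam R k) (a w ^+ 2).
 move: Pw; rewrite -/(Phi w); lra.
Qed.

Section gz_bounds.
Variables (k : nat) (x : R).
Hypothesis x0 : 0 < x.
Let z := gz k x.
Let q : R := sqrt k.+1%:R.
Let s : R := sqrt (k%:R + 2^-1).

Let q0 : 0 < q. Proof. by rewrite sqrtr_gt0 ltr0n. Qed.
Let s0 : 0 < s. Proof. by rewrite sqrtr_gt0 ltr_wpDl// ler0n. Qed.

Let lo : Phi (q * ln (x / k.+1%:R)) <= cdfR (@gam R k) x.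
Proof.
have := gam_cdf_ge_Phi k (q * ln (x / k.+1%:R)); rewrite /= -/q.
rewrite mulrAC divff ?gt_eqF// mul1r lnK ?posrE ?divr_gt0 ?ltr0n//.
by rewrite mulrCA divff ?mulr1// pnatr_eq0.
Qed.

Let up : cdfR (@gam R k) x <= Phi (2 * (sqrt x - s)).
Proof.
have := @gam_cdf_le_Phi k (2 * (sqrt x - s)); rewrite /= -/s.
rewrite (_ : s + _ / 2 = sqrt x); last by field.
rewrite sqr_sqrtr ?(ltW x0)//; apply.
have : 0 < sqrt x by rewrite sqrtr_gt0.
lra.
Qed.

Let cdf01 : 0 < cdfR (@gam R k) x < 1.
Proof.
by rewrite (lt_le_trans (Phi_gt0 _) lo) (le_lt_trans up (Phi_lt1 _)).
Qed.

Lemma gz_upper : x <= k.+1%:R * expR (z / q).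
Proof.
have k0 : (0 : R) < k.+1%:R by rewrite ltr0n.
suff H : q * ln (x / k.+1%:R) <= z.
 rewrite mulrC -ler_pdivrMr// -[leLHS]lnK ?posrE ?divr_gt0//.
 by rewrite ler_expR ler_pdivlMr// mulrC.
rewrite leNgt; apply/negP => zw.
have : cdfR (gam k) x <= Phi z by rewrite -quantile_le.
by move=> /(le_trans lo); rewrite leNgt Phi_lt.
Qed.

Lemma gz_lower : s + z / 2 <= sqrt x.
Proof.
have : z <= 2 * (sqrt x - s) by rewrite /z /gz quantile_le// up.
lra.
Qed.

End gz_bounds.

Lemma expR_sub_le t : expR t - 1 - t <= t ^+ 2 * expR `|t| :> R.
Proof.
have e1 := expR_ge1Dx t; have e2 := expR_ge1Dx (- t).
have e0 := expR_gt0 t.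
have H : expR t - 1 <= t * expR t.
 have : (1 - t) * expR t <= 1.
  rewrite -[leRHS](@mulVf _ (expR t)) ?gt_eqF// -expRN.
  by rewrite ler_wpM2r// ltW.
 lra.
have [t0|t0] := leP 0 t.
 rewrite ger0_norm// expr2 -mulrA.
 have : t * (expR t - 1) <= t * (t * expR t) by rewrite ler_wpM2l.
 lra.
have h1 : 1 <= expR `|t| by rewrite -expR0 ler_expR.
have : t * (expR t - 1) <= t ^+ 2 by rewrite expr2 ler_wnM2l// ?(ltW t0)//; lra.
have : t ^+ 2 * 1 <= t ^+ 2 * expR `|t| by rewrite ler_wpM2l// sqr_ge0.
lra.
Qed.

Lemma sqr_le_expR t : t ^+ 2 <= 4 * expR `|t| :> R.
Proof.
have -> : `|t| = `|t| / 2 + `|t| / 2 by field.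
rewrite expRD; have := expR_ge1Dx (`|t| / 2); set e := expR _.
have t0 := normr_ge0 t => h.
have : (`|t| / 2) ^+ 2 <= e ^+ 2 by rewrite lerXn2r ?nnegrE//; lra.
rewrite exprMn real_normK ?num_real// exprVn -expr2; lra.
Qed.

(** The upper bound (k + 1) exp(z / q) and the lower bound (s + z / 2)^2 for x both agree with k + 1
    + q z up to an error that does not grow with k. This uniformity in the shape is what makes a
    block cost O(1) whatever its length. *)
Lemma gz_err k x (z := gz k x) : 0 < x -> `|x - k.+1%:R - sqrt k.+1%:R * z| <= 4 * expR (2 * `|z|).
Proof.
move=> x0; have hu := gz_upper k x0; have hl := gz_lower k x0.
rewrite -/z in hu hl; set q := sqrt k.+1%:R in hu *.
set s := sqrt (k%:R + _) in hl.
have s20 : (0 : R) < k%:R + 2^-1 by rewrite ltr_wpDl// ler0n.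
have s0 : 0 < s by rewrite sqrtr_gt0.
have ss : s ^+ 2 = k%:R + 2^-1 by rewrite sqr_sqrtr// ltW.
have qq : q ^+ 2 = k.+1%:R by rewrite sqr_sqrtr// ler0n.
have q1 : 1 <= q by rewrite -sqrtr1 ler_wsqrtr// ler1n.
have q0 : 0 < q by apply: lt_le_trans q1.
have zn := normr_ge0 z.
have E1 : 1 + `|z| <= expR `|z| by exact: expR_ge1Dx.
have E2 : expR `|z| <= expR (2 * `|z|) by rewrite ler_expR; lra.
have bs : k.+1%:R = s ^+ 2 + 2^-1 by rewrite ss -natr1; field.
rewrite ler_norml; apply/andP; split.
 have sq : s <= q by rewrite ler_wsqrtr// bs ss lerDl.
 (* If s + z / 2 < 0 the lower bound on sqrt x is void, but then k + 1 + q z is nonpositive and x >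
    0 suffices. *)
 have [sz|sz] := leP 0 (s + z / 2).
  have : (s + z / 2) ^+ 2 <= x.
   by rewrite -[leRHS]sqr_sqrtr ?(ltW x0)// lerXn2r ?nnegrE.
  have qs : q - s <= 2^-1.
   have : (q - s) * (q + s) = 2^-1 by rewrite -subr_sqr qq bs; field.
   have : (q - s) * 1 <= (q - s) * (q + s) by apply: ler_wpM2l; lra.
   lra.
  have H : (q - s) * z <= 2^-1 * `|z|.
   apply: (@le_trans _ _ ((q - s) * `|z|)).
    by rewrite ler_wpM2l ?subr_ge0// ler_norm.
   by rewrite ler_wpM2r.
  have -> : (s + z / 2) ^+ 2 = s ^+ 2 + s * z + z ^+ 2 / 4 by field.
  have := sqr_ge0 z; move: H; rewrite mulrBl bs; lra.
 have H : s * (- z) <= q * (- z) by rewrite ler_wpM2r//; lra.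
 have : s * (2 * s) <= s * (- z) by rewrite ler_wpM2l ?(ltW s0)//; lra.
 have -> : s * (2 * s) = 2 * s ^+ 2 by rewrite expr2; ring.
 move: H; rewrite !mulrN => H.
 have : (2^-1 : R) <= s ^+ 2 by rewrite ss lerDr.
 have := expR_gt0 (2 * `|z|); rewrite bs.
 lra.
have e := expR_sub_le (z / q).
have H : k.+1%:R * (expR (z / q) - 1 - z / q) <= k.+1%:R * ((z / q) ^+ 2 * expR `|z / q|).
 by rewrite ler_wpM2l.
have E3 : k.+1%:R * ((z / q) ^+ 2 * expR `|z / q|) <= z ^+ 2 * expR `|z|.
 rewrite mulrA (_ : k.+1%:R * (z / q) ^+ 2 = z ^+ 2); last first.
  by rewrite -qq; field; rewrite gt_eqF.
 rewrite ler_wpM2l ?sqr_ge0// ler_expR normrM normfV (gtr0_norm q0).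
 by rewrite ler_pdivrMr// ler_peMr.
have E4 : z ^+ 2 * expR `|z| <= 4 * expR (2 * `|z|).
 rewrite (_ : 2 * `|z| = `|z| + `|z|); last by ring.
 rewrite expRD mulrA ler_pM2r ?expR_gt0//.
 exact: sqr_le_expR.
have E5 : k.+1%:R * (expR (z / q) - 1 - z / q) = k.+1%:R * expR (z / q) - k.+1%:R - q * z.
 by rewrite -qq; field; rewrite gt_eqF.
lra.
Qed.

End gamma_normal.

(** * Uniform order statistics and exponential spacings *)

Section order_statistics.
Context {R : realType}.
Notation RS := (@rseq R).
Notation RM := (measurableTypeR R).
Notation leb := (@lebesgue_measure R).
Implicit Types (x y : nat -> R) (n k l : nat) (t a : R).

Lemma sorted_sort (s : seq R) : sorted <=%O (sort <=%R s).
Proof. exact: sort_le_sorted. Qed.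

Lemma order_stat0 x n : order_stat x n 0 = 0. Proof. by []. Qed.

Lemma order_stat_big x n k : (n < k)%N -> order_stat x n k = 1.
Proof. by move=> nk; rewrite /order_stat nth_default//= size_sort size_mkseq. Qed.

Lemma order_stat_le x n k a : (k < n)%N -> (order_stat x n k.+1 <= a) = (k < count (fun z : R => (z
 <= a)%R) (mkseq x n))%N.
Proof.
move=> kn; rewrite /order_stat/=.
have E : count (fun z : R => (z <= a)%R) (sort <=%R (mkseq x n)) = count (fun z : R => (z <= a)%R)
 (mkseq x n).
 by apply/permP; rewrite perm_sort.
have [h|h] := ltnP.
 by apply: nth_count_le; [exact: sorted_sort|rewrite E].
apply/negbTE; rewrite -ltNge; apply: nth_count_gt; first exact: sorted_sort.
by rewrite E h size_sort size_mkseq.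
Qed.

Lemma meas_count_le n k a : measurable [set x : RS | (k < count (fun z : R => (z <= a)%R) (mkseq x
 n))%N].
Proof.
elim: n k => [|n IH] k; first by rewrite (_ : [set _ | _] = set0)// -subset0.
have mr : measurable [set x : RS | (x n <= a)%R].
 by apply: meas_le_fun => //; exact: meas_coord.
have E x : count (fun z : R => (z <= a)%R) (mkseq x n.+1) = (count (fun z : R => (z <= a)%R) (mkseq
 x n) + (x n <= a)%R)%N.
 by rewrite -addn1 /mkseq iotaD map_cat count_cat/= addn0.
case: k => [|k].
 rewrite (_ : [set _ | _] = [set x : rseq | (0 < count (fun z : R => (z <= a)%R) (mkseq x n))%N]
  `|` [set x : rseq | (x n <= a)%R]); first exact: measurableU.
 apply/seteqP; split=> x; rewrite /mkset E addn_gt0; first by case/orP => [|b0]; [left|right; move: b0; case: (x n <= a)].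
 by case=> ->; rewrite ?orbT.
rewrite (_ : [set _ | _] = [set x : rseq | (k.+1 < count (fun z : R => (z <= a)%R) (mkseq x n))%N]
 `|` ([set x : rseq | (k < count (fun z : R => (z <= a)%R) (mkseq x n))%N] `&` [set x : rseq | (x n
 <= a)%R])).
 by apply: measurableU => //; exact: measurableI.
apply/seteqP; split=> x; rewrite /setU/setI/mkset E; case: (x n <= a)%R; rewrite ?addn1 ?addn0.
- by rewrite ltnS; right.
- by left.
- by rewrite ltnS; case=> [/ltnW|[]].
- by case=> [|[]].
Qed.

Definition order_stats n (x : rseq) : RS := order_stat x n.

Lemma meas_order_stats n : measT (order_stats n).
Proof.
apply: meas_rseq => -[|k]; first exact: measurable_cst.
have [kn|kn] := ltnP k n; last first.
 rewrite (_ : (fun x => _) = cst 1); first exact: measurable_cst.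
 by apply/funext => x; rewrite /order_stats order_stat_big.
apply: (measurability _ (RGenOInfty.measurableE R)) => _ [_ [a ->] <-].
rewrite setTI (_ : _ @^-1` _ = ~` [set x : rseq | (k < count (fun z : R => (z <= a)%R) (mkseq x
 n))%N]).
 by apply: measurableC; exact: meas_count_le.
apply/seteqP; split=> x /=; rewrite in_itv/= andbT -order_stat_le// ltNge => /negP.
 by [].
by [].
Qed.

Lemma order_stat_perm x y n : perm_eq (mkseq x n) (mkseq y n) -> order_stat x n = order_stat y n.
Proof.
move=> h; apply/funext => k; rewrite /order_stat; congr (nth _ (_ :: _) _).
exact/perm_sort_leP.
Qed.

Definition swap0 j i : nat := if i == 0 then j else if i == j then 0 else i.

Lemma swap0K j : involutive (swap0 j).
Proof.
move=> i; rewrite /swap0; have [->|i0] := eqVneq i 0%N.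
 by rewrite eqxx; case: (eqVneq j 0).
have [->|ij] := eqVneq i j; first by rewrite eqxx.
by rewrite (negbTE i0) (negbTE ij).
Qed.

Lemma order_stat_swap x n j : (j < n)%N -> order_stat (x \o swap0 j) n = order_stat x n.
Proof.
move=> jn; apply: order_stat_perm.
rewrite /mkseq map_comp; apply: perm_map.
have sl i : (swap0 j i < n)%N = (i < n)%N.
 rewrite /swap0; have [->|_] := eqVneq i 0%N; first by rewrite jn (leq_ltn_trans _ jn).
 by have [->|//] := eqVneq i j; rewrite jn (leq_ltn_trans _ jn).
apply: uniq_perm; rewrite ?iota_uniq ?(map_inj_uniq (inv_inj (swap0K j))) ?iota_uniq//.
move=> i; rewrite -{1}(swap0K j i) (mem_map (inv_inj (swap0K j))) !mem_iota !add0n /=.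
exact: sl.
Qed.

Definition scale_upto n t y i : R := if (i < n)%N then t * y i else y i.

Lemma meas_scale_upto n t : measT (fun y : rseq => scale_upto n t y : rseq).
Proof.
apply: meas_rseq => i; rewrite /scale_upto; case: (i < n)%N.
 by apply: measM => //; exact: meas_coord.
exact: meas_coord.
Qed.

Lemma has_pdf_unif : has_pdf (@unif R) (bpdf 0 0).
Proof.
have E : (bpdf 0 0 : R -> R) = \1_(`]0, 1[%classic).
 apply/funext => v; rewrite /bpdf indicE mem_setE in_itv/=.
 by case: ifP => //= _; rewrite !fact0 factS fact0 !mulr1 divr1.
split; first by rewrite E; exact: measurable_indic.
 by move=> v; exact: bpdf_ge0.
move=> A mA; rewrite unif_itv01// E integral_indic//.
rewrite setIC; apply/eqP; rewrite eq_le; apply/andP; split; last first.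
 rewrite le_measure ?inE//; [exact: measurableI|exact: measurableI|].
 by apply: setSI => x /=; rewrite !in_itv/= => /andP[/ltW -> ->].
apply: (@le_trans _ _ (leb ((`]0%R, 1%R[%classic `&` A) `|` [set 0%R]))).
 rewrite le_measure ?inE//; [exact: measurableI|by apply: measurableU => //; exact: measurableI|].
 move=> x [/=]; rewrite !in_itv/= le_eqVlt => /andP[/predU1P[<-|x0] x1 Ax]; first by right.
 by left; rewrite x0 x1.
apply: (le_trans (measureU2 _ _ _)) => //; first exact: measurableI.
rewrite -[leRHS]adde0; apply: (leeD (lexx _)).
by rewrite -[leLHS]/(lebesgue_measure [set 0%R]) lebesgue_measure_set1.
Qed.

Lemma unif_scale t (g : RM -> \bar R) : 0 < t <= 1 -> measT g -> (forall u, (0 <= g u)%E) ->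
 (\int[unif]_u ((\1_[set u | (u <= t)%R] u)%:E * g u) = t%:E * \int[unif]_u g (t * u)%R)%E.
Proof.
move=> /andP[t0 t1] mg g0.
have mt : measurable [set u : RM | (u <= t)%R].
 by rewrite (_ : [set _ | _] = `]-oo, t]%classic).
have mgt : measT (fun u : RM => g (t * u)).
 by apply: (mcomp mg); exact: measM.
rewrite (pdf_integral has_pdf_unif); last 2 first.
- apply: emeasM => //.
 exact: (meas_ind mt).
- by move=> u; rewrite mule_ge0// lee_fin.
rewrite (pdf_integral has_pdf_unif)//.
pose h (u : RM) := (g u * (\1_(`]0, t[%classic) u)%:E)%E.
have mh : measT h.
 apply: emeasM => //.
 by apply: (meas_ind _) => //; exact: measurable_itv.
have h0 u : (0 <= h u)%E by rewrite mule_ge0// lee_fin.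
transitivity (\int[leb]_u h u)%E; last first.
 have E := ge0_integral_affine 0 t0 mh h0.
 rewrite -[LHS]mul1e -(@divff _ t) ?gt_eqF// EFinM -muleA -E; congr (_ * _)%E.
 apply: eq_integral => u _; rewrite addr0 /h; congr (_ * _%:E)%E.
 rewrite /bpdf indicE mem_setE in_itv/= pmulr_rgt0// gtr_pMr//.
 by case: ifP => // _; rewrite !fact0 factS fact0 !mulr1 divr1.
apply: ge0_ae_eq_integral => //.
- apply: emeasM; last by apply: mcomp => //; exact: meas_bpdf.
 apply: emeasM => //.
 exact: (meas_ind mt).
- by move=> u _; rewrite mule_ge0 ?mule_ge0// lee_fin// bpdf_ge0.
exists [set t]; split => //; first exact: lebesgue_measure_set1.
move=> u /=; apply: contra_notP => /eqP ut _.
rewrite /h muleC muleA [RHS]muleC -EFinM; congr (_%:E * _)%E.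
have -> : \1_[set u0 | (u0 <= t)%R] u = (u < t)%R%:R :> R.
 rewrite indicE lt_neqAle ut/=; congr ((nat_of_bool _)%:R).
 by apply/idP/idP => h1; [exact: set_mem h1|exact/mem_set].
rewrite /bpdf indicE mem_setE in_itv/=.
case: (ltP 0 u) => u0; rewrite ?mul0r//=.
case: (ltP u t) => utl; rewrite ?mulr0//.
by rewrite (lt_le_trans utl t1) !fact0 factS fact0 !mulr1 divr1.
Qed.

(** Conditioning in integral form, by iteration of [unif_scale]: uniform variables conditioned not
    to exceed t are t times uniform variables. *)
Lemma pow_unif_scale n t (h : rseq -> \bar R) : 0 < t <= 1 -> measT h -> (forall y, (0 <= h y)%E) ->
 (\int[pow unif]_y ((\1_[set y : rseq | forall i, (i < n)%N -> (y i <= t)%R] y)%:E * h y) = (t ^+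
 n)%:E * \int[pow unif]_y h (scale_upto n t y))%E.
Proof.
move=> t01; have [t0 t1] := andP t01.
elim: n h => [|n IH] h mh h0.
 rewrite expr0 mul1e; apply: eq_integral => y _.
 by rewrite indicE mem_set ?mul1e//=.
have mS k : measurable [set y : RS | forall i, (i < k)%N -> (y i <= t)%R].
 rewrite (_ : [set _ | _] = [set y : rseq | forall i, (i < k)%N -> `]-oo, t]%classic (y i : RM)]).
  by apply: meas_rects; exists k, (fun=> `]-oo, t]%classic).
 by apply/seteqP; split=> y H i /H; rewrite /= in_itv.
have mind k : measT (fun y : RS => (\1_[set y : rseq | forall i, (i < k)%N -> (y i <= t)%R] y :
 R)%:E).
 exact: (mcomp _ (measurable_indic (mS k))).
have mc := mp_cons (powP (@unif R)).
have mhc := mcomp mh mc.1.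
rewrite (mp_ge0_integral mc); last 2 first.
- by apply: emeasM => //; exact: mind.
- by move=> y; rewrite mule_ge0// lee_fin.
rewrite (mp_ge0_integral mc); last 2 first.
- exact: (mcomp mh (meas_scale_upto n.+1 t)).
- by move=> y; exact: h0.
rewrite !prodP_ge0_integral; last 4 first.
- exact: (mcomp (mcomp mh (meas_scale_upto n.+1 t)) mc.1).
- by move=> y; exact: h0.
- exact: (mcomp (emeasM (mind n.+1) mh) mc.1).
- by move=> y; rewrite mule_ge0// lee_fin.
pose k (u : RM) := (\int[pow unif]_y h (scons u (scale_upto n t y)))%E.
have mhk : measT (fun p : RM * rseq => h (scons p.1 (scale_upto n t p.2))).
 exact: (mcomp mhc (meas_pair measurable_fst (mcomp (meas_scale_upto n t) measurable_snd))).
have mk : measT k.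
 exact: (@measurable_fun_fubini_tonelli_F _ _ RM rseq R (pow unif) _ mhk (fun=> h0 _)).
have k0 u : (0 <= k u)%E by apply: integral_ge0.
transitivity (\int[unif]_u ((\1_[set u | (u <= t)%R] u)%:E * ((t ^+ n)%:E * k u)))%E.
 apply: eq_integral => u _ /=.
 have mhu : measT (fun y : rseq => h (scons u y)).
  exact: (mcomp mhc (meas_pairl u)).
 rewrite /k -(IH _ mhu (fun=> h0 _)) -ge0_integralZl ?lee_fin//; last 2 first.
 - by apply: emeasM => //; exact: mind.
 - by move=> y _; rewrite mule_ge0// lee_fin.
 apply: eq_integral => y _; rewrite muleA; congr (_ * _)%E.
 rewrite -EFinM !indicE -natrM mulnb; congr ((nat_of_bool _)%:R%:E).
 apply/idP/andP; rewrite !inE/=.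
  by move=> H; split; [exact: (H 0%N)|move=> i ilt; exact: (H i.+1)].
 by case=> H1 H2 [|i]; [move=> _; exact: H1|exact: H2].
rewrite unif_scale//; last 2 first.
- by apply: emeasM.
- by move=> u; rewrite mule_ge0// lee_fin exprn_ge0// ltW.
rewrite ge0_integralZl//; last 2 first.
- have mtu : measT (fun u : RM => (t * u : RM)) by exact: measM.
 exact: (mcomp mk mtu).
- by rewrite lee_fin exprn_ge0// ltW.
rewrite muleA -EFinM -exprS; congr (_ * _)%E.
apply: eq_integral => u _; apply: eq_integral => y _ /=; congr (h _).
by apply/funext => -[|i].
Qed.

(** Meant for [p.1] the maximum of a sample of size n + 1 and [p.2] the other observations relative
    to that maximum. *)
Definition peel n (p : RM * rseq) : RS := order_stats n.+1 (scons p.1 (scale_upto n p.1 p.2)).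

Lemma meas_peel n : measT (peel n).
Proof.
apply: (mcomp (meas_order_stats n.+1)).
apply: meas_rseq => -[|i]; first exact: measurable_fst.
have m : measT (fun p : RM * rseq => p.2 i : RM).
 exact: (mcomp (meas_coord i) measurable_snd).
rewrite /scons /scale_upto; case: (i < n)%N; last exact: m.
exact: measM.
Qed.

(* By exchangeability the maximum may be assumed to be the first observation, whence the factor [n + 1];
  given its value [t], the others are [t] times uniform variables. *)
Lemma order_stats_le_peel n B : measurable B -> (pow unif (order_stats n.+1 @^-1` B) <= prodP (betP
 n 0) (pow unif) (peel n @^-1` B))%E.
Proof.
move=> mB; set D := _ @^-1` B.
have mD : measurable D by apply: meas_preim => //; exact: meas_order_stats.
pose M j := [set x : RS | forall i, (i <= n)%N -> (x i <= x j)%R].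
have mM j : measurable (M j).
 rewrite (_ : M j = \bigcap_(i in [set i | (i <= n)%N]) [set x : rseq | (x i <= x j)%R]).
  apply: bigcap_measurableType => // i _.
  by apply: meas_le_fun; exact: meas_coord.
 by apply/seteqP; split=> x.
have PM j : (j <= n)%N -> pow unif (D `&` M j) = pow unif (D `&` M 0%N).
 move=> jn; have [_ E] := mp_reindex (powP (@unif R)) (inv_inj (swap0K j)).
 rewrite -(E (D `&` M 0%N)); last exact: measurableI.
 congr (pow unif _); apply/seteqP; split=> x [].
  rewrite /D /= => DB MM; split; first by move: DB; rewrite /order_stats order_stat_swap.
  move=> i ilt; apply: (MM (swap0 j i)).
  by rewrite /swap0; case: ifP => // _; case: ifP.
 rewrite /D /= => DB MM; split; first by move: DB; rewrite /order_stats order_stat_swap.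
 move=> i ilt; have := MM (swap0 j i); rewrite /comp swap0K; apply.
 by rewrite /swap0; case: ifP => // _; case: ifP.
have D1 : (pow unif D <= n.+1%:R%:E * pow unif (D `&` M 0%N))%E.
 have sub : D `<=` \big[setU/set0]_(j < n.+1) (D `&` M j).
  move=> x Dx.
  have [j _ Hj] := @arg_maxP _ _ 'I_n.+1 ord0 xpredT (fun i : 'I_n.+1 => x i) isT.
  rewrite -(bigcup_mkord n.+1 (fun j => D `&` M j)); exists j => //=; split => // i ilt.
  exact: (Hj (Ordinal (ilt : (i < n.+1)%N)) isT).
 apply: (@le_trans _ _ (pow unif (\big[setU/set0]_(j < n.+1) (D `&` M j)))).
  rewrite le_measure ?inE//; apply: bigsetU_measurable => j _; exact: measurableI.
 apply: (le_trans (@Boole_inequality _ _ _ (pow unif) (fun j => D `&` M j) n.+1 _)).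
  by move=> i _; exact: measurableI.
 rewrite (eq_bigr (fun=> pow unif (D `&` M 0%N))); last by move=> j _; exact/PM/leq_ord.
 by rewrite big_const_ord iter_addr addr0 mule_natl.
apply: (le_trans D1).
pose F (x : rseq) : \bar R := (\1_D x)%:E.
have mF : measT F by exact: (meas_ind mD).
have F0 x : (0 <= F x)%E by rewrite lee_fin.
have mc := mp_cons (powP (@unif R)).
have mFc := mcomp mF mc.1.
have -> : pow unif (D `&` M 0%N) = (\int[unif]_t \int[pow unif]_y ((\1_[set y : rseq | forall i, (i
 < n)%N -> (y i <= t)%R] y)%:E * F (scons t y)))%E.
 have mDM : measurable (D `&` M 0%N) by exact: measurableI.
 rewrite -[LHS]mul1e -[in LHS](setIT (_ `&` _)) mul1e -integral_indic//.
 have mG : measT (fun x : rseq => (\1_(D `&` M 0%N) x)%:E : \bar R).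
  exact: (meas_ind mDM).
 rewrite (mp_ge0_integral mc); last 2 first.
 - exact: mG.
 - by move=> y; rewrite lee_fin.
 rewrite prodP_ge0_integral; last 2 first.
 - exact: (mcomp mG mc.1).
 - by move=> y; rewrite lee_fin.
 apply: eq_integral => t _; apply: eq_integral => y _ /=.
 rewrite /F indicI /= mulrC EFinM; congr (_%:E * _)%E.
 rewrite !indicE; congr ((nat_of_bool _)%:R); apply/idP/idP; rewrite !inE /M /=.
  by move=> H i ilt; exact: (H i.+1).
 by move=> H [|i]//; exact: H.
pose k (t : RM) := (\int[pow unif]_y F (scons t (scale_upto n t y)))%E.
have mpe := meas_peel n.
have mkk : measT (fun p : RM * rseq => F (scons p.1 (scale_upto n p.1 p.2))).
 rewrite (_ : (fun p => _) = fun p => (\1_(peel n @^-1` B) p : R)%:E).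
  apply: (meas_ind _) => //.
  exact: meas_preim.
 by apply/funext => p.
have mk : measT k.
 exact: (@measurable_fun_fubini_tonelli_F _ _ RM rseq R (pow unif) _ mkk (fun=> F0 _)).
have k0 t : (0 <= k t)%E by apply: integral_ge0.
have -> : prodP (betP n 0) (pow unif) (peel n @^-1` B) = (\int[betP n 0]_t k t)%E.
 rewrite prodPE; apply: eq_integral => t _.
 have mt : measurable [set y | (peel n @^-1` B) (t, y)].
  exact: (meas_preim (mcomp mpe (meas_pairl t)) mB).
 rewrite -[LHS]mul1e -[in LHS](setIT [set y | _]) mul1e -integral_indic//.
pose Z := [set p : RM * rseq | forall i, (i < n)%N -> (p.2 i <= p.1)%R].
have mZ : measurable Z.
 rewrite (_ : Z = \bigcap_(i in [set i | (i < n)%N]) [set p : RM * rseq | (p.2 i <= p.1)%R]).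
  apply: bigcap_measurableType => // i _.
  by apply: meas_le_fun => //; exact: (mcomp (meas_coord i) measurable_snd).
 by apply/seteqP; split=> x.
pose w (t : RM) := (\int[pow unif]_y ((\1_[set y : rseq | forall i, (i < n)%N -> (y i <= t)%R] y :
 R)%:E * F (scons t y)))%E.
have mw : measT w.
 apply: (@measurable_fun_fubini_tonelli_F _ _ RM rseq R (pow unif) (fun p => (\1_Z p : R)%:E * F
  (scons p.1 p.2))%E).
  by apply: emeasM => //; exact: (meas_ind mZ).
 by move=> p; rewrite mule_ge0// lee_fin.
have w0 t : (0 <= w t)%E.
 by apply: integral_ge0 => y _; rewrite mule_ge0// lee_fin.
have mb (a b : nat) : measT (fun t : RM => (bpdf a b t)%:E).
 by apply: mcomp => //; exact: meas_bpdf.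
rewrite (pdf_integral (betP_pdf n 0))// (pdf_integral has_pdf_unif mw w0).
rewrite -ge0_integralZl//; last 2 first.
- exact: emeasM.
- by move=> t _; rewrite mule_ge0// lee_fin bpdf_ge0.
apply: ge0_le_integral => //.
- by move=> t _; rewrite mule_ge0// mule_ge0// lee_fin bpdf_ge0.
- by apply: emeasM => //; exact: emeasM.
- exact: emeasM.
move=> t _; rewrite /bpdf; case: ifP => [/andP[t0 t1]|_]; last by rewrite !mule0.
rewrite /w (pow_unif_scale n _ (mcomp mFc (meas_pairl t)) (fun=> F0 _)); last first.
 by rewrite t0 ltW.
rewrite -/(k t) muleC -muleA [leRHS]muleC.
rewrite [leLHS]muleAC lee_wpmul2r// -!EFinM lee_fin.
rewrite !addn0 (factS n) (factS 0) !fact0 !natrM le_eqVlt; apply/orP; left.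
by apply/eqP; field; rewrite pnatr_eq0 -lt0n fact_gt0.
Qed.

(** An inequality between two probabilities that holds for all events, hence for complements too, is
    an equality. Ties for the maximum never have to be shown negligible. *)
Lemma mp_order_stats_peel n : mp (prodP (betP n 0) (pow unif)) (law (pow unif) (meas_order_stats
 n.+1)) (peel n).
Proof.
have mpe := meas_peel n.
split => // B mB; have mo := meas_order_stats n.+1.
rewrite -[RHS]/(pow unif (order_stats n.+1 @^-1` B)).
apply/eqP; rewrite eq_le order_stats_le_peel// andbT.
have mO : measurable (order_stats n.+1 @^-1` B) by exact: meas_preim.
have mP : measurable (peel n @^-1` B) by exact: meas_preim.
have H := order_stats_le_peel n (measurableC mB).
have {H} : (1 - pow unif (order_stats n.+1 @^-1` B) <= 1 - prodP (betP n 0) (pow unif) (peel n @^-1`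
 B))%E.
 by rewrite -!probability_setC.
rewrite -(@fineK _ (pow unif _)) ?fin_num_measure//.
rewrite -(@fineK _ (prodP _ _ _)) ?fin_num_measure//.
by rewrite -!EFinB !lee_fin lerD2l lerN2.
Qed.


(** The spacings multiplied by a total and continued by another sequence: the result is a full
    i.i.d. exponential sequence instead of a finite vector, so the lemmas on sequences apply to
    it. *)
Definition gamma_spacings n (p : (rseq * RM) * rseq) : RS := fun l => if (l <= n)%N then p.1.2 *
 (order_stat p.1.1 n l.+1 - order_stat p.1.1 n l) else p.2 (l - n.+1)%N.

Definition gaps n (p : (rseq * RM) * rseq) : RS := fun l => if (l <= n)%N then p.1.2 * (p.1.1 l.+1 -
 p.1.1 l) else p.2 (l - n.+1)%N.

Lemma meas_gaps n : measT (gaps n).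
Proof.
apply: meas_rseq => l; rewrite /gaps.
have mo k : measT (fun p : (rseq * RM) * rseq => p.1.1 k : RM).
 exact: (mcomp (meas_coord k) (mcomp measurable_fst measurable_fst)).
case: (l <= n)%N; last first.
 exact: (mcomp (meas_coord _) measurable_snd).
apply: measM; last by apply: measB; exact: mo.
exact: (mcomp measurable_snd measurable_fst).
Qed.

Lemma order_stat_peel n t y k : 0 < t -> (forall i, (i < n)%N -> 0 <= y i <= 1) -> (k <= n.+1)%N ->
 order_stat (scons t (scale_upto n t y)) n.+1 k = t * order_stat y n k.
Proof.
move=> t0 y01 kn; rewrite /order_stat.
have -> : mkseq (scons t (scale_upto n t y)) n.+1 = t :: map (fun z => t * z) (mkseq y n).
 rewrite /mkseq /=; congr (_ :: _); rewrite -map_comp (iotaDl 1 0) -map_comp.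
 apply/eq_in_map => i; rewrite mem_iota add0n /= => ilt.
 by rewrite /scale_upto ilt.
have -> : sort <=%R (t :: map (fun z => t * z) (mkseq y n)) = rcons (map (fun z => t * z) (sort <=%R
 (mkseq y n))) t.
 apply: (sorted_eq le_trans le_anti (sorted_sort _)).
  rewrite (sorted_pairwise le_trans) -cats1 pairwise_cat allrel1r /= andbT.
  rewrite -(sorted_pairwise le_trans); apply/andP; split.
   apply/allP => z /mapP[u]; rewrite mem_sort => /mapP[i].
   rewrite mem_iota add0n => /andP[_ /y01/andP[_ yi1]] -> ->.
   by rewrite ger_pMr.
  apply: (homo_sorted (e := <=%R)) (sorted_sort _) => a b.
  by rewrite ler_pM2l.
 rewrite perm_sort -cats1 perm_sym perm_catC /= perm_cons perm_map// perm_sort.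
 exact: perm_refl.
case: k kn => [|k] kn /=; first by rewrite mulr0.
rewrite nth_rcons size_map size_sort size_mkseq.
case: (ltngtP k n) => kn'; first by rewrite (nth_map 1)// size_sort size_mkseq.
 by move: kn; rewrite ltnS leqNgt kn'.
by rewrite nth_default ?mulr1// size_sort size_mkseq kn'.
Qed.

(** Induction on the sample size, peeling off the maximum t. The total g splits into t g and (1 - t)
    g, by [mp_gamma_beta] an independent gamma variable of the preceding shape and an exponential;
    the latter is the last spacing and is put in front of the continuation. *)
Lemma mp_gamma_spacings n : mp (prodP (prodP (pow unif) (gam n)) (pow expP)) (pow expP)
 (gamma_spacings n).
Proof.
elim: n => [|n IH].
 have mc := mp_cons (powP (@expP R)).
 apply: (mp_eqfun _ (mp_comp (mp_comp (mp_assocV (pow unif) (gam 0) (pow expP)) (mp_snd _ _)) mc))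
  => -[[x g] f].
 apply/funext => -[|l]; rewrite /gamma_spacings/=.
  by rewrite order_stat0 order_stat_big// subr0 mulr1.
 by rewrite subSS subn0.
have mo := mp_law (pow unif) (meas_order_stats n.+1).
pose L := law (pow unif) (meas_order_stats n.+1).
have H1 := mp_prod (mp_prod mo (mp_id (gam n.+1))) (mp_id (pow (@expP R))).
suff H : mp (prodP (prodP L (gam n.+1)) (pow expP)) (pow expP) (gaps n.+1).
 by apply: (mp_eqfun _ (mp_comp H1 H)) => -[[x g] f].
apply: (mp_cancel (@meas_gaps n.+1) (mp_prod (mp_prod (mp_order_stats_peel n) (mp_id (gam n.+1)))
 (mp_id (pow (@expP R))))).
pose F (q : ((RM * rseq) * RM) * rseq) : rseq := gamma_spacings n ((q.1.1.2, q.1.1.1 * q.1.2 : RM),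
 scons ((1 - q.1.1.1) * q.1.2) q.2).
have HF : mp (prodP (prodP (prodP (betP n 0) (pow unif)) (gam n.+1)) (pow expP)) (pow expP) F.
 have gb := @mp_gamma_beta R n 0; rewrite addn0 in gb.
 have S1 := mp_prod (mp_swap (betP n 0) (pow (@unif R))) (mp_id (gam n.+1)).
 have S2 := mp_comp S1 (mp_assocV (pow unif) (betP n 0) (gam n.+1)).
 have S3 := mp_comp S2 (mp_prod (mp_id (pow unif)) gb).
 have S4 := mp_comp S3 (mp_assoc (pow unif) (gam n) (gam 0)).
 have S5 := mp_prod S4 (mp_id (pow (@expP R))).
 have S6 := mp_comp S5 (mp_assocV (prodP (pow unif) (gam n)) (gam 0) (pow expP)).
 have S7 := mp_comp S6 (mp_prod (mp_id _) (mp_cons (powP (@expP R)))).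
 by apply: (mp_eqfun _ (mp_comp S7 IH)) => -[[[t y] g] f].
(* A full event. Off it the relative values could exceed 1, or t could fail to be positive, and t
   would not be the largest value of the sample as [order_stat_peel] requires. *)
pose good := [set q : ((RM * RS) * RM) * RS | (0 : R) < q.1.1.1 /\ forall i, (i < n)%N -> (0 : R) <=
 q.1.1.2 i <= 1].
pose G1 := [set t : RM | 0 < t].
pose G2 := [set y : RS | forall i, (i < n)%N -> `[0, 1]%classic (y i : RM)].
have mG1 : measurable G1.
 by rewrite (_ : G1 = `]0, +oo[%classic)//; apply/seteqP; split=> x /=; rewrite in_itv/= andbT.
have mG2 : measurable G2.
 by apply: meas_rects; exists n, (fun=> `[0, 1]%classic).
have goodE : good = (G1 `*` G2) `*` setT `*` setT.
 apply/seteqP; split=> [[[[t y] g] f]|[[[t y] g] f]] /=.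
  by move=> [t0 H]; do !split => //; move=> i /H; rewrite /= in_itv.
 by move=> [[[t0 H] _] _]; split => // i /H; rewrite /= in_itv.
have mgood : measurable good.
 by rewrite goodE; do !apply: measurableX.
apply: (@mp_ae _ _ _ _ _ _ _ F _ (~` good) _ _ _ _ HF).
- have S := mp_prod (mp_prod (mp_order_stats_peel n) (mp_id (gam n.+1))) (mp_id (pow (@expP R))).
 exact: (mcomp (@meas_gaps n.+1) S.1).
- exact: measurableC.
- rewrite probability_setC// goodE !prodPX//; do ?[exact: measurableX].
 have -> : betP n 0 G1 = 1%E.
  rewrite -(@probability_setT _ _ _ (betP n 0)); have [_ _ bE] := betP_pdf (R := R) n 0.
  rewrite !bE// [LHS]integral_mkcond; apply: eq_integral => v _.
  rewrite patchE; case: ifPn => // /negP vG.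
  by rewrite /bpdf; case: ifP => // /andP[v0 _]; case: vG; exact/mem_set.
 have -> : pow unif G2 = 1%E.
  rewrite [LHS](@powP R unif n (fun=> `[0, 1]%classic) (fun=> measurable_itv _)).
  rewrite (eq_bigr (fun=> 1%E)) ?big1// => i _.
  have := @probability_setT _ _ _ (@unif R).
  by rewrite !unifE// setTI setIid.
 by rewrite !probability_setT !mule1 subee.
 by do !apply: measurableX.
move=> [[[t y] g] f] /contrapT [/= t0 H]; apply/funext => l.
rewrite /F /gamma_spacings /gaps /=.
have [ln|ln] := leqP l n.
 rewrite (leqW ln) /peel/= /order_stats !order_stat_peel// ?ltnS//; last exact: leqW.
 by rewrite -mulrBr mulrA (mulrC t).
have [ln1|ln1] := leqP l n.+1.
 have -> : l = n.+1 by apply/eqP; rewrite eqn_leq ln1.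
 rewrite subnn /= /peel /order_stats order_stat_big// order_stat_peel//.
 by rewrite order_stat_big// mulr1 mulrC.
by rewrite -(subnSK ln1).
Qed.

End order_statistics.

(** * Sums of a sequence over blocks and over cells *)

Section blocks.
Context {R : realType}.
Notation RS := (@rseq R).
Notation RM := (measurableTypeR R).
Implicit Types (S : nat -> R) (b : nat) (bs : seq nat) (h : nat -> R -> R) (t : R -> R).

Definition prefix_sum b S : R := \sum_(l < b) S l.

Definition shift_by b S : RS := fun l => S (b + l)%N.

Lemma meas_prefix_sum b : measT (prefix_sum b : RS -> RM).
Proof. by apply: measurable_sum => l; exact: meas_coord. Qed.

Lemma meas_shift_by b : measT (shift_by b : RS -> RS).
Proof. exact: meas_reindex. Qed.

Lemma mp_sum_shift a b : mp (pow (gam a)) (prodP (gam (b.+1 * a.+1).-1) (pow (gam a))) (fun S : RS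
 => (prefix_sum b.+1 S : RM, shift_by b.+1 S)).
Proof.
elim: b => [|b IH].
 apply: (mp_cancel _ (mp_cons (powP (gam a)))).
  apply: meas_pair; [exact: meas_prefix_sum|exact: meas_shift_by].
 rewrite mul1n /=; apply: (mp_eqfun _ (mp_id _)) => -[x S] /=.
 by rewrite /prefix_sum big_ord_recl big_ord0 addr0.
apply: (mp_cancel _ (mp_cons (powP (gam a)))).
 apply: meas_pair; [exact: meas_prefix_sum|exact: meas_shift_by].
have H1 := mp_comp (mp_prod (mp_id (@gam R a)) IH) (mp_assoc _ _ _).
have H2 := mp_comp H1 (mp_prod (@mp_gam_add R a (b.+1 * a.+1).-1) (mp_id _)).
rewrite (_ : (b.+2 * a.+1).-1 = (a + (b.+1 * a.+1).-1).+1); last by rewrite !mulSn /=; lia.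
apply: (mp_eqfun _ H2) => -[x S] /=.
by rewrite /prefix_sum [in RHS]big_ord_recl.
Qed.

(** Consumes [S] in consecutive blocks of lengths [bs], replacing a block of length b by [h b] of
    its sum; the terms after the last block are mapped by [t], so that an infinite sequence results
    again. *)
Fixpoint blk h t bs S : RS := if bs is b :: bs' then scons (h b (prefix_sum b S)) (blk h t bs'
 (shift_by b S)) else fun l => t (S l).

Lemma mp_blk a nu h t bs : all (leq 1) bs -> (forall b, (0 < b)%N -> b \in bs -> mp (gam (b *
 a.+1).-1) nu (h b : RM -> RM)) -> mp (gam a) nu (t : RM -> RM) -> mp (pow (gam a)) (pow nu) (blk h
 t bs : RS -> RS).
Proof.
move=> + + mt; elim: bs => [_ _|[//|b] bs IH /= bs1 mh].
 exact: mp_map (powP _) (powP _) mt.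
have IH' : mp (pow (gam a)) (pow nu) (blk h t bs : RS -> RS).
 by apply: IH => // b' b0 bb; apply: mh => //; rewrite inE bb orbT.
have mb : mp (gam (b.+1 * a.+1).-1) nu (h b.+1 : RM -> RM).
 by apply: mh => //; exact: mem_head.
have H := mp_comp (mp_sum_shift a b) (mp_prod mb IH').
by apply: (mp_eqfun _ (mp_comp H (mp_cons (powP nu)))).
Qed.

Lemma blkE h t bs S i : (i < size bs)%N -> blk h t bs S i = h (nth 0%N bs i) (\sum_(l < nth 0%N bs
 i) S (sumn (take i bs) + l)%N).
Proof.
elim: bs S i => [//|b bs IH] S [|i] /= ilt; first by [].
by rewrite IH//; congr (h _ _); apply: eq_bigr => l _; rewrite /shift_by addnA.
Qed.

Lemma blk_nseqE h t M b S i : (i < M)%N -> blk h t (nseq M b) S i = h b (\sum_(l < b) S (i * b +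
 l)%N).
Proof.
move=> iM; rewrite blkE ?size_nseq// nth_nseq iM take_nseq ?(ltnW iM)//.
by rewrite sumn_nseq mulnC.
Qed.

(** The indices below K are permuted so that the fibers of [kap] become consecutive blocks, and
    [mp_blk] applies. Surjectivity of [kap] keeps the blocks nonempty. *)
Lemma mp_cells a (kap : nat -> nat) K M : (forall k, (k < K)%N -> (kap k < M)%N) -> (forall i, (i <
 M)%N -> exists2 k, (k < K)%N & kap k = i) -> exists2 Z : RS -> RS, mp (pow (gam a)) (pow gauss) Z
 & forall S i, (i < M)%N -> Z S i = gz ((\sum_(k < K) (kap k == i)) * a.+1).-1 (\sum_(k < K) (kap k
 == i)%:R * S k).
Proof.
move=> kM Mk.
pose c i := [seq k <- iota 0 K | kap k == i].
pose s := flatten [seq c i | i <- iota 0 M].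
pose bs := [seq size (c i) | i <- iota 0 M].
have sP : perm_eq s (iota 0 K).
 apply: uniq_perm; rewrite ?iota_uniq//.
  rewrite /s; elim: M {kM Mk bs s} 0%N => [//|M IH] j /=.
  rewrite cat_uniq filter_uniq ?iota_uniq// IH andbT/=.
  apply/hasPn => k /flattenP[_ /mapP[i + ->]]; rewrite mem_iota => /andP[ji _].
  by rewrite !mem_filter => /andP[/eqP-> _]; rewrite gtn_eqF.
 move=> k; apply/flattenP/idP.
  by move=> [_ /mapP[i _ ->]]; rewrite mem_filter => /andP[].
 move=> kK; exists (c (kap k)); last by rewrite mem_filter eqxx.
 by apply: map_f; rewrite mem_iota kM//; move: kK; rewrite mem_iota.
have ss : size s = K by rewrite (perm_size sP) size_iota.
pose p l := nth l s l.
have pK l : (l < K)%N -> (p l < K)%N.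
 move=> lK; have : p l \in s by rewrite mem_nth// ss.
 by rewrite (perm_mem sP) mem_iota.
have pE l : (K <= l)%N -> p l = l by move=> lK; rewrite /p nth_default// ss.
have pinj : injective p.
 move=> l l'; have [lK|lK] := ltnP l K; have [lK'|lK'] := ltnP l' K.
 - rewrite /p (set_nth_default l' l) ?ss// => /eqP.
  by rewrite nth_uniq ?ss// ?(perm_uniq sP) ?iota_uniq// => /eqP.
 - by rewrite (pE l')// => E; move: (pK _ lK); rewrite E ltnNge lK'.
 - by rewrite (pE l)// => E; move: (pK _ lK'); rewrite -E ltnNge lK.
 - by rewrite !pE.
have bs0 : all (leq 1) bs.
 apply/allP => _ /mapP[i + ->]; rewrite mem_iota add0n => /andP[_ /Mk[k kK ki]].
 have : k \in c i by rewrite mem_filter ki eqxx mem_iota.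
 by case: (c i).
have H := @mp_blk a gauss (fun b => gz (b * a.+1).-1) (gz a) bs bs0 (fun b _ _ => mp_gz _) (mp_gz
 a).
exists (fun S => blk (fun b => gz (b * a.+1).-1) (gz a) bs (S \o p)).
 exact: mp_comp (mp_reindex (powP _) pinj) H.
move=> S i iM.
have bsi : nth 0%N bs i = size (c i) by rewrite (nth_map 0%N) ?size_iota// nth_iota.
have iE : iota 0 K = index_iota 0 K by rewrite /index_iota subn0.
have szc : size (c i) = (\sum_(k < K) (kap k == i))%N.
 rewrite size_filter -sum1_count big_mkcond iE big_mkord.
 by apply: eq_bigr => k _; case: (kap k == i).
rewrite blkE ?size_map ?size_iota// bsi; congr (gz (_ * _).-1 _) => //.
have -> : \sum_(k < K) (kap k == i)%:R * S k = \sum_(k <- c i) S k.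
 rewrite big_filter iE big_mkord [RHS]big_mkcond.
 by apply: eq_bigr => k _; case: (kap k == i); rewrite ?mul1r ?mul0r.
rewrite [RHS](big_nth 0%N) big_mkord; apply: eq_bigr => -[l lt] _ /=; congr (S _).
have oE : sumn (take i bs) = size (flatten [seq c i | i <- iota 0 i]).
 rewrite size_flatten /shape -map_comp /bs -map_take take_iota (minn_idPl (ltnW iM)).
 by [].
rewrite /p oE (set_nth_default 0%N); last first.
 rewrite /s -(subnKC iM) addSnnS iotaD map_cat flatten_cat size_cat ltn_add2l add0n.
 by rewrite /= size_cat (leq_trans lt)// leq_addr.
rewrite /s -(subnKC iM) addSnnS iotaD map_cat flatten_cat nth_cat ltnNge leq_addr /= add0n.
by rewrite addKn nth_cat lt.
Qed.

End blocks.

(** * Moments and centered variables *)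

Section moments.
Context {R : realType}.
Notation RM := (measurableTypeR R).
Notation leb := (@lebesgue_measure R).

Lemma mp_integral d d' (T : mtype d) (T' : mtype d') (P : prob T R) (Q : prob T' R) (f : T -> T') (g
 : T' -> \bar R) : mp P Q f -> measT g -> (\int[Q]_y g y = \int[P]_x g (f x))%E.
Proof.
move=> mf mg; rewrite [LHS]integralE [RHS]integralE; congr (_ - _)%E.
 rewrite (mp_ge0_integral mf); [|exact: measurable_funepos|].
  by apply: eq_integral => x _; rewrite !funeposE.
 by move=> y; exact: funepos_ge0.
rewrite (mp_ge0_integral mf); [|exact: measurable_funeneg|].
 by apply: eq_integral => x _; rewrite !funenegE.
by move=> y; exact: funeneg_ge0.
Qed.

Lemma integral_prob_cst d (T : mtype d) (P : prob T R) (c : R) : (\int[P]_x c%:E = c%:E)%E.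
Proof.
rewrite (integral_cst _ measurableT) [X in (_ * X)%E](_ : _ = 1%E) ?mule1//.
exact: probability_setT.
Qed.

Lemma integrable_of_sqr d (T : mtype d) (P : prob T R) (e : T -> R) (C : R) : measT e -> (\int[P]_x
 (e x ^+ 2)%:E <= C%:E)%E -> P.-integrable setT (EFin \o e).
Proof.
move=> me eC.
have me2 : measT (fun x => (e x ^+ 2)%:E).
 by apply: mcomp => //; exact: measX.
apply/integrableP; split; first exact: mcomp.
apply: (@le_lt_trans _ _ (\int[P]_x (1 + (e x ^+ 2)%:E))%E).
 apply: ge0_le_integral => //.
 - by do 2 apply: mcomp => //.
 - by apply: emeasurable_funD.
 move=> x _; rewrite /= -EFinD lee_fin.
 have : 0 <= (`|e x| - 2^-1) ^+ 2 by exact: sqr_ge0.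
 rewrite -(real_normK (num_real (e x))).
 have := normr_ge0 (e x); rewrite !expr2; nra.
rewrite ge0_integralD//; last by move=> x _; rewrite lee_fin sqr_ge0.
rewrite (integral_prob_cst P 1).
by rewrite lte_add_pinfty ?ltry// (le_lt_trans eC) ?ltry.
Qed.

(* Random variables that are centered with variance at most [C], in a form that feeds inductions on
  sums of independent variables. *)
Definition centered d (T : mtype d) (P : prob T R) (C : R) (e : T -> R) := measT e /\ forall s : R,
 (\int[P]_x ((s + e x) ^+ 2)%:E <= (s ^+ 2 + C)%:E)%E.

Lemma centeredI d (T : mtype d) (P : prob T R) (C : R) (e : T -> R) : measT e -> (\int[P]_x (e x)%:E
 = 0)%E -> (\int[P]_x (e x ^+ 2)%:E <= C%:E)%E -> centered P C e.
Proof.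
move=> me e0 eC; split => // s.
have me2 : measT (fun x => (e x ^+ 2)%:E).
 by apply: mcomp => //; exact: measX.
have ie := integrable_of_sqr me eC.
have ie2 : P.-integrable setT (fun x => (e x ^+ 2)%:E).
 apply/integrableP; split => //.
 under eq_integral => x _ do rewrite gee0_abs ?lee_fin ?sqr_ge0//.
 by rewrite (le_lt_trans eC) ?ltry.
have ic : P.-integrable setT (fun=> (s ^+ 2)%:E).
 by apply: finite_measure_integrable_cst.
have ise : P.-integrable setT (fun x => (s *+ 2)%:E * (e x)%:E)%E.
 exact: integrableZl.
rewrite (eq_integral (fun x => ((s ^+ 2)%:E + ((s *+ 2)%:E * (e x)%:E + (e x ^+ 2)%:E)))%E); last first.
 by move=> x _; rewrite -EFinM -!EFinD; congr EFin; ring.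
rewrite integralD//; last exact: integrableD.
rewrite integralD// integralZl// e0 mule0 add0e.
by rewrite integral_prob_cst EFinD leeD2l.
Qed.

Lemma mp_centered d d' (T : mtype d) (T' : mtype d') (P : prob T R) (Q : prob T' R) (f : T -> T') C
 (e : T' -> R) : mp P Q f -> centered Q C e -> centered P C (e \o f).
Proof.
move=> mf [me He]; split; first exact: mcomp mf.1.
move=> s; apply: le_trans (He s).
rewrite (mp_ge0_integral mf (g := fun y => ((s + e y) ^+ 2)%:E))//.
 by apply: mcomp => //; apply: measX; exact: measD.
by move=> y; rewrite lee_fin sqr_ge0.
Qed.

Lemma centeredZ d (T : mtype d) (P : prob T R) C (e : T -> R) (c : R) : centered P C e -> centered P
 (c ^+ 2 * C) (fun x => c * e x).
Proof.
move=> [me He]; split; first exact: measM.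
have [->|c0] := eqVneq c 0 => s.
 rewrite expr0n mul0r addr0.
 rewrite (eq_integral (cst (s ^+ 2)%:E)); last by move=> x _; rewrite mul0r addr0.
 by rewrite integral_prob_cst.
rewrite (eq_integral (fun x => ((c ^+ 2)%:E * ((c^-1 * s + e x) ^+ 2)%:E))%E); last first.
 by move=> x _; rewrite -EFinM -exprMn mulrDr mulrA divff// mul1r.
rewrite ge0_integralZl//; last 3 first.
- by apply: mcomp => //; apply: measX; exact: measD.
- by move=> x _; rewrite lee_fin sqr_ge0.
- by rewrite lee_fin sqr_ge0.
apply: (@le_trans _ _ ((c ^+ 2)%:E * ((c^-1 * s) ^+ 2 + C)%:E)%E).
 by rewrite lee_wpmul2l// lee_fin sqr_ge0.
by rewrite -EFinM lee_fin mulrDr -exprMn mulrA divff// mul1r.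
Qed.

Lemma centered_ge0 d (T : mtype d) (P : prob T R) C (e : T -> R) : centered P C e -> 0 <= C.
Proof.
move=> [_ /(_ 0)]; rewrite expr0n add0r -lee_fin; apply: le_trans.
by apply: integral_ge0 => x _; rewrite lee_fin sqr_ge0.
Qed.

Lemma integral_gam k : (\int[@gam R k]_x x%:E = k.+1%:R%:E)%E.
Proof.
rewrite -integral_gam_abs; apply: ae_eq_integral => //.
 by apply: mcomp.
exists `]-oo, 0]%classic; split; [exact: measurable_itv|exact: gam_pos|].
move=> x /=; rewrite in_itv/= leNgt; apply: contra_notN => x0 _.
by rewrite gtr0_norm.
Qed.

Lemma centered_gam k : centered (@gam R k) k.+1%:R (fun x : RM => x - k.+1%:R).
Proof.
have mx : measT (fun x : RM => x : R) by [].
have ix : (@gam R k).-integrable setT (EFin \o (fun x : RM => x : R)).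
 by apply: integrable_of_sqr => //; rewrite integral_gam_sqr.
have ic c : (@gam R k).-integrable setT (fun=> c%:E).
 by apply: finite_measure_integrable_cst.
have E0 : (\int[@gam R k]_x (x - k.+1%:R)%:E = 0)%E.
 under eq_integral => x _ do rewrite EFinB.
 by rewrite integralB// integral_gam integral_prob_cst subee.
apply: centeredI => //; first exact: measB.
rewrite (eq_integral (fun x : RM => ((x : R) ^+ 2)%:E + ((- (k.+1%:R *+ 2))%:E * x%:E + (k.+1%:R ^+ 2)%:E))%E); last first.
 by move=> x _; rewrite -EFinM -!EFinD; congr EFin; ring.
have ix2 : (@gam R k).-integrable setT (fun x => (x ^+ 2)%:E).
 apply/integrableP; split.
  by apply: mcomp => //; exact: measX.
 under eq_integral => x _ do rewrite gee0_abs ?lee_fin ?sqr_ge0//.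
 by rewrite integral_gam_sqr ltry.
rewrite integralD//; last by apply: integrableD => //; exact: integrableZl.
rewrite integralD//; last exact: integrableZl.
rewrite integralZl// integral_gam integral_gam_sqr integral_prob_cst -!EFinM -!EFinD lee_fin.
by rewrite -[k.+2%:R]natr1 mulrDr mulr1; set a : R := k.+1%:R; lra.
Qed.

Lemma gauss_exp_abs (a : R) : (\int[gauss]_z (expR (a * `|z|))%:E <= (2 * expR (a ^+ 2 / 2))%:E)%E.
Proof.
have m1 (c : R) : measT (fun z : RM => (expR (c * z))%:E).
 by apply: meas_expRl; exact: measM.
apply: (@le_trans _ _ (\int[gauss]_z ((expR (a * z))%:E + (expR (- a * z))%:E))%E).
 apply: ge0_le_integral => //.
 - by apply: meas_expRl; apply: measM => //; exact: mcomp.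
 - exact: emeasurable_funD.
 move=> z _; rewrite -EFinD lee_fin; have := expR_gt0 (a * z); have := expR_gt0 (- a * z).
 by case: (ger0P z) => _; rewrite ?mulrN ?mulNr; lra.
rewrite ge0_integralD//; try by move=> z _; rewrite lee_fin expR_ge0.
by rewrite !gauss_mgf sqrrN -EFinD lee_fin mulr_natl mulr2n.
Qed.

Lemma integral_gauss : (\int[@gauss R]_z z%:E = 0)%E.
Proof.
have m1 : measT (fun z : RM => z%:E) by exact: mcomp.
have ix : (@gauss R).-integrable setT (EFin \o (fun x : RM => x : R)).
 apply: (@integrable_of_sqr _ _ _ _ (4 * (2 * expR (1 ^+ 2 / 2)))) => //.
 apply: (@le_trans _ _ (\int[gauss]_z (4%:E * (expR (1 * `|z|))%:E))%E).
  apply: ge0_le_integral => //.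
  - by move=> z _; rewrite lee_fin sqr_ge0.
  - by apply: mcomp => //; exact: measX.
  - apply: measurable_funeM; apply: meas_expRl.
   by apply: measM => //; exact: mcomp.
  by move=> z _; rewrite -EFinM lee_fin mul1r sqr_le_expR.
 rewrite ge0_integralZl//; first by rewrite (EFinM 4) lee_wpmul2l// gauss_exp_abs.
 by apply: meas_expRl; apply: measM => //; exact: mcomp.
have fx := integrable_fin_num measurableT ix.
have : (\int[@gauss R]_z z%:E = - \int[@gauss R]_z z%:E)%E.
 rewrite [LHS](mp_integral mp_gauss_opp m1).
 under eq_integral => z _ do rewrite EFinN -mulN1e.
 by rewrite -EFinN integralZl// EFinN mulN1e.
move: fx => /=; case: (\int[_]_z _)%E => //= r _ [] H; congr EFin.
by move: H; lra.
Qed.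

Definition gz_res k (x : R) : R := x - k.+1%:R - sqrt k.+1%:R * gz k x.

(** 16 is the square of the constant 4 in [gz_err], and 2 exp 8 bounds the mean of exp(4 |Z|) for a
    standard normal Z. *)
Definition gz_var : R := 32 * expR 8.

Lemma centered_gz_res k : centered (@gam R k) gz_var (gz_res k).
Proof.
have mg : measT (gz k : RM -> RM) := (mp_gz k).1.
have me : measT (gz_res k : RM -> RM).
 apply: measB; first exact: measB.
 exact: measM.
have He2 : (\int[gam k]_x (gz_res k x ^+ 2)%:E <= gz_var%:E)%E.
 apply: (@le_trans _ _ (\int[gam k]_x (16%:E * (expR (4 * `|gz k x|))%:E))%E).
  have mE : measT (fun x : RM => (expR (4 * `|gz k x|))%:E).
   apply: meas_expRl; apply: measM => //.
   exact: mcomp.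
  apply: ae_ge0_le_integral => //.
  - by move=> z _; rewrite lee_fin sqr_ge0.
  - by apply: mcomp => //; exact: measX.
  - exact: measurable_funeM.
  exists `]-oo, 0]%classic; split; [exact: measurable_itv|exact: gam_pos|].
  move=> x /=; rewrite in_itv/=; apply: contra_notP => /negP; rewrite -ltNge => x0 _.
  rewrite -EFinM lee_fin -sqr_normr//.
  apply: (@le_trans _ _ ((4 * expR (2 * `|gz k x|)) ^+ 2)).
   by apply: lerXn2r; rewrite ?nnegrE ?mulr_ge0 ?expR_ge0//; exact: gz_err.
  rewrite exprMn -expRM_natl mulrA le_eqVlt; apply/orP; left; apply/eqP.
  by congr (_ * expR (_ * _)); ring.
 have mE : measT (fun z : RM => (expR (4 * `|z|))%:E).
  by apply: meas_expRl; apply: measM => //; exact: mcomp.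
 rewrite ge0_integralZl//; last exact: (mcomp mE mg).
 rewrite -(mp_ge0_integral (mp_gz k) mE); last by move=> z; rewrite lee_fin expR_ge0.
 rewrite /gz_var (_ : 32 * expR 8 = 16 * (2 * expR (4 ^+ 2 / 2))).
  by rewrite (EFinM 16) lee_wpmul2l// gauss_exp_abs.
 by rewrite mulrA; congr (_ * expR _); [ring|field].
apply: centeredI => //.
have [mc _] := centered_gam k.
have ic : (@gam R k).-integrable setT (EFin \o (fun x : RM => x - k.+1%:R)).
 apply: (@integrable_of_sqr _ _ _ _ (0 ^+ 2 + k.+1%:R)) => //.
 have [_ /(_ 0)] := centered_gam k.
 by under eq_integral => x _ do rewrite add0r.
have q0 : 0 < sqrt k.+1%:R :> R by rewrite sqrtr_gt0 ltr0n.
have igz : (@gam R k).-integrable setT (EFin \o (fun x : RM => gz k x)).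
 have ie := integrable_of_sqr me He2.
 have := integrableZl measurableT (sqrt k.+1%:R)^-1 (integrableB measurableT ic ie).
 apply: eq_integrable => // x _ /=; rewrite -EFinD -EFinM; congr EFin.
 by rewrite /gz_res opprB addrCA subrr addr0 mulKf// gt_eqF.
rewrite /gz_res; under eq_integral => x _ do rewrite EFinB EFinM.
rewrite integralB//; last exact: integrableZl.
rewrite integralZl// -(mp_integral (mp_gz k) (g := fun z : RM => z%:E))//.
rewrite integral_gauss mule0 sube0.
under eq_integral => x _ do rewrite EFinB.
have ic' c : (@gam R k).-integrable setT (fun=> c%:E).
 by apply: finite_measure_integrable_cst.
have ix : (@gam R k).-integrable setT (EFin \o (fun x : RM => x : R)).
 by apply: integrable_of_sqr => //; rewrite integral_gam_sqr.
 by rewrite integralB// integral_gam integral_prob_cst subee.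
exact: mcomp.
Qed.

End moments.

(** * Kolmogorov's maximal inequality *)

Section maximal_inequality.
Context {R : realType}.
Notation RS := (@rseq R).
Notation RM := (measurableTypeR R).
Implicit Types (S : nat -> R) (b : nat) (bs : seq nat) (e : nat -> R -> R) (s x : R).

Definition bsum bs S : RS := blk (fun=> id) id bs S.

Lemma meas_bsum bs : measT (bsum bs : RS -> RS).
Proof.
elim: bs => [|b bs IH]; first by apply: meas_rseq => n; exact: meas_coord.
exact: (mcomp meas_scons (meas_pair (@meas_prefix_sum R b) (mcomp IH (@meas_shift_by R b)))).
Qed.

Definition exceeds n e x (p : RM * RS) : Prop := exists k, (k <= n)%N /\ x <= `|p.1 + \sum_(i < k) e
 i (p.2 i)|.

Lemma meas_exceeds n e x d (T : mtype d) (f : T -> RM) (g : T -> RS) : (forall i, measT (e i : RM ->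
 RM)) -> measT f -> measT g -> measurable [set w | exceeds n e x (f w, g w)].
Proof.
move=> me mf mg.
rewrite (_ : [set w | _] = \bigcup_(k in [set k | (k <= n)%N]) [set w | x <= `|f w + \sum_(i < k) e
 i (g w i)|]); last first.
 by apply/seteqP; split => w [k]; [case=> kn H; exists k|move=> kn H; exists k].
apply: bigcup_measurable => k _.
apply: meas_le_fun => //; apply: mcomp => //; apply: measD => //.
 apply: measurable_sum => i; apply: (mcomp (me i)).
 exact: (mcomp (meas_coord i) mg).
Qed.

(** Induction with an arbitrary start s. If |s| >= x, then x^2 <= s^2 suffices. Otherwise the first
    block moves the start to s + e_0, and the form of [centered] turns the bound for the new start
    into s^2 + C_0 plus the other variances. No stopping time is introduced. *)
Lemma kolmogorov_blk a bs e (C : nat -> R) s x : all (leq 1) bs -> 0 < x -> (forall i, measT (e i :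
 RM -> RM)) -> (forall i, (i < size bs)%N -> centered (gam (nth 0%N bs i * a.+1).-1) (C i) (e i))
 -> ((x ^+ 2)%:E * pow (gam a) [set S | exceeds (size bs) e x (s, bsum bs S)] <= (s ^+ 2 + \sum_(i
 < size bs) C i)%:E)%E.
Proof.
move=> + x0; elim: bs e C s => [|b bs IH] e C s bs1 me ce.
 rewrite big_ord0 addr0; have [xs|sx] := leP x `|s|.
  apply: (@le_trans _ _ ((x ^+ 2)%:E * 1)%E).
   rewrite lee_wpmul2l ?lee_fin ?sqr_ge0//; apply: probability_le1.
   by apply: meas_exceeds => //; exact: (meas_bsum [::]).
  rewrite mule1 lee_fin -(real_normK (num_real s)).
  by apply: lerXn2r; rewrite ?nnegrE ?normr_ge0// ltW.
 rewrite [X in pow _ X](_ : _ = set0) ?measure0 ?mule0 ?lee_fin ?sqr_ge0//.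
 rewrite -subset0 => S [k [/=]]; rewrite leqn0 => /eqP->.
 by rewrite big_ord0 addr0 leNgt sx.
case: b bs1 ce => [//|b] /= bs1 ce.
have C0 i : (i < (size bs).+1)%N -> 0 <= C i by move=> /ce; exact: centered_ge0.
have [xs|sx] := leP x `|s|.
 apply: (@le_trans _ _ ((x ^+ 2)%:E * 1)%E).
  rewrite lee_wpmul2l ?lee_fin ?sqr_ge0//; apply: probability_le1.
  by apply: meas_exceeds => //; exact: (meas_bsum (b.+1 :: bs)).
 rewrite mule1 lee_fin; apply: (@le_trans _ _ (s ^+ 2)).
  rewrite -[leRHS](real_normK (num_real s)).
  by apply: lerXn2r; rewrite ?nnegrE ?normr_ge0// ltW.
 by rewrite lerDl sumr_ge0// => i _; exact: C0.
pose e' i := e i.+1.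
pose A := [set p : RM * RS | exceeds (size bs) e' x (s + e 0%N p.1, bsum bs p.2)].
have mA : measurable A.
 apply: meas_exceeds => [i| |]; first exact: me.
  by apply: measD => //; exact: (mcomp (me 0%N)).
 exact: (mcomp (meas_bsum bs)).
have mxs : measT (fun y : RM => pow (gam a) [set S | A (y, S)]).
 rewrite (_ : (fun y => _) = pow (gam a) \o xsection A).
  exact: (measurable_fun_xsection (pow (gam a)) mA).
 apply/funext => y; rewrite /= /xsection/=; congr (pow _ _).
 by apply/seteqP; split => S /=; rewrite in_setE.
have [mss H] := mp_sum_shift (R := R) a b.
have -> : [set S | exceeds (size bs).+1 e x (s, bsum (b.+1 :: bs) S)] = (fun S => (prefix_sum b.+1 S
 : RM, shift_by b.+1 S)) @^-1` A.
 apply/seteqP; split => S [k [kn]] /=.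
  case: k kn => [|k] kn; first by rewrite big_ord0 addr0 leNgt sx.
  by rewrite big_ord_recl addrA => H'; exists k; split.
 by move=> H'; exists k.+1; split => //; rewrite /= big_ord_recl addrA.
rewrite H// prodPE -ge0_integralZl//; last by rewrite lee_fin sqr_ge0.
apply: (@le_trans _ _ (\int[gam (b.+1 * a.+1).-1]_y ((s + e 0%N y) ^+ 2 + \sum_(i < size bs) C
 i.+1)%:E)%E).
 apply: ge0_le_integral => //.
 - by move=> y _; rewrite mule_ge0// lee_fin sqr_ge0.
 - exact: measurable_funeM.
 - apply: mcomp => //; apply: measD => //.
  by apply: measX; apply: measD => //; exact: me.
 move=> y _; exact: (IH e' (fun i => C i.+1) (s + e 0%N y) bs1 (fun i => me i.+1) (fun i ilt => ce
  i.+1 ilt)).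
have [_ /(_ s)] := ce 0%N isT.
under [X in _ -> (X <= _)%E]eq_integral => y _ do rewrite EFinD.
rewrite ge0_integralD//; last 3 first.
- by move=> y _; rewrite lee_fin sqr_ge0.
- by apply: mcomp => //; apply: measX; apply: measD => //; exact: me.
- by move=> y _; rewrite lee_fin sumr_ge0// => i _; apply: C0; rewrite ltnS.
move=> h; rewrite integral_prob_cst big_ord_recl addrA EFinD.
exact: leeD.
Qed.

Lemma bsum_nseq1 n S : bsum (nseq n 1%N) S = S.
Proof.
rewrite /bsum; elim: n S => [//|n IH] S; apply/funext => -[|i] /=.
 by rewrite /prefix_sum big_ord_recl big_ord0 addr0.
by rewrite IH.
Qed.

(** An i.i.d. sequence of any law is the quantile transform of exponentials, taken in blocks of
    length 1. *)
Lemma kolmogorov (mu : prob RM R) n e (C : nat -> R) s x : 0 < x -> (forall i, measT (e i : RM ->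
 RM)) -> (forall i, (i < n)%N -> centered mu (C i) (e i)) -> ((x ^+ 2)%:E * pow mu [set S | exceeds
 n e x (s, S)] <= (s ^+ 2 + \sum_(i < n) C i)%:E)%E.
Proof.
move=> x0 me ce.
pose h : RM -> RM := quantile mu \o cdfR (gam 0).
have mh : mp (gam 0) mu h.
 exact: mp_comp (mp_cdfR (@gam_cdf_continuous R 0)) (mp_quantile mu).
have [_ <-] := mp_map (powP (gam 0)) (powP mu) mh; last by apply: meas_exceeds => //; exact: measurable_cst.
have := @kolmogorov_blk 0 (nseq n 1%N) (fun i => e i \o h) C s x.
rewrite size_nseq.
rewrite (_ : [set S | exceeds n (fun i => e i \o h) x (s, bsum (nseq n 1%N) S)] = (fun (S : RS) =>
 (fun i => h (S i)) : RS) @^-1` [set S | exceeds n e x (s, S)]); last first.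
 by apply/seteqP; split=> S /=; rewrite bsum_nseq1.
apply => //.
- by apply/allP => i; rewrite mem_nseq => /andP[_ /eqP ->].
- by move=> i; exact: (mcomp (me i) mh.1).
- by move=> i ilt; rewrite nth_nseq ilt; apply: (mp_centered mh); exact: ce.
Qed.

End maximal_inequality.

(** * Exponential tail bounds *)

Section tails.
Context {R : realType}.
Notation RS := (@rseq R).
Notation RM := (measurableTypeR R).

Lemma meas_ge d (T : mtype d) (f : T -> R) (x : R) : measT (f : T -> RM) -> measurable [set w | (x
 <= f w)%R].
Proof. by move=> mf; exact: meas_le_fun. Qed.

Lemma markov_exp d (T : mtype d) (P : prob T R) (f : T -> R) (x C : R) : measT f -> (\int[P]_w (expR
 (f w))%:E <= C%:E)%E -> (P [set w | (x <= f w)%R] <= (C * expR (- x))%:E)%E.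
Proof.
move=> mf fC.
have mA : measurable [set w | (x <= f w)%R] by exact: meas_ge.
rewrite -[leLHS]mul1e -[in leLHS](setIT [set w | _]) mul1e -integral_indic//.
rewrite EFinM muleC; apply: (@le_trans _ _ ((expR (- x))%:E * \int[P]_w (expR (f w))%:E)%E).
 rewrite -ge0_integralZl//; last exact: meas_expRl.
 apply: ge0_le_integral => //.
 - exact: (meas_ind mA).
 - by apply: measurable_funeM; exact: meas_expRl.
 move=> w _; rewrite -EFinM lee_fin -expRD indicE.
 case: (boolP (w \in _)) => [/set_mem/= xw|_]; last exact: expR_ge0.
 by rewrite -expR0 ler_expR addrC subr_ge0.
by rewrite lee_wpmul2l// lee_fin expR_ge0.
Qed.

Lemma gauss_tail (x : R) : 0 <= x -> (@gauss R [set z : RM | (x <= `|z|)%R] <= (2 * expR (- (x ^+ 2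
 / 2)))%:E)%E.
Proof.
move=> x0.
have mf : measT (fun z : RM => x * `|z| : R).
 by apply: measM => //; exact: mcomp.
have := markov_exp (x ^+ 2) mf (gauss_exp_abs x).
have [->|xn0] := eqVneq x 0.
 move=> _; rewrite expr0n mul0r oppr0 expR0 mulr1.
 apply: (@le_trans _ _ 1%E); last by rewrite lee_fin ler1n.
 apply: probability_le1; rewrite (_ : [set _ | _] = setT)//.
 by apply/seteqP; split => z //= _; exact: normr_ge0.
have -> : [set z : RM | x ^+ 2 <= x * `|z|] = [set z | x <= `|z|].
 by apply/seteqP; split => z /=; rewrite expr2 ler_pM2l// lt_neqAle eq_sym xn0.
move=> /le_trans; apply; rewrite lee_fin -mulrA -expRD.
apply: le_of_eq.
by congr (_ * expR _); field.
Qed.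

Lemma mp_coord (mu : prob RM R) i : mp (pow mu) mu (fun z : RS => z i : RM).
Proof.
have h0 : mp (pow mu) mu (fun z : RS => z 0%N : RM).
 apply: (mp_cancel (g := fun z : RS => z 0%N : RM) _ (mp_cons (powP mu))).
  exact: meas_coord.
 exact: (mp_eqfun _ (mp_fst mu (pow mu))).
apply: (mp_eqfun _ (mp_comp (mp_reindex (powP mu) (@addnI i)) h0)) => z /=.
by rewrite addn0.
Qed.

(** A deterministic growth condition under which the Schauder series converges uniformly. With the
    coefficient 4 of the logarithm, the probability that it fails at index i is at most 2 exp(-a) /
    (i + 1)^2, which is summable. *)
Definition tame (a : R) (z : nat -> R) : Prop := forall i, z i ^+ 2 <= 2 * a + 4 * ln i.+1%:R.

Lemma meas_tame a : measurable [set z : RS | tame a z].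
Proof.
rewrite (_ : [set z | _] = \bigcap_i [set z : RS | z i ^+ 2 <= 2 * a + 4 * ln i.+1%:R]).
 apply: bigcap_measurableType => // i _.
 by apply: meas_le_fun => //; apply: measX; exact: meas_coord.
by apply/seteqP; split=> z; [move=> H i _; exact: H|move=> H i; exact: H].
Qed.

Lemma sum_inv_sqr_le n : \sum_(i < n) (i.+1%:R ^+ 2)^-1 <= 2 :> R.
Proof.
suff H : \sum_(i < n.+1) (i.+1%:R ^+ 2)^-1 <= 2 - n.+1%:R^-1 :> R.
 apply: le_trans (_ : _ <= \sum_(i < n.+1) (i.+1%:R ^+ 2)^-1) _.
  by rewrite big_ord_recr/= lerDl invr_ge0 sqr_ge0.
 by apply: le_trans H _; rewrite gerBl invr_ge0.
elim: n => [|n IH]; first by rewrite big_ord_recl big_ord0 expr1n invr1; lra.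
rewrite big_ord_recr/=; apply: (le_trans (lerD IH (lexx _))).
have n0 : (0 : R) < n.+1%:R by rewrite ltr0n.
rewrite -[n.+2%:R]natr1; move: (n.+1%:R : R) n0 => y n0.
have y1 : y + 1 != 0 by rewrite gt_eqF// addr_gt0.
have yn0 : y != 0 by rewrite gt_eqF.
have -> : 2 - y^-1 + ((y + 1) ^+ 2)^-1 = 2 - (y + 1)^-1 - (y * (y + 1) ^+ 2)^-1.
 by field; rewrite y1 yn0.
by rewrite gerBl invr_ge0 mulr_ge0 ?sqr_ge0// ltW.
Qed.

Lemma pow_tame (a : R) : 0 <= a -> (pow gauss (~` [set z : RS | tame a z]) <= (4 * expR (-
 a))%:E)%E.
Proof.
move=> a0; pose r i : R := sqrt (2 * a + 4 * ln i.+1%:R).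
have ln0 i : 0 <= ln i.+1%:R :> R by rewrite ln_ge0// ler1n.
have r2 i : 0 <= 2 * a + 4 * ln i.+1%:R :> R by have := ln0 i; lra.
pose A i := [set z : RS | (r i <= `|z i|)%R].
have mA i : measurable (A i).
 by apply: meas_ge; apply: mcomp => //; exact: meas_coord.
have PA i : (pow gauss (A i) <= (2 * expR (- a) * (i.+1%:R ^+ 2)^-1)%:E)%E.
 have [_ E] := mp_coord gauss i.
 rewrite -[pow gauss (A i)]/(pow gauss ((fun z : RS => z i : RM) @^-1` [set z | r i <= `|z|])).
 rewrite E; last by apply: (@meas_ge _ RM (fun z : RM => `|z|)); exact: mcomp.
 apply: (le_trans (gauss_tail (sqrtr_ge0 _))); rewrite lee_fin sqr_sqrtr//.
 rewrite -mulrA ler_wpM2l// (_ : - _ = - a + - (2%:R * ln i.+1%:R)); last by field.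
 by rewrite expRD ler_wpM2l ?expR_ge0// expRN expRM_natl lnK// posrE ltr0n.
apply: (@le_trans _ _ (pow gauss (\bigcup_i A i))).
 rewrite le_measure ?inE//; [by apply: measurableC; exact: meas_tame|exact: bigcup_measurable|].
 move=> z /= /existsNP[i /negP]; rewrite -ltNge => H; exists i => //=.
 rewrite /A /= -[leRHS]sqrtr_sqr ler_wsqrtr//; exact: ltW.
apply: (le_trans (generalized_Boole_inequality (pow gauss) mA (bigcup_measurable (fun k _ => mA k)))).
apply: lime_le; first by apply: is_cvg_nneseries => *; exact: measure_ge0.
near=> n; rewrite big_mkord; apply: (@le_trans _ _ (\sum_(i < n) (2 * expR (- a) * (i.+1%:R ^+ 2)^-1)%:E)%E).
 by apply: lee_sum => i _; exact: PA.
rewrite sumEFin lee_fin -mulr_sumr.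
have := sum_inv_sqr_le n; have := expR_gt0 (- a); set X := \sum_(_ < _) _; set E := expR _.
by nra.
Unshelve. all: by end_near. Qed.

Lemma exp_mgf_le (l : R) : `|l| <= 2^-1 -> (\int[expP]_x (expR (l * (x - 1)))%:E <= (expR (2 * l ^+
 2))%:E)%E.
Proof.
rewrite ler_norml => /andP[l2a l2b]; have l1 : l < 1 by lra.
rewrite (eq_integral (fun x : RM => (expR (- l))%:E * (expR (l * x))%:E)%E); last first.
 by move=> x _; rewrite -EFinM -expRD; congr (expR _)%:E; ring.
rewrite ge0_integralZl//; last first.
 by apply: meas_expRl; exact: measM.
rewrite expP_mgf// -EFinM lee_fin ler_pdivrMr ?subr_gt0//.
have -> : expR (2 * l ^+ 2) = expR (- l) * expR (l + 2 * l ^+ 2).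
 by rewrite -expRD; congr expR; ring.
rewrite -mulrA ler_peMr ?expR_ge0//.
have l10 : 0 < 1 - l by lra.
have := expR_ge1Dx (l + 2 * l ^+ 2); rewrite -(ler_pM2r l10); apply: le_trans.
have -> : (1 + (l + 2 * l ^+ 2)) * (1 - l) = 1 + l ^+ 2 * (1 - 2 * l) by ring.
by rewrite lerDl mulr_ge0 ?sqr_ge0//; lra.
Qed.

Lemma exp_sum_mgf_le (l : R) j : `|l| <= 2^-1 -> (\int[pow expP]_S (expR (l * (prefix_sum j S -
 j%:R)))%:E <= (expR (2 * l ^+ 2 * j%:R))%:E)%E.
Proof.
move=> l2; elim: j => [|j IH].
 rewrite (eq_integral (cst 1%E)) => [|S _]; last first.
  by rewrite /prefix_sum big_ord0 subrr mulr0 expR0.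
 by rewrite (integral_prob_cst _ 1) mulr0 expR0.
have mf k : measT (fun S : RS => (expR (l * (prefix_sum k S - k%:R)))%:E).
 apply: meas_expRl; apply: measM => //; apply: measB => //.
 exact: meas_prefix_sum.
have mc := mp_cons (powP (@expP R)).
rewrite (mp_ge0_integral mc (mf j.+1)); last by move=> S; rewrite lee_fin expR_ge0.
rewrite prodP_ge0_integral; last 2 first.
- exact: (mcomp (mf j.+1) mc.1).
- by move=> S; rewrite lee_fin expR_ge0.
have mx : measT (fun x : RM => (expR (l * (x - 1)))%:E).
 by apply: meas_expRl; apply: measM => //; exact: measB.
pose c := (\int[pow expP]_S (expR (l * (prefix_sum j S - j%:R)))%:E)%E.
have c0 : (0 <= c)%E by apply: integral_ge0 => S _; rewrite lee_fin expR_ge0.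
rewrite (eq_integral (fun x : RM => (expR (l * (x - 1)))%:E * c)%E); last first.
 move=> x _; rewrite /c -ge0_integralZl ?lee_fin ?expR_ge0//.
 apply: eq_integral => S _ /=; rewrite -EFinM -expRD; congr (expR _)%:E.
 by rewrite /prefix_sum big_ord_recl/= -natr1; ring.
have cf : c \is a fin_num by rewrite ge0_fin_numE// (le_lt_trans IH) ?ltry.
rewrite -(fineK cf); under eq_integral => x _ do rewrite muleC.
rewrite ge0_integralZl// ?lee_fin ?fine_ge0// fineK// muleC.
rewrite -[j.+1%:R]natr1 mulrDr mulr1 addrC expRD EFinM.
by apply: lee_pmul => //; [apply: integral_ge0 => x _; rewrite lee_fin expR_ge0|exact: exp_mgf_le].
Qed.

Lemma chernoff b j (x : R) : (j <= b)%N -> 0 <= x <= 2 * b%:R -> (pow expP [set S : RS | (x <=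
 `|prefix_sum j S - j%:R|)%R] <= (2 * expR (- (x ^+ 2 / (8 * b%:R))))%:E)%E.
Proof.
move=> jb /andP[x0 xb].
have ms : measT (fun S : RS => prefix_sum j S - j%:R : RM).
 by apply: measB => //; exact: meas_prefix_sum.
have [b0|b0] := posnP b.
 rewrite b0 mulr0 invr0 mulr0 oppr0 expR0 mulr1.
 apply: (@le_trans _ _ 1%E); last by rewrite lee_fin ler1n.
 by apply: probability_le1; apply: meas_ge; exact: mcomp.
have b0' : (0 : R) < b%:R by rewrite ltr0n.
(* The minimizer of 2 l^2 b - l x; the hypothesis x <= 2 b keeps it in the range l <= 1/2 of
   [exp_mgf_le]. *)
pose l : R := x / (4 * b%:R).
have l0 : 0 <= l by rewrite divr_ge0// mulr_ge0// ltW.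
have l2 : l <= 2^-1 by rewrite ler_pdivrMr ?mulr_gt0//; lra.
have H (s : R) : `|s| = 1 -> (pow expP [set S : RS | (x <= s * (prefix_sum j S - j%:R))%R] <= (expR
 (- (x ^+ 2 / (8 * b%:R))))%:E)%E.
 move=> s1; have s2 : s ^+ 2 = 1 by rewrite -(real_normK (num_real s)) s1 expr1n.
 have ls2 : `|l * s| <= 2^-1 by rewrite normrM s1 mulr1 ger0_norm.
 have mls : measT (fun S : RS => l * s * (prefix_sum j S - j%:R) : R).
  exact: measM.
 have := markov_exp (l * x) mls (exp_sum_mgf_le j ls2).
 move=> H; apply: le_trans (le_trans _ H) _.
  rewrite le_measure ?inE//; last first.
  - by move=> S /= xS; rewrite -mulrA ler_wpM2l.
  - exact: meas_ge.
  - by apply: meas_ge; exact: measM.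
 rewrite -expRD lee_fin ler_expR exprMn s2 mulr1.
 apply: (@le_trans _ _ (2 * l ^+ 2 * b%:R + - (l * x))).
  by rewrite lerD2r ler_wpM2l ?ler_nat// mulr_ge0// sqr_ge0.
 apply: le_of_eq; rewrite /l; field.
 by rewrite gt_eqF.
have H1 := H 1 (normr1 _); have H2 := H (-1) (normrN1 _).
apply: (@le_trans _ _ (pow expP ([set S : RS | (x <= 1 * (prefix_sum j S - j%:R))%R] `|` [set S : RS
 | (x <= -1 * (prefix_sum j S - j%:R))%R]))).
 rewrite le_measure ?inE//; last first.
 - by move=> S /=; case: (ger0P (prefix_sum j S - j%:R)) => _ h; [left|right]; lra.
 - by apply: measurableU; apply: meas_ge; exact: measM.
 - by apply: meas_ge; exact: mcomp.
apply: (le_trans (measureU2 _ _ _)).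
- by apply: meas_ge; exact: measM.
- by apply: meas_ge; exact: measM.
by rewrite mulr_natl mulr2n EFinD; exact: leeD.
Qed.

End tails.

(** * Schauder functions of the Brownian bridge *)

Section schauder.
Context {R : realType}.
Implicit Types (s t u x : R) (M J L i k l : nat) (z : nat -> R).

Definition clamp x : R := Num.max 0 (Num.min 1 x).

Lemma clampP x : [\/ x <= 0 /\ clamp x = 0, 0 <= x <= 1 /\ clamp x = x | 1 <= x /\ clamp x = 1].
Proof.
have [x0|x0] := leP x 0.
 by apply: Or31; split => //; rewrite /clamp; apply/max_idPl; rewrite ge_min x0 orbT.
have [x1|x1] := leP x 1.
 apply: Or32; split; first by rewrite (ltW x0).
 by rewrite /clamp (min_idPr x1); apply/max_idPr/ltW.
apply: Or33; split; first exact: ltW.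
by rewrite /clamp (min_idPl (ltW x1)); apply/max_idPr.
Qed.

Lemma clamp01 x : 0 <= clamp x <= 1.
Proof. by case: (clampP x) => -[h ->]; rewrite ?lexx ?ler01//. Qed.

Lemma clamp_nd x y : x <= y -> clamp x <= clamp y.
Proof.
move=> xy; case: (clampP x) => -[hx ->]; case: (clampP y) => -[hy ->]; try lra.
Qed.

Lemma clamp_lip x y : x <= y -> clamp y - clamp x <= y - x.
Proof.
move=> xy; case: (clampP x) => -[hx ->]; case: (clampP y) => -[hy ->]; try lra.
Qed.

Lemma sum_clamp M x : 0 <= x <= M%:R -> \sum_(l < M) clamp (x - l%:R) = x.
Proof.
suff H : \sum_(l < M) clamp (x - l%:R) = Num.max 0 (Num.min M%:R x).
 by move=> /andP[x0 xM]; rewrite H (min_idPr xM); apply/max_idPr.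
elim: M x => [|M IH] x.
 by rewrite big_ord0; apply/esym/max_idPl; rewrite ge_min lexx.
rewrite big_ord_recl subr0 (eq_bigr (fun l : 'I_M => clamp (x - 1 - l%:R))); last first.
 by move=> l _; congr clamp; rewrite /= /bump add1n -natr1; ring.
rewrite IH -natr1; have M0 : (0 : R) <= M%:R by rewrite ler0n.
set y : R := M%:R in M0 *.
case: (clampP x) => -[hx ->]; rewrite !(minElt, maxElt); do ![case: ifPn]; rewrite -?leNgt; lra.
Qed.

Definition tent x : R := clamp x - clamp (x - 1).

Lemma tent_ge0 x : 0 <= tent x.
Proof. by rewrite subr_ge0 clamp_nd// gerBl. Qed.

Lemma sum_tent_le M x : \sum_(k < M) tent (x - (2 * k)%:R) <= 1.
Proof.
apply: (@le_trans _ _ (clamp x - clamp (x - (2 * M)%:R))); last first.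
 by have := clamp01 x; have := clamp01 (x - (2 * M)%:R); lra.
elim: M => [|M IH]; first by rewrite big_ord0 muln0 subr0 subrr.
rewrite big_ord_recr/=; apply: (le_trans (lerD IH (lexx _))).
rewrite /tent; have : clamp (x - (2 * M.+1)%:R) <= clamp (x - (2 * M)%:R - 1).
 by apply: clamp_nd; rewrite mulnS natrD; lra.
lra.
Qed.

Lemma sum_double (f : nat -> R) M : \sum_(l < 2 * M) f l = \sum_(l < M) (f (2 * l)%N + f (2 *
 l).+1).
Proof.
elim: M => [|M IH]; first by rewrite muln0 !big_ord0.
by rewrite mulnS !addSn add0n !big_ord_recr/= IH addrA.
Qed.

Lemma clamp_double x : clamp (2 * x) + clamp (2 * x - 1) = 2 * clamp x.
Proof.
by case: (clampP x) => -[h ->]; case: (clampP (2 * x)) => -[h1 ->]; case: (clampP (2 * x - 1)) =>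
 -[h2 ->]; lra.
Qed.

Definition pow2 J : R := (2 ^ J)%:R.

Lemma pow2_gt0 J : 0 < pow2 J. Proof. by rewrite ltr0n expn_gt0. Qed.

Lemma pow2S J : pow2 J.+1 = 2 * pow2 J. Proof. by rewrite /pow2 expnS natrM. Qed.

Lemma pow2_ge1 J : 1 <= pow2 J. Proof. by rewrite ler1n expn_gt0. Qed.

(** The covariance of a Brownian motion interpolated linearly between the points l / 2^J. *)
Definition Qcov J s t : R := (pow2 J)^-1 * \sum_(l < 2 ^ J) clamp (pow2 J * s - l%:R) * clamp (pow2
 J * t - l%:R).

Lemma Qcov_min J s t : 0 <= s <= 1 -> 0 <= t <= 1 -> 0 <= Num.min s t - Qcov J s t <= (pow2 J)^-1.
Proof.
wlog st : s t / s <= t => [H|].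
 have /orP[/H//|ts] := le_total s t.
 move=> s01 t01; have := H t s ts t01 s01; rewrite minC /Qcov.
 by under eq_bigr => l _ do rewrite mulrC.
move=> /andP[s0 s1] /andP[t0 t1]; rewrite (min_idPl st).
have M0 := pow2_gt0 J.
have E : s = (pow2 J)^-1 * \sum_(l < 2 ^ J) clamp (pow2 J * s - l%:R).
 rewrite sum_clamp ?mulVKf ?gt_eqF// ?mulKf ?gt_eqF//.
 by rewrite mulr_ge0 ?(ltW M0)//= ler_piMr// ltW.
rewrite [X in X - _]E /Qcov -mulrBr -sumrB.
have iM : 0 <= (pow2 J)^-1 by rewrite invr_ge0 ltW.
apply/andP; split.
 rewrite mulr_ge0// sumr_ge0// => l _.
 have := clamp01 (pow2 J * s - l%:R); have := clamp01 (pow2 J * t - l%:R); nra.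
rewrite -[leRHS]mulr1 ler_wpM2l//.
apply: (@le_trans _ _ (\sum_(l < 2 ^ J) (clamp (pow2 J * s - l%:R) - clamp (pow2 J * s - l.+1%:R)))).
 apply: ler_sum => l _; rewrite -natr1 opprD addrA; set y := pow2 J * s - l%:R.
 have yt : clamp y <= clamp (pow2 J * t - l%:R).
  by apply: clamp_nd; rewrite lerD2r ler_wpM2l// ltW.
 have := clamp01 (pow2 J * t - l%:R); move: yt; set w := clamp (pow2 J * t - l%:R) => yw w01.
 have -> : clamp y - clamp y * w = clamp y * (1 - w) by ring.
 case: (clampP y) => -[hy cy]; case: (clampP (y - 1)) => -[hy' ->]; move: yw; rewrite cy; nra.
have -> : \sum_(l < 2 ^ J) (clamp (pow2 J * s - l%:R) - clamp (pow2 J * s - l.+1%:R)) = clamp (pow2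
 J * s) - clamp (pow2 J * s - (2 ^ J)%:R).
 elim: (2 ^ J)%N => [|n IH]; first by rewrite big_ord0 subr0 subrr.
 by rewrite big_ord_recr/= IH; lra.
have := clamp01 (pow2 J * s); have := clamp01 (pow2 J * s - (2 ^ J)%:R); lra.
Qed.

(** Levy's refinement in terms of covariances: halving the mesh adds an independent tent around each
    new midpoint, and the parallelogram identity for the two halves of a cell gives the
    coefficient. *)
Lemma QcovS J s t : Qcov J.+1 s t = Qcov J s t + \sum_(k < 2 ^ J) ((2 * sqrt (pow2 J))^-1 * tent
 (pow2 J.+1 * s - (2 * k)%:R)) * ((2 * sqrt (pow2 J))^-1 * tent (pow2 J.+1 * t - (2 * k)%:R)).
Proof.
rewrite /Qcov expnS (sum_double (fun l => clamp (pow2 J.+1 * s - l%:R) * clamp (pow2 J.+1 * t - l%:R))).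
rewrite pow2S !mulr_sumr -big_split/=.
apply: eq_bigr => k _.
have M0 := pow2_gt0 J; have sM : sqrt (pow2 J) ^+ 2 = pow2 J by rewrite sqr_sqrtr// ltW.
have sM0 : sqrt (pow2 J) != 0 by rewrite sqrtr_eq0 -ltNge.
have D u : 2 * pow2 J * u - (2 * k)%:R = 2 * (pow2 J * u - k%:R) by rewrite natrM; ring.
have D1 u : 2 * pow2 J * u - (2 * k).+1%:R = 2 * (pow2 J * u - k%:R) - 1.
 by rewrite -[(2 * k).+1%:R]natr1 natrM; ring.
rewrite /tent !D !D1.
have E u := clamp_double (pow2 J * u - k%:R).
have Es := E s; have Et := E t.
set a := clamp (2 * (pow2 J * s - k%:R)) in Es *.
set b := clamp (2 * (pow2 J * s - k%:R) - 1) in Es *.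
set c := clamp (2 * (pow2 J * t - k%:R)) in Et *.
set d := clamp (2 * (pow2 J * t - k%:R) - 1) in Et *.
have -> : clamp (pow2 J * s - k%:R) = (a + b) / 2 by rewrite Es; field.
have -> : clamp (pow2 J * t - k%:R) = (c + d) / 2 by rewrite Et; field.
set q := sqrt (pow2 J) in sM sM0 *; by rewrite -sM; field.
Qed.

(** Levy's construction started at level L instead of 0. For i < 2^L these are the functions of the
    interpolated bridge of a walk with 2^L steps, so that the first 2^L coefficients of the Brownian
    bridge are the normalized steps themselves, as the block sums provide them. The others are
    Schauder tents, with level the binary logarithm of i. *)
Definition psi L i t : R := if (i < 2 ^ L)%N then (sqrt (pow2 L))^-1 * (clamp (pow2 L * t - i%:R) -
 t) else let j := trunc_log 2 i in (2 * sqrt (pow2 j))^-1 * tent (pow2 j.+1 * t - (2 * (i - 2 ^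
 j))%:R).

Lemma psi_base L i t : (i < 2 ^ L)%N -> psi L i t = (sqrt (pow2 L))^-1 * (clamp (pow2 L * t - i%:R)
 - t).
Proof. by rewrite /psi => ->. Qed.

Lemma psi_fine L J k t : (L <= J)%N -> (k < 2 ^ J)%N -> psi L (2 ^ J + k) t = (2 * sqrt (pow2 J))^-1
 * tent (pow2 J.+1 * t - (2 * k)%:R).
Proof.
move=> LJ kJ; rewrite /psi ltnNge (leq_trans (leq_pexp2l _ LJ)) ?leq_addr//=.
have -> : trunc_log 2 (2 ^ J + k) = J.
 by apply: trunc_log_eq => //; rewrite leq_addr expnS mul2n -addnn ltn_add2l.
by rewrite addKn.
Qed.

Lemma sum_pow2S (f : nat -> R) J : \sum_(i < 2 ^ J.+1) f i = \sum_(i < 2 ^ J) f i + \sum_(k < 2 ^ J)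
 f (2 ^ J + k)%N.
Proof. by rewrite expnS mul2n -addnn big_split_ord. Qed.

(** At J = L the clamps of s add up to 2^L s, which yields [Qcov L] minus s t; each further level is
    [QcovS]. The first 2^L functions add up to 0 and are not linearly independent, but only the
    covariance matters. *)
Lemma sum_psi_psi L J s t : (L <= J)%N -> 0 <= s <= 1 -> 0 <= t <= 1 -> \sum_(i < 2 ^ J) psi L i s *
 psi L i t = Qcov J s t - s * t.
Proof.
move=> LJ s01 t01; elim: J LJ => [|J IH] LJ.
 move: LJ; rewrite leqn0 => /eqP->.
 rewrite /Qcov /pow2 !expn0 !big_ord_recl !big_ord0 /= !addr0 !psi_base//.
 rewrite /pow2 !expn0 !sqrtr1 !invr1 !mul1r !subr0.
 have c u : 0 <= u <= 1 -> clamp u = u.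
  by move=> h; case: (clampP u) => -[h' ->]; lra.
 by rewrite !c//; ring.
move: LJ; rewrite leq_eqVlt => /predU1P[->|LJ]; last first.
 rewrite (sum_pow2S (fun i => psi L i s * psi L i t)) IH// QcovS addrAC; do 2 congr (_ + _).
 by apply: eq_bigr => k _; rewrite !psi_fine.
under eq_bigr => i _ do rewrite !psi_base//.
set L' := J.+1; have M0 := pow2_gt0 L'.
have sM : sqrt (pow2 L') ^+ 2 = pow2 L' by rewrite sqr_sqrtr// ltW.
have sM0 : sqrt (pow2 L') != 0 by rewrite sqrtr_eq0 -ltNge.
have S u : 0 <= u <= 1 -> \sum_(l < 2 ^ L') clamp (pow2 L' * u - l%:R) = pow2 L' * u.
 move=> /andP[u0 u1]; rewrite sum_clamp//.
 by rewrite mulr_ge0 ?(ltW M0)//= ler_piMr// ltW.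
under eq_bigr => i _ do rewrite mulrACA -invfM -expr2 sM.
rewrite -mulr_sumr.
under eq_bigr => i _ do rewrite mulrBl !mulrBr opprB addrA.
rewrite !(big_split, sumrN)/= -!mulr_suml -!mulr_sumr !S// sumr_const card_ord -[_ *+ _]mulr_natl.
by rewrite -/(pow2 L') /Qcov; field; rewrite gt_eqF.
Qed.

(** Bounds the sup norm of level J of a series with [tame a] coefficients. For J = L and 2^L of
    order sqrt N it has the order of the claimed rate, and all errors below are measured in units of
    it. *)
Definition Dlev (a : R) J : R := (sqrt (pow2 J))^-1 * sqrt (a + J%:R + 3).

Lemma Dlev_ge0 a J : 0 <= Dlev a J.
Proof. by rewrite mulr_ge0 ?invr_ge0 ?sqrtr_ge0. Qed.

(** Any ratio above 1 / sqrt 2 holds for large J; thanks to the summand 3 the ratio 5/6 holds from J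
    = 0 on. Its geometric series gives the factor 6 below. *)
Lemma DlevS a J : 0 <= a -> Dlev a J.+1 <= 5 / 6 * Dlev a J.
Proof.
move=> a0; have M0 := pow2_gt0 J; have J0 : (0 : R) <= J%:R by rewrite ler0n.
rewrite -[leRHS]ger0_norm ?mulr_ge0 ?Dlev_ge0// -sqrtr_sqr.
rewrite -[leLHS]ger0_norm ?Dlev_ge0// -sqrtr_sqr ler_wsqrtr//.
rewrite /Dlev !exprMn !exprVn !sqr_sqrtr ?(ltW (pow2_gt0 _))//; try by rewrite -?natr1; lra.
rewrite -[J.+1%:R]natr1 pow2S invfM.
have y0 : 0 <= (pow2 J)^-1 by rewrite invr_ge0 ltW.
set y := (pow2 J)^-1 in y0 *.
have : 0 <= y * (a + J%:R) by rewrite mulr_ge0// addr_ge0.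
have -> : 2^-1 * y * (a + (J%:R + 1) + 3) = 2^-1 * (y * (a + J%:R)) + 2 * y by field.
have -> : 5 ^+ 2 / 6 ^+ 2 * (y * (a + J%:R + 3)) = 25 / 36 * (y * (a + J%:R)) + 75 / 36 * y by field.
lra.
Qed.

Lemma Dlev_geo a L i : 0 <= a -> Dlev a (L + i) <= (5 / 6) ^+ i * Dlev a L.
Proof.
move=> a0; elim: i => [|i IH]; first by rewrite addn0 mul1r.
rewrite addnS exprS -mulrA; apply: (le_trans (DlevS _ a0)).
by rewrite ler_wpM2l.
Qed.

Lemma Dlev_sum a L n : 0 <= a -> \sum_(i < n) Dlev a (L + i) <= 6 * Dlev a L.
Proof.
move=> a0; apply: (@le_trans _ _ (\sum_(i < n) (5 / 6) ^+ i * Dlev a L)).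
 by apply: ler_sum => i _; exact: Dlev_geo.
rewrite -mulr_suml ler_wpM2r ?Dlev_ge0//.
have -> : \sum_(i < n) (5 / 6) ^+ i = 6 * (1 - (5 / 6) ^+ n) :> R.
 elim: n => [|n IH]; first by rewrite big_ord0 expr0 subrr mulr0.
 by rewrite big_ord_recr/= IH exprS; field.
have : 0 <= (5 / 6 : R) ^+ n by rewrite exprn_ge0//; lra.
lra.
Qed.

Lemma tame_bound a z J i : 0 <= a -> tame a z -> (i < 2 ^ J.+1)%N -> `|z i| <= 2 * sqrt (a + J%:R +
 3).
Proof.
move=> a0 tz iJ; have J0 : (0 : R) <= J%:R by rewrite ler0n.
rewrite -[leRHS]ger0_norm ?mulr_ge0 ?sqrtr_ge0// -[leRHS]sqrtr_sqr -[leLHS]sqrtr_sqr ler_wsqrtr//.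
rewrite exprMn sqr_sqrtr; last lra.
apply: (le_trans (tz i)).
have : ln i.+1%:R <= J.+1%:R :> R.
 apply: (@le_trans _ _ (ln (expR (J.+1%:R : R)))); last by rewrite expRK.
 rewrite ler_ln ?posrE ?ltr0n ?expR_gt0//.
 apply: (@le_trans _ _ (2 ^+ J.+1)).
  by rewrite -natrX ler_nat.
 rewrite -[J.+1%:R]mulr1 expRM_natl; apply: lerXn2r; rewrite ?nnegrE ?expR_ge0//.
 by have := expR_ge1Dx (1 : R); lra.
rewrite -natr1 expr2; lra.
Qed.

Definition Sg L J u z : R := \sum_(i < 2 ^ J) psi L i u * z i.

(** The tents of one level add up to at most 1 at every point, so the level contributes no more than
    the bound on a single one of its terms. *)
Lemma Sg_step a L J u z : 0 <= a -> tame a z -> (L <= J)%N -> `|Sg L J.+1 u z - Sg L J u z| <= Dlev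
 a J.
Proof.
move=> a0 tz LJ; rewrite /Sg (sum_pow2S (fun i => psi L i u * z i)) addrAC subrr add0r.
apply: (le_trans (ler_norm_sum _ _ _)).
have sM0 : 0 < sqrt (pow2 J) by rewrite sqrtr_gt0 pow2_gt0.
apply: (@le_trans _ _ (\sum_(k < 2 ^ J) Dlev a J * tent (pow2 J.+1 * u - (2 * k)%:R))).
 apply: ler_sum => k _; rewrite psi_fine// normrM normrM (ger0_norm (tent_ge0 _)).
 rewrite mulrAC ler_wpM2r ?tent_ge0// ger0_norm ?invr_ge0 ?mulr_ge0 ?(ltW sM0)//.
 rewrite invfM /Dlev mulrAC [leLHS]mulrC ler_wpM2l ?invr_ge0 ?(ltW sM0)//.
 rewrite mulrC ler_pdivrMr// mulrC; apply: tame_bound => //.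
 by rewrite expnS mul2n -addnn ltn_add2l.
by rewrite -mulr_sumr ler_piMr ?Dlev_ge0// sum_tent_le.
Qed.

Lemma Sg_tail a L J n u z : 0 <= a -> tame a z -> (L <= J)%N -> `|Sg L (J + n) u z - Sg L J u z| <=
 6 * Dlev a J.
Proof.
move=> a0 tz LJ; apply: le_trans (Dlev_sum J n a0).
elim: n => [|n IH]; first by rewrite addn0 subrr normr0 big_ord0.
rewrite addnS big_ord_recr/= addrC.
have -> : Sg L (J + n).+1 u z - Sg L J u z = (Sg L (J + n).+1 u z - Sg L (J + n) u z) + (Sg L (J +
 n) u z - Sg L J u z) by ring.
apply: normD_le => //.
by apply: Sg_step => //; exact: leq_trans LJ (leq_addr _ _).
Qed.

(** The coefficients are bounded by [tame_bound], and the increments of the base functions from u to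
    v, before normalization, have total size at most 2 * 2^L * |u - v|. At distances of order 2^(-L)
    the bound is of order [Dlev a L]. *)
Lemma Sg_modulus a L u v z : 0 <= a -> tame a z -> 0 <= u <= 1 -> 0 <= v <= 1 -> `|Sg L L u z - Sg L
 L v z| <= 4 * pow2 L * Dlev a L * `|u - v|.
Proof.
move=> a0 tz; wlog uv : u v / u <= v => [H|].
 have /orP[/H//|vu] := le_total u v.
 by move=> u01 v01; rewrite distrC (distrC u); exact: H.
move=> /andP[u0 u1] /andP[v0 v1].
have M0 := pow2_gt0 L; have sM0 : 0 < sqrt (pow2 L) by rewrite sqrtr_gt0.
set r := sqrt (a + L%:R + 3); have r0 : 0 <= r by exact: sqrtr_ge0.
rewrite /Sg -sumrB (_ : `|u - v| = v - u); last by rewrite distrC ger0_norm ?subr_ge0.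
apply: (le_trans (ler_norm_sum _ _ _)).
apply: (@le_trans _ _ (\sum_(i < 2 ^ L) 2 * Dlev a L * ((clamp (pow2 L * v - i%:R) - clamp (pow2 L * u - i%:R)) + (v - u)))).
 apply: ler_sum => i _; rewrite -mulrBl normrM !psi_base// -mulrBr normrM.
 rewrite ger0_norm ?invr_ge0 ?(ltW sM0)// /Dlev -/r.
 have zi : `|z i| <= 2 * r.
  by apply: tame_bound => //; rewrite (leq_trans (ltn_ord i))// leq_pexp2l.
 have c : `|clamp (pow2 L * u - i%:R) - u - (clamp (pow2 L * v - i%:R) - v)| <= clamp (pow2 L * v -
  i%:R) - clamp (pow2 L * u - i%:R) + (v - u).
  have : clamp (pow2 L * u - i%:R) <= clamp (pow2 L * v - i%:R).
   by apply: clamp_nd; rewrite lerD2r ler_wpM2l// ltW.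
  by rewrite ler_norml => h; apply/andP; split; lra.
 set e := clamp (pow2 L * v - i%:R) - clamp (pow2 L * u - i%:R) + (v - u) in c *.
 set y := `|clamp (pow2 L * u - i%:R) - u - (clamp (pow2 L * v - i%:R) - v)| in c *.
 have -> : 2 * ((sqrt (pow2 L))^-1 * r) * e = (sqrt (pow2 L))^-1 * (e * (2 * r)) by ring.
 rewrite -mulrA ler_wpM2l ?invr_ge0 ?(ltW sM0)//.
 by apply: ler_pM => //; rewrite /y.
rewrite -mulr_sumr big_split/= sumrB !sum_clamp; last 2 first.
- by rewrite mulr_ge0 ?(ltW M0)//= ler_piMr// ltW.
- by rewrite mulr_ge0 ?(ltW M0)//= ler_piMr// ltW.
rewrite sumr_const card_ord -[_ *+ _]mulr_natl -/(pow2 L) -mulrBr.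
by apply: le_of_eq; ring.
Qed.

End schauder.

(** * Integration over the unit interval *)

Section unit_interval_integral.
Context {R : realType}.
Notation RM := (measurableTypeR R).
Notation leb := (@lebesgue_measure R).
Implicit Types (f g : R -> R).

Definition int01 f : R := \int[leb]_(s in `[0, 1]) f s.

Definition ok01 f := measT (f : RM -> RM) /\ exists C : R, forall s, 0 <= s <= 1 -> `|f s| <= C.

Lemma leb01 : leb `[0, 1]%classic = 1%E.
Proof. by rewrite lebesgue_measure_itv/= lte_fin ltr01 oppr0 adde0. Qed.

Lemma ok01_integrable f : ok01 f -> leb.-integrable `[0, 1]%classic (EFin \o (f : RM -> R)).
Proof.
move=> [mf [C fC]]; apply: measurable_bounded_integrable => //.
- have H : (leb `[0%R, 1%R]%classic < +oo)%E by rewrite leb01 ltry.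
 exact: H.
- exact: measurable_funTS.
exists C; split; first exact: num_real.
move=> x Cx s /=; rewrite in_itv/= => s01; exact: le_trans (fC s s01) (ltW Cx).
Qed.

Lemma ok01_cst (c : R) : ok01 (fun=> c).
Proof. by split; [exact: measurable_cst|exists `|c|]. Qed.

Lemma ok01D f g : ok01 f -> ok01 g -> ok01 (fun s => f s + g s).
Proof.
move=> [mf [C fC]] [mg [D gD]]; split; first exact: measD.
exists (C + D) => s s01; apply: (le_trans (ler_normD _ _)).
by apply: lerD; [exact: fC|exact: gD].
Qed.

Lemma ok01M f g : ok01 f -> ok01 g -> ok01 (fun s => f s * g s).
Proof.
move=> [mf [C fC]] [mg [D gD]]; split; first exact: measM.
exists (C * D) => s s01; rewrite normrM.
by apply: ler_pM => //; [exact: fC|exact: gD].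
Qed.

Lemma ok01N f : ok01 f -> ok01 (fun s => - f s).
Proof.
move=> [mf [C fC]]; split; first exact: measurable_funN.
by exists C => s s01; rewrite normrN; exact: fC.
Qed.

Lemma ok01Z (c : R) f : ok01 f -> ok01 (fun s => c * f s).
Proof. by move=> h; apply: ok01M => //; exact: ok01_cst. Qed.

Lemma ok01B f g : ok01 f -> ok01 g -> ok01 (fun s => f s - g s).
Proof. by move=> hf hg; apply: ok01D => //; exact: ok01N. Qed.

Lemma ok01_sum n (F : nat -> R -> R) : (forall i, (i < n)%N -> ok01 (F i)) -> ok01 (fun s => \sum_(i
 < n) F i s).
Proof.
elim: n => [|n IH] h.
 rewrite (_ : (fun s => _) = fun=> 0); first exact: ok01_cst.
 by apply/funext => s; rewrite big_ord0.
rewrite (_ : (fun s => _) = fun s => \sum_(i < n) F i s + F n s); last first.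
 by apply/funext => s; rewrite big_ord_recr.
by apply: ok01D; [apply: IH => i ilt; apply: h; rewrite ltnW|exact: h].
Qed.

Lemma int01_cst (c : R) : int01 (fun=> c) = c.
Proof.
transitivity (c * fine (leb `[0, 1]%classic)); first exact: Rintegral_cst.
by rewrite leb01 mulr1.
Qed.

Lemma int01D f g : ok01 f -> ok01 g -> int01 (fun s => f s + g s) = int01 f + int01 g.
Proof. by move=> hf hg; apply: RintegralD => //; exact: ok01_integrable. Qed.

Lemma int01B f g : ok01 f -> ok01 g -> int01 (fun s => f s - g s) = int01 f - int01 g.
Proof. by move=> hf hg; apply: RintegralB => //; exact: ok01_integrable. Qed.

Lemma int01Z (c : R) f : ok01 f -> int01 (fun s => c * f s) = c * int01 f.
Proof. by move=> hf; apply: RintegralZl => //; exact: ok01_integrable. Qed.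

Lemma int01_sum n (F : nat -> R -> R) : (forall i, (i < n)%N -> ok01 (F i)) -> int01 (fun s =>
 \sum_(i < n) F i s) = \sum_(i < n) int01 (F i).
Proof.
elim: n => [|n IH] h.
 rewrite big_ord0 -[RHS](int01_cst 0); apply: eq_Rintegral => s _.
 by rewrite big_ord0.
rewrite big_ord_recr/= -IH; last by move=> i ilt; apply: h; rewrite ltnW.
rewrite -int01D//; [|by apply: ok01_sum => i ilt; apply: h; rewrite ltnW|exact: h].
by apply: eq_Rintegral => s _; rewrite big_ord_recr.
Qed.

Lemma eq_int01 f g : (forall s, 0 <= s <= 1 -> f s = g s) -> int01 f = int01 g.
Proof. by move=> fg; apply: eq_Rintegral => s; rewrite inE/= in_itv; exact: fg. Qed.

Lemma int01_le f g : ok01 f -> ok01 g -> (forall s, 0 <= s <= 1 -> f s <= g s) -> int01 f <= int01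
 g.
Proof.
move=> hf hg fg; have h1 := ok01_integrable hf; have h2 := ok01_integrable hg.
by apply: le_Rintegral => // s; rewrite /= in_itv; exact: fg.
Qed.

Lemma int01_norm_le f (C : R) : ok01 f -> (forall s, 0 <= s <= 1 -> `|f s| <= C) -> `|int01 f| <= C.
Proof.
move=> hf fC; have H s : 0 <= s <= 1 -> - C <= f s <= C by move=> /fC; rewrite ler_norml.
have h1 := int01_le (ok01_cst (- C)) hf (fun s h => proj1 (andP (H s h))).
have h2 := int01_le hf (ok01_cst C) (fun s h => proj2 (andP (H s h))).
by rewrite ler_norml -(int01_cst (- C)) h1 -[leRHS](int01_cst C) h2.
Qed.

Lemma int01_dist_le f g (C : R) : ok01 f -> ok01 g -> (forall s, 0 <= s <= 1 -> `|f s - g s| <= C)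
 -> `|int01 f - int01 g| <= C.
Proof. by move=> hf hg h; rewrite -int01B//; apply: int01_norm_le => //; exact: ok01B. Qed.

Lemma lip_continuous f (C : R) : (forall x y, `|f x - f y| <= C * `|x - y|) -> continuous f.
Proof.
move=> fC x; apply/cvgrPdist_le => e e0.
have C0 : 0 <= C.
 by have := le_trans (normr_ge0 _) (fC 1 0); rewrite subr0 normr1 mulr1.
near=> y; apply: (le_trans (fC x y)); apply: (@le_trans _ _ ((C + 1) * `|x - y|)).
 by rewrite ler_wpM2r// lerDl.
rewrite mulrC -ler_pdivlMr ?ltr_wpDl//.
near: y; apply: cvgr_dist_le; last by rewrite divr_gt0// ltr_wpDl.
exact: cvg_id.
Unshelve. all: by end_near. Qed.

Lemma ok01_continuous f : continuous f -> (exists C : R, forall s, 0 <= s <= 1 -> `|f s| <= C) -> ok01 f.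
Proof. by move=> cf h; split => //; exact: cont_meas. Qed.

End unit_interval_integral.

(** * Convergence and continuity of the bridge series *)

Section brownian_series.
Context {R : realType}.
Notation RS := (@rseq R).
Notation RM := (measurableTypeR R).
Implicit Types (u v s t a : R) (z : nat -> R) (L J n : nat).

Lemma cvg_of_tail (x e : nat -> R) L : (forall J n, (L <= J)%N -> `|x (J + n)%N - x J| <= e J) -> e
 @ \oo --> 0 -> cvgn x /\ forall J, (L <= J)%N -> `|limn x - x J| <= e J.
Proof.
move=> xe e0.
have cx : cvgn x.
 apply/cauchy_cvgP/cauchy_exP => d d0.
 have dn : 0 < d / 4 by rewrite divr_gt0.
 have /cvgrPdist_le/(_ _ dn)[N _ HN'] := e0.
 have HN J : (N <= J)%N -> `|e J| <= d / 4 by move=> /HN'; rewrite sub0r normrN.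
 pose J := maxn N L.
 have HJ : forall n, `|x (J + n)%N - x J| <= d / 4.
  move=> n; apply: (le_trans (xe J n (leq_maxr _ _))).
  by apply: le_trans (HN J (leq_maxl _ _)); exact: ler_norm.
 exists (x J); exists J => //= p Jp; rewrite /ball/= -(subnKC Jp) distrC.
 by apply: le_lt_trans (HJ _) _; rewrite ltr_pdivrMr// ltr_pMr// ltr1n.
split => // J LJ.
have cJ : `|x n - x J| @[n --> \oo] --> `|limn x - x J|.
 by apply: cvg_norm; apply: cvgB => //; exact: cvg_cst.
apply: (cvgr_to_le cJ); near=> n.
have nJ : (J <= n)%N by near: n; exact: nbhs_infty_ge.
by rewrite -(subnKC nJ); exact: xe.
Unshelve. all: by end_near. Qed.

Lemma Dlev_cvg0 a : 0 <= a -> Dlev a J @[J --> \oo] --> (0 : R).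
Proof.
move=> a0; apply: (@squeeze_cvgr _ _ _ _ (fun=> 0) (fun J => (5 / 6) ^+ J * Dlev a 0)).
- by near=> J; rewrite Dlev_ge0/= -{1}(add0n J) Dlev_geo.
- exact: cvg_cst.
- rewrite -[X in _ --> X](mul0r (Dlev a 0)); apply: cvgM; last exact: cvg_cst.
 by apply: cvg_expr; rewrite ger0_norm; lra.
Unshelve. all: by end_near. Qed.

Definition good z := exists2 a : R, 0 <= a & tame a z.

Lemma tame_mono a b z : a <= b -> tame a z -> tame b z.
Proof. by move=> ab h i; apply: (le_trans (h i)); rewrite lerD2r ler_wpM2l. Qed.

Lemma goodE : [set z : RS | good z] = \bigcup_(k in setT) [set z : RS | tame k%:R z].
Proof.
apply/seteqP; split => z; last by move=> [k _ h]; exists k%:R.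
move=> [a a0 h]; exists (Num.truncn a).+1 => //; apply: tame_mono h.
exact/ltW/truncnS_gt.
Qed.

Lemma meas_good : measurable [set z : RS | good z].
Proof. by rewrite goodE; apply: bigcup_measurable => k _; exact: meas_tame. Qed.

Lemma pow_not_good : pow gauss (~` [set z : RS | good z]) = 0%E.
Proof.
apply/eqP; rewrite eq_le measure_ge0 andbT; apply/lee_addgt0Pr => e e0; rewrite add0e.
have [k Hk] : exists k : nat, 4 * expR (- (k%:R : R)) <= e.
 exists (Num.truncn (4 / e)).+1.
 rewrite expRN ler_pdivrMr ?expR_gt0// mulrC -ler_pdivrMr//.
 by apply: (le_trans (ltW (truncnS_gt _))); apply: le_trans (expR_ge1Dx _); rewrite lerDr.
apply: (@le_trans _ _ (pow gauss (~` [set z : RS | tame k%:R z]))).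
 rewrite le_measure ?inE//; try by apply: measurableC; [exact: meas_good|exact: meas_tame].
 - by apply: measurableC; exact: meas_good.
 - by apply: measurableC; exact: meas_tame.
 by apply: subsetC => z h; exists k%:R.
by apply: (le_trans (pow_tame _)) => //; rewrite lee_fin.
Qed.

(** Sequences outside the full event [good] are replaced by 0. The series then has a continuous sum
    for every outcome, as [brownian_bridge] demands of all paths. *)
Definition zhat (z : RS) : RS := if `[< good z >] then z else fun=> 0.

Lemma zhat_id z : good z -> zhat z = z.
Proof. by move=> h; rewrite /zhat asboolT. Qed.

Lemma zhat_good z : good (zhat z).
Proof.
rewrite /zhat; case: ifPn => [/asboolP//|_]; exists 0 => // i.
by rewrite expr0n mulr0 add0r mulr_ge0// ln_ge0// ler1n.
Qed.

Lemma meas_zhat : measT zhat.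
Proof.
apply: meas_rseq => i.
rewrite (_ : (fun z => _) = fun z : RS => \1_[set z | good z] z * z i).
 apply: measM; last exact: meas_coord.
 exact: (measurable_indic meas_good).
apply/funext => z; rewrite /zhat indicE; case: asboolP => h.
 by rewrite mem_set ?mul1r.
by rewrite memNset ?mul0r.
Qed.

Lemma mp_zhat : mp (pow gauss) (pow gauss) zhat.
Proof.
apply: (@mp_ae R _ _ RS RS (pow gauss) (pow gauss) id zhat (~` [set z | good z])).
- exact: meas_zhat.
- by apply: measurableC; exact: meas_good.
- exact: pow_not_good.
- by move=> z /contrapT h; rewrite zhat_id.
- exact: mp_id.
Qed.

Definition Bser L u z : R := limn (fun J => Sg L J u (zhat z)).

Lemma Bser_close L u a z J : 0 <= a -> tame a z -> (L <= J)%N -> `|Bser L u z - Sg L J u z| <= 6 *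
 Dlev a J.
Proof.
move=> a0 tz LJ.
have D0 : 6 * Dlev a J @[J --> \oo] --> (0 : R).
 by rewrite -[X in _ --> X](mulr0 6); apply: cvgM; [exact: cvg_cst|exact: Dlev_cvg0].
have [_] := @cvg_of_tail (fun J => Sg L J u z) (fun J => 6 * Dlev a J) L (fun J n LJ => Sg_tail n u
 a0 tz LJ) D0.
by rewrite /Bser zhat_id; [exact|exists a].
Qed.

Lemma Sg_cvg L u z : Sg L J u (zhat z) @[J --> \oo] --> Bser L u z.
Proof.
have [a a0 tz] := zhat_good z.
have D0 : 6 * Dlev a J @[J --> \oo] --> (0 : R).
 by rewrite -[X in _ --> X](mulr0 6); apply: cvgM; [exact: cvg_cst|exact: Dlev_cvg0].
by have [] := @cvg_of_tail (fun J => Sg L J u (zhat z)) (fun J => 6 * Dlev a J) L (fun J n LJ =>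
 Sg_tail n u a0 tz LJ) D0.
Qed.

Lemma meas_Sg L J u : measT (Sg L J u : RS -> RM).
Proof.
by apply: measurable_sum => i; apply: measM => //; exact: meas_coord.
Qed.

Lemma meas_Bser L u : measT (Bser L u : RS -> RM).
Proof.
apply: (@measurable_fun_cvg _ _ _ setT (fun J (z : RS) => Sg L J u (zhat z))).
 by move=> J; exact: (mcomp (meas_Sg L J u) meas_zhat).
by move=> z _; exact: Sg_cvg.
Qed.

Lemma psi_lip L i : exists C : R, forall u v, `|psi L i u - psi L i v| <= C * `|u - v|.
Proof.
have clip (c b : R) u v : 0 <= c -> `|clamp (c * u - b) - clamp (c * v - b)| <= c * `|u - v|.
 move=> c0; have -> : c * `|u - v| = `|c * u - c * v|.
  by rewrite -mulrBr normrM ger0_norm.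
 have /orP[h|h] := le_total (c * u - b) (c * v - b).
  rewrite distrC ger0_norm ?subr_ge0 ?clamp_nd//.
  apply: (le_trans (clamp_lip h)); rewrite distrC.
  by have := ler_norm (c * v - c * u); lra.
 rewrite ger0_norm ?subr_ge0 ?clamp_nd//.
 apply: (le_trans (clamp_lip h)).
 by have := ler_norm (c * u - c * v); lra.
rewrite /psi; case: (i < 2 ^ L)%N => /=.
 exists ((sqrt (pow2 L))^-1 * (pow2 L + 1)) => u v.
 rewrite -mulrBr normrM ger0_norm ?invr_ge0 ?sqrtr_ge0// -mulrA ler_wpM2l ?invr_ge0 ?sqrtr_ge0//.
 rewrite (_ : forall x y : R, x - u - (y - v) = (x - y) + (v - u)); last by move=> x y; ring.
 apply: (le_trans (ler_normD _ _)); rewrite mulrDl mul1r (distrC v) lerD2r.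
 exact: clip (ltW (pow2_gt0 _)).
set j := trunc_log 2 i.
exists ((2 * sqrt (pow2 j))^-1 * (pow2 j.+1 + pow2 j.+1)) => u v.
have q0 : 0 <= (2 * sqrt (pow2 j : R))^-1 by rewrite invr_ge0 mulr_ge0 ?sqrtr_ge0.
rewrite -mulrBr normrM ger0_norm// -mulrA ler_wpM2l// /tent.
rewrite (_ : forall x y x' y' : R, x - y - (x' - y') = (x - x') + (y' - y)); last first.
 by move=> x y x' y'; ring.
apply: (le_trans (ler_normD _ _)); rewrite mulrDl; apply: lerD.
 exact: clip (ltW (pow2_gt0 _)).
by rewrite -!addrA -!opprD distrC; exact: clip (ltW (pow2_gt0 _)).
Qed.

Lemma psi_continuous L i : continuous (psi L i : R -> R).
Proof. by have [C h] := psi_lip L i; exact: lip_continuous h. Qed.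

Lemma Sg_continuous L J z : continuous (fun u => Sg L J u z).
Proof.
rewrite /Sg; elim: (2 ^ J)%N => [|n IH] u.
 rewrite (_ : (fun u => _) = fun=> 0); first exact: cvg_cst.
 by apply/funext => v; rewrite big_ord0.
rewrite (_ : (fun u => _) = fun u => \sum_(i < n) psi L i u * z i + psi L n u * z n).
 by apply: cvgD; [exact: IH|apply: cvgM; [exact: psi_continuous|exact: cvg_cst]].
by apply/funext => v; rewrite big_ord_recr.
Qed.

Lemma uniform_limit_continuous (f : nat -> R -> R) (g : R -> R) (e : nat -> R) L : (forall J,
 continuous (f J)) -> (forall J u, (L <= J)%N -> `|g u - f J u| <= e J) -> e @ \oo --> 0 ->
 continuous g.
Proof.
move=> cf gf e0 u; apply/cvgrPdist_le => d d0.
have dn : 0 < d / 3 by rewrite divr_gt0.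
 have /cvgrPdist_le/(_ _ dn)[N _ HN'] := e0.
 have HN J : (N <= J)%N -> `|e J| <= d / 3 by move=> /HN'; rewrite sub0r normrN.
pose J := maxn N L.
have HJ v : `|g v - f J v| <= d / 3.
 apply: (le_trans (gf J v (leq_maxr _ _))).
 by apply: le_trans (HN J (leq_maxl _ _)); exact: ler_norm.
have d3 : 0 < d / 3 by rewrite divr_gt0.
have /cvgrPdist_le/(_ _ d3) := cf J u.
apply: filterS => v; have := HJ u; have := HJ v.
rewrite !ler_norml => /andP[h1 h2] /andP[h3 h4] /andP[h5 h6].
by apply/andP; split; lra.
Qed.

Lemma Bser_continuous L z : continuous (fun u => Bser L u z).
Proof.
have [a a0 tz] := zhat_good z.
apply: (@uniform_limit_continuous (fun J u => Sg L J u (zhat z)) _ (fun J => 6 * Dlev a J) L).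
- by move=> J; exact: Sg_continuous.
- move=> J u LJ; rewrite /Bser -{1}(zhat_id (zhat_good z)); exact: Bser_close.
- by rewrite -[X in _ --> X](mulr0 6); apply: cvgM; [exact: cvg_cst|exact: Dlev_cvg0].
Qed.

End brownian_series.

(** * Limits and second moments of Gaussian variables *)

Section gaussian_limits.
Context {R : realType}.
Notation RM := (measurableTypeR R).
Implicit Types (t x : R).

Lemma dominated_cvg1 d (T : mtype d) (P : prob T R) (f_ : nat -> T -> R) (f : T -> R) : (forall n,
 measT (f_ n)) -> (forall w, f_ ^~ w @ \oo --> f w) -> (forall n w, 0 <= f_ n w <= 1) -> (\int[P]_w
 (f_ n w)%:E @[n --> \oo] --> \int[P]_w (f w)%:E)%E.
Proof.
move=> mf ff f01.
apply: (@dominated_cvg _ _ _ P setT measurableT (fun n w => (f_ n w)%:E) (fun w => (f w)%:E) (cst 1%E)).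
- by move=> n; exact: mcomp.
- by move=> w _; apply: cvg_EFin; [exact: nearW|exact: ff].
- by [].
- by apply: finite_measure_integrable_cst.
- move=> n w _; rewrite gee0_abs ?lee_fin; first by case/andP: (f01 n w).
 by case/andP: (f01 n w).
Qed.

(** Continuous functions decreasing to the indicator of y <= x. Limits of laws are tested on them,
    the indicator being discontinuous at x. *)
Definition ramp n x y : R := clamp (1 + n%:R * (x - y)).

Lemma ramp01 n x y : 0 <= ramp n x y <= 1. Proof. exact: clamp01. Qed.

Lemma clamp_lip2 (a b : R) : `|clamp a - clamp b| <= `|a - b|.
Proof.
have /orP[h|h] := le_total a b.
 by rewrite distrC (distrC a) !ger0_norm ?subr_ge0 ?clamp_nd// clamp_lip.
by rewrite !ger0_norm ?subr_ge0 ?clamp_nd// clamp_lip.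
Qed.

Lemma clamp_continuous : continuous (clamp : R -> R).
Proof. by apply: (@lip_continuous _ _ 1) => a b; rewrite mul1r clamp_lip2. Qed.

Lemma ramp_continuous n x : continuous (ramp n x).
Proof.
apply: (@lip_continuous _ _ n%:R) => a b; apply: (le_trans (clamp_lip2 _ _)).
rewrite (_ : _ - _ = n%:R * (b - a)); last by ring.
by rewrite normrM distrC ger0_norm.
Qed.

Lemma meas_ramp n x : measT (ramp n x : RM -> RM).
Proof. exact: cont_meas (@ramp_continuous n x). Qed.

Lemma ramp_cvg x y : ramp n x y @[n --> \oo] --> ((y <= x)%R%:R : R).
Proof.
have [yx|xy] := leP y x.
 rewrite (_ : ramp^~ x ^~ y = fun=> 1); first exact: cvg_cst.
 apply/funext => n; rewrite /ramp; have n0 : 0 <= n%:R * (x - y) by rewrite mulr_ge0// subr_ge0.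
 by case: (clampP (1 + n%:R * (x - y))) => -[h ->]; lra.
rewrite (_ : false%:R = 0 :> R)//; apply: cvg_near_cst; near=> n; rewrite /ramp.
have : 1 + n%:R * (x - y) <= 0.
 rewrite -opprB mulrN subr_le0 -ler_pdivrMr ?subr_gt0//.
 by near: n; exact: nbhs_infty_ger.
by case: (clampP (1 + n%:R * (x - y))) => -[h ->]; lra.
Unshelve. all: by end_near. Qed.

Lemma mp_of_ramps d (T : mtype d) (P : prob T R) (Q : prob RM R) (f : T -> RM) : measT f -> (forall
 n x, \int[P]_w (ramp n x (f w))%:E = \int[Q]_y (ramp n x y)%:E)%E -> mp P Q f.
Proof.
move=> mf H; apply: mp_cdf => // x.
have mx : measurable [set y : RM | (y <= x)%R].
 by rewrite (_ : [set _ | _] = `]-oo, x]%classic)//; apply/seteqP; split => y /=; rewrite in_itv.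
have D1 : (\int[P]_w (ramp n x (f w))%:E @[n --> \oo] --> \int[P]_w ((f w <= x)%R%:R : R)%:E)%E.
 apply: dominated_cvg1 => [n|w|n w]; [|exact: ramp_cvg|exact: ramp01].
 exact: (mcomp (meas_ramp n x) mf).
have D2 : (\int[Q]_y (ramp n x y)%:E @[n --> \oo] --> \int[Q]_y ((y <= x)%R%:R : R)%:E)%E.
 apply: dominated_cvg1 => [n|w|n w]; [|exact: ramp_cvg|exact: ramp01].
 exact: meas_ramp.
have E : (\int[P]_w ((f w <= x)%R%:R : R)%:E = \int[Q]_y ((y <= x)%R%:R : R)%:E)%E.
 have e : (fun n : nat => \int[P]_w (ramp n x (f w))%:E)%E = (fun n => \int[Q]_y (ramp n x y)%:E)%E.
  by apply/funext => n; exact: H.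
 have D3 : (\int[P]_w (ramp n x (f w))%:E @[n --> \oo] --> \int[Q]_y ((y <= x)%R%:R : R)%:E)%E.
  by rewrite e; exact: D2.
 exact: (cvg_unique (@ereal_hausdorff R) D1 D3).
have mfx := meas_preim mf mx.
have I d' (T' : mtype d') (P' : prob T' R) (A : set T') (g : T' -> bool) : measurable A -> (forall
 w, A w <-> g w) -> P' A = (\int[P']_w ((g w)%:R : R)%:E)%E.
 move=> mA Ag; rewrite -[LHS]mul1e -[in LHS](setIT A) mul1e -integral_indic//.
 apply: eq_integral => w _; rewrite indicE; congr (_%:R%:E).
 by congr nat_of_bool; apply/idP/idP => [/set_mem/Ag|/Ag h]//; exact/mem_set.
rewrite (I _ _ P _ (fun w => f w <= x)%R)// E -(I _ _ Q `]-oo, x]%classic (fun y => y <= x)%R)//.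
Qed.

Lemma meas_scale t : measT (fun z : RM => t * z : RM).
Proof. exact: measM. Qed.

(** The centered normal law of standard deviation |t| as an image measure, so that the degenerate
    case t = 0 needs no separate treatment in limits. *)
Definition gau t : prob RM R := law gauss (meas_scale t).

Lemma mp_gau t : mp gauss (gau t) (fun z : RM => t * z : RM).
Proof. exact: mp_law. Qed.

Lemma gau_gaussian t : 0 <= t -> gaussian_law (gau t : set RM -> \bar R).
Proof.
rewrite le_eqVlt => /predU1P[<-|t0]; [left|right].
 exists 0 => A mA; have [_ <-//] := mp_gau 0; rewrite diracE.
 rewrite (_ : _ @^-1` A = if 0 \in A then setT else set0).
  by case: ifP => _; [exact: probability_setT|exact: measure0].
 apply/seteqP; split => z /=; rewrite mul0r.
  by move=> h; rewrite mem_set.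
 by case: ifPn => // /set_mem.
exists 0, t; split; first exact: t0.
move=> A mA; have [_ H1] := mp_gau t; have [_ H2] := mp_gauss_scale t0.
transitivity (@gauss R ((fun z : RM => (t * z : RM)) @^-1` A)).
 exact/esym/(H1 A mA).
exact: (H2 A mA).
Qed.

Lemma mp_lincomb_gau n (c : nat -> R) : mp (pow gauss) (gau (sqrt (\sum_(i < n) c i ^+ 2))) (lincomb
 n c).
Proof.
have S0 : 0 <= \sum_(i < n) c i ^+ 2 by rewrite sumr_ge0// => i _; exact: sqr_ge0.
set t := sqrt _; have tt : t ^+ 2 = \sum_(i < n) c i ^+ 2 by rewrite sqr_sqrtr.
have [t0|t0] := eqVneq t 0.
 rewrite t0; apply: (mp_eqfun _ (mp_comp (mp_coord gauss 0) (mp_gau 0))) => z /=.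
 rewrite mul0r /lincomb big1// => i _.
 have /eqP : \sum_(i < n) c i ^+ 2 = 0 by rewrite -tt t0 expr0n.
 rewrite psumr_eq0; last by move=> j _; exact: sqr_ge0.
 by move=> /allP/(_ i (mem_index_enum _)); rewrite sqrf_eq0 => /eqP ->; rewrite mul0r.
have H : \sum_(i < n) (c i / t) ^+ 2 = 1.
 under eq_bigr => i _ do rewrite exprMn.
 by rewrite -mulr_suml -tt exprVn divff// expf_neq0.
apply: (mp_eqfun _ (mp_comp (mp_lincomb (c := fun i => c i / t) H) (mp_gau t))) => z /=.
rewrite /lincomb mulr_sumr; apply: eq_bigr => i _.
by rewrite mulrA (mulrCA t) divff// mulr1.
Qed.

(** For each continuous test function [ramp] dominated convergence applies both to the variables X_k
    and to t_k Z, and the two limits coincide. *)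
Lemma mp_gau_lim d (T : mtype d) (P : prob T R) (X_ : nat -> T -> R) (X : T -> R) (t_ : nat -> R) t
 : (forall n, mp P (gau (t_ n)) (X_ n : T -> RM)) -> (forall w, X_ ^~ w @ \oo --> X w) -> t_ @ \oo
 --> t -> mp P (gau t) (X : T -> RM).
Proof.
move=> hX XX tt.
have mX : measT (X : T -> RM).
 by apply: (@measurable_fun_cvg _ _ _ setT X_) => [n|w _]; [exact: (hX n).1|exact: XX].
apply: mp_of_ramps => // n x.
have mr : measT (fun y : RM => (ramp n x y)%:E).
 by apply: mcomp => //; exact: meas_ramp.
have r0 y : (0 <= (ramp n x y)%:E)%E by rewrite lee_fin; case/andP: (ramp01 n x y).
rewrite (mp_ge0_integral (mp_gau t))//.
have D1 : (\int[P]_w (ramp n x (X_ k w))%:E @[k --> \oo] --> \int[P]_w (ramp n x (X w))%:E)%E.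
 apply: dominated_cvg1 => [k|w|k w]; [|by apply: continuous_cvg => //; exact: ramp_continuous|exact: ramp01].
 exact: (mcomp (meas_ramp n x) (hX k).1).
have D2 : (\int[gauss]_z (ramp n x (t_ k * z))%:E @[k --> \oo] --> \int[gauss]_z (ramp n x (t * z))%:E)%E.
 apply: dominated_cvg1 => [k|z|k z]; [|apply: continuous_cvg; [exact: ramp_continuous|]|exact: ramp01].
  exact: (mcomp (meas_ramp n x) (meas_scale _)).
 by apply: cvgM => //; exact: cvg_cst.
have E k : (\int[P]_w (ramp n x (X_ k w))%:E = \int[gauss]_z (ramp n x (t_ k * z))%:E)%E.
 by rewrite -(mp_ge0_integral (mp_gau (t_ k)) mr r0) (mp_ge0_integral (hX k) mr r0).
have D3 : (\int[P]_w (ramp n x (X_ k w))%:E @[k --> \oo] --> \int[gauss]_z (ramp n x (t * z))%:E)%E.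
 by rewrite (_ : (fun k : nat => _) = (fun k => \int[gauss]_z (ramp n x (t_ k * z))%:E)%E)//; apply/funext.
exact: (cvg_unique (@ereal_hausdorff R) D1 D3).
Qed.

(** With phi the normal density, x^2 phi(x) is the derivative of Phi(x) - x phi(x), which tends to 1
    at infinity. *)
Lemma half_gauss_sqr : (\int[@lebesgue_measure R]_(x in `[0%R, +oo[) (x ^+ 2 * normal_pdf 0 1 x)%:E
 = 1 - (Phi 0)%:E :> \bar R)%E.
Proof.
have pdfE : normal_pdf 0 1 = (fun x => normal_peak 1 * expR (- (x ^+ 2 / 2))) :> (R -> R).
 by apply/funext => y; exact: normal_pdf01.
have dp x : is_derive x 1 (normal_pdf 0 1 : R -> R) (- x * normal_pdf 0 1 x).
 rewrite pdfE; apply: drv_eq (drvZ _ (drv_exp (drvN (drvM (drvX 2 (drv_id x)) (drv_cst 2^-1 x))))) _.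
 by rewrite /= expr1; field.
have dG x : is_derive x 1 (fun x : R => Phi x - x * normal_pdf 0 1 x) (x ^+ 2 * normal_pdf 0 1 x).
 apply: drv_eq (drvB (Phi_derive x) (drvM (drv_id x) (dp x))) _.
 by ring.
have cG : continuous (fun x : R => Phi x - x * normal_pdf 0 1 x).
 by move=> x; exact: (drv_continuous (dG x)).
have cf : continuous (fun x : R => x ^+ 2 * normal_pdf 0 1 x).
 move=> x; exact: (drv_continuous (drvM (drvX 2 (drv_id x)) (dp x))).
rewrite (@ge0_continuous_FTC2y R (fun x => x ^+ 2 * normal_pdf 0 1 x) (fun x => Phi x - x *
 normal_pdf 0 1 x) 0 1).
- by rewrite mul0r subr0.
- by move=> x _; rewrite mulr_ge0 ?sqr_ge0// normal_pdf_ge0.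
- by apply: continuous_subspaceT.
- rewrite -[X in _ --> X]subr0; apply: cvgB; first exact: cdfR_y.
 have pk : 0 < normal_peak 1 :> R by rewrite normal_peak_gt0.
 apply: (@squeeze_cvgr _ _ _ _ (fun=> 0) (fun x => 2 * normal_peak 1 * x^-1)).
 + near=> x; have x0 : 0 < x by near: x; exact: nbhs_pinfty_gt.
  rewrite mulr_ge0 ?normal_pdf_ge0 ?(ltW x0)//= normal_pdf01 mulrCA.
  rewrite (_ : 2 * normal_peak 1 / x = normal_peak 1 * (2 / x)); last by ring.
  rewrite ler_pM2l// expRN ler_pdivrMr ?expR_gt0//.
  have := expR_ge1Dx (x ^+ 2 / 2) => h.
  have : 2 / x * (x ^+ 2 / 2) <= 2 / x * expR (x ^+ 2 / 2).
   by rewrite ler_wpM2l ?divr_ge0 ?(ltW x0)//; lra.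
  by apply: le_trans; apply: le_of_eq; field; rewrite gt_eqF.
 + exact: cvg_cst.
 + rewrite -[X in _ --> X](mulr0 (2 * normal_peak 1)); apply: cvgM; first exact: cvg_cst.
  apply/gtr0_cvgV0; last exact: cvg_id.
  by near=> x; near: x; exact: nbhs_pinfty_gt.
- by move=> x _; case: (dG x).
- by apply: cvg_at_right_filter; exact: cG.
- by move=> x _; rewrite derive1E; case: (dG x).
Unshelve. all: by end_near. Qed.

Lemma integral_gauss_sqr : (\int[@gauss R]_z (z ^+ 2)%:E = 1)%E.
Proof.
have m1 : measT (fun z : RM => (z ^+ 2)%:E).
 by apply: mcomp => //; exact: measX.
have m0 : measurable (`[0, +oo[%classic : set RM) by exact: measurable_itv.
pose h (z : RM) : \bar R := ((\1_(`[0, +oo[%classic) z : R)%:E * (z ^+ 2)%:E)%E.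
have mh : measT h.
 by apply: emeasM => //; exact: (meas_ind m0).
have h0 z : (0 <= h z)%E by rewrite mule_ge0 ?lee_fin ?sqr_ge0.
have hE : (\int[gauss]_z h z = 1 - (Phi 0)%:E)%E.
 rewrite -half_gauss_sqr [RHS]integral_mkcond (pdf_integral (normal_has_pdf 1))//.
 apply: eq_integral => z _; rewrite patchE /h indicE; case: ifPn => _.
  by rewrite mul1e -EFinM.
 by rewrite !mul0e.
have P0 : Phi 0 = 2^-1 :> R.
 have mN : measurable (`]-oo, 0[%classic : set RM) by exact: measurable_itv.
 have E1 : @gauss R `]-oo, 0]%classic = @gauss R `[0, +oo[%classic.
  have [_ <-//] := @mp_gauss_opp R; congr (gauss _).
  by apply/seteqP; split => z /=; rewrite !in_itv/= andbT oppr_le0 ?oppr_ge0.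
 have E2 : @gauss R `[0, +oo[%classic = (1 - @gauss R `]-oo, 0%R[%classic)%E.
  rewrite -probability_setC//; congr (gauss _).
  by apply/seteqP; split => z /=; rewrite !in_itv/= andbT leNgt => /negP.
 have E3 : @gauss R `]-oo, 0]%classic = @gauss R `]-oo, 0[%classic.
  have [_ _ gE] := normal_has_pdf (R := R) 1.
  rewrite !gE// [RHS]integral_itv_bndo_bndc//.
  apply: measurable_funTS; apply: mcomp => //; exact: measurable_normal_pdf.
 have := E1; rewrite E2 -E3 -cdfRE -/(Phi 0) -EFinB => -[]; lra.
transitivity (\int[gauss]_z (h z + h (- z)%R))%E.
 apply: eq_integral => z _; rewrite /h !indicE !mem_setE !in_itv/= !andbT oppr_ge0 sqrrN.
 by case: (ltgtP 0 z) => [z0|z0|<-]; rewrite ?mul0e ?mul1e ?add0e ?adde0// expr0n/= adde0.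
rewrite ge0_integralD//; last exact: (mcomp mh (mp_gauss_opp).1).
rewrite -(mp_ge0_integral mp_gauss_opp)// hE P0 -!EFinB -EFinD; congr EFin; lra.
Qed.

Lemma gau_mean d (T : mtype d) (P : prob T R) t (X : T -> R) : mp P (gau t) (X : T -> RM) ->
 (\int[P]_w (X w)%:E = 0)%E.
Proof.
move=> hX; have m1 : measT (fun z : RM => z%:E) by exact: mcomp.
rewrite -(mp_integral hX m1) (mp_integral (mp_gau t) m1).
under eq_integral => z _ do rewrite EFinM.
rewrite integralZl// ?integral_gauss ?mule0//.
apply: (@integrable_of_sqr _ _ RM (@gauss R) id 1) => //.
by rewrite integral_gauss_sqr.
Qed.

Lemma gau_var d (T : mtype d) (P : prob T R) t (X : T -> R) : mp P (gau t) (X : T -> RM) ->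
 (\int[P]_w (X w ^+ 2)%:E = (t ^+ 2)%:E)%E.
Proof.
move=> hX; have m1 : measT (fun z : RM => (z ^+ 2)%:E).
 by apply: mcomp => //; exact: measX.
rewrite -(mp_integral hX m1) (mp_integral (mp_gau t) m1).
under eq_integral => z _ do rewrite exprMn EFinM.
rewrite ge0_integralZl// ?integral_gauss_sqr ?mule1//.
 by move=> z _; rewrite lee_fin sqr_ge0.
by rewrite lee_fin sqr_ge0.
Qed.

Lemma cvg_bigsum (I : Type) (r : seq I) (F : I -> nat -> R) (l : I -> R) : (forall i, F i n @[n -->
 \oo] --> l i) -> \sum_(i <- r) F i n @[n --> \oo] --> \sum_(i <- r) l i.
Proof.
move=> h; elim: r => [|i r IH].
 rewrite big_nil (_ : (fun n => _) = fun=> 0); first exact: cvg_cst.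
 by apply/funext => n; rewrite big_nil.
rewrite big_cons (_ : (fun n => _) = fun n => F i n + \sum_(j <- r) F j n).
 exact: cvgD.
by apply/funext => n; rewrite big_cons.
Qed.

End gaussian_limits.

(** * A bridge whose integral is a prescribed normal variable *)

Section bridge_process.
Context {R : realType}.
Notation RS := (@rseq R).
Notation RM := (measurableTypeR R).
Variables (L : nat) (H : R -> R).
Hypotheses (cH : continuous H) (H01 : forall v, 0 <= H v <= 1).
Implicit Types (u v s t a : R) (z : nat -> R) (J n : nat).

Lemma ok01_cont (f : R -> R) : continuous f -> ok01 f.
Proof.
move=> cf; apply: ok01_continuous => //.
have [c _ hc] := @EVT_max R (fun s => `|f s|) 0 1 ler01 (continuous_subspaceT (fun s => cvg_norm (cf
 s))).
by exists `|f c| => s s01; apply: hc; rewrite in_itv.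
Qed.

Lemma ok01_comp (f : R -> R) : continuous f -> ok01 (f \o H).
Proof. by move=> cf; apply: ok01_cont => s; apply: continuous_comp; [exact: cH|exact: cf]. Qed.

Definition Iv i : R := int01 (fun s => psi L i (H s)).

Definition IB z : R := int01 (fun s => Bser L (H s) z).

(** The covariance of B(u) with the integral of B(H(s)) over s, for a Brownian bridge B; [ssq] is
    the variance of that integral. *)
Definition Jf u : R := int01 (fun s => Num.min u (H s) - u * H s).

Definition ssq : R := int01 (fun s => Jf (H s)).

Lemma ok_psi i : ok01 (fun s => psi L i (H s)).
Proof. by apply: (ok01_comp (f := psi L i)); exact: psi_continuous. Qed.

Lemma ok_Sg J z : ok01 (fun s => Sg L J (H s) z).
Proof. by apply: (ok01_comp (f := fun u => Sg L J u z)); exact: Sg_continuous. Qed.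

Lemma ok_Bser z : ok01 (fun s => Bser L (H s) z).
Proof. by apply: (ok01_comp (f := fun u => Bser L u z)); exact: Bser_continuous. Qed.

Lemma int_Sg J z : int01 (fun s => Sg L J (H s) z) = \sum_(i < 2 ^ J) Iv i * z i.
Proof.
rewrite /Sg (int01_sum (F := fun i s => psi L i (H s) * z i)); last first.
 by move=> i _; apply: ok01M; [exact: ok_psi|exact: ok01_cst].
apply: eq_bigr => i _; rewrite mulrC -int01Z; last exact: ok_psi.
by apply: eq_int01 => s _; rewrite mulrC.
Qed.

Lemma IB_close a z J : 0 <= a -> tame a z -> (L <= J)%N -> `|IB z - \sum_(i < 2 ^ J) Iv i * z i| <=
 6 * Dlev a J.
Proof.
move=> a0 tz LJ; rewrite -int_Sg; apply: int01_dist_le; [exact: ok_Bser|exact: ok_Sg|].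
by move=> s _; exact: Bser_close.
Qed.

Lemma zhat_idem z : zhat (zhat z) = zhat z.
Proof. by rewrite zhat_id//; exact: zhat_good. Qed.

Lemma IB_cvg z : \sum_(i < 2 ^ J) Iv i * zhat z i @[J --> \oo] --> IB z.
Proof.
have [a a0 tz] := zhat_good z.
have E : IB z = IB (zhat z).
 by apply: eq_int01 => s _; rewrite /Bser zhat_idem.
rewrite E; apply/cvgrPdist_le => e e0.
have D0 : 6 * Dlev a J @[J --> \oo] --> (0 : R).
 by rewrite -[X in _ --> X](mulr0 6); apply: cvgM; [exact: cvg_cst|exact: Dlev_cvg0].
have /cvgrPdist_le/(_ _ e0)[N _ HN] := D0.
exists (maxn N L) => // J /=; rewrite geq_max => /andP[NJ LJ].
apply: (le_trans (IB_close a0 tz LJ)); have := HN J NJ.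
by rewrite sub0r normrN; apply: le_trans; exact: ler_norm.
Qed.

Lemma meas_IB : measT (IB : RS -> RM).
Proof.
apply: (@measurable_fun_cvg _ _ _ setT (fun J (z : RS) => \sum_(i < 2 ^ J) Iv i * zhat z i)).
 move=> J; apply: measurable_sum => i; apply: measM => //.
 exact: (mcomp (meas_coord i) meas_zhat).
by move=> z _; exact: IB_cvg.
Qed.

Lemma ok_cov u : ok01 (fun s => Num.min u (H s) - u * H s).
Proof.
have cm : continuous (fun v : R => Num.min u v).
 apply: (@lip_continuous _ _ 1) => x y; rewrite mul1r.
 rewrite !minElt; case: ltP => h1; case: ltP => h2; rewrite ?subrr ?normr0//; by have := ler_norm
  (x - y); have := ler_norm (y - x); rewrite (distrC y x) ler_norml; lra.
apply: ok01B; first exact: (ok01_comp cm).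
by apply: ok01Z; apply: (ok01_comp (f := id)) => x; exact: cvg_id.
Qed.

Lemma cov_norm u u' s : `|(Num.min u (H s) - u * H s) - (Num.min u' (H s) - u' * H s)| <= 2 * `|u - u'|.
Proof.
have /andP[h0 h1] := H01 s; set h := H s in h0 h1 *.
have A : `|Num.min u h - Num.min u' h| <= `|u - u'|.
 rewrite !minElt; case: ltP => h3; case: ltP => h4; rewrite ?subrr ?normr0//; by have := ler_norm
  (u - u'); have := ler_norm (u' - u); rewrite (distrC u' u) ler_norml; lra.
rewrite (_ : _ - _ - (_ - _) = (Num.min u h - Num.min u' h) + (u' - u) * h); last by ring.
apply: (le_trans (ler_normD _ _)); rewrite normrM (ger0_norm h0) (distrC u').
have : `|u - u'| * h <= `|u - u'| by rewrite ler_piMr.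
lra.
Qed.

Lemma Jf_lip u u' : `|Jf u - Jf u'| <= 2 * `|u - u'|.
Proof.
by apply: int01_dist_le => [||s _]; [exact: ok_cov|exact: ok_cov|exact: cov_norm].
Qed.

Lemma Jf_continuous : continuous Jf.
Proof. exact: lip_continuous Jf_lip. Qed.

Lemma sum_psi_Iv J u : \sum_(i < 2 ^ J) psi L i u * Iv i = int01 (fun s => \sum_(i < 2 ^ J) psi L i
 u * psi L i (H s)).
Proof.
rewrite (int01_sum (F := fun i s => psi L i u * psi L i (H s))); last first.
 by move=> i _; apply: ok01Z; exact: ok_psi.
by apply: eq_bigr => i _; rewrite int01Z//; exact: ok_psi.
Qed.

Lemma Jf_close J u : (L <= J)%N -> 0 <= u <= 1 -> `|Jf u - \sum_(i < 2 ^ J) psi L i u * Iv i| <=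
 (pow2 J)^-1.
Proof.
move=> LJ u01; rewrite sum_psi_Iv; apply: int01_dist_le; first exact: ok_cov.
 by apply: (ok01_sum (F := fun i s => psi L i u * psi L i (H s))) => i _; apply: ok01Z; exact: ok_psi.
move=> s _; rewrite (sum_psi_psi LJ u01 (H01 s)).
rewrite (_ : _ - _ - _ = Num.min u (H s) - Qcov J u (H s)); last by ring.
by rewrite ger0_norm; have /andP[] := Qcov_min J u01 (H01 s).
Qed.

Lemma ssq_close J : (L <= J)%N -> `|ssq - \sum_(i < 2 ^ J) Iv i ^+ 2| <= (pow2 J)^-1.
Proof.
move=> LJ.
have -> : \sum_(i < 2 ^ J) Iv i ^+ 2 = int01 (fun s => \sum_(i < 2 ^ J) psi L i (H s) * Iv i).
 rewrite (int01_sum (F := fun i s => psi L i (H s) * Iv i)); last first.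
  by move=> i _; apply: ok01M; [exact: ok_psi|exact: ok01_cst].
 apply: eq_bigr => i _; rewrite expr2 -{1}/(Iv i) -int01Z; last exact: ok_psi.
 by apply: eq_int01 => s _; rewrite mulrC.
apply: int01_dist_le.
- exact: (ok01_comp Jf_continuous).
- apply: (ok01_sum (F := fun i s => psi L i (H s) * Iv i)) => i _.
 by apply: ok01M; [exact: ok_psi|exact: ok01_cst].
- by move=> s _; exact: Jf_close.
Qed.

Lemma pow2V_cvg0 : (pow2 J)^-1 @[J --> \oo] --> (0 : R).
Proof.
rewrite (_ : (fun J => _) = fun J => (2^-1) ^+ J :> R).
 by apply: cvg_expr; rewrite ger0_norm; lra.
by apply/funext => J; rewrite /pow2 natrX exprVn.
Qed.

Lemma close_cvg (x : R) (f : nat -> R) : (forall J, (L <= J)%N -> `|x - f J| <= (pow2 J)^-1) -> f @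
 \oo --> x.
Proof.
move=> h; apply/cvgrPdist_le => e e0.
have /cvgrPdist_le/(_ _ e0)[N _ HN] := pow2V_cvg0.
exists (maxn N L) => // J /=; rewrite geq_max => /andP[NJ LJ].
apply: (le_trans (h J LJ)); have := HN J NJ.
by rewrite sub0r normrN; apply: le_trans; exact: ler_norm.
Qed.

Hypothesis ssq0 : 0 < ssq.

(** The coefficient of the regression of B(u) on the integral of B(H(s)). *)
Definition rho u : R := Jf u / ssq.

Definition sig : R := sqrt ssq.

Lemma sigK : sig ^+ 2 = ssq. Proof. by rewrite sqr_sqrtr// ltW. Qed.

(** The integral [IB] contained in the series bridge is exchanged with minus [sig] times an
    independent standard normal variable, which has the same variance; the law is unchanged, and the
    integral of the new bridge is explicit ([int_bridge]). *)
Definition bridge u (p : RS * RM) : R := Bser L u p.1 - rho u * (sig * p.2 + IB p.1).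

Definition bridge_coef u J i : R := if i is i'.+1 then psi L i' u - rho u * Iv i' else - (sig * rho
 u).

(** Besides the covariance of the series there are, in the limit, Jf(u) Jf(v) / ssq once from the
    fresh normal, minus twice from the cross terms and once from the integral removed. These
    cancel. *)
Lemma bridge_coef_cov u v : 0 <= u <= 1 -> 0 <= v <= 1 -> \sum_(i < (2 ^ J).+1) bridge_coef u J i *
 bridge_coef v J i @[J --> \oo] --> (Num.min u v - u * v : R).
Proof.
move=> u01 v01.
have E J : (L <= J)%N -> \sum_(i < (2 ^ J).+1) bridge_coef u J i * bridge_coef v J i = ssq * (rho u
 * rho v) + (Qcov J u v - u * v) - rho v * (\sum_(i < 2 ^ J) psi L i u * Iv i) - rho u * (\sum_(i <
 2 ^ J) psi L i v * Iv i) + rho u * rho v * (\sum_(i < 2 ^ J) Iv i ^+ 2).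
 move=> LJ; rewrite big_ord_recl /= -(sum_psi_psi LJ u01 v01) !mulr_sumr -!addrA; congr (_ + _).
  by rewrite -sigK; ring.
 rewrite -!sumrN -!big_split/=; apply: eq_bigr => i _; ring.
have C1 := close_cvg (fun J LJ => Jf_close LJ u01).
have C2 := close_cvg (fun J LJ => Jf_close LJ v01).
have C3 := close_cvg ssq_close.
have C4 : Qcov J u v @[J --> \oo] --> Num.min u v.
 apply: close_cvg => J _; have /andP[q0 q1] := Qcov_min J u01 v01.
 by rewrite ger0_norm.
have -> : Num.min u v - u * v = ssq * (rho u * rho v) + (Num.min u v - u * v) - rho v * Jf u - rho u
 * Jf v + rho u * rho v * ssq.
 by rewrite /rho; field; rewrite gt_eqF.
have D : (ssq * (rho u * rho v) + (Qcov J u v - u * v) - rho v * (\sum_(i < 2 ^ J) psi L i u * Iv i)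
 - rho u * (\sum_(i < 2 ^ J) psi L i v * Iv i) + rho u * rho v * (\sum_(i < 2 ^ J) Iv i ^+ 2)) @[J
 --> \oo] --> (ssq * (rho u * rho v) + (Num.min u v - u * v) - rho v * Jf u - rho u * Jf v + rho u
 * rho v * ssq).
 apply: cvgD; [apply: cvgB; [apply: cvgB; [apply: cvgD; [exact: cvg_cst|]|]|]|].
 - by apply: cvgB; [exact: C4|exact: cvg_cst].
 - by apply: cvgM; [exact: cvg_cst|exact: C1].
 - by apply: cvgM; [exact: cvg_cst|exact: C2].
 - by apply: cvgM; [exact: cvg_cst|exact: C3].
apply: cvg_trans D; apply: near_eq_cvg; near=> J; rewrite E//.
by near: J; exact: nbhs_infty_ge.
Unshelve. all: by end_near. Qed.

Definition bridge_seq (p : RS * RM) : RS := scons p.2 (zhat p.1).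

Lemma mp_bridge_seq : mp (prodP (pow gauss) gauss) (pow gauss) bridge_seq.
Proof.
have S1 := mp_comp (mp_swap (pow gauss) (@gauss R)) (mp_prod (mp_id gauss) (@mp_zhat R)).
by apply: (mp_eqfun _ (mp_comp S1 (mp_cons (powP gauss)))) => -[z x].
Qed.

Lemma bridge_cvg u p : \sum_(i < (2 ^ J).+1) bridge_coef u J i * bridge_seq p i @[J --> \oo] -->
 bridge u p.
Proof.
have E J : \sum_(i < (2 ^ J).+1) bridge_coef u J i * bridge_seq p i = Sg L J u (zhat p.1) - rho u *
 (sig * p.2 + \sum_(i < 2 ^ J) Iv i * zhat p.1 i).
 rewrite big_ord_recl /= /Sg.
 have -> : \sum_(i < 2 ^ J) (psi L i u - rho u * Iv i) * zhat p.1 i = \sum_(i < 2 ^ J) psi L i u *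
  zhat p.1 i - rho u * \sum_(i < 2 ^ J) Iv i * zhat p.1 i.
  rewrite mulr_sumr -sumrB; apply: eq_bigr => i _; ring.
 by ring.
rewrite (_ : (fun J => _) = fun J => Sg L J u (zhat p.1) - rho u * (sig * p.2 + \sum_(i < 2 ^ J) Iv
 i * zhat p.1 i)); last by apply/funext.
apply: cvgB; first exact: Sg_cvg.
apply: cvgM; first exact: cvg_cst.
by apply: cvgD; [exact: cvg_cst|exact: IB_cvg].
Qed.

(** Each partial sum is a linear form in one i.i.d. normal sequence, hence normal with explicit
    variance; values and variances converge, and [mp_gau_lim] gives the law of the limit. *)
Lemma mp_bridge_comb n (t a : 'I_n -> R) : (forall k, 0 <= t k <= 1) -> let q := \sum_k \sum_l a k *
 a l * (Num.min (t k) (t l) - t k * t l) in 0 <= q /\ mp (prodP (pow gauss) gauss) (gau (sqrt q))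
 (fun p => \sum_k a k * bridge (t k) p : RM).
Proof.
move=> t01 q.
pose c J i := \sum_k a k * bridge_coef (t k) J i.
have cq : \sum_(i < (2 ^ J).+1) c J i ^+ 2 @[J --> \oo] --> q.
 rewrite (_ : (fun J => _) = fun J => \sum_k \sum_l a k * a l * \sum_(i < (2 ^ J).+1) bridge_coef
  (t k) J i * bridge_coef (t l) J i).
  apply: cvg_bigsum => k; apply: cvg_bigsum => l; apply: cvgM; first exact: cvg_cst.
  exact: bridge_coef_cov.
 apply/funext => J; under [RHS]eq_bigr => k _ do under eq_bigr => l _ do rewrite mulr_sumr.
 under [RHS]eq_bigr => k _ do rewrite exchange_big.
 rewrite exchange_big/=; apply: eq_bigr => i _.
 rewrite expr2 /c mulr_suml; apply: eq_bigr => k _; rewrite mulr_sumr.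
 by apply: eq_bigr => l _; ring.
have q0 : 0 <= q.
 apply: (cvgr_to_ge cq); apply: nearW => J.
 by apply: sumr_ge0 => i _; exact: sqr_ge0.
split => //.
apply: (@mp_gau_lim _ _ _ _ (fun J p => lincomb (2 ^ J).+1 (c J) (bridge_seq p)) _ (fun J => sqrt
 (\sum_(i < (2 ^ J).+1) c J i ^+ 2))).
- move=> J; exact: mp_comp mp_bridge_seq (mp_lincomb_gau _ _).
- move=> p; rewrite (_ : (fun J => _) = fun J => \sum_k a k * \sum_(i < (2 ^ J).+1) bridge_coef (t
 k) J i * bridge_seq p i).
  apply: cvg_bigsum => k; apply: cvgM; first exact: cvg_cst.
  exact: bridge_cvg.
 apply/funext => J; rewrite /lincomb /c.
 under eq_bigr => i _ do rewrite mulr_suml.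
 rewrite exchange_big/=; apply: eq_bigr => k _; rewrite mulr_sumr.
 by apply: eq_bigr => i _; rewrite mulrA.
- by apply: continuous_cvg => //; exact: sqrt_continuous.
Qed.

Lemma meas_bridge u : measT (bridge u : RS * RM -> RM).
Proof.
apply: measB; first exact: (mcomp (meas_Bser L u) measurable_fst).
apply: measM => //; apply: measD; first exact: measM.
exact: (mcomp meas_IB measurable_fst).
Qed.

Lemma bridge_continuous p : continuous (fun u => bridge u p).
Proof.
move=> u; apply: cvgB; first exact: Bser_continuous.
apply: cvgM; last exact: cvg_cst.
by apply: cvgM; [exact: Jf_continuous|exact: cvg_cst].
Qed.

Lemma int_rho : int01 (fun s => rho (H s)) = 1.
Proof.
rewrite /rho; under eq_fun do rewrite mulrC.
by rewrite int01Z ?mulVf ?gt_eqF//; exact: (ok01_comp Jf_continuous).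
Qed.

(** [rho] along H has integral 1 ([int_rho]), so the two occurrences of [IB] cancel. *)
Lemma int_bridge p : int01 (fun s => bridge (H s) p) = - (sig * p.2).
Proof.
rewrite /bridge int01B; last 2 first.
- exact: ok_Bser.
- apply: ok01M; last exact: ok01_cst.
 by apply: ok01M; [exact: (ok01_comp Jf_continuous)|exact: ok01_cst].
have -> : int01 (fun s => rho (H s) * (sig * p.2 + IB p.1)) = sig * p.2 + IB p.1.
 under eq_fun do rewrite mulrC.
 rewrite int01Z ?int_rho ?mulr1//.
 by apply: ok01M; [exact: (ok01_comp Jf_continuous)|exact: ok01_cst].
by rewrite -/(IB p.1); ring.
Qed.

End bridge_process.

(** * Functions with quadratically small increments *)

Section flat.
Context {R : realType}.
Implicit Types (x y v : R) (a n : nat).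

(* Splitting [x, y] into n equal parts bounds the increment by C / n. *)
Lemma flat_constant (D : R -> R) (C : R) : (forall x y, 0 <= x -> x <= y -> y <= 1 -> `|D y - D x|
 <= C * (y - x) ^+ 2) -> forall v, 0 <= v <= 1 -> D v = D 0.
Proof.
move=> hD v /andP[v0 v1].
have C0 : 0 <= C.
 by have := le_trans (normr_ge0 _) (hD 0 1 (lexx _) ler01 (lexx _)); rewrite subr0 expr1n mulr1.
have step n k : (k <= n.+1)%N -> `|D (k%:R / n.+1%:R * v) - D 0| <= k%:R * (C / n.+1%:R ^+ 2).
 elim: k => [|k IH] kn; first by rewrite !mul0r subrr normr0.
 have N0 : (0 : R) < n.+1%:R by rewrite ltr0n.
 have -> : D (k.+1%:R / n.+1%:R * v) - D 0 = (D (k.+1%:R / n.+1%:R * v) - D (k%:R / n.+1%:R * v)) +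
  (D (k%:R / n.+1%:R * v) - D 0) by ring.
 apply: (le_trans (ler_normD _ _)); rewrite -[in leRHS]nat1r mulrDl mul1r.
 apply: lerD; last by apply: IH; exact: ltnW.
 have kv : k.+1%:R / n.+1%:R * v - k%:R / n.+1%:R * v = v / n.+1%:R.
  by rewrite -[k.+1%:R]nat1r; field; rewrite nat1r pnatr_eq0.
 apply: (le_trans (hD _ _ _ _ _)).
 - by rewrite !mulr_ge0// invr_ge0.
 - by rewrite -subr_ge0 kv divr_ge0.
 - apply: mulr_ile1 => //; rewrite ?divr_ge0// ler_pdivrMr// mul1r ler_nat//.
 rewrite kv ler_wpM2l// expr_div_n -[leRHS]mul1r ler_wpM2r ?invr_ge0 ?exprn_ge0//.
 by rewrite exprn_ile1.
have main n : `|D v - D 0| <= C / n.+1%:R.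
 have := step n n.+1 (leqnn _); rewrite divff ?pnatr_eq0// mul1r => /le_trans; apply.
 by apply: le_of_eq; field; rewrite nat1r pnatr_eq0.
apply/eqP; rewrite -subr_eq0 -normr_le0; apply/ler_addgt0Pl => e e0; rewrite addr0.
have := archi_boundP (divr_ge0 C0 (ltW e0)); set n := Num.bound _ => hn.
apply: (le_trans (main n)); rewrite ler_pdivrMr ?ltr0n//.
rewrite mulrC -ler_pdivrMr//; apply: (le_trans (ltW hn)); rewrite ler_nat; exact: leqnSn.
Qed.

Lemma pow_lip n x y : 0 <= x <= 1 -> 0 <= y <= 1 -> `|y ^+ n - x ^+ n| <= n%:R * `|y - x|.
Proof.
move=> /andP[x0 x1] /andP[y0 y1]; elim: n => [|n IH]; first by rewrite subrr normr0 mul0r.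
rewrite (_ : _ - _ = y * (y ^+ n - x ^+ n) + x ^+ n * (y - x)); last by rewrite !exprS; ring.
apply: (le_trans (ler_normD _ _)); rewrite !normrM -[n.+1%:R]natr1 mulrDl mul1r.
apply: lerD.
 by apply: le_trans IH; rewrite ger0_norm// ler_piMl.
by rewrite ger0_norm ?exprn_ge0// ler_piMl// exprn_ile1.
Qed.

Lemma pow_taylor n x y : 0 <= x <= 1 -> 0 <= y <= 1 -> `|y ^+ n - x ^+ n - n%:R * x ^+ n.-1 * (y -
 x)| <= (n ^ 2)%:R * (y - x) ^+ 2.
Proof.
move=> /andP[x0 x1] /andP[y0 y1]; elim: n => [|n IH].
 by rewrite !mul0r !subrr normr0.
have -> : y ^+ n.+1 - x ^+ n.+1 - n.+1%:R * x ^+ n.+1.-1 * (y - x) = y * (y ^+ n - x ^+ n - n%:R * x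
 ^+ n.-1 * (y - x)) + n%:R * x ^+ n.-1 * (y - x) ^+ 2.
 by case: n {IH} => [|n]/=; rewrite ?expr0 ?expr1 -?[n.+2%:R]natr1 !exprS; ring.
apply: (le_trans (ler_normD _ _)).
rewrite normrM (ger0_norm y0).
rewrite [X in _ + X]ger0_norm; last by rewrite mulr_ge0 ?sqr_ge0// mulr_ge0 ?exprn_ge0.
apply: (@le_trans _ _ ((n ^ 2)%:R * (y - x) ^+ 2 + n%:R * (y - x) ^+ 2)).
 apply: lerD.
  by apply: le_trans IH; rewrite ler_piMl.
 by rewrite ler_wpM2r ?sqr_ge0// ler_piMr// exprn_ile1.
rewrite -mulrDl ler_wpM2r ?sqr_ge0// -natrD ler_nat; lia.
Qed.

End flat.

(** * The Beta(m, m) distribution function and the variance of the bridge integral *)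

Section beta_cdf.
Context {R : realType}.
Notation RM := (measurableTypeR R).
Notation leb := (@lebesgue_measure R).
Variable a : nat.
Implicit Types (x y v t : R).

Definition bK : R := (a + a).+1`!%:R / (a`!%:R * a`!%:R).

Lemma bK_gt0 : 0 < bK.
Proof. by rewrite divr_gt0 ?mulr_gt0 ?ltr0n ?fact_gt0. Qed.

(** The polynomial formula of the density, which is Lipschitz on the closed interval; [bpdf], cut
    off at 0 and 1, is not when the exponent is 0. *)
Definition bden t : R := bK * (t * (1 - t)) ^+ a.

Definition Hc : R -> R := cdfR (betP a a).

Lemma par01 t : 0 <= t <= 1 -> 0 <= t * (1 - t) <= 1.
Proof. by move=> /andP[t0 t1]; rewrite mulr_ge0 ?subr_ge0//= mulr_ile1 ?subr_ge0 ?gerBl. Qed.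

Lemma par_lip x y : 0 <= x <= 1 -> 0 <= y <= 1 -> `|y * (1 - y) - x * (1 - x)| <= `|y - x|.
Proof.
move=> /andP[x0 x1] /andP[y0 y1].
rewrite (_ : _ - _ = (y - x) * (1 - x - y)); last by ring.
by rewrite normrM ler_piMr// ler_norml; lra.
Qed.

Lemma bden_ge0 t : 0 <= t <= 1 -> 0 <= bden t.
Proof. by move=> /par01/andP[h _]; rewrite mulr_ge0 ?exprn_ge0// ltW// bK_gt0. Qed.

Lemma bden_le t : 0 <= t <= 1 -> bden t <= bK.
Proof.
by move=> /par01/andP[h h1]; rewrite ler_piMr ?exprn_ile1// ltW// bK_gt0.
Qed.

Lemma bden_lip x y : 0 <= x <= 1 -> 0 <= y <= 1 -> `|bden y - bden x| <= bK * a%:R * `|y - x|.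
Proof.
move=> hx hy; rewrite -mulrBr normrM gtr0_norm ?bK_gt0// -mulrA ler_wpM2l ?(ltW bK_gt0)//.
apply: (le_trans (pow_lip _ (par01 hx) (par01 hy))).
by rewrite ler_wpM2l//; exact: par_lip.
Qed.

Lemma bpdfE t : 0 < t < 1 -> bpdf a a t = bden t.
Proof. by move=> h; rewrite /bpdf h /bden /bK exprMn. Qed.

Lemma meas_bden : measT (bden : RM -> RM).
Proof. 
apply: measM => //; apply: measX; apply: measM => //.
exact: measB.
Qed.

Lemma leb_itv x y : x <= y -> leb `[x, y]%classic = (y - x)%:E.
Proof.
move=> xy; rewrite lebesgue_measure_itv/= lte_fin.
by case: ltgtP xy => // ->; rewrite subrr.
Qed.

Lemma Hc_sub x y : 0 <= x -> x <= y -> y <= 1 -> (Hc y - Hc x)%:E = (\int[leb]_(t in `[x, y]) (bden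
 t)%:E)%E.
Proof.
move=> x0 xy y1; have pdf := @betP_pdf R a a.
rewrite (cdfR_sub_pdf pdf xy).
have mb : measurable_fun (setT : set RM) (fun t : RM => (bden t)%:E).
 by apply/measE; exact: meas_bden.
have [mf _ _] := pdf.
have mf' : measurable_fun (setT : set RM) (fun t : RM => (bpdf a a t)%:E).
 by apply/measE.
rewrite -!integral_itv_obnd_cbnd; [|exact: measurable_funTS..].
rewrite -!integral_itv_bndo_bndc; [|exact: measurable_funTS..].
apply: eq_integral => t; rewrite inE/= in_itv/= => /andP[xt ty].
by rewrite bpdfE// (le_lt_trans x0 xt) (lt_le_trans ty y1).
Qed.

(** First-order expansions with explicit quadratic remainders are used in place of derivatives. They
    feed [flat_constant], and they quantify the effect of the odds transform. *)
Lemma Hc_quad x y : 0 <= x -> x <= y -> y <= 1 -> `|Hc y - Hc x - bden x * (y - x)| <= bK * a%:R *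
 (y - x) ^+ 2.
Proof.
move=> x0 xy y1; have hx : 0 <= x <= 1 by rewrite x0 (le_trans xy).
pose e := bK * a%:R * (y - x).
have d0 : 0 <= y - x by rewrite subr_ge0.
have e0 : 0 <= e by rewrite !mulr_ge0// ltW// bK_gt0.
have mxy : measurable (`[x, y]%classic : set RM) by exact: measurable_itv.
have int_cst (c : R) : (\int[leb]_(t in `[x, y]) c%:E = (c * (y - x))%:E)%E.
 by rewrite EFinM -(leb_itv xy); exact: integral_cst.
have mb : measurable_fun (`[x, y]%classic : set RM) (fun t : RM => (bden t)%:E).
 by apply: measurable_funTS; apply/measE; exact: meas_bden.
have near t : t \in `[x, y] -> [/\ 0 <= t <= 1, bden t <= bden x + e & bden x <= bden t + e].
 rewrite in_itv/= => /andP[xt ty].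
 have ht : 0 <= t <= 1 by rewrite (le_trans x0 xt) (le_trans ty y1).
 have := bden_lip hx ht; rewrite [X in _ * X]ger0_norm ?subr_ge0// ler_norml => /andP[h1 h2].
 have h3 : bK * a%:R * (t - x) <= e by rewrite ler_wpM2l ?lerB// mulr_ge0// ltW// bK_gt0.
 split => //; lra.
have U : Hc y - Hc x <= (bden x + e) * (y - x).
 rewrite -lee_fin Hc_sub// -int_cst; apply: ge0_le_integral => //.
 - by move=> t /near[h _ _]; rewrite lee_fin bden_ge0.
 - by move=> t /near[_ h _]; rewrite lee_fin.
have Lw : bden x * (y - x) <= Hc y - Hc x + e * (y - x).
 rewrite -lee_fin EFinD Hc_sub// -(int_cst (bden x)) -(int_cst e) -ge0_integralD//; last first.
  by move=> t /near[h _ _]; rewrite lee_fin bden_ge0.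
 apply: ge0_le_integral => //.
 - by move=> t _; rewrite lee_fin bden_ge0.
 - exact: emeasurable_funD.
 - by move=> t /near[_ _ h]; rewrite -EFinD lee_fin.
rewrite (_ : bK * a%:R * _ = e * (y - x)); last by rewrite /e; ring.
by rewrite ler_norml; lra.
Qed.

Lemma Hc_le1 v : 0 <= Hc v <= 1.
Proof. by rewrite cdfR_ge0 cdfR_le1. Qed.

Lemma Hc_nd x y : x <= y -> Hc x <= Hc y.
Proof. exact: cdfR_nd. Qed.

Lemma Hc_lip x y : 0 <= x -> x <= y -> y <= 1 -> Hc y - Hc x <= bK * (y - x).
Proof.
move=> x0 xy y1.
have mxy : measurable (`[x, y]%classic : set RM) by exact: measurable_itv.
have -> : bK * (y - x) = bK * y - bK * x by ring.
apply: (cdfR_sub_le (g := fun=> bK) (G := fun t => bK * t) (betP_pdf a a) xy) => //.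
- by move=> t _; apply: drv_eq (drvZ bK (drv_id t)) _; rewrite mulr1.
- by move=> t _; exact: cvg_cst.
move=> t /andP[xt ty]; rewrite /bpdf; case: ifP => [/andP[t0 t1]|_]; last exact/ltW/bK_gt0.
rewrite -exprMn; apply: bden_le; lra.
Qed.

Lemma bpdf_le t : bpdf a a t <= bK.
Proof.
rewrite /bpdf; case: ifP => [/andP[t0 t1]|_]; last exact/ltW/bK_gt0.
by rewrite -exprMn; apply: bden_le; lra.
Qed.

Lemma Hc_continuous : continuous Hc.
Proof. exact: (cdfR_continuous (betP_pdf a a) bpdf_le). Qed.

Lemma Hc0 : Hc 0 = 0.
Proof.
apply: EFin_inj; rewrite cdfRE (pdf_indic (betP_pdf a a))// integral0_eq// => t _.
rewrite indicE mem_setE in_itv/= /bpdf; by case: leP => t0; rewrite ?mul0e ?mule0.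
Qed.

Lemma Hc1 : Hc 1 = 1.
Proof.
apply: EFin_inj; rewrite cdfRE (pdf_indic (betP_pdf a a))// -(integral_bpdf a a).
apply: eq_integral => t _; rewrite indicE mem_setE in_itv/=.
case: leP => t1; rewrite ?mul1e// /bpdf (lt_gtF t1) andbF mul0e//.
Qed.

Lemma Hc_lt x y : 0 <= x -> x < y -> y <= 1 -> Hc x < Hc y.
Proof.
move=> x0 xy y1; pose d := (y - x) / 3.
have d0 : 0 < d by rewrite divr_gt0// subr_gt0.
pose c := bK * (d * d) ^+ a.
have c0 : 0 < c by rewrite mulr_gt0 ?bK_gt0// exprn_gt0// mulr_gt0.
have yE : y = x + 3 * d by rewrite /d; field.
have h : c * (x + 2 * d) - c * (x + d) <= Hc (x + 2 * d) - Hc (x + d).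
 apply: (cdfR_sub_ge (g := fun=> c) (G := fun t => c * t) (betP_pdf a a)); first lra.
 - by move=> t _; apply: drv_eq (drvZ c (drv_id t)) _; rewrite mulr1.
 - by move=> t _; exact: cvg_cst.
 move=> t /andP[xt ty]; rewrite (ltW c0) bpdfE; last by lra.
 rewrite /c /bden ler_wpM2l ?(ltW bK_gt0)//; apply: lerXn2r; rewrite ?nnegrE ?mulr_ge0; try lra.
 by apply: ler_pM; lra.
have h1 : Hc x <= Hc (x + d) by apply: Hc_nd; lra.
have h2 : Hc (x + 2 * d) <= Hc y by apply: Hc_nd; lra.
have h3 : c * (x + 2 * d) - c * (x + d) = c * d by ring.
have : 0 < c * d by rewrite mulr_gt0.
lra.
Qed.

Lemma HbetaE v : 0 <= v <= 1 -> Hbeta a.+1 v = Hc v.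
Proof.
move=> /andP[v0 v1].
have -> : Hc v = Hc v - Hc 0 by rewrite Hc0 subr0.
apply: EFin_inj; rewrite Hc_sub// /Hbeta.
have -> : beta_const a.+1 = bK.
 by rewrite /beta_const /bK mulSn mul1n addnS addSn /= expr2.
set I := (X in (bK * X)%R).
have mb : measurable_fun (`[0, v]%classic : set RM) (fun t : RM => ((t * (1 - t)) ^+ a)%:E).
 apply: measurable_funTS; apply/measE; apply: measX; apply: measM => //.
 exact: measB.
transitivity (bK%:E * \int[leb]_(t in `[0%R, v]) ((t * (1 - t)) ^+ a)%:E)%E; last first.
 rewrite -ge0_integralZl//; last by rewrite lee_fin ltW// bK_gt0.
 move=> t; rewrite /= in_itv/= => /andP[t0 t1]; rewrite lee_fin exprn_ge0//.
 by have /andP[] : 0 <= t * (1 - t) <= 1 by apply: par01; lra.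
rewrite EFinM; congr (_ * _)%E; rewrite /I /Rintegral fineK.
 by apply: eq_integral => t _; rewrite /= exprMn.
have f0 t : `[0%R, v]%classic t -> (0 <= (t ^+ a * (1 - t) ^+ a)%:E)%E.
 rewrite /= in_itv/= => /andP[t0 t1]; rewrite lee_fin mulr_ge0 ?exprn_ge0//; lra.
rewrite ge0_fin_numE; last exact: integral_ge0.
apply: (@le_lt_trans _ _ (\int[leb]_(t in `[0%R, v]) 1%:E)%E).
 apply: ge0_le_integral => //.
 - by apply: measurable_funTS; apply/measE; apply: measM; apply: measX => //; exact: measB.
 - move=> t; rewrite /= in_itv/= => /andP[t0 t1]; rewrite lee_fin -exprMn exprn_ile1//.
  by have /andP[] : 0 <= t * (1 - t) <= 1 by apply: par01; lra.
  by have /andP[] : 0 <= t * (1 - t) <= 1 by apply: par01; lra.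
have -> : (\int[leb]_(t in `[0%R, v]) 1%:E = 1%:E * leb `[0%R, v]%classic)%E by exact: integral_cst.
by rewrite leb_itv// mul1e ltry.
Qed.

(** The density at v times v (1 - v), that is the derivative of H(odds r v) in r at r = 1. Hence the
    shape (v (1 - v))^m of all correction terms. *)
Definition phiK v : R := bK * (v * (1 - v)) ^+ a.+1.

Let cov u s : R := Num.min u (Hc s) - u * Hc s.

(** At u = H(v) the kernel min(u, H(s)) - u H(s) has u-derivative 1{s > v} - H(s), whose integral
    over s is 1 - v minus the integral of H. Its increment from x to y lies between the values of
    this formula at v = y and at v = x. *)
Lemma Jf_Hc_step x y : 0 <= x -> x <= y -> y <= 1 -> `|Jf Hc (Hc y) - Jf Hc (Hc x) - (Hc y - Hc x) *
 (1 - int01 Hc - x)| <= (Hc y - Hc x) * (y - x).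
Proof.
move=> x0 xy y1; set d := Hc y - Hc x.
have d0 : 0 <= d by rewrite subr_ge0 Hc_nd.
have okc u : ok01 (cov u) by apply: ok_cov; exact: Hc_continuous.
have okH : ok01 Hc by apply: ok01_cont; exact: Hc_continuous.
pose st (c s : R) : R := if s <= c then 0 else 1.
have okst c : ok01 (st c).
 split.
  apply: measurable_fun_ifT => //; exact: measurable_fun_ler.
 by exists 1 => s _; rewrite /st; case: ifP; rewrite ?normr0 ?normr1.
have ist c : 0 <= c <= 1 -> int01 (st c) = 1 - c.
 move=> /andP[c0 c1].
 have -> : int01 (st c) = fine (\int[leb]_(s in `[0%R, 1%R]) ((\1_(`]c, +oo[%classic : set RM) s : R)%:E))%E.
  congr fine; apply: eq_integral => s _.
  by rewrite /st indicE mem_setE in_itv/= andbT; case: leP.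
 rewrite integral_indic//.
 have -> : (`]c, +oo[%classic : set RM) `&` `[0, 1]%classic = `]c, 1]%classic.
  by apply/seteqP; split => s /=; rewrite !in_itv/= andbT; lra.
 have E : leb `]c, 1]%classic = (1 - c)%:E.
  by rewrite lebesgue_measure_itv/= lte_fin; case: ltgtP c1 => // ->; rewrite subrr.
 exact: (congr1 fine E).
have hs s : 0 <= s <= 1 -> d * (st y s - Hc s) <= cov (Hc y) s - cov (Hc x) s <= d * (st x s - Hc
 s).
 move=> s01; rewrite /cov /st.
 have [sx|xs] := leP s x.
  have h1 := Hc_nd sx; have h2 := Hc_nd (le_trans sx xy); rewrite (le_trans sx xy).
  by rewrite !min_r// /d; lra.
 have h1 := Hc_nd (ltW xs); rewrite (min_l h1).
 have [sy|ys] := leP s y.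
  have h2 := Hc_nd sy; rewrite (min_r h2) /d.
  by move: (Hc s) (Hc x) (Hc y) h1 h2 => p q r h1 h2; lra.
 have h2 := Hc_nd (ltW ys); rewrite (min_l h2).
 rewrite (_ : Hc y - Hc y * Hc s - (Hc x - Hc x * Hc s) = d * (1 - Hc s)) ?lexx//.
 by rewrite /d; ring.
have ok1 c : ok01 (fun s => d * (st c s - Hc s)) by apply: ok01Z; exact: ok01B.
have i1 c : 0 <= c <= 1 -> int01 (fun s => d * (st c s - Hc s)) = d * (1 - c - int01 Hc).
 by move=> hc; rewrite int01Z ?int01B ?ist//; exact: ok01B.
have E : Jf Hc (Hc y) - Jf Hc (Hc x) = int01 (fun s => cov (Hc y) s - cov (Hc x) s).
 by rewrite int01B.
have ok2 := ok01B (okc (Hc y)) (okc (Hc x)).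
have l1 := int01_le (ok1 y) ok2 (fun s h => proj1 (andP (hs s h))).
have l2 := int01_le ok2 (ok1 x) (fun s h => proj2 (andP (hs s h))).
have hx : 0 <= x <= 1 by rewrite x0 (le_trans xy).
have hy : 0 <= y <= 1 by rewrite (le_trans x0 xy).
rewrite E; rewrite (i1 y hy) in l1; rewrite (i1 x hx) in l2.
have e1 : d * (1 - y - int01 Hc) = d * (1 - int01 Hc - x) - d * (y - x) by ring.
have e2 : d * (1 - x - int01 Hc) = d * (1 - int01 Hc - x) by ring.
rewrite e1 in l1; rewrite e2 in l2.
have : 0 <= d * (y - x) by rewrite mulr_ge0// subr_ge0.
move: (d * (y - x)) (d * (1 - int01 Hc - x)) l1 l2 => p q.
by rewrite ler_norml; move: (int01 _) => I u1 u2 u3; clear -u1 u2 u3; lra.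
Qed.

Lemma phiK_step x y : 0 <= x <= 1 -> 0 <= y <= 1 -> `|phiK y - phiK x - a.+1%:R * bden x * (1 - 2 *
 x) * (y - x)| <= bK * ((a.+1 ^ 2)%:R + a.+1%:R) * (y - x) ^+ 2.
Proof.
move=> hx hy; rewrite /phiK /bden.
set p := x * (1 - x); set q := y * (1 - y).
have T := pow_taylor a.+1 (par01 hx) (par01 hy); rewrite -/p -/q /= in T.
have -> : bK * q ^+ a.+1 - bK * p ^+ a.+1 - a.+1%:R * (bK * p ^+ a) * (1 - 2 * x) * (y - x) = bK *
 ((q ^+ a.+1 - p ^+ a.+1 - a.+1%:R * p ^+ a * (q - p)) - a.+1%:R * p ^+ a * (y - x) ^+ 2).
 by rewrite /p /q; ring.
rewrite normrM (gtr0_norm bK_gt0) -[leRHS]mulrA ler_wpM2l ?(ltW bK_gt0)//.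
apply: (le_trans (ler_normB _ _)); rewrite mulrDl; apply: lerD.
 apply: (le_trans T); rewrite ler_wpM2l// -sqr_normr// -[leRHS]real_normK ?num_real//.
 by rewrite lerXn2r ?nnegrE//; exact: par_lip.
have /andP[p0 p1] := par01 hx.
rewrite ger0_norm; last by rewrite mulr_ge0 ?sqr_ge0// mulr_ge0 ?exprn_ge0.
by rewrite ler_wpM2r ?sqr_ge0// ler_piMr// exprn_ile1.
Qed.

Lemma phiK0 : phiK 0 = 0. Proof. by rewrite /phiK mul0r expr0n mulr0. Qed.
Lemma phiK1 : phiK 1 = 0. Proof. by rewrite /phiK subrr mulr0 expr0n mulr0. Qed.

(** With h the density and mu the integral of H, the derivative of Jf(H(v)) is h (1 - mu - v) and
    that of [phiK] is m h (1 - 2 v), so the left-hand side has derivative 0; it vanishes at 0. The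
    value of mu is still unknown here. *)
Lemma Jf_HcE_mean v : 0 <= v <= 1 -> Jf Hc (Hc v) - phiK v / (2 * a.+1%:R) - (2^-1 - int01 Hc) * Hc
 v = 0.
Proof.
move=> v01; set mu := int01 Hc.
pose D v := Jf Hc (Hc v) - phiK v / (2 * a.+1%:R) - (2^-1 - mu) * Hc v.
have D0 : D 0 = 0.
 rewrite /D Hc0 phiK0 mul0r mulr0 !subr0 -[RHS](int01_cst 0); apply: eq_int01 => s _.
 by rewrite mul0r subr0 min_l//; case/andP: (Hc_le1 s).
rewrite -[LHS]/(D v) -D0.
apply: (flat_constant (D := D) (C := bK + bK * a%:R * 2 + bK * (a.+1%:R + 1))) => // x y x0 xy y1.
have hx : 0 <= x <= 1 by rewrite x0 (le_trans xy).
have hy : 0 <= y <= 1 by rewrite (le_trans x0 xy).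
have A1 := Jf_Hc_step x0 xy y1; have A2 := Hc_quad x0 xy y1; have A3 := phiK_step hx hy.
have A4 := Hc_lip x0 xy y1; have dH : 0 <= Hc y - Hc x by rewrite subr_ge0 Hc_nd.
have B1 : (Hc y - Hc x) * (y - x) <= bK * (y - x) ^+ 2.
 by rewrite expr2 mulrA ler_wpM2r// subr_ge0.
have B2 : `|(Hc y - Hc x - bden x * (y - x)) * (2^-1 - x)| <= bK * a%:R * (y - x) ^+ 2.
 rewrite normrM; apply: le_trans A2; rewrite ler_piMr// ler_norml; lra.
pose k : R := a.+1%:R; have k0 : 0 < k by rewrite ltr0n.
have B3 : `|(phiK y - phiK x - k * bden x * (1 - 2 * x) * (y - x)) / (2 * k)| <= bK * (k + 1) * (y -
 x) ^+ 2.
 have k2 : 0 <= (2 * k)^-1 by rewrite invr_ge0 mulr_ge0// ltW.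
 rewrite normrM (ger0_norm k2) ler_pdivrMr ?mulr_gt0//.
 apply: (le_trans A3).
 have -> : bK * (k + 1) * (y - x) ^+ 2 * (2 * k) = (bK * (k ^+ 2 + k) * (y - x) ^+ 2) * 2 by ring.
 rewrite natrX -/k; suff : 0 <= bK * (k ^+ 2 + k) * (y - x) ^+ 2 by lra.
 rewrite mulr_ge0 ?sqr_ge0// mulr_ge0 ?(ltW bK_gt0)//.
 by rewrite addr_ge0 ?sqr_ge0// ltW.
have -> : D y - D x = (Jf Hc (Hc y) - Jf Hc (Hc x) - (Hc y - Hc x) * (1 - mu - x)) + (Hc y - Hc x -
 bden x * (y - x)) * (2^-1 - x) - (phiK y - phiK x - k * bden x * (1 - 2 * x) * (y - x)) / (2 * k).
 rewrite /D -/k; move: (Jf Hc (Hc y)) (Jf Hc (Hc x)) (Hc y) (Hc x) (phiK y) (phiK x) (bden x) => j1 j2 h1 h2 p1 p2 b1.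
 by field; rewrite gt_eqF.
have n0 : 0 <= bK * a%:R * (y - x) ^+ 2 by rewrite mulr_ge0 ?sqr_ge0// mulr_ge0// ltW// bK_gt0.
apply: (le_trans (ler_normB _ _)); apply: (le_trans (lerD (ler_normD _ _) (lexx _))).
have -> : (bK + bK * a%:R * 2 + bK * (a.+1%:R + 1)) * (y - x) ^+ 2 = bK * (y - x) ^+ 2 + (bK * a%:R
 * (y - x) ^+ 2 + bK * a%:R * (y - x) ^+ 2) + bK * (k + 1) * (y - x) ^+ 2.
 by rewrite /k; ring.
apply: lerD B3; apply: lerD; first exact: le_trans A1 B1.
by apply: (le_trans B2); rewrite lerDl.
Qed.

(** Read off from the preceding identity at v = 1, where Jf(H) and [phiK] both vanish, instead of
    from the symmetry of the law. *)
Lemma int01_Hc : int01 Hc = 2^-1.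
Proof.
have := @Jf_HcE_mean 1; rewrite ler01 lexx Hc1 phiK1 mul0r subr0 mulr1 => /(_ isT).
have -> : Jf Hc 1 = 0.
 rewrite -[RHS](int01_cst 0); apply: eq_int01 => s _.
 by rewrite mul1r min_r ?subrr//; case/andP: (Hc_le1 s).
lra.
Qed.

Lemma Jf_HcE v : 0 <= v <= 1 -> Jf Hc (Hc v) = phiK v / (2 * a.+1%:R).
Proof. by move=> /Jf_HcE_mean; rewrite int01_Hc subrr mul0r subr0 => /eqP; rewrite subr_eq0 => /eqP. Qed.

(** The reciprocal of the integral of [phiK], hence the factor in [rho (H v) = lam0 * phiK v]. The
    variance [ssq] comes out as 1 / (4 (2 m + 1)), which is the variance of a Beta(m, m)
    variable. *)
Definition lam0 : R := 2 * (2 * a.+1 + 1)%:R / a.+1%:R.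

Lemma lam0_gt0 : 0 < lam0. Proof. by rewrite divr_gt0 ?mulr_gt0 ?ltr0n// addn1. Qed.

Lemma int01_phiK : int01 phiK = lam0^-1.
Proof.
pose c : R := bK * (a.+1`!%:R * a.+1`!%:R) / (a.+1 + a.+1).+1`!%:R.
have -> : lam0^-1 = c.
 have f0 : (a`!%:R : R) != 0 by rewrite pnatr_eq0 -lt0n fact_gt0.
 have f1 : ((a + a).+1`!%:R : R) != 0 by rewrite pnatr_eq0 -lt0n fact_gt0.
 have a0 : 0 <= a%:R :> R by [].
 have e1 : (2 * a.+1 + 1)%:R = a%:R + a%:R + 3 :> R by rewrite -natrD -natrD; congr _%:R; lia.
 have e2 : a.+1%:R = a%:R + 1 :> R by rewrite natr1.
 have e3 : (a.+1 + a.+1).+1`!%:R = (a%:R + a%:R + 3) * ((a%:R + a%:R + 2) * (a + a).+1`!%:R) :> R.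
  rewrite addSn addnS factS factS !natrM; congr (_ * (_ * _)); rewrite -?natrD; congr _%:R; lia.
 rewrite /c /lam0 /bK e1 e3 (factS a) natrM e2.
 by field; rewrite f0 f1/=; repeat (apply/andP; split); rewrite gt_eqF//; lra.
rewrite /int01 /Rintegral -[RHS]/(fine c%:E); congr fine.
rewrite -[RHS]mule1 -(integral_bpdf a.+1 a.+1) -ge0_integralZl//; last 3 first.
- by apply/measE; exact: meas_bpdf.
- by move=> t _; rewrite lee_fin bpdf_ge0.
- by rewrite lee_fin !mulr_ge0 ?invr_ge0// ltW// bK_gt0.
rewrite [LHS]integral_mkcond; apply: eq_integral => t _.
rewrite patchE mem_setE in_itv/= /bpdf -EFinM.
case: ifP => [h|/negbT h].
 case: ifP => [h'|/negbT h'].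
  congr EFin; rewrite /c /phiK exprMn; field.
  by rewrite !pnatr_eq0 -!lt0n !fact_gt0.
 have [->|->] : t = 0 \/ t = 1.
  have := h; have := h'; rewrite negb_and -!leNgt => /orP[] h1 /andP[h2 h3].
   by left; apply/eqP; rewrite eq_le h1.
  by right; apply/eqP; rewrite eq_le h3.
  by rewrite phiK0 mulr0.
 by rewrite phiK1 mulr0.
case: ifP => [h'|_]; last by rewrite mulr0.
by exfalso; move/negP: h; apply; lra.
Qed.

Lemma ssq_Hc : ssq Hc = (2 * a.+1%:R * lam0)^-1.
Proof.
have okp : ok01 phiK.
 split.
  by apply: measM => //; apply: measX; apply: measM => //; exact: measB.
 exists bK => s /par01/andP[h0 h1].
 rewrite ger0_norm ?mulr_ge0 ?exprn_ge0 ?(ltW bK_gt0)//.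
 by rewrite ler_piMr ?exprn_ile1// ltW// bK_gt0.
transitivity (int01 (fun s => (2 * a.+1%:R)^-1 * phiK s)).
 by apply: eq_int01 => s s01; rewrite Jf_HcE// mulrC.
by rewrite int01Z// int01_phiK [RHS]invfM.
Qed.

Lemma ssq_Hc_gt0 : 0 < ssq Hc.
Proof. by rewrite ssq_Hc invr_gt0 !mulr_gt0 ?ltr0n ?lam0_gt0. Qed.

Lemma rho_Hc v : 0 <= v <= 1 -> rho Hc (Hc v) = lam0 * phiK v.
Proof.
move=> v01; rewrite /rho Jf_HcE// ssq_Hc invrK; field.
by rewrite nat1r pnatr_eq0.
Qed.

End beta_cdf.

(** * Laws of processes on the unit interval *)

Section path_laws.
Context {R : realType}.
Notation RM := (measurableTypeR R).

Lemma path_events_local (E : set (R -> R)) : path_events E -> forall f g : R -> R, (forall v, v \in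
 `[0, 1] -> f v = g v) -> E f <-> E g.
Proof.
move=> hE; pose C : set (set (R -> R)) := [set E | forall f g : R -> R, (forall v, v \in `[0, 1] ->
 f v = g v) -> E f <-> E g].
suff : C E by [].
apply: hE; split.
 split; first by [].
  move=> A hA f g fg; rewrite setTD /=; split => nA /(hA _ _ fg)//.
 move=> A hA f g fg; split => -[n _ An]; exists n => //.
  by apply/(hA n _ _ fg).
 by apply/(hA n _ _ fg).
move=> _ [u u01 [B mB <-]] f g fg /=.
by rewrite fg//; exact: set_mem.
Qed.

Lemma path_events_measurable d (T : mtype d) (F : R -> T -> R) (E : set (R -> R)) : (forall v, v \in
 `[0, 1] -> measT (F v : T -> RM)) -> path_events E -> measurable [set p | E (fun v => F v p)].
Proof.
move=> mF hE; pose C : set (set (R -> R)) := [set E | measurable [set p | E (fun v => F v p)]].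
suff : C E by [].
apply: hE; split.
 split; first exact: measurable0.
  move=> A mA; rewrite /C/= (_ : [set _ | _] = ~` [set p | A (fun v => F v p)]).
   exact: measurableC.
  by apply/seteqP; split => p /=; [case|].
 move=> A mA; rewrite /C/= (_ : [set _ | _] = \bigcup_n [set p | A n (fun v => F v p)]).
  by apply: bigcup_measurable => n _; exact: mA.
 by apply/seteqP; split => p /= -[n _ An]; exists n.
move=> _ [u u01 [B mB <-]]; rewrite setTI /C/=.
have mu := mF u u01.
exact: (meas_preim mu mB).
Qed.

(** Both processes are the same functional of inputs with the same law. Agreement at times in [0, 1]
    is enough since path events see no other times. *)
Lemma eq_in_law_mp d (T : mtype d) (P : prob T R) d' (T' : mtype d') (Q : prob T' R) (f g : T -> T')
 (F : R -> T' -> R) (U V : R -> T -> R) : (forall v, v \in `[0, 1] -> measT (F v : T' -> RM)) -> mp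
 P Q f -> mp P Q g -> (forall v w, v \in `[0, 1] -> U v w = F v (f w)) -> (forall v w, v \in `[0,
 1] -> V v w = F v (g w)) -> eq_in_law P U V.
Proof.
move=> mF [mf hf] [mg hg] UF VF E hE; have mE := path_events_measurable mF hE.
have lf w := path_events_local hE (f := U^~ w) (g := F^~ (f w)) (fun v v01 => UF v w v01).
have lg w := path_events_local hE (f := V^~ w) (g := F^~ (g w)) (fun v v01 => VF v w v01).
transitivity (Q [set p | E (fun v => F v p)]).
 by rewrite -hf//; congr (P _); apply/seteqP; split => w /=; [exact: (lf w).1|exact: (lf w).2].
by rewrite -hg//; congr (P _); apply/seteqP; split => w /=; [exact: (lg w).2|exact: (lg w).1].
Qed.

Lemma gaussian_law_ext (mu nu : set R -> \bar R) : (forall A : set RM, measurable A -> mu A = nu A)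
 -> gaussian_law nu -> gaussian_law mu.
Proof.
move=> h [[m H]|[m [s [s0 H]]]]; [left|right].
 by exists m => A mA; rewrite h// H.
by exists m, s; split => // A mA; rewrite h// H.
Qed.

End path_laws.

(** * The constructed process is a Brownian bridge *)

Section bridges.
Context {R : realType}.
Notation RM := (measurableTypeR R).
Variables (L : nat) (H : R -> R).
Hypotheses (cH : continuous H) (H01 : forall v, 0 <= H v <= 1) (ssq0 : 0 < ssq H).
Context d (Omega : mtype d) (P : prob Omega R).
Variable pr : Omega -> @rseq R * RM.
Hypothesis hpr : mp P (prodP (pow gauss) gauss) pr.
Notation B := (fun u w => bridge L H u (pr w)).

Lemma mp_bridge1 u : 0 <= u <= 1 -> mp P (gau (sqrt (u - u * u))) (B u : Omega -> RM).
Proof.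
move=> u01; have [q0 h] := mp_bridge_comb L cH H01 ssq0 (t := fun _ : 'I_1 => u) (fun=> 1) (fun=> u01).
move: q0 h; rewrite !big_ord1 !mul1r minxx => _ h.
by apply: mp_eqfun (mp_comp hpr h) => w /=; rewrite big_ord1 mul1r.
Qed.

Lemma mp_bridge2 u v : 0 <= u <= 1 -> 0 <= v <= 1 -> exists2 q : R, q = (u - u * u) + (v - v * v) +
 2 * (Num.min u v - u * v) /\ 0 <= q & mp P (gau (sqrt q)) (fun w => B u w + B v w : RM).
Proof.
move=> u01 v01.
have t01 (k : 'I_2) : 0 <= (if k == ord0 then u else v) <= 1 by case: ifP.
have [q0 h] := mp_bridge_comb L cH H01 ssq0 (fun=> 1) t01.
move: q0 h; set q := (X in 0 <= X) => q0 h.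
have qE : q = (u - u * u) + (v - v * v) + 2 * (Num.min u v - u * v).
 rewrite /q !big_ord_recl !big_ord0 /= !minxx (minC v u); ring.
exists q; first by [].
apply: mp_eqfun (mp_comp hpr h) => w /=.
by rewrite !big_ord_recl big_ord0 /= !mul1r addr0.
Qed.

Lemma sqr_int (X : Omega -> R) q : 0 <= q -> mp P (gau (sqrt q)) (X : Omega -> RM) -> (\int[P]_w (X
 w ^+ 2)%:E = q%:E)%E /\ P.-integrable setT (fun w => (X w ^+ 2)%:E).
Proof.
move=> q0 hX; have E := gau_var hX; rewrite sqr_sqrtr// in E; split => //.
have mX : measT (fun w => (X w ^+ 2)%:E).
 by apply/measE; apply: measX; exact: hX.1.
apply/integrableP; split => //.
rewrite (eq_integral (fun w => (X w ^+ 2)%:E)) ?E ?ltry// => w _.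
by rewrite gee0_abs// lee_fin sqr_ge0.
Qed.

(** Polarization: the variances of B(u), B(v) and B(u) + B(v) are known from their normal laws. *)
Lemma bridge_cov u v : 0 <= u <= 1 -> 0 <= v <= 1 -> (\int[P]_w (B u w * B v w)%:E = (Num.min u v -
 u * v)%:E)%E.
Proof.
move=> u01 v01.
have [q [qE q0] hq] := mp_bridge2 u01 v01.
have pos x : 0 <= x <= 1 -> 0 <= x - x * x :> R by move=> /andP[x0 x1]; rewrite subr_ge0 ler_piMr.
have [E1 I1] := sqr_int q0 hq.
have [E2 I2] := sqr_int (pos _ u01) (mp_bridge1 u01).
have [E3 I3] := sqr_int (pos _ v01) (mp_bridge1 v01).
have I23 := integrableD measurableT I2 I3.
transitivity (\int[P]_w ((2^-1)%:E * ((B u w + B v w) ^+ 2)%:E - (2^-1)%:E * ((B u w ^+ 2)%:E + (B v w ^+ 2)%:E)))%E.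
 apply: eq_integral => w _.
 transitivity ((2^-1 * (B u w + B v w) ^+ 2 - 2^-1 * (B u w ^+ 2 + B v w ^+ 2))%:E) => //.
 by congr EFin; field.
rewrite integralB//; [|exact: integrableZl..].
rewrite !integralZl// integralD// E1 E2 E3.
transitivity ((2^-1 * q - 2^-1 * (u - u * u + (v - v * v)))%:E) => //.
by rewrite qE; congr EFin; field.
Qed.

Lemma bridge_brownian : brownian_bridge P B.
Proof.
have itv01 (u : R) : u \in `[0, 1] -> (0 <= u <= 1)%R by rewrite in_itv.
split.
- by move=> u _; exact: (mcomp (meas_bridge L cH u) hpr.1).
- move=> w; apply: continuous_subspaceT; exact: bridge_continuous.
- move=> n t a t01.
 have [q0 h] := mp_bridge_comb L cH H01 ssq0 a (fun k => itv01 _ (t01 k)).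
 apply: (gaussian_law_ext _ (gau_gaussian (sqrtr_ge0 (\sum_k \sum_l a k * a l * (Num.min (t k) (t l) - t k * t l))))) => A mA.
 have [_ <-//] := mp_comp hpr h.
- move=> u /itv01 u01; rewrite unlock; exact: gau_mean (mp_bridge1 u01).
- move=> u v /itv01 u01 /itv01 v01; rewrite unlock; exact: bridge_cov.
Qed.

End bridges.

(** * The corrected bridge *)

Section corrected_bridge.
Context {R : realType}.
Notation RM := (measurableTypeR R).
Variables (L a : nat).
Notation H := (@Hc R a).

(** The component of the bridge uncorrelated with its integral. It is common to the bridge and to
    all its corrections, and to the two bridges of the theorem. *)
Definition bridge_core v (z : nat -> R) : R := Bser L (H v) z - rho H (H v) * IB L H z.

(** The constant of the theorem is [rho] along H: the correction multiplies the integral, minus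
    [sig] times the fresh normal, by x [rho], so the weight of that normal passes from 1 to 1 -
    x. *)
Lemma corrected_bridge d (Omega : mtype d) (pr : Omega -> @rseq R * RM) x v w : v \in `[0, 1] ->
 corrected a.+1 (4 * x) (fun u w => bridge L H u (pr w)) v w = bridge_core v (pr w).1 - (1 - x) *
 (rho H (H v) * sig H * (pr w).2).
Proof.
rewrite in_itv/= => v01; rewrite /corrected /time_changed HbetaE//.
have -> : \int[lebesgue_measure]_(s in `[0, 1]) bridge L H (Hbeta a.+1 s) (pr w) = - (sig H * (pr w).2).
 rewrite -(int_bridge L (@Hc_continuous R a) (@Hc_le1 R a) (@ssq_Hc_gt0 R a) (pr w)).
 by apply: eq_int01 => s s01; rewrite HbetaE.
have -> : 4 * x * (2 * a.+1 + 1)%:R * (((2 * a.+1).-1)`!%:R / ((2 * a.+1)%:R * a.+1.-1`!%:R ^+ 2)) *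
 (v * (1 - v)) ^+ a.+1 = x * rho H (H v).
 rewrite rho_Hc// /lam0 /phiK /bK.
 have -> : (2 * a.+1).-1 = (a + a).+1 by lia.
 rewrite /= (natrM _ 2 a.+1) expr2; field.
 by rewrite nat1r !pnatr_eq0 -lt0n fact_gt0.
rewrite /bridge_core /bridge; ring.
Qed.

(** Coefficient 8 is x = 2, which only changes the sign of the fresh normal. *)
Lemma corrected8_law d (Omega : mtype d) (P : prob Omega R) (pr : Omega -> @rseq R * RM) : mp P
 (prodP (pow gauss) gauss) pr -> eq_in_law P (time_changed a.+1 (fun u w => bridge L H u (pr w)))
 (corrected a.+1 8 (fun u w => bridge L H u (pr w))).
Proof.
move=> hpr.
have flip := mp_prod (mp_id (pow (@gauss R))) (@mp_gauss_opp R).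
apply: (eq_in_law_mp (F := fun v p => bridge L H (H v) p) _ hpr (mp_comp hpr flip)).
- by move=> v _; exact: meas_bridge (@Hc_continuous R a) _.
- by move=> v w; rewrite in_itv/= => v01; rewrite /time_changed HbetaE.
move=> v w v01; rewrite (_ : 8 = 4 * 2); last by ring.
by rewrite corrected_bridge// /bridge_core /bridge/=; ring.
Qed.

End corrected_bridge.

(** * Approximation of the uniform empirical process by a normal walk *)

Section uniform_empirical.
Context {R : realType}.
Notation RM := (measurableTypeR R).
Variables (L n : nat) (a K : R).
Notation Mn := (2 ^ L)%N.
Notation M := (pow2 L : R).
Notation dl := (Dlev a L : R).
Let b := (n.+1 %/ Mn)%N.
Hypotheses (n_ge : (Mn * Mn <= n)%N) (n_lt : (n < 4 * (Mn * Mn))%N) (a1 : 1 <= a) (K1 : 1 <= K) (KM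
 : K <= M) (dl1 : dl <= 1).
Variables (e z u : nat -> R) (g : R).

Lemma Mn_gt0 : (0 < Mn)%N. Proof. by rewrite expn_gt0. Qed.

Lemma blk_le : (Mn <= b)%N.
Proof. by rewrite leq_divRL ?Mn_gt0// (leq_trans n_ge). Qed.

Lemma blk_mul : (b * Mn <= n.+1 < b * Mn + Mn)%N.
Proof. by rewrite leq_divM/= -mulSnr ltn_ceil// Mn_gt0. Qed.

Lemma blk_ub : (b <= 4 * Mn)%N.
Proof.
rewrite -ltnS ltn_divLR ?Mn_gt0//; apply: leq_ltn_trans n_lt _.
by rewrite (mulSn (4 * Mn)) mulnA -[X in (X < _)%N]add0n ltn_add2r Mn_gt0.
Qed.

Lemma sqrt_M : sqrt M ^+ 2 = M.
Proof. by rewrite sqr_sqrtr// ltW// pow2_gt0. Qed.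

Lemma kap_ge1 : 1 <= sqrt (a + L%:R + 3).
Proof.
have L0 := ler0n R L; rewrite -[leLHS]sqrtr1 ler_wsqrtr//; move: a1 L0; lra.
Qed.

Lemma dlE : M * dl = sqrt M * sqrt (a + L%:R + 3).
Proof.
have s0 : sqrt M != 0 by rewrite gt_eqF// sqrtr_gt0 pow2_gt0.
by rewrite /Dlev -{1}sqrt_M expr2; field.
Qed.

Lemma sqrtM_le : sqrt M <= M * dl.
Proof. by rewrite dlE ler_peMr ?sqrtr_ge0// kap_ge1. Qed.

Lemma Mdl_ge1 : 1 <= M * dl.
Proof. by apply: le_trans sqrtM_le; rewrite -sqrtr1 ler_wsqrtr// pow2_ge1. Qed.

Lemma sqrt_n_ge : M <= sqrt n%:R.
Proof.
rewrite -[leLHS]ger0_norm ?(ltW (pow2_gt0 L))// -sqrtr_sqr ler_wsqrtr//.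
by rewrite expr2 /pow2 -natrM ler_nat.
Qed.

Lemma sqrt_n_le : sqrt n%:R <= 2 * M.
Proof.
rewrite -[leRHS]ger0_norm ?mulr_ge0 ?(ltW (pow2_gt0 L))// -sqrtr_sqr ler_wsqrtr//.
by rewrite exprMn -!natrX -natrM ler_nat; move: n_lt; rewrite -mulnn; lia.
Qed.

(** The hypotheses that follow describe an event on which the approximation is deterministic: bounds
    for the whole walk, for its oscillation inside blocks, and for the partial sums of the residuals
    of the quantile transforms. The block variables enter [z] with a minus sign because an empirical
    process is, to first order, minus the quantile process. *)
Definition dev j : R := \sum_(l < j) (e l - 1).

Hypothesis dev_all : forall j, (j <= n.+1)%N -> `|dev j| <= K * sqrt n%:R.
Hypothesis dev_blk : forall l i, (l <= Mn)%N -> (i <= b)%N -> `|\sum_(k < i) (e (l * b + k)%N - 1)|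
 <= 8 * (M * dl).
Hypothesis dev_res : forall l, (l <= Mn)%N -> `|\sum_(i < l) gz_res b.-1 (\sum_(k < b) e (i * b +
 k)%N)| <= K * sqrt M.
Hypotheses (z_blk : forall i, (i < Mn)%N -> z i = - gz b.-1 (\sum_(k < b) e (i * b + k)%N)) (z_tame
 : tame a z).

Lemma dev_add l i : dev (l * b + i) = dev (l * b) + \sum_(k < i) (e (l * b + k)%N - 1).
Proof. by rewrite /dev big_split_ord. Qed.

Lemma dev_mul l : dev (l * b) = \sum_(i < l) (\sum_(k < b) e (i * b + k)%N - b%:R).
Proof.
elim: l => [|l IH]; first by rewrite mul0n /dev !big_ord0.
rewrite mulSnr dev_add IH big_ord_recr/=; congr (_ + _).
by rewrite sumrB sumr_const card_ord.
Qed.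

Definition Wz l : R := \sum_(i < l) z i.

Lemma dev_W l i : (l <= Mn)%N -> (i <= b)%N -> `|dev (l * b + i) + sqrt b%:R * Wz l| <= (K + 8) * (M
 * dl).
Proof.
move=> lM ib; rewrite dev_add dev_mul.
have b0 : (0 < b)%N := leq_trans Mn_gt0 blk_le.
have -> : \sum_(i < l) (\sum_(k < b) e (i * b + k)%N - b%:R) = \sum_(i < l) gz_res b.-1 (\sum_(k <
 b) e (i * b + k)%N) - sqrt b%:R * Wz l.
 rewrite /Wz mulr_sumr -sumrB; apply: eq_bigr => k _.
 rewrite z_blk ?(leq_trans (ltn_ord k))// /gz_res prednK//; ring.
rewrite addrAC subrK.
apply: (le_trans (ler_normD _ _)); rewrite mulrDl; apply: lerD; last exact: dev_blk.
apply: (le_trans (dev_res lM)); rewrite ler_wpM2l ?(le_trans ler01)//; exact: sqrtM_le.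
Qed.

Hypothesis e_os : forall l, (l <= n)%N -> e l = g * (order_stat u n l.+1 - order_stat u n l).

Lemma dev_os j : (j <= n.+1)%N -> j%:R + dev j = g * order_stat u n j.
Proof.
elim: j => [_|j IH jn]; first by rewrite /dev big_ord0 addr0 mulr0.
rewrite /dev big_ord_recr/= -/(dev j) e_os// -[j.+1%:R]natr1.
have := IH (ltnW jn); move: (order_stat u n j.+1) (order_stat u n j) => p q; lra.
Qed.

Lemma gE : g = n.+1%:R + dev n.+1.
Proof. by rewrite dev_os// order_stat_big// mulr1. Qed.

Lemma g_ge0 : 0 <= g.
Proof.
rewrite gE; have := dev_all (leqnn n.+1); rewrite ler_norml => /andP[h _].
have : K * sqrt n%:R <= n%:R.
 rewrite -[leRHS]sqr_sqrtr// expr2 ler_wpM2r ?sqrtr_ge0//.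
 exact: le_trans KM sqrt_n_ge.
rewrite -natr1; lra.
Qed.

Definition ecount (h : R) : nat := count (fun x : R => (x <= h)%R) (mkseq u n).

Lemma ecount_le h : (ecount h <= n)%N.
Proof. by rewrite (leq_trans (count_size _ _))// size_mkseq. Qed.

Lemma ecountE h : (ecount h)%:R = \sum_(k < n) (u k <= h)%R%:R :> R.
Proof.
rewrite /ecount /mkseq count_map -sum1_count big_mkcond natr_sum -[in iota 0 n](subn0 n).
by rewrite -/(index_iota 0 n) big_mkord; apply: eq_bigr => k _ /=; case: ifP.
Qed.

Lemma ecount_os h : 0 <= h <= 1 -> order_stat u n (ecount h) <= h <= order_stat u n (ecount h).+1.
Proof.
move=> /andP[h0 h1]; have jn := ecount_le h; apply/andP; split.
 case E : (ecount h) jn => [|j] jn; first by rewrite order_stat0.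
 by rewrite order_stat_le// -/(ecount h) E.
have [jlt|jge] := ltnP (ecount h) n; last by rewrite order_stat_big// ltnS.
by apply: ltW; rewrite ltNge order_stat_le// -/(ecount h) ltnn.
Qed.

Lemma ecount_blk h : 0 <= h <= 1 -> (ecount h %/ b <= Mn)%N.
Proof.
move=> _; have jn := ecount_le h; have b0 : (0 < b)%N := leq_trans Mn_gt0 blk_le.
rewrite -ltnS ltn_divLR//; have /andP[_ h2] := blk_mul.
apply: (leq_ltn_trans jn); rewrite mulSn addnC mulnC; apply: leq_trans (ltnW h2) _.
by rewrite leq_add2l blk_le.
Qed.

(** The order statistic of rank j is (j + dev j) / g with g = n + 1 + dev (n + 1). The point h lies
    between those of ranks j and j + 1, where j is the number of observations up to h; multiplying
    by g expresses n h - j by the walk. *)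
Lemma ecount_dev h : 0 <= h <= 1 -> `|n%:R * h - (ecount h)%:R - (dev (ecount h) - h * dev n.+1 -
 h)| <= 1 + 16 * (M * dl).
Proof.
set j := ecount h.
move=> h01; have /andP[c1 c2] := ecount_os h01; have jn : (j <= n)%N := ecount_le h.
rewrite -/j in c1 c2.
have g0 := g_ge0.
have E1 := dev_os (leqW jn); have E2 : j.+1%:R + dev j.+1 = _ := dev_os (jn : (j.+1 <= n.+1)%N).
have A1 : j%:R + dev j <= g * h by rewrite E1 ler_wpM2l.
have A2 : g * h <= j.+1%:R + dev j.+1 by rewrite E2 ler_wpM2l.
have b0 : (0 < b)%N := leq_trans Mn_gt0 blk_le.
have lM : (j %/ b <= Mn)%N := ecount_blk h01.
have ib := ltn_pmod j b0.
have S1 := dev_add (j %/ b) (j %% b); rewrite -divn_eq in S1.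
have S2 := dev_add (j %/ b) (j %% b).+1; rewrite addnS -divn_eq in S2.
have B1 := dev_blk lM (ltnW ib); have B2 := dev_blk lM ib.
have G := gE; move: S1 S2 B1 B2.
set p := \sum_(k < j %% b) _; set q := \sum_(k < (j %% b).+1) _ => S1 S2.
rewrite !ler_norml => /andP[B1 B1'] /andP[B2 B2'].
have G' : g * h = n%:R * h + h + h * dev n.+1 by rewrite G -natr1; ring.
rewrite G' in A1 A2; rewrite -[j.+1%:R]natr1 in A2.
have Md := Mdl_ge1.
apply/andP; split; lra.
Qed.

Lemma clamp_natB l i : clamp (l%:R - i%:R : R) = (i < l)%N%:R.
Proof.
have [il|li] := ltnP i l.
 have h : 1 <= l%:R - i%:R :> R by rewrite lerBrDr nat1r ler_nat.
 by case: (clampP (l%:R - i%:R : R)) => -[h' ->]; move: h h' => /=; lra.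
have h : l%:R - i%:R <= 0 :> R by rewrite subr_le0 ler_nat.
by case: (clampP (l%:R - i%:R : R)) => -[h' ->]; move: h h' => /=; lra.
Qed.

Lemma Sg_block l : (l <= Mn)%N -> Sg L L (l%:R / M) z = (sqrt M)^-1 * (Wz l - l%:R / M * Wz Mn).
Proof.
move=> lM; rewrite /Sg /Wz (big_ord_widen _ z lM) [X in _ * (X - _)]big_mkcond.
rewrite mulr_sumr -sumrB mulr_sumr; apply: eq_bigr => i _.
rewrite psi_base// mulrC [M * _]mulrC divfK ?gt_eqF ?pow2_gt0// clamp_natB.
by case: ifP => _ /=; ring.
Qed.

Lemma n_ge1 : (1 <= n)%N.
Proof. by apply: leq_trans n_ge; rewrite muln_gt0 Mn_gt0. Qed.

Lemma sqrM_le : M * M <= n%:R.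
Proof. by rewrite /pow2 -natrM ler_nat. Qed.

(** Both sources of error are of the size of a block: the count differs from n h by O(sqrt n), and a
    block has about n / M, that is about sqrt n, terms. *)
Lemma ecount_close h : 0 <= h <= 1 -> `|(ecount h %/ b)%:R / M - h| <= (4 * K + 21) / M.
Proof.
move=> h01; have jn := ecount_le h; have D := ecount_dev h01.
have lM := ecount_blk h01.
have b0 : (0 < b)%N := leq_trans Mn_gt0 blk_le.
move: D jn lM; set j := ecount h; set l := (j %/ b)%N => D jn lM.
have N0 : 0 < n%:R :> R by rewrite ltr0n n_ge1.
have M0 : 0 < M := pow2_gt0 L.
have h2 : `|l%:R * n%:R - j%:R * M| <= 3 * n%:R :> R.
 have jE := divn_eq j b; rewrite -/l in jE; have ib := ltn_pmod j b0.
 have /andP[b1 b2] := blk_mul; have ng := n_ge; have n1 := n_ge1; have bM := blk_le; have m0 := Mn_gt0.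
 have u1 : (l * n <= j * Mn + n)%N.
  have : (l * n <= l * (b * Mn) + l * Mn)%N by rewrite -mulnDr leq_mul2l (ltnW (ltnW b2)) orbT.
  have : (l * Mn <= Mn * Mn)%N by rewrite leq_mul2r lM orbT.
  have : (l * (b * Mn) <= j * Mn)%N by rewrite mulnA leq_mul2r {1}jE leq_addr orbT.
  move: (l * n)%N (l * (b * Mn))%N (l * Mn)%N (Mn * Mn)%N (j * Mn)%N ng => p1 p2 p3 p4 p5.
  by clear; lia.
 have u2 : (j * Mn <= l * n + 3 * n)%N.
  have e1 : (j * Mn = l * (b * Mn) + (j %% b) * Mn)%N by rewrite {1}jE mulnDl mulnA.
  have e2 : (l * (b * Mn) <= l * n.+1)%N by rewrite leq_mul2l b1 orbT.
  have e3 : ((j %% b) * Mn <= b * Mn)%N by rewrite leq_mul2r (ltnW ib) orbT.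
  have e4 : (Mn <= Mn * Mn)%N by rewrite leq_pmulr.
  have ln : (l <= n)%N := leq_trans lM (leq_trans e4 ng).
  rewrite mulnS in e2; rewrite e1; apply: (leq_trans (leq_add e2 (leq_trans e3 b1))).
  by move: (l * n)%N ln n1 => p ln n1; clear -ln n1; lia.
 have v1 : l%:R * n%:R <= j%:R * M + n%:R by rewrite /pow2 -!natrM -natrD ler_nat.
 have v2 : j%:R * M <= l%:R * n%:R + 3 * n%:R by rewrite /pow2 -!natrM -natrD ler_nat.
 by move: (_ * M) (l%:R * n%:R) v1 v2 => p q v1 v2; rewrite ler_norml; lra.
have h1 : `|n%:R * h - j%:R| <= (4 * K + 18) * M.
 have d1 := dev_all (leqW jn); have d2 := dev_all (leqnn n.+1).
 have sn := sqrt_n_le; have k0 : 0 <= K := le_trans ler01 K1.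
 have kk : K * sqrt n%:R <= K * (2 * M) by rewrite ler_wpM2l.
 have hd : `|h * dev n.+1| <= K * (2 * M).
  by rewrite normrM (le_trans _ (le_trans d2 kk))// ler_piMl// ler_norml; lra.
 have md : M * dl <= M by rewrite ler_piMr// ltW.
 have m1 := pow2_ge1 L : 1 <= M.
 move: D d1 hd; rewrite !ler_norml; move: (dev j) (h * dev n.+1) => p q.
 have -> : (4 * K + 18) * M = 2 * (K * (2 * M)) + 18 * M by ring.
 lra.
rewrite -(ler_pM2r N0) -(ler_pM2r M0).
have -> : `|l%:R / M - h| * n%:R * M = `|(l%:R * n%:R - j%:R * M) - M * (n%:R * h - j%:R)|.
 rewrite -mulrA -[X in _ * X](ger0_norm (_ : 0 <= n%:R * M)) ?mulr_ge0 ?ltW// -normrM.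
 by congr Num.norm; field; rewrite gt_eqF.
have -> : (4 * K + 21) / M * n%:R * M = 3 * n%:R + (4 * K + 18) * n%:R by field; rewrite gt_eqF.
apply: (le_trans (ler_normB _ _)); apply: lerD => //.
rewrite normrM (ger0_norm (ltW M0)); apply: (le_trans (ler_wpM2l (ltW M0) h1)).
rewrite mulrCA; apply: ler_wpM2l; last exact: sqrM_le.
move: K1; lra.
Qed.

Lemma sqrt_ratio (r := sqrt b%:R * sqrt M / sqrt n%:R) : [/\ 0 <= r, r <= 2 & `|r - 1| <= M^-1].
Proof.
have N0 : 0 < n%:R :> R by rewrite ltr0n n_ge1.
have M0 : 0 < M := pow2_gt0 L.
have r0 : 0 <= r by rewrite !mulr_ge0 ?invr_ge0 ?sqrtr_ge0.
have r2 : r ^+ 2 = (b * Mn)%:R / n%:R.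
 by rewrite natrM /r !exprMn exprVn !sqr_sqrtr// ltW.
have E : `|r ^+ 2 - 1| <= M^-1.
 rewrite r2 -(ler_pM2r N0) -{2}(ger0_norm (ltW N0)) -normrM mulrBl divfK ?gt_eqF// mul1r.
 have /andP[b1 b2] := blk_mul; have m1 : 1 <= M := pow2_ge1 L.
 apply: (@le_trans _ _ M).
  have c1 : (b * Mn)%:R <= n%:R + 1 :> R by rewrite natr1 ler_nat.
  have c2 : n%:R + 1 <= (b * Mn)%:R + M :> R by rewrite natr1 -natrD ler_nat ltnW.
  by rewrite ler_norml; lra.
 by rewrite mulrC ler_pdivlMr// sqrM_le.
have H : `|r - 1| <= M^-1.
 apply: le_trans E; rewrite (_ : r ^+ 2 - 1 = (r - 1) * (r + 1)); last by ring.
 by rewrite normrM ler_peMr// ger0_norm; lra.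
split => //; have : M^-1 <= 1 by rewrite invf_le1// pow2_ge1.
by move: H; rewrite ler_norml; lra.
Qed.

Lemma alpha_close h : 0 <= h <= 1 -> `|sqrt n%:R * ((ecount h)%:R / n%:R - h) - Sg L L h z| <= (50 *
 K + 290) * dl.
Proof.
move=> h01; have jn := ecount_le h; have D := ecount_dev h01.
have lM := ecount_blk h01; have C := ecount_close h01.
have b0 : (0 < b)%N := leq_trans Mn_gt0 blk_le.
have [r0 r2 r1] := sqrt_ratio.
have N0 : 0 < n%:R :> R by rewrite ltr0n n_ge1.
have M0 : 0 < M := pow2_gt0 L.
have a0 : 0 <= a := le_trans ler01 a1.
have W1 := dev_W lM (ltnW (ltn_pmod (ecount h) b0)); rewrite -divn_eq in W1.
have W2 : `|dev n.+1 + sqrt b%:R * Wz Mn| <= (K + 8) * (M * dl).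
 have /andP[b1 b2] := blk_mul.
 have ib : (n.+1 - b * Mn <= b)%N.
  by rewrite leq_subLR (leq_trans (ltnW b2))// leq_add2l blk_le.
 by have := dev_W (leqnn Mn) ib; rewrite mulnC subnKC.
have l01 : 0 <= (ecount h %/ b)%:R / M <= 1.
 by rewrite divr_ge0 ?(ltW M0)//= ler_pdivrMr// mul1r ler_nat.
have Sl := Sg_block lM.
have Wm : `|Wz Mn| <= 2 * (M * (sqrt M * (M * dl))) / M.
 apply: (le_trans (ler_norm_sum _ _ _)).
 apply: (@le_trans _ _ (\sum_(i < Mn) 2 * sqrt (a + L%:R + 3))).
  apply: ler_sum => i _; apply: tame_bound => //.
  by apply: (leq_trans (ltn_ord i)); rewrite leq_exp2l.
 rewrite sumr_const card_ord -[leLHS]mulr_natl dlE -/M -[X in X * _]/M.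
 rewrite (_ : 2 * _ / M = M * (2 * sqrt (a + L%:R + 3)))//.
 rewrite (_ : sqrt M * (sqrt M * sqrt (a + L%:R + 3)) = M * sqrt (a + L%:R + 3)).
  by field; rewrite gt_eqF.
 by rewrite mulrA -expr2 sqrt_M.
have M1 := Sg_modulus L a0 z_tame l01 h01; have M2 := Sg_modulus L a0 z_tame h01 (_ : 0 <= 0 <= 1).
have {M2} := M2 _; rewrite lexx ler01 => /(_ isT).
have -> : Sg L L 0 z = 0.
 have := Sg_block (leq0n Mn); rewrite mul0r => ->.
 by rewrite /Wz big_ord0 mul0r subrr mulr0.
rewrite !subr0 => M2.
move: D C W1 l01 Sl M1; set j := ecount h; set l := (j %/ b)%N; set t := l%:R / M => D C W1 t01 Sl M1.
set S := Sg L L h z in M1 M2 *; set St := Sg L L t z in Sl M1.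
set sn := sqrt n%:R; have sn0 : 0 < sn by rewrite sqrtr_gt0.
set q := sqrt M in Sl Wm r0 r1 r2; have q0 : 0 < q by rewrite sqrtr_gt0.
set sb := sqrt b%:R in W1 W2 r0 r1 r2.
pose th := dev j + sb * Wz l - h * (dev n.+1 + sb * Wz Mn) - h + (n%:R * h - j%:R - (dev j - h * dev
 n.+1 - h)).
have snE : sn * sn = n%:R by rewrite -expr2 sqr_sqrtr// ltW.
(* With t = l / M the grid point of the block of j, the terms are: the move of the interpolated walk
   from t to h, the discrepancy between the normalizations sqrt (b M) and sqrt n, the same move in
   the linear part of the bridge, and the walk errors collected in [th]. *)
have E : sn * (j%:R / n%:R - h) - S = sb * q / sn * (St - S) + (sb * q / sn - 1) * S + sb * q / sn *
 ((t - h) * (Wz Mn / q)) - th / sn.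
 rewrite Sl /th -snE; field; by rewrite !gt_eqF.
have Md := Mdl_ge1.
have d4 : 0 <= 4 * M * dl by rewrite mulr_ge0 ?Dlev_ge0// mulr_ge0 ?(ltW M0).
have k0 : 0 <= K := le_trans ler01 K1.
have nn : M <= sn := sqrt_n_ge.
have Th : `|th / sn| <= (2 * K + 34) * dl.
 rewrite normrM (gtr0_norm (_ : 0 < sn^-1)) ?invr_gt0// ler_pdivrMr//.
 apply: (@le_trans _ _ ((2 * K + 34) * (M * dl))); last first.
  by rewrite -mulrA ler_wpM2l ?addr_ge0 ?mulr_ge0// mulrC ler_wpM2l ?Dlev_ge0.
 have W2' : `|h * (dev n.+1 + sb * Wz Mn)| <= (K + 8) * (M * dl).
  by rewrite normrM (le_trans _ W2)// ler_piMl// ler_norml; lra.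
 rewrite /th; move: D W1 W2'; rewrite !ler_norml.
 move: (n%:R * h - j%:R - (dev j - h * dev n.+1 - h)) (dev j + sb * Wz l) (h * (dev n.+1 + sb * Wz Mn)) => p1 p2 p3.
 have -> : (2 * K + 34) * (M * dl) = (K + 8) * (M * dl) + (K + 8) * (M * dl) + 18 * (M * dl) by ring.
 lra.
have T1 : `|sb * q / sn * (St - S)| <= 2 * (4 * (4 * K + 21) * dl).
 rewrite normrM (ger0_norm r0); apply: ler_pM => //.
 apply: (le_trans M1); apply: (le_trans (ler_wpM2l _ C)).
  exact: d4.
 by apply: le_of_eq; field; rewrite gt_eqF.
have T2 : `|(sb * q / sn - 1) * S| <= 4 * dl.
 rewrite normrM; apply: (@le_trans _ _ (M^-1 * (4 * M * dl))).
  apply: ler_pM => //; apply: (le_trans M2).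
  by rewrite ler_piMr// ger0_norm; lra.
 by apply: le_of_eq; field; rewrite gt_eqF.
have T3 : `|sb * q / sn * ((t - h) * (Wz Mn / q))| <= 2 * (2 * (4 * K + 21) * dl).
 rewrite normrM (ger0_norm r0); apply: ler_pM => //.
 rewrite normrM; apply: (@le_trans _ _ ((4 * K + 21) / M * (2 * (M * dl)))).
  apply: ler_pM => //; rewrite normrM (gtr0_norm (_ : 0 < q^-1)) ?invr_gt0// ler_pdivrMr//.
  apply: (le_trans Wm).
  by apply: le_of_eq; field; rewrite gt_eqF.
 by apply: le_of_eq; field; rewrite gt_eqF.
rewrite E; apply: (le_trans (ler_normB _ _)).
have -> : (50 * K + 290) * dl = 2 * (4 * (4 * K + 21) * dl) + 4 * dl + 2 * (2 * (4 * K + 21) * dl) + (2 * K + 34) * dl by ring.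
apply: lerD => //; apply: normD_le => //.
by apply: normD_le.
Qed.

End uniform_empirical.

(** * Exchanging the integral in the approximating walk *)

Section core_approximation.
Context {R : realType}.
Variables (L : nat) (H : R -> R).
Hypotheses (cH : continuous H) (H01 : forall v, 0 <= H v <= 1) (ssq0 : 0 < ssq H).
Notation Mn := (2 ^ L)%N.
Notation M := (pow2 L : R).
Notation s := (sig H).

Definition ssqM : R := \sum_(i < Mn) Iv L H i ^+ 2.

(** The unit vector whose linear form is the truncated integral, normalized. [swap_dir] along it
    exchanges that integral with the fresh normal. *)
Definition dirM i : R := Iv L H i / sqrt ssqM.

Hypothesis M_large : 2 / ssq H <= M.

Let M0 : 0 < M := pow2_gt0 L.

Lemma s_gt0 : 0 < s. Proof. by rewrite sqrtr_gt0. Qed.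

Lemma ssqM_close : `|ssq H - ssqM| <= M^-1.
Proof. exact: ssq_close. Qed.

Lemma sM_ge : s / 2 <= sqrt ssqM.
Proof.
have h : ssq H / 4 <= ssqM.
 have := ssqM_close; rewrite ler_norml => /andP[_ h].
 have : M^-1 <= ssq H / 2.
  by rewrite -(invrK (ssq H / 2)) lef_pV2 ?posrE ?invr_gt0 ?divr_gt0// invf_div.
 by move: (M^-1) ssq0 h => p q0 h h'; lra.
rewrite -(@ger0_norm _ (s / 2)) ?divr_ge0 ?(ltW s_gt0)// -sqrtr_sqr ler_wsqrtr//.
by rewrite expr_div_n sigK// -natrX.
Qed.

Lemma sM_gt0 : 0 < sqrt ssqM.
Proof. by apply: lt_le_trans sM_ge; rewrite divr_gt0// s_gt0. Qed.

Lemma sqr_sM : sqrt ssqM ^+ 2 = ssqM.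
Proof. by rewrite sqr_sqrtr// sumr_ge0// => i _; exact: sqr_ge0. Qed.

Lemma dirM_unit : \sum_(i < Mn) dirM i ^+ 2 = 1.
Proof.
rewrite /dirM; under eq_bigr do rewrite expr_div_n.
by rewrite -mulr_suml sqr_sM -/ssqM divff// gt_eqF// -sqr_sM exprn_gt0// sM_gt0.
Qed.

Lemma sM_close : `|sqrt ssqM - s| <= (M * s)^-1.
Proof.
have E : (sqrt ssqM - s) * (sqrt ssqM + s) = ssqM - ssq H.
 by rewrite -[in RHS]sqr_sM -[in RHS](sigK ssq0); ring.
have p0 : 0 < sqrt ssqM + s by rewrite addr_gt0 ?sM_gt0 ?s_gt0.
rewrite invfM -(ler_pM2r s_gt0) mulfVK ?gt_eqF ?s_gt0//.
apply: (le_trans _ ssqM_close); rewrite [leRHS]distrC -E normrM (gtr0_norm p0).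
by rewrite ler_wpM2l// lerDr ltW// sM_gt0.
Qed.

Lemma Jf_le1 u : 0 <= u <= 1 -> `|Jf H u| <= 1.
Proof.
move=> u01; apply: int01_norm_le; first exact: ok_cov.
move=> v _; have := H01 v; case/andP: u01 => u0 u1 /andP[h0 h1].
have m1 : Num.min u (H v) <= u by rewrite ge_min lexx.
have m2 : 0 <= Num.min u (H v) by rewrite le_min u0.
have : 0 <= u * H v <= 1 by rewrite mulr_ge0//= mulr_ile1.
by move: (u * H v) => p; rewrite ler_norml; lra.
Qed.

(** Removing the regression on the integral makes the core insensitive, up to truncation at level L,
    to a change of the coefficients along [dirM]. So it may be computed from the exchanged
    coefficients [zp], which are independent of [et], although the empirical process is built from
    [z]. *)
Lemma core_close (t K : R) (z : nat -> R) (et' v : R) (zp := shift_upto Mn dirM (et' - lincomb Mn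
 dirM z) z) (et := lincomb Mn dirM z) : 1 <= t -> tame t zp -> `|et| <= K -> `|et'| <= K -> `|(Bser
 L (H v) zp - rho H (H v) * IB L H zp) - (Sg L L (H v) z - Jf H (H v) / s * et)| <= (6 + 6 / ssq H
 + 4 * K / s + 4 * K / (s * ssq H)) * Dlev t L.
Proof.
move=> t1 tz hK hK'; set u := H v; have u01 : 0 <= u <= 1 := H01 v.
have t0 : 0 <= t := le_trans ler01 t1.
have K0 : 0 <= K := le_trans (normr_ge0 _) hK.
set d := Dlev t L; have d0 : 0 <= d := Dlev_ge0 _ _.
have Md : M^-1 <= d by rewrite -(ler_pM2l M0) divff ?gt_eqF//; exact: Mdl_ge1.
set sM := sqrt ssqM; have sM0 : 0 < sM := sM_gt0; have s0 := s_gt0; have sMs : s / 2 <= sM := sM_ge.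
pose Su := \sum_(i < Mn) psi L i u * Iv L H i.
have zpE i : (i < Mn)%N -> zp i = z i + dirM i * (et' - et) by move=> h; rewrite /zp /shift_upto h -/et; ring.
have S1 : Sg L L u zp = Sg L L u z + Su / sM * (et' - et).
 rewrite /Sg /Su !mulr_suml -big_split/=; apply: eq_bigr => i _.
 by rewrite zpE// /dirM -/sM; ring.
have S2 : \sum_(i < Mn) Iv L H i * zp i = sM * et'.
 transitivity (sM * et + sM * (et' - et)); last by ring.
 have E1 : sM * et = \sum_(i < Mn) Iv L H i * z i.
  rewrite /et /lincomb mulr_sumr; apply: eq_bigr => i _.
  by rewrite /dirM -/sM; field; rewrite gt_eqF.
 have E2 : sM = \sum_(i < Mn) Iv L H i * dirM i.
  rewrite /dirM -/sM; under eq_bigr do rewrite mulrA -expr2.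
  by rewrite -mulr_suml -/ssqM -sqr_sM -/sM expr2 mulfK// gt_eqF.
 rewrite E1 E2 mulr_suml -big_split/=; apply: eq_bigr => i _.
 by rewrite zpE//; ring.
have B1 := Bser_close u t0 tz (leqnn L).
have B2 := IB_close cH t0 tz (leqnn L); rewrite S2 -/sM in B2.
have B3 := Jf_close cH H01 (leqnn L) u01; rewrite -/Su in B3.
have B4 := ssqM_close; have J1 := Jf_le1 u01; set J := Jf H u in B3 J1 *.
rewrite S1 in B1.
set q := ssq H in B4 *.
have sq : s ^+ 2 = q := sigK ssq0.
have eE : `|et' - et| <= 2 * K.
 by apply: (le_trans (ler_normB _ _)); move: hK hK'; lra.
(* T1 and T2 truncate the series and its integral, T3 replaces the discrete covariance [Su] by J,
   and T4 and T5 replace the discrete variance and standard deviation by [ssq] and s. *)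
pose T1 := Bser L u zp - (Sg L L u z + Su / sM * (et' - et)).
pose T2 := rho H u * (IB L H zp - sM * et').
pose T3 := (Su - J) / sM * (et' - et).
pose T4 := J * ((q - ssqM) / (sM * q)) * et'.
pose T5 := J * ((sM - s) / (s * sM)) * et.
have -> : Bser L u zp - rho H u * IB L H zp - (Sg L L u z - J / s * et) = T1 - T2 + T3 + T4 + T5.
 rewrite /T1 /T2 /T3 /T4 /T5 -sqr_sM -/sM /rho -/J -/q -sq; field.
 by rewrite !gt_eqF.
have inv2 : sM^-1 <= 2 / s by rewrite -[2 / s]invf_div lef_pV2// posrE divr_gt0.
have iM0 : 0 <= sM^-1 by rewrite invr_ge0 ltW.
have is0 : 0 <= s^-1 by rewrite invr_ge0 ltW.
have iq0 : 0 <= q^-1 by rewrite invr_ge0 ltW.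
have n1 : `|T1| <= 6 * d by exact: B1.
have n2 : `|T2| <= 6 / q * d.
 rewrite normrM /rho normrM -/J -/q (ger0_norm iq0).
 rewrite (_ : 6 / q * d = 1 / q * (6 * d)); last by ring.
 by apply: ler_pM => //; [exact: mulr_ge0|exact: ler_wpM2r].
have n3 : `|T3| <= 4 * K / s * d.
 rewrite /T3 !normrM (ger0_norm iM0) distrC.
 have -> : 4 * K / s * d = d * (2 / s) * (2 * K) by ring.
 apply: ler_pM; rewrite ?mulr_ge0//; apply: ler_pM => //; exact: le_trans B3 Md.
have n4 : `|T4| <= 2 * K / (s * q) * d.
 rewrite /T4 !normrM.
 have -> : 2 * K / (s * q) * d = 1 * (d * (2 / s * q^-1)) * K by rewrite invfM; ring.
 apply: ler_pM; rewrite ?mulr_ge0//; apply: ler_pM; rewrite ?mulr_ge0//.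
 apply: ler_pM => //; first exact: le_trans B4 Md.
 by rewrite invfM normrM (ger0_norm iM0) (ger0_norm iq0) ler_wpM2r.
have n5 : `|T5| <= 2 * K / (s * q) * d.
 rewrite /T5 !normrM.
 have -> : 2 * K / (s * q) * d = 1 * ((d / s) * (s^-1 * (2 / s))) * K.
  by rewrite -sq; field; rewrite gt_eqF.
 apply: ler_pM; rewrite ?mulr_ge0//; apply: ler_pM; rewrite ?mulr_ge0//.
 apply: ler_pM => //.
  by apply: (le_trans sM_close); rewrite invfM ler_wpM2r.
 by rewrite invfM normrM (ger0_norm is0) (ger0_norm iM0) ler_wpM2l.
have -> : (6 + 6 / q + 4 * K / s + 4 * K / (s * q)) * d = 6 * d + 6 / q * d + 4 * K / s * d + 2 * K
 / (s * q) * d + 2 * K / (s * q) * d by ring.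
apply: normD_le => //.
apply: normD_le => //.
apply: normD_le => //.
by apply: (le_trans (ler_normB _ _)); apply: lerD.
Qed.

End core_approximation.

(** * The odds transform and its effect on the distribution function *)

Section odds.
Context {R : realType}.
Implicit Types v r x y : R.

(** Multiplies the odds v / (1 - v) by r. *)
Definition odds r v : R := v * r / (1 - v + v * r).

Lemma odds_den r v : 0 < r -> 0 <= v <= 1 -> 0 < 1 - v + v * r.
Proof.
move=> r0 /andP[v0 v1]; have [->|vn0] := eqVneq v 0; first by rewrite mul0r; lra.
have : 0 < v * r by rewrite mulr_gt0// lt_neqAle eq_sym vn0.
lra.
Qed.

Lemma odds01 r v : 0 < r -> 0 <= v <= 1 -> 0 <= odds r v <= 1.
Proof.
move=> r0 v01; have D := odds_den r0 v01; case/andP: v01 => v0 v1.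
rewrite divr_ge0 ?mulr_ge0 ?(ltW r0) ?(ltW D)//= ler_pdivrMr// mul1r; lra.
Qed.

Lemma odds_close r v : `|r - 1| <= 2^-1 -> 0 <= v <= 1 -> `|odds r v - v| <= `|r - 1| /\ `|odds r v
 - v - v * (1 - v) * (r - 1)| <= 2 * (r - 1) ^+ 2.
Proof.
move=> r2 v01; have r0 : 0 < r by move: r2; rewrite ler_norml; lra.
have D := odds_den r0 v01; have D2 : 2^-1 <= 1 - v + v * r.
 rewrite (_ : 1 - v + v * r = 1 + v * (r - 1)); last by ring.
 have : `|v * (r - 1)| <= 2^-1.
  by rewrite normrM (le_trans _ r2)// ler_piMl// ler_norml; lra.
 by rewrite ler_norml; move: (v * (r - 1)) => p; lra.
have iD : 0 <= (1 - v + v * r)^-1 <= 2.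
 by rewrite invr_ge0 (ltW D)/= -[leRHS]invrK lef_pV2// posrE.
have p01 := par01 v01.
have E1 : odds r v - v = v * (1 - v) * (1 - v + v * r)^-1 * (r - 1).
 by rewrite /odds; field; rewrite gt_eqF.
have E2 : odds r v - v - v * (1 - v) * (r - 1) = - (v * (1 - v) * v * (1 - v + v * r)^-1 * (r - 1)
 ^+ 2).
 by rewrite /odds; field; rewrite gt_eqF.
have q4 : v * (1 - v) <= 4^-1.
 have := sqr_ge0 (v - 2^-1); rewrite (_ : (v - 2^-1) ^+ 2 = 4^-1 - v * (1 - v)); last by field.
 lra.
move: p01 q4 E1 E2; set w := v * (1 - v); set iv := _^-1 in iD * => p01 q4 E1 E2.
case/andP: p01 => w0 w1; case/andP: iD => i0 i2; case/andP: v01 => v0 v1.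
have wi := mulr_ge0 w0 i0; have wvi := mulr_ge0 (mulr_ge0 w0 v0) i0.
have wv1 : w * v <= 1 by exact: mulr_ile1.
move: w iv w0 w1 i0 i2 wi wvi wv1 q4 E1 E2 => w iv w0 w1 i0 i2 wi wvi wv1 q4 E1 E2.
split.
 rewrite E1 normrM (ger0_norm wi); apply: ler_piMl => //.
 by apply: (@le_trans _ _ (4^-1 * 2)); [apply: ler_pM|lra].
rewrite E2 normrN normrM (ger0_norm wvi) (ger0_norm (sqr_ge0 _)) ler_wpM2r ?sqr_ge0//.
by rewrite -[leRHS]mul1r; apply: ler_pM => //; exact: mulr_ge0.
Qed.

Variable a : nat.
Notation H := (@Hc R a).

Lemma Hc_quad2 x y : 0 <= x <= 1 -> 0 <= y <= 1 -> `|H y - H x - bden a x * (y - x)| <= 2 * (bK a *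
 a%:R) * (y - x) ^+ 2.
Proof.
move=> x01 y01; have C0 : 0 <= bK a * a%:R :> R by rewrite mulr_ge0// ltW// bK_gt0.
have sq0 := sqr_ge0 (y - x).
have /orP[xy|yx] := le_total x y.
 apply: (le_trans (Hc_quad a (proj1 (andP x01)) xy (proj2 (andP y01)))).
 by have := mulr_ge0 C0 sq0; rewrite -[leRHS]mulrA; lra.
have h := Hc_quad a (proj1 (andP y01)) yx (proj2 (andP x01)).
have l := bden_lip a x01 y01.
rewrite (_ : H y - H x - _ = - (H x - H y - bden a y * (x - y)) + (bden a y - bden a x) * (y - x)); last by ring.
apply: (le_trans (ler_normD _ _)); rewrite normrN.
rewrite (_ : 2 * _ * _ = bK a * a%:R * (x - y) ^+ 2 + bK a * a%:R * (y - x) ^+ 2); last by ring.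
apply: lerD => //; rewrite normrM -[(y - x) ^+ 2]real_normK ?num_real// expr2 mulrA.
by rewrite ler_wpM2r.
Qed.

Lemma Hc_lip2 x y : 0 <= x <= 1 -> 0 <= y <= 1 -> `|H y - H x| <= bK a * `|y - x|.
Proof.
move=> /andP[x0 x1] /andP[y0 y1]; have /orP[xy|yx] := le_total x y.
 by rewrite !ger0_norm ?subr_ge0 ?Hc_nd//; exact: Hc_lip.
by rewrite distrC (distrC y) !ger0_norm ?subr_ge0 ?Hc_nd//; exact: Hc_lip.
Qed.

(** The derivative of [odds] in r at r = 1 is v (1 - v); multiplied by the density it is [phiK].
    Both expansions have remainders quadratic in r - 1. *)
Lemma Hc_odds r v : `|r - 1| <= 2^-1 -> 0 <= v <= 1 -> `|H (odds r v) - H v - phiK a v * (r - 1)| <=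
 bK a * (2 * a%:R + 2) * (r - 1) ^+ 2.
Proof.
move=> r2 v01; have r0 : 0 < r by move: r2; rewrite ler_norml; lra.
have o01 := odds01 r0 v01; have [c1 c2] := odds_close r2 v01.
have q := Hc_quad2 v01 o01.
have b0 := bden_ge0 a v01; have b1 := bden_le a v01.
have pE : phiK a v = bden a v * (v * (1 - v)) by rewrite /phiK /bden exprSr mulrA.
rewrite (_ : _ - _ - _ = (H (odds r v) - H v - bden a v * (odds r v - v)) + bden a v * (odds r v - v
 - v * (1 - v) * (r - 1))); last by rewrite pE; ring.
apply: (le_trans (ler_normD _ _)).
rewrite (_ : bK a * _ * _ = 2 * (bK a * a%:R) * (r - 1) ^+ 2 + bK a * (2 * (r - 1) ^+ 2)); last by ring.
apply: lerD.
 apply: (le_trans q); rewrite ler_wpM2l ?mulr_ge0// ?(ltW (bK_gt0 _))//.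
 by rewrite -sqr_normr// -[leRHS]real_normK ?num_real// lerXn2r ?nnegrE.
by rewrite normrM (ger0_norm b0); apply: ler_pM.
Qed.

Lemma ratio_expand (x y k : R) : `|x| <= k -> `|y| <= k -> k <= 4^-1 -> let r := (1 + x) / (1 + y)
 in [/\ `|r - 1| <= 3 * k & `|r - 1 - (x - y)| <= 3 * k ^+ 2].
Proof.
move=> xk yk k4 r; have k0 : 0 <= k := le_trans (normr_ge0 _) xk.
have y1 : 3 / 4 <= 1 + y by move: yk; rewrite ler_norml; lra.
have y0 : 0 < 1 + y by lra.
have E1 : r - 1 = (x - y) / (1 + y) by rewrite /r; field; rewrite gt_eqF.
have E2 : r - 1 - (x - y) = - (x - y) * y / (1 + y) by rewrite /r; field; rewrite gt_eqF.
have xy : `|x - y| <= 2 * k by apply: (le_trans (ler_normB _ _)); lra.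
have iv : `|(1 + y)^-1| <= 3 / 2.
 rewrite ger0_norm ?invr_ge0 ?(ltW y0)//; apply: (@le_trans _ _ ((3 / 4)^-1)).
  by rewrite lef_pV2 ?posrE//; lra.
 by rewrite invf_div; lra.
split.
 rewrite E1 normrM (_ : 3 * k = 2 * k * (3 / 2)); last by field.
 exact: ler_pM.
rewrite E2 !normrM normrN (_ : 3 * k ^+ 2 = 2 * k * k * (3 / 2)); last by field.
by apply: ler_pM; rewrite ?mulr_ge0//; apply: ler_pM.
Qed.

(* The integral of the time-changed empirical process is minus the centered mean. *)
Lemma int_ecount n (V : nat -> R) : (0 < n)%N -> (forall k, (k < n)%N -> 0 <= V k <= 1) -> int01
 (fun s => sqrt n%:R * ((ecount n (H \o V) (H s))%:R / n%:R - H s)) = - (\sum_(k < n) (V k - 2^-1))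
 / sqrt n%:R.
Proof.
move=> n0 V01; have N0 : 0 < n%:R :> R by rewrite ltr0n.
pose st (c s : R) : R := if c <= s then 1 else 0.
have okst c : ok01 (st c).
 split; first by apply: measurable_fun_ifT => //; exact: measurable_fun_ler.
 by exists 1 => s _; rewrite /st; case: ifP; rewrite ?normr0 ?normr1.
have ist c : 0 <= c <= 1 -> int01 (st c) = 1 - c.
 move=> /andP[c0 c1].
 have -> : int01 (st c) = fine (\int[@lebesgue_measure R]_(s in `[0%R, 1%R]) ((\1_(`[c,
  +oo[%classic : set (measurableTypeR R)) s : R)%:E))%E.
  congr fine; apply: eq_integral => s _.
  by rewrite /st indicE mem_setE in_itv/= andbT; case: leP.
 rewrite integral_indic//.
 have -> : (`[c, +oo[%classic : set (measurableTypeR R)) `&` `[0, 1]%classic = `[c, 1]%classic.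
  by apply/seteqP; split => s /=; rewrite !in_itv/= andbT; lra.
 exact: (congr1 fine (leb_itv c1)).
have okH : ok01 H by apply: ok01_cont; exact: Hc_continuous.
have oks : ok01 (fun s => \sum_(k < n) st (V k) s).
 by apply: (ok01_sum (F := fun k s => st (V k) s)) => k _; exact: okst.
transitivity (int01 (fun s => (sqrt n%:R)^-1 * (\sum_(k < n) st (V k) s - n%:R * H s))).
 apply: eq_int01 => s s01; rewrite ecountE.
 have -> : \sum_(k < n) ((H \o V) k <= H s)%R%:R = \sum_(k < n) st (V k) s :> R.
  apply: eq_bigr => k _; rewrite /st /=; have /andP[k0 k1] := V01 k (ltn_ord k).
  case: (leP (V k) s) => [h|h].
   by rewrite Hc_nd.
  by rewrite leNgt Hc_lt//; case/andP: s01.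
 have s0 : sqrt n%:R != 0 :> R by rewrite gt_eqF// sqrtr_gt0.
 have qE : n%:R = sqrt n%:R * sqrt n%:R :> R by rewrite -expr2 sqr_sqrtr// ltW.
 move: (\sum_(k < n) _) (sqrt _) s0 (H s) qE => S q q0 h ->.
 by field.
rewrite int01Z; last by apply: ok01B => //; exact: ok01Z.
rewrite int01B ?int01Z ?int01_Hc//; last exact: ok01Z.
rewrite (int01_sum (F := fun k s => st (V k) s)) => [|k _]; last exact: okst.
rewrite (eq_bigr (fun k : 'I_n => 1 - V k)) => [|k _]; last by rewrite ist// V01.
rewrite !sumrB !sumr_const card_ord -mulr_natl; field.
by rewrite mulr1 gt_eqF// sqrtr_gt0.
Qed.

End odds.

(** * Selected and leftover spacings *)

Section selection.
Variables (m N n1 : nat) (i : nat -> nat).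
Hypotheses (m0 : (0 < m)%N) (adm : admissible m n1 N i).

Let pos j := (i (j %/ m) + j %% m)%N.

Lemma adm_gap k k' : (k < k')%N -> (k' <= N)%N -> (i k + m <= i k')%N.
Proof.
elim: k' => [//|k' IH]; rewrite ltnS leq_eqVlt => /predU1P[->|kk'] k'N.
 by case: (adm.1 k' k'N).
have h := IH kk' (ltnW k'N); have [h1 _] := adm.1 k' k'N.
by apply: (leq_trans h); exact: ltnW.
Qed.

Lemma pos_lt j j' : (j < j')%N -> (j' < N.+1 * m)%N -> (pos j < pos j')%N.
Proof.
move=> jj' j'n; have k'N : (j' %/ m <= N)%N by rewrite -ltnS ltn_divLR.
have := leq_div2r m (ltnW jj'); rewrite leq_eqVlt => /predU1P[E|kk'].
 have := jj'; rewrite {1}(divn_eq j m) {1}(divn_eq j' m) E ltn_add2l => h.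
 by rewrite /pos E ltn_add2l.
have h := adm_gap kk' k'N; apply: leq_trans (leq_trans h (leq_addr _ _)).
by rewrite /pos ltn_add2l ltn_pmod.
Qed.

Lemma pos_bound j : (j < N.+1 * m)%N -> (pos j < n1.+1)%N.
Proof.
move=> jn; have kN : (j %/ m <= N)%N by rewrite -ltnS ltn_divLR.
apply: (@leq_trans (i (j %/ m) + m)); first by rewrite /pos ltn_add2l ltn_pmod.
apply: leq_trans adm.2; move: kN; rewrite leq_eqVlt => /predU1P[->//|kN].
by apply: (leq_trans (adm_gap kN (leqnn N))); exact: leq_addr.
Qed.

Lemma pos_inj j j' : (j < N.+1 * m)%N -> (j' < N.+1 * m)%N -> pos j = pos j' -> j = j'.
Proof.
move=> jn j'n E; case: (ltngtP j j') => // h.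
 by have := pos_lt h j'n; rewrite E ltnn.
by have := pos_lt h jn; rewrite E ltnn.
Qed.

Let sel := map pos (iota 0 (N.+1 * m)).
Let left := [seq l <- iota 0 n1.+1 | l \notin sel].

Lemma sel_uniq : uniq sel.
Proof.
rewrite map_inj_in_uniq ?iota_uniq// => j j'; rewrite !mem_iota /= !add0n.
exact: pos_inj.
Qed.

Lemma sel_perm : perm_eq (iota 0 n1.+1) (sel ++ left).
Proof.
apply: uniq_perm; first exact: iota_uniq.
 rewrite cat_uniq sel_uniq filter_uniq ?iota_uniq// andbT/=.
 by apply/hasPn => l; rewrite mem_filter => /andP[].
move=> l; rewrite mem_cat mem_filter; case: (boolP (l \in sel)) => //=.
by case/mapP => j; rewrite mem_iota add0n/= => jn ->; rewrite -[_ :: _]/(iota 0 n1.+1) mem_iota add0n pos_bound.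
Qed.

Lemma selection : exists (a b : nat -> nat) (r : nat), [/\ injective a, injective b, forall x y, a x
 <> b y, (N.+1 * m + r)%N = n1.+1 & (forall k l, (k <= N)%N -> (l < m)%N -> a (k * m + l)%N = (i k
 + l)%N) /\ forall (R : realType) (e : nat -> R), \sum_(l < n1.+1) e l = \sum_(j < N.+1 * m) e (a
 j) + \sum_(j < r) e (b j)].
Proof.
(* Past its finite part, [a] adds even numbers to n1 + 1 and [b] odd ones: the values lie outside
   the sample and have different parities. *)
pose a j := if (j < N.+1 * m)%N then pos j else (n1.+1 + j.*2)%N.
pose b j := if (j < size left)%N then nth 0%N left j else (n1.+1 + j.*2.+1)%N.
have left_lt j : (j < size left)%N -> (nth 0%N left j < n1.+1)%N.
 by move=> /(mem_nth 0%N); rewrite mem_filter mem_iota add0n => /andP[_].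
have left_notin j : (j < size left)%N -> nth 0%N left j \notin sel.
 by move=> /(mem_nth 0%N); rewrite mem_filter => /andP[].
have left_uniq : uniq left by rewrite filter_uniq ?iota_uniq.
exists a, b, (size left); split.
- move=> j j'; rewrite /a; case: ltnP => h; case: ltnP => h' E.
 + exact: pos_inj.
 + by have := pos_bound h; rewrite E; lia.
 + by have := pos_bound h'; rewrite -E; lia.
 + lia.
- move=> j j'; rewrite /b; case: ltnP => h; case: ltnP => h' E.
 + by apply/eqP; rewrite -(nth_uniq 0%N h h' left_uniq); apply/eqP.
 + by have := left_lt _ h; rewrite E; lia.
 + by have := left_lt _ h'; rewrite -E; lia.
 + lia.
- move=> j j'; rewrite /a /b; case: ltnP => h; case: ltnP => h' E.
 + have := left_notin _ h'; rewrite -E => /negP; apply.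
  by apply/mapP; exists j => //; rewrite mem_iota.
 + by have := pos_bound h; rewrite E; lia.
 + by have := left_lt _ h'; rewrite -E; lia.
 + lia.
- by have := perm_size sel_perm; rewrite size_cat size_map !size_iota.
split.
 move=> k l kN lm; rewrite /a /pos divnMDl// divn_small// addn0 modnMDl modn_small//.
 rewrite ifT//; apply: (@leq_trans (k.+1 * m)); first by rewrite mulSn addnC ltn_add2r.
 by rewrite leq_mul2r ltnS kN orbT.
move=> R e; have -> : \sum_(l < n1.+1) e l = \sum_(l <- iota 0 n1.+1) e l.
 by rewrite -[in RHS](subn0 n1.+1) -/(index_iota 0 n1.+1) big_mkord.
rewrite (perm_big _ sel_perm) big_cat/=; congr (_ + _).
 rewrite /sel big_map -[X in iota 0 X](subn0 (N.+1 * m)) -/(index_iota 0 (N.+1 * m)) big_mkord.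
 by apply: eq_bigr => j _; rewrite /a ltn_ord.
by rewrite (big_nth 0%N) big_mkord; apply: eq_bigr => j _; rewrite /b ltn_ord.
Qed.

End selection.

(** * Ratios of spacings in terms of beta variables *)

Section ratio_events.
Context {R : realType}.

(** Dividing G by c1 and G' by c2 divides the odds G / G' by r = c1 / c2, which amounts to
    multiplying the odds of the threshold v by r. If G = G' = 0 both quotients are 0 and both
    inequalities hold. *)
Lemma ratio_le_odds (c1 c2 G G' v : R) : 0 < c1 -> 0 < c2 -> 0 <= G -> 0 <= G' -> 0 <= v <= 1 -> (G
 / c1 / (G / c1 + G' / c2) <= v) = (G / (G + G') <= odds (c1 / c2) v).
Proof.
move=> c10 c20 G0 G'0 v01; have r0 : 0 < c1 / c2 by rewrite divr_gt0.
have D := odds_den r0 v01; have /andP[od0 _] := odds01 r0 v01.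
have [GG|GG] := eqVneq (G + G') 0.
 have -> : G = 0 by lra.
 by rewrite !mul0r od0; case/andP: v01.
have GG0 : 0 < G + G' by rewrite lt_neqAle eq_sym GG addr_ge0.
have d0 : 0 < G / c1 + G' / c2.
 have [G00|Gn] := eqVneq G 0.
  by rewrite G00 mul0r add0r divr_gt0//; move: GG0; rewrite G00 add0r.
 by rewrite ltr_pwDl ?divr_ge0 ?(ltW c20)// divr_gt0// lt_neqAle eq_sym Gn.
rewrite ler_pdivrMr// [RHS]ler_pdivrMr// /odds [X in _ = (_ <= X)]mulrAC ler_pdivlMr//.
rewrite -subr_ge0 -[in RHS]subr_ge0 -(pmulr_rge0 _ c10); congr (0 <= _).
by field; rewrite !gt_eqF.
Qed.

Variables (a : nat).
Notation m := a.+1.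
Notation H := (@Hc R a).

(** The scale factors are common to all ratios, so gamma_N at v involves the empirical process of
    the V_k at the single displaced point [odds r v]. *)
Lemma gamma_processE n1 n2 N (i j : nat -> nat) (x y eX eY V : nat -> R) (TX TY v : R) (r := (TX /
 (nblocks m n1).+1%:R) / (TY / (nblocks m n2).+1%:R)) : (forall k, (k <= N)%N -> (i k + m <=
 n1.+1)%N /\ (j k + m <= n2.+1)%N) -> 0 < TX -> 0 < TY -> (forall l, 0 <= eX l) -> (forall l, 0 <=
 eY l) -> (forall l, (l <= n1)%N -> eX l = TX * (order_stat x n1 l.+1 - order_stat x n1 l)) ->
 (forall l, (l <= n2)%N -> eY l = TY * (order_stat y n2 l.+1 - order_stat y n2 l)) -> (forall k, (k
 <= N)%N -> V k = (\sum_(l < m) eX (i k + l)%N) / (\sum_(l < m) eX (i k + l)%N + \sum_(l < m) eY (j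
 k + l)%N)) -> 0 <= v <= 1 -> gamma_process m n1 n2 N i j x y v = sqrt N.+1%:R * ((ecount N.+1 (H
 \o V) (H (odds r v)))%:R / N.+1%:R - H v).
Proof.
move=> bnd TX0 TY0 eX0 eY0 eXE eYE VE v01; rewrite /gamma_process HbetaE//; congr (_ * (_ - _)).
rewrite /ratio_edf mulrC ecountE; congr (_ / _); apply: eq_bigr => k _.
have kN : (k <= N)%N by rewrite -ltnS.
have [bi bj] := bnd k kN.
have tel (e : nat -> R) T X n0 i0 : (i0 + m <= n0.+1)%N -> (forall l, (l <= n0)%N -> e l = T *
 (order_stat X n0 l.+1 - order_stat X n0 l)) -> \sum_(l < m) e (i0 + l)%N = T * m_spacing m X n0
 i0.
 move=> h eE; rewrite /m_spacing; move: h; elim: (m) => [|m' IH] h.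
  by rewrite big_ord0 addn0 subrr mulr0.
 rewrite big_ord_recr/= IH; last by apply: leq_trans h; rewrite leq_add2l.
 by rewrite eE ?addnS//; [ring|rewrite -ltnS -addnS].
have c0 q : 0 < (nblocks m q).+1%:R :> R by rewrite ltr0n.
have GX := tel _ _ _ _ _ bi eXE; have GY := tel _ _ _ _ _ bj eYE.
set G := \sum_(l < m) eX (i k + l)%N in GX; set G' := \sum_(l < m) eY (j k + l)%N in GY.
have G0 : 0 <= G by apply: sumr_ge0.
have G'0 : 0 <= G' by apply: sumr_ge0.
rewrite /spacing_ratio.
have -> : (nblocks m n1).+1%:R * m_spacing m x n1 (i k) = G / (TX / (nblocks m n1).+1%:R).
 by rewrite GX; field; rewrite !gt_eqF.
have -> : (nblocks m n2).+1%:R * m_spacing m y n2 (j k) = G' / (TY / (nblocks m n2).+1%:R).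
 by rewrite GY; field; rewrite !gt_eqF.
have C1 : 0 < TX / (nblocks m n1).+1%:R by rewrite divr_gt0.
have C2 : 0 < TY / (nblocks m n2).+1%:R by rewrite divr_gt0.
rewrite (ratio_le_odds C1 C2 G0 G'0 v01) -/r /= VE// -/G -/G'.
have V01 : 0 <= G / (G + G') <= 1.
 rewrite divr_ge0 ?addr_ge0//=; have [->|nz] := eqVneq (G + G') 0; first by rewrite invr0 mulr0.
 by rewrite ler_pdivrMr ?mul1r ?lerDl// lt_neqAle eq_sym nz addr_ge0.
have r0 : 0 < r by rewrite divr_gt0.
have o01 := odds01 r0 v01.
congr (_%:R); congr nat_of_bool; case: (leP (G / (G + G')) (odds r v)) => h; first by rewrite Hc_nd.
apply/esym/negbTE; rewrite -ltNge; apply: Hc_lt => //; first by case/andP: o01.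
by case/andP: V01.
Qed.

End ratio_events.

(** * Linearization of the scale ratio *)

Section expansion.
Context {R : realType}.
Implicit Types (K : R) (m n : nat).

Lemma total_close m n n1 M1 (T K : R) : (0 < m)%N -> (0 < n)%N -> (n <= M1)%N -> (M1 * m <= n1.+1)%N
 -> (n1.+1 < M1 * m + m)%N -> 1 <= K -> `|T - n1.+1%:R| <= K * sqrt n1.+1%:R -> `|T / (m%:R *
 M1%:R) - 1| <= 3 * K / sqrt n%:R.
Proof.
move=> m0 n0 nM l1 l2 K1 hT; set D : R := m%:R * M1%:R.
have M10 : (0 < M1)%N := leq_trans n0 nM.
have D0 : 0 < D by rewrite mulr_gt0 ?ltr0n.
have sn0 : 0 < sqrt n%:R :> R by rewrite sqrtr_gt0 ltr0n.
have sD0 : 0 < sqrt D by rewrite sqrtr_gt0.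
have DE : sqrt D * sqrt D = D by rewrite -expr2 sqr_sqrtr// ltW.
have DN : D = (M1 * m)%:R by rewrite /D mulrC natrM.
have d1 : D <= n1.+1%:R by rewrite DN ler_nat.
have d2 : n1.+1%:R <= D + m%:R by rewrite DN -natrD ler_nat ltnW.
have mD : m%:R <= D by rewrite DN ler_nat leq_pmull.
have s2 : sqrt n1.+1%:R <= 2 * sqrt D.
 rewrite -[leRHS]ger0_norm ?mulr_ge0 ?sqrtr_ge0// -sqrtr_sqr ler_wsqrtr//.
 by rewrite exprMn sqr_sqrtr ?(ltW D0)//; lra.
have snD : sqrt n%:R <= sqrt D.
 rewrite ler_wsqrtr// DN ler_nat (leq_trans nM)// leq_pmulr//.
have K0 : 0 <= K := le_trans ler01 K1.
have h : `|T - D| <= 2 * K * sqrt D + m%:R.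
 rewrite (_ : T - D = (T - n1.+1%:R) + (n1.+1%:R - D)); last by ring.
 apply: normD_le.
  by apply: (le_trans hT); rewrite mulrAC mulrC ler_wpM2r.
 by rewrite ger0_norm; lra.
rewrite (_ : T / D - 1 = (T - D) / D); last by field; rewrite gt_eqF.
rewrite normrM [X in _ * X]gtr0_norm ?invr_gt0// ler_pdivrMr//; apply: (le_trans h).
have -> : 3 * K / sqrt n%:R * D = 2 * K * sqrt D * (sqrt D / sqrt n%:R) + K * (D / sqrt n%:R).
 move: (sqrt D) (sqrt n%:R) DE sn0 => sD sn <- sn0.
 by field; rewrite gt_eqF.
apply: lerD.
 by rewrite ler_peMr ?mulr_ge0 ?sqrtr_ge0// ler_pdivlMr// mul1r.
rewrite -[leLHS]mul1r; apply: ler_pM => //.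
rewrite ler_pdivlMr// DN mulnC natrM ler_wpM2l//.
apply: (@le_trans _ _ n%:R); last by rewrite ler_nat.
rewrite -[leRHS]sqr_sqrtr// expr2 ler_peMl ?sqrtr_ge0//.
by rewrite -[leLHS]sqrtr1 ler_wsqrtr// ler1n.
Qed.

(** What remains of sqrt n (r - 1), to first order, once the sum of the V_k - 1/2 is taken out: it
    is centered given the V_k. The leftover sums have r1 + 1 and r2 + 1 terms, one of them beyond
    the sample, so that they are never empty and each is a gamma variable. *)
Definition lead_term m n (A a1 a2 : R) r1 r2 (V S lX lY : nat -> R) : R := (m%:R * sqrt n%:R)^-1 *
 (\sum_(k < n) (S k - (2 * m)%:R) * (A * V k - a2) + a1 * (\sum_(l < r1.+1) lX l - r1.+1%:R) - a2 *
 (\sum_(l < r2.+1) lY l - r2.+1%:R)).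

(** Replacing S_k by (S_k - 2 m) + 2 m separates the part centered given the V_k from a multiple of
    the sum of the V_k - 1/2. The last bracket comes from the extra leftover terms and from n1 + 1
    and n2 + 1 not being multiples of m. *)
Lemma ratio_lead m n n1 n2 M1 M2 r1 r2 (TX TY : R) (V S lX lY : nat -> R) (a1 := n%:R / M1%:R : R)
 (a2 := n%:R / M2%:R : R) : (0 < m)%N -> (0 < n)%N -> (0 < M1)%N -> (0 < M2)%N -> (n * m + r1 =
 n1.+1)%N -> (n * m + r2 = n2.+1)%N -> TX = \sum_(k < n) V k * S k + \sum_(l < r1) lX l -> TY =
 \sum_(k < n) (1 - V k) * S k + \sum_(l < r2) lY l -> sqrt n%:R * (TX / (m%:R * M1%:R) - 1 - (TY /
 (m%:R * M2%:R) - 1)) = lead_term m n (a1 + a2) a1 a2 r1 r2 V S lX lY + 2 * (a1 + a2) * (\sum_(k <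
 n) (V k - 2^-1) / sqrt n%:R) + (m%:R * sqrt n%:R)^-1 * (a2 * (lY r2 - 1) - a1 * (lX r1 - 1) + a1 *
 (n1.+1%:R - m%:R * M1%:R) - a2 * (n2.+1%:R - m%:R * M2%:R)).
Proof.
move=> m0 n0 M10 M20 e1 e2 hX hY.
have sn0 : sqrt n%:R != 0 :> R by rewrite gt_eqF// sqrtr_gt0 ltr0n.
have nE : n%:R = sqrt n%:R * sqrt n%:R :> R by rewrite -expr2 sqr_sqrtr.
pose p := \sum_(k < n) V k * S k; pose q := \sum_(k < n) S k; pose b := \sum_(k < n) V k.
have E1 : \sum_(k < n) (S k - (2 * m)%:R) * ((a1 + a2) * V k - a2) = (a1 + a2) * p - a2 * q - (2 *
 m)%:R * ((a1 + a2) * b) + n%:R * ((2 * m)%:R * a2).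
 rewrite /p /q /b !mulr_sumr -sumrB -sumrB.
 have -> : n%:R * ((2 * m)%:R * a2) = \sum_(k < n) ((2 * m)%:R * a2).
  by rewrite sumr_const card_ord mulr_natl.
 by rewrite -big_split/=; apply: eq_bigr => k _; ring.
have E2 : \sum_(k < n) (1 - V k) * S k = q - p.
 by rewrite /p /q -sumrB; apply: eq_bigr => k _; ring.
have E3 : \sum_(k < n) (V k - 2^-1) / sqrt n%:R = (b - n%:R / 2) / sqrt n%:R.
 by rewrite -mulr_suml sumrB sumr_const card_ord -(mulr_natl 2^-1 n).
rewrite hX hY /lead_term E1 E2 E3 -/p !big_ord_recr/= -e1 -e2.
clear E1 E2 E3; clearbody p q b; move: (\sum_(l < r1) lX l) (\sum_(l < r2) lY l) => sX sY.
rewrite !natrD !natrM -[r1.+1%:R]natr1 -[r2.+1%:R]natr1 /a1 /a2.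
move: (sqrt _) sn0 nE => sn sn0 nE.
have M1n : M1%:R != 0 :> R by rewrite pnatr_eq0 -lt0n.
have M2n : M2%:R != 0 :> R by rewrite pnatr_eq0 -lt0n.
have mn : m%:R != 0 :> R by rewrite pnatr_eq0 -lt0n.
rewrite nE; field.
by rewrite mn sn0 M1n M2n.
Qed.

End expansion.

(** * Deterministic approximation of gamma_N on a good event *)

Section gamma_close.
Context {R : realType}.
Variables (a L N : nat) (t K C1 C7 : R).
Notation m := a.+1.
Notation n := N.+1.
Notation H := (@Hc R a).
Notation Mn := (2 ^ L)%N.
Notation M := (pow2 L : R).
Notation dl := (Dlev t L : R).
Notation s := (sig H).
Hypotheses (n_ge : (Mn * Mn <= n)%N) (t1 : 1 <= t) (K1 : 1 <= K) (K24 : 24 * K <= M) (M_large : 2 /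
 ssq H <= M) (C10 : 0 <= C1).
Variables (n1 n2 : nat) (i j : nat -> nat) (r1 r2 : nat).
Notation M1 := (nblocks m n1).+1.
Notation M2 := (nblocks m n2).+1.
Hypotheses (nM1 : (n <= M1)%N) (nM2 : (n <= M2)%N) (n1_blk : (M1 * m <= n1.+1 < M1 * m + m)%N)
 (n2_blk : (M2 * m <= n2.+1 < M2 * m + m)%N) (ij_bnd : forall k, (k <= N)%N -> (i k + m <= n1.+1)%N
 /\ (j k + m <= n2.+1)%N) (r1E : (n * m + r1 = n1.+1)%N) (r2E : (n * m + r2 = n2.+1)%N).
Variables (x y eX eY V S lX lY z : nat -> R) (TX TY et' zeta q : R).
Notation a1 := (n%:R / M1%:R : R).
Notation a2 := (n%:R / M2%:R : R).
Notation A := (a1 + a2).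
Hypotheses (eX0 : forall l, 0 <= eX l) (eY0 : forall l, 0 <= eY l) (eXE : forall l, (l <= n1)%N ->
 eX l = TX * (order_stat x n1 l.+1 - order_stat x n1 l)) (eYE : forall l, (l <= n2)%N -> eY l = TY
 * (order_stat y n2 l.+1 - order_stat y n2 l)).
Let G k := \sum_(l < m) eX (i k + l)%N.
Let G' k := \sum_(l < m) eY (j k + l)%N.
Hypotheses (VE : forall k, (k <= N)%N -> V k = G k / (G k + G' k)) (SE : forall k, (k <= N)%N -> S k
 = G k + G' k) (sumX : \sum_(l < n1.+1) eX l = \sum_(k < n) G k + \sum_(l < r1) lX l) (sumY :
 \sum_(l < n2.+1) eY l = \sum_(k < n) G' k + \sum_(l < r2) lY l) (devX : `|\sum_(l < n1.+1) (eX l -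
 1)| <= K * sqrt n1.+1%:R) (devY : `|\sum_(l < n2.+1) (eY l - 1)| <= K * sqrt n2.+1%:R) (lX1 : `|lX
 r1 - 1| <= K) (lY1 : `|lY r2 - 1| <= K) (z_tame : tame t z).
Hypothesis alpha : forall h, 0 <= h <= 1 -> `|sqrt n%:R * ((ecount n (H \o V) h)%:R / n%:R - h) - Sg
 L L h z| <= C1 * dl.
Let et := lincomb Mn (dirM L H) z.
Let zp := shift_upto Mn (dirM L H) (et' - et) z.
Hypotheses (zp_tame : tame t zp) (et_le : `|et| <= K) (et'_le : `|et'| <= K) (lead : `|lead_term m n
 A a1 a2 r1 r2 V S lX lY - q * zeta| <= C7 * dl).

Definition gamma_const : R := (6 + 6 / ssq H + 4 * K / s + 4 * K / (s * ssq H)) + (C1 + 36 * bK a *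
 K + 81 * (bK a * (2 * a%:R + 2)) * K ^+ 2 + 27 * bK a * K ^+ 2 + bK a * (2 * K + 2) + bK a * C7 +
 4 * bK a * (C1 + K / s)).

Let M0 : 0 < M := pow2_gt0 L.

Lemma norm01 (p : R) : 0 <= p <= 1 -> `|p| <= 1.
Proof. by move=> /andP[p0 p1]; rewrite ger0_norm. Qed.

Lemma norm01_add (p p' : R) : 0 <= p <= 1 -> 0 <= p' <= 1 -> `|2 * (p + p')| <= 4.
Proof. by move=> h h'; rewrite ger0_norm; lra. Qed.

Lemma eps4_le (k k' c p1 p2 p3 p4 : R) : k <= k' -> `|p1| <= k -> `|p2| <= k -> 0 <= p3 <= c -> 0 <=
 p4 <= c -> `|p1 - p2 + p3 - p4| <= 2 * k' + 2 * c.
Proof. by move=> kk; rewrite !ler_norml; lra. Qed.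

Lemma dl_ge : M^-1 <= dl.
Proof. by rewrite -(ler_pM2l M0) divff ?gt_eqF//; exact: Mdl_ge1. Qed.

Lemma sqrt_n_inv : (sqrt n%:R)^-1 <= M^-1.
Proof.
rewrite lef_pV2 ?posrE ?sqrtr_gt0//.
rewrite -[leLHS]ger0_norm ?(ltW M0)// -sqrtr_sqr ler_wsqrtr//.
by rewrite expr2 /pow2 -natrM ler_nat.
Qed.

Lemma telescope_total (e u : nat -> R) T p : (forall l, (l <= p)%N -> e l = T * (order_stat u p l.+1
 - order_stat u p l)) -> T = \sum_(l < p.+1) e l.
Proof.
move=> eE; suff h k : (k <= p.+1)%N -> \sum_(l < k) e l = T * order_stat u p k.
 by rewrite h// order_stat_big// mulr1.
elim: k => [|k IH] kp; first by rewrite big_ord0 mulr0.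
by rewrite big_ord_recr/= IH ?eE//; [ring|exact: ltnW].
Qed.

Lemma gamma_close v : 0 <= v <= 1 -> `|gamma_process m n1 n2 N i j x y v - (bridge_core L a v zp +
 phiK a v * ((lam0 a - 2 * A) * s * et + q * zeta))| <= gamma_const * dl.
Proof.
move=> v01.
have d0 : 0 <= dl := Dlev_ge0 _ _.
pose sn : R := sqrt n%:R; have sn0 : 0 < sn by rewrite sqrtr_gt0.
have snM : sn^-1 <= M^-1 := sqrt_n_inv.
have snd : sn^-1 <= dl := le_trans snM dl_ge.
have snE : n%:R = sn * sn by rewrite -expr2 sqr_sqrtr.
have isn0 : 0 <= sn^-1 by rewrite invr_ge0 ltW.
have K0 : 0 <= K := le_trans ler01 K1.
have G0 k : 0 <= G k by apply: sumr_ge0.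
have G'0 k : 0 <= G' k by apply: sumr_ge0.
have GV k : (k <= N)%N -> G k = V k * S k /\ G' k = (1 - V k) * S k.
 move=> kN; rewrite VE// SE//; have [E|E] := eqVneq (G k + G' k) 0.
  by move: (G0 k) (G'0 k) => g0 g0'; rewrite E !mulr0; split; lra.
 by split; field.
have V01 k : (k < n)%N -> 0 <= V k <= 1.
 rewrite ltnS => kN; rewrite VE// divr_ge0 ?addr_ge0//=.
 have [->|nz] := eqVneq (G k + G' k) 0; first by rewrite invr0 mulr0.
 by rewrite ler_pdivrMr ?mul1r ?lerDl// lt_neqAle eq_sym nz addr_ge0.
have TXE := telescope_total eXE; have TYE := telescope_total eYE.
have dX : `|TX - n1.+1%:R| <= K * sqrt n1.+1%:R.
 by move: devX; rewrite sumrB sumr_const card_ord -TXE.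
have dY : `|TY - n2.+1%:R| <= K * sqrt n2.+1%:R.
 by move: devY; rewrite sumrB sumr_const card_ord -TYE.
have /andP[n1a n1b] := n1_blk; have /andP[n2a n2b] := n2_blk.
have X1 := total_close (ltn0Sn a) (ltn0Sn N) nM1 n1a n1b K1 dX.
have Y1 := total_close (ltn0Sn a) (ltn0Sn N) nM2 n2a n2b K1 dY.
set xr := TX / (m%:R * M1%:R) - 1 in X1; set yr := TY / (m%:R * M2%:R) - 1 in Y1.
pose k := 3 * K / sn.
have k8 : k <= 8^-1.
 apply: (@le_trans _ _ (3 * K / M)); first by rewrite ler_wpM2l// mulr_ge0.
 by rewrite ler_pdivrMr//; move: K24; lra.
have k4 : k <= 4^-1 by lra.
have kd : k <= 3 * K * dl by rewrite ler_wpM2l ?mulr_ge0.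
have M_neq : M != 0 by rewrite gt_eqF.
have kM : M * k <= 3 * K.
 rewrite /k mulrCA ler_piMr ?mulr_ge0// -(divff M_neq).
 by rewrite ler_wpM2l// ltW.
have k0 : 0 <= k by rewrite mulr_ge0 ?mulr_ge0.
have snk : sn * k ^+ 2 <= 9 * K ^+ 2 * dl.
 rewrite (_ : sn * k ^+ 2 = 9 * K ^+ 2 * sn^-1); last by rewrite /k; field; rewrite gt_eqF.
 by rewrite ler_wpM2l ?mulr_ge0 ?sqr_ge0.
have [R1 R2] := ratio_expand X1 Y1 k4.
pose r := (TX / M1%:R) / (TY / M2%:R).
have c1 : (0 : R) < m%:R * M1%:R by rewrite mulr_gt0.
have c2 : (0 : R) < m%:R * M2%:R by rewrite mulr_gt0.
have pos e c T : 0 < c -> e = T / c - 1 -> `|e| <= k -> 0 < T.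
 move=> cc eE; rewrite ler_norml => /andP[h _].
 have : 0 < T / c by rewrite (_ : T / c = e + 1); [lra|rewrite eE; ring].
 by rewrite pmulr_lgt0// invr_gt0.
have TX0 : 0 < TX := pos _ _ _ c1 erefl X1.
have TY0 : 0 < TY := pos _ _ _ c2 erefl Y1.
have rE : (1 + xr) / (1 + yr) = r.
 rewrite /r /xr /yr; field; rewrite ?gt_eqF//; lra.
rewrite rE in R1 R2.
rewrite -/sn -/k in R1 R2.
have r2' : `|r - 1| <= 2^-1 by lra.
have r0 : 0 < r by rewrite !divr_gt0.
have w01 := odds01 r0 v01; set w := odds r v in w01.
have [w1 _] := odds_close r2' v01; rewrite -/w in w1.
have T3b := Hc_odds a r2' v01; rewrite -/w in T3b.
have h01 := Hc_le1 a w; have u01 := Hc_le1 a v.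
rewrite (gamma_processE ij_bnd TX0 TY0 eX0 eY0 eXE eYE VE v01) -/r -/w -/sn.
have T1b := alpha h01; rewrite -/sn in T1b.
have T2b := Sg_modulus L (le_trans ler01 t1) z_tame h01 u01.
have hu := Hc_lip2 a v01 w01.
have T8b := @core_close R L H (@Hc_continuous R a) (Hc_le1 a) (@ssq_Hc_gt0 R a) M_large t K z et' v t1 zp_tame et_le et'_le.
rewrite -/zp -/et -/(bridge_core L a v zp) in T8b.
have s0 : 0 < s by rewrite sqrtr_gt0; exact: ssq_Hc_gt0.
have s_neq : s != 0 by rewrite gt_eqF.
have ss : s * s = (2 * m%:R * lam0 a)^-1.
 by rewrite -expr2 (sigK (@ssq_Hc_gt0 R a)) ssq_Hc.
have l0 := @lam0_gt0 R a.
have JE : Jf H (H v) / s = phiK a v * lam0 a * s.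
 rewrite Jf_HcE//; apply: (mulIf s_neq); rewrite divfK ?gt_eqF// -[RHS]mulrA ss.
 by field; rewrite gt_eqF//= nat1r pnatr_eq0.
rewrite JE in T8b.
have bK0 := @bK_gt0 R a.
have ph0 : 0 <= phiK a v <= bK a.
 have /andP[p0 p1] := par01 v01.
 by rewrite mulr_ge0 ?exprn_ge0 ?(ltW bK0)//= ler_piMr ?exprn_ile1 ?(ltW bK0).
set ph := phiK a v in ph0 T3b T8b *; case/andP: ph0 => ph0 ph1.
have M10 : (0 : R) < M1%:R by [].
have M20 : (0 : R) < M2%:R by [].
have a101 : 0 <= a1 <= 1 by rewrite divr_ge0//= ler_pdivrMr// mul1r ler_nat.
have a201 : 0 <= a2 <= 1 by rewrite divr_ge0//= ler_pdivrMr// mul1r ler_nat.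
have hX : TX = \sum_(k < n) V k * S k + \sum_(l < r1) lX l.
 rewrite TXE sumX; congr (_ + _); apply: eq_bigr => p _.
 by case: (GV p _) => //; rewrite -ltnS.
have hY : TY = \sum_(k < n) (1 - V k) * S k + \sum_(l < r2) lY l.
 rewrite TYE sumY; congr (_ + _); apply: eq_bigr => p _.
 by case: (GV p _) => //; rewrite -ltnS.
have LE := ratio_lead (ltn0Sn a) (ltn0Sn N) (ltn0Sn (nblocks m n1)) (ltn0Sn (nblocks m n2)) r1E r2E hX hY.
rewrite -/xr -/yr -/sn in LE.
have lead' := lead; set W := lead_term _ _ _ _ _ _ _ _ _ _ _ in LE lead'.
set J := \sum_(k < n) (V k - 2^-1) / sn in LE.
pose ep : R := (m%:R * sn)^-1 * (a2 * (lY r2 - 1) - a1 * (lX r1 - 1) + a1 * (n1.+1%:R - m%:R *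
 M1%:R) - a2 * (n2.+1%:R - m%:R * M2%:R)).
have {}LE : sn * (xr - yr) = W + 2 * A * J + ep := LE.
have epb : `|ep| <= (2 * K + 2) * dl.
 have m1 : 1 <= m%:R :> R by rewrite ler1n.
 have m0 : 0 < m%:R :> R by rewrite ltr0n.
 have q1 : 0 <= (n1.+1%:R - m%:R * M1%:R : R) <= m%:R.
  rewrite subr_ge0 lerBlDr -natrM -natrD !ler_nat mulnC n1a/= addnC; exact: ltnW.
 have q2 : 0 <= (n2.+1%:R - m%:R * M2%:R : R) <= m%:R.
  rewrite subr_ge0 lerBlDr -natrM -natrD !ler_nat mulnC n2a/= addnC; exact: ltnW.
 have g1 : `|a2 * (lY r2 - 1)| <= K.
  by rewrite normrM (le_trans _ lY1)// ler_piMl// norm01.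
 have g2 : `|a1 * (lX r1 - 1)| <= K.
  by rewrite normrM (le_trans _ lX1)// ler_piMl// norm01.
 have g3 : 0 <= a1 * (n1.+1%:R - m%:R * M1%:R) <= m%:R.
  case/andP: q1 => q1 q1'; case/andP: a101 => b1 b1'.
  by rewrite mulr_ge0//= -[leRHS]mul1r ler_pM.
 have g4 : 0 <= a2 * (n2.+1%:R - m%:R * M2%:R) <= m%:R.
  case/andP: q2 => q1' q1''; case/andP: a201 => b1 b1'.
  by rewrite mulr_ge0//= -[leRHS]mul1r ler_pM.
 rewrite /ep normrM ger0_norm ?invr_ge0 ?mulr_ge0 ?(ltW sn0)// invfM.
 apply: (@le_trans _ _ (m%:R^-1 * dl * ((2 * K + 2) * m%:R))); last first.
  by apply: le_of_eq; field; rewrite nat1r pnatr_eq0.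
 apply: ler_pM; [by rewrite mulr_ge0// invr_ge0|by []|by rewrite ler_wpM2l// invr_ge0|].
 have km : K <= K * m%:R by rewrite ler_peMr.
 by rewrite mulrDl -mulrA; apply: eps4_le km g1 g2 g3 g4.
(* The approximation of the empirical process is integrated along H: the integral of the process is
   - J by [int_ecount], that of the walk is sqrt ssqM times et. *)
have Jb : `|J + s * et| <= (C1 + K / s) * dl.
 have okH : ok01 H by apply: ok01_cont; exact: Hc_continuous.
 have okE : ok01 (fun s => sn * ((ecount n (H \o V) (H s))%:R / n%:R - H s)).
  apply: ok01Z; apply: ok01B => //; apply: ok01M; last exact: ok01_cst.
  rewrite (_ : (fun s => _) = fun s => \sum_(k < n) ((H \o V) k <= H s)%R%:R); last first.
   by apply/funext => q'; rewrite ecountE.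
  apply: (ok01_sum (F := fun k s => ((H \o V) k <= H s)%R%:R)) => p _; split.
   rewrite (_ : (fun s => _) = fun s => if (H \o V) p <= H s then 1 else 0); last first.
    by apply/funext => q'; case: ifP.
   apply: measurable_fun_ifT => //; apply: measurable_fun_ler => //; exact: okH.1.
  by exists 1 => q' _; case: ((H \o V) p <= H q'); rewrite ?normr1 ?normr0.
 have I1 := int01_dist_le okE (ok_Sg L (@Hc_continuous R a) L z) (fun q' _ => alpha (Hc_le1 a q')).
 rewrite int_ecount// (int_Sg L (@Hc_continuous R a)) in I1.
 have sE : \sum_(i0 < Mn) Iv L H i0 * z i0 = sqrt (ssqM L H) * et.
  rewrite /et /lincomb mulr_sumr; apply: eq_bigr => p _; rewrite /dirM.
  have := @sM_gt0 R L H (@Hc_continuous R a) (Hc_le1 a) (@ssq_Hc_gt0 R a) M_large.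
  by move=> h; field; rewrite gt_eqF.
 have sc := @sM_close R L H (@Hc_continuous R a) (Hc_le1 a) (@ssq_Hc_gt0 R a) M_large.
 rewrite sE mulNr mulr_suml -/sn -/J in I1.
 rewrite (_ : J + s * et = - (- J - sqrt (ssqM L H) * et) - (sqrt (ssqM L H) - s) * et); last by ring.
 apply: (le_trans (ler_normB _ _)); rewrite [leRHS]mulrDl; apply: lerD; first by rewrite normrN.
 rewrite normrM (_ : K / s * dl = (dl / s) * K); last by ring.
 apply: ler_pM => //; apply: (le_trans sc).
 by rewrite invfM ler_wpM2r ?invr_ge0 ?(ltW s0)//; exact: dl_ge.
(* T1 passes from the empirical process to the normal walk at H(w), T2 moves it to H(v), T3 and T4
   linearize H(odds r v) and r, T5 is the remainder of [ratio_lead], T6 the normal approximation of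
   the lead term, T7 replaces J by - s et, and T8 is [core_close]. *)
pose T1 := sn * ((ecount n (H \o V) (H w))%:R / n%:R - H w) - Sg L L (H w) z.
pose T2 := Sg L L (H w) z - Sg L L (H v) z.
pose T3 := sn * (H w - H v - ph * (r - 1)).
pose T4 := ph * (sn * (r - 1 - (xr - yr))).
pose T5 := ph * ep.
pose T6 := ph * (W - q * zeta).
pose T7 := ph * (2 * A * (J + s * et)).
pose T8 := bridge_core L a v zp - (Sg L L (H v) z - ph * lam0 a * s * et).
have -> : sn * ((ecount n (H \o V) (H w))%:R / n%:R - H v) - (bridge_core L a v zp + ph * ((lam0 a -
 2 * A) * s * et + q * zeta)) = T1 + T2 + T3 + T4 + T5 + T6 + T7 - T8.
 rewrite /T1 /T2 /T3 /T4 /T5 /T6 /T7 /T8.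
 have := LE; set A' := A; move=> LE'.
 have -> : sn * (r - 1 - (xr - yr)) = sn * (r - 1) - (W + 2 * A' * J + ep) by rewrite -LE'; ring.
 move: (bridge_core _ _ _ _) (Sg _ _ (H w) _) (Sg _ _ (H v) _) ((ecount _ _ _)%:R / _) => *.
 ring.
have b1 : `|T1| <= C1 * dl by [].
have b2 : `|T2| <= 36 * bK a * K * dl.
 apply: (le_trans T2b).
 apply: (@le_trans _ _ (4 * M * dl * (bK a * (3 * k)))).
  rewrite ler_wpM2l//; first by rewrite mulr_ge0// mulr_ge0// ltW.
  apply: (le_trans hu); rewrite ler_wpM2l ?(ltW bK0)//; exact: le_trans w1 R1.
 rewrite (_ : 4 * M * dl * _ = 12 * bK a * dl * (M * k)); last by ring.
 rewrite (_ : 36 * bK a * K * dl = 12 * bK a * dl * (3 * K)); last by ring.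
 by rewrite ler_wpM2l// mulr_ge0// mulr_ge0// ltW.
have rk : (r - 1) ^+ 2 <= 9 * k ^+ 2.
 rewrite -sqr_normr// (_ : 9 * k ^+ 2 = (3 * k) ^+ 2); last by ring.
 by rewrite lerXn2r ?nnegrE ?mulr_ge0.
have b3 : `|T3| <= 81 * (bK a * (2 * a%:R + 2)) * K ^+ 2 * dl.
 have C0 : 0 <= bK a * (2 * a%:R + 2) :> R by rewrite mulr_ge0 ?(ltW bK0)// addr_ge0// mulr_ge0.
 rewrite /T3 normrM (gtr0_norm sn0).
 apply: (@le_trans _ _ (sn * (bK a * (2 * a%:R + 2) * (9 * k ^+ 2)))).
  rewrite ler_wpM2l ?(ltW sn0)//; apply: (le_trans T3b).
  by rewrite ler_wpM2l.
 rewrite (_ : sn * _ = bK a * (2 * a%:R + 2) * 9 * (sn * k ^+ 2)); last by ring.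
 rewrite (_ : 81 * _ * _ * _ = bK a * (2 * a%:R + 2) * 9 * (9 * K ^+ 2 * dl)); last by ring.
 by rewrite ler_wpM2l// mulr_ge0.
have b4 : `|T4| <= 27 * bK a * K ^+ 2 * dl.
 rewrite /T4 normrM (ger0_norm ph0) normrM (gtr0_norm sn0).
 rewrite (_ : 27 * _ * _ * _ = bK a * (3 * (9 * K ^+ 2 * dl))); last by ring.
 apply: ler_pM => //; first by rewrite mulr_ge0// ltW.
 apply: (@le_trans _ _ (sn * (3 * k ^+ 2))); first by rewrite ler_wpM2l// ltW.
 by rewrite mulrCA ler_wpM2l.
have b5 : `|T5| <= bK a * (2 * K + 2) * dl.
 by rewrite /T5 normrM (ger0_norm ph0) -mulrA; apply: ler_pM.
have b6 : `|T6| <= bK a * C7 * dl.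
 by rewrite /T6 normrM (ger0_norm ph0) -mulrA; apply: ler_pM.
have b7 : `|T7| <= 4 * bK a * (C1 + K / s) * dl.
 rewrite /T7 normrM (ger0_norm ph0) (_ : 4 * _ * _ * _ = bK a * (4 * ((C1 + K / s) * dl))); last by ring.
 apply: ler_pM => //; rewrite normrM; apply: ler_pM => //.
 exact: norm01_add.
rewrite /gamma_const mulrDl [leRHS]addrC.
apply: (le_trans (ler_normB _ _)); apply: lerD => //.
rewrite 6!(mulrDl _ _ dl).
do 6! (apply: normD_le => //).
Qed.

End gamma_close.

(** * Events of small probability *)

Section small_events.
Context {R : realType}.
Notation RS := (@rseq R).
Notation RM := (measurableTypeR R).

(** Measurability is part of the notion because [bigO_P] asks for a measurable exceptional set. *)
Definition small d (T : mtype d) (P : prob T R) (c : R) (B : set T) := measurable B /\ (P B <=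
 c%:E)%E.

Lemma smallU d (T : mtype d) (P : prob T R) c c' (B B' : set T) : small P c B -> small P c' B' ->
 small P (c + c') (B `|` B').
Proof.
move=> [m1 h1] [m2 h2]; split; first exact: measurableU.
by apply: (le_trans (measureU2 _ m1 m2)); rewrite EFinD leeD.
Qed.

Lemma small_mp d d' (T : mtype d) (T' : mtype d') (P : prob T R) (Q : prob T' R) (f : T -> T') c (B
 : set T') : mp P Q f -> small Q c B -> small P c (f @^-1` B).
Proof. by move=> [mf hf] [mB h]; split; [exact: meas_preim|rewrite hf]. Qed.

Lemma small_le d (T : mtype d) (P : prob T R) c c' (B : set T) : c <= c' -> small P c B -> small P
 c' B.
Proof. by move=> cc [mB h]; split => //; apply: (le_trans h); rewrite lee_fin. Qed.

Lemma small_prod d1 d2 (T1 : mtype d1) (T2 : mtype d2) (P1 : prob T1 R) (P2 : prob T2 R) c (B : set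
 (T1 * T2)) : measurable B -> 0 <= c -> (forall x, (P2 [set y | B (x, y)] <= c%:E)%E) -> small
 (prodP P1 P2) c B.
Proof.
move=> mB c0 h; split => //; rewrite prodPE.
rewrite -[leRHS](integral_prob_cst P1 c).
apply: ge0_le_integral => //.
rewrite (_ : (fun x => _) = P2 \o xsection B); first exact: measurable_fun_xsection.
by apply/funext => x /=; congr (P2 _); apply/seteqP; split => y; rewrite /xsection/= inE.
Qed.

Lemma small_kolmogorov (mu : prob RM R) n (e : nat -> R -> R) (C : nat -> R) x : 0 < x -> (forall i,
 measT (e i : RM -> RM)) -> (forall i, (i < n)%N -> centered mu (C i) (e i)) -> small (pow mu)
 ((\sum_(i < n) C i) / x ^+ 2) [set S : RS | exists k, (k <= n)%N /\ x <= `|\sum_(i < k) e i (S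
 i)|].
Proof.
move=> x0 me ce; have mE := meas_exceeds n x me (measurable_cst (0 : RM)) (@measurable_id _ RS setT).
have E : [set S : RS | exists k, (k <= n)%N /\ x <= `|\sum_(i < k) e i (S i)|] = [set S | exceeds n
 e x (0, S)].
 by apply/seteqP; split => S /= -[k [kn h]]; exists k; rewrite add0r in h *.
rewrite E; split; first exact: mE.
have h := kolmogorov 0 x0 me ce; rewrite expr0n add0r in h.
by rewrite EFinM lee_pdivlMr ?exprn_gt0// muleC.
Qed.

Lemma small_coord (mu : prob RM R) i c (B : set RM) : small mu c B -> small (pow mu) c [set s : RS |
 B (s i)].
Proof. exact: small_mp (mp_coord mu i). Qed.

Lemma small_null (mu : prob RM R) (B : set RM) : measurable B -> mu B = 0%E -> small (pow mu) 0 [set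
 s : RS | exists k, B (s k)].
Proof.
move=> mB B0; have mBk k : measurable [set s : RS | B (s k)].
 exact: meas_preim (meas_coord k) mB.
have E : [set s : RS | exists k, B (s k)] = \bigcup_k [set s : RS | B (s k)].
 by apply/seteqP; split => s /= [k]; [move=> h|move=> _ h]; exists k.
split; first by rewrite E; exact: bigcup_measurable.
have := measure_sigma_subadditive (pow mu) mBk (bigcup_measurable (fun k _ => mBk k)) (@subset_refl _ _) : (pow mu _ <= _)%E.
rewrite -E => /le_trans; apply.
rewrite eseries0// => k _ _; have [_ h] := mp_coord mu k.
exact: etrans (h B mB) B0.
Qed.

Lemma small_chebyshev d (T : mtype d) (P : prob T R) C (e : T -> R) x : 0 < x -> centered P C e ->
 small P (C / x ^+ 2) [set w | x <= `|e w|].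
Proof.
move=> x0 [me ce]; have mA : measurable [set w | x <= `|e w|].
 by apply: meas_ge; exact: mcomp.
split => //; rewrite EFinM lee_pdivlMr ?exprn_gt0//.
apply: (@le_trans _ _ (\int[P]_w (e w ^+ 2)%:E)%E); last first.
 have := ce 0; rewrite expr0n add0r => h; apply: le_trans h.
 by apply: le_of_eq; apply: eq_integral => w _; rewrite add0r.
rewrite muleC -[X in P X]setIT -integral_indic// -ge0_integralZl//; last 2 first.
- exact: (meas_ind mA).
- by rewrite lee_fin sqr_ge0.
apply: ge0_le_integral => //.
- by move=> w _; rewrite lee_fin mulr_ge0 ?sqr_ge0// indicE.
- by apply: measurable_funeM; exact: (meas_ind mA).
- by apply/measE; exact: measX.
move=> w _; rewrite -EFinM lee_fin indicE; case: (boolP (w \in _)) => h.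
 rewrite mulr1 -[leRHS]real_normK ?num_real//.
 by rewrite lerXn2r ?nnegrE ?(ltW x0)//; exact: (set_mem h).
by rewrite mulr0 sqr_ge0.
Qed.

Lemma small_markov_sum (mu : prob RM R) (f : R -> R) C n x : 0 < x -> measT (f : RM -> RM) ->
 (forall y, 0 <= f y) -> (\int[mu]_y (f y)%:E <= C%:E)%E -> small (pow mu) (n%:R * C / x) [set s :
 RS | x <= \sum_(i < n) f (s i)].
Proof.
move=> x0 mf f0 fC.
have mF : measT (fun s : RS => \sum_(i < n) f (s i) : RM).
 by apply: measurable_sum => i; exact: (mcomp mf (meas_coord i)).
have mA : measurable [set s : RS | x <= \sum_(i < n) f (s i)] by exact: meas_ge.
split => //; rewrite EFinM lee_pdivlMr//.
apply: (@le_trans _ _ (\int[pow mu]_s (\sum_(i < n) f (s i))%:E)%E); last first.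
 under eq_integral => s _ do rewrite -sumEFin.
 rewrite ge0_integral_sum//; last 2 first.
 - by move=> i; apply/measE; exact: (mcomp mf (meas_coord i)).
 - by move=> i s _; rewrite lee_fin.
 apply: (@le_trans _ _ (\sum_(i < n) C%:E)%E); last first.
  by rewrite sumEFin lee_fin sumr_const card_ord mulr_natl.
 apply: lee_sum => i _.
 rewrite -(mp_ge0_integral (mp_coord mu i) (g := fun y : RM => (f y)%:E))//.
 exact/measE.
rewrite muleC -[X in pow mu X]setIT -integral_indic// -ge0_integralZl//; last 2 first.
- exact: (meas_ind mA).
- by rewrite lee_fin ltW.
apply: ge0_le_integral => //.
- by move=> w _; rewrite lee_fin mulr_ge0 ?(ltW x0)// indicE.
- by apply: measurable_funeM; exact: (meas_ind mA).
- exact/measE.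
move=> w _; rewrite -EFinM lee_fin indicE; case: (boolP (w \in _)) => h.
 by rewrite mulr1; exact: (set_mem h).
by rewrite mulr0 sumr_ge0.
Qed.

Lemma meas_fin_family d d' (T : mtype d) (T' : mtype d') (I : finType) (k : T -> I) (f : I -> T ->
 T') : (forall i, measurable [set w | k w = i]) -> (forall i, measT (f i)) -> measT (fun w => f (k
 w) w).
Proof.
move=> mk mf _ B mB; rewrite setTI.
rewrite (_ : _ @^-1` B = \bigcup_(i in [set: I]) ([set w | k w = i] `&` f i @^-1` B)).
 apply: fin_bigcup_measurable; first exact: finite_finset.
 by move=> i _; apply: measurableI => //; exact: meas_preim.
by apply/seteqP; split => [w /= h|w [i _ [/= <- h]]//]; exists (k w).
Qed.

Lemma centered_bounded (mu : prob RM R) (f : R -> R) : measT (f : RM -> RM) -> (\int[mu]_x (f x)%:E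
 = 0)%E -> (\int[mu]_x (f x ^+ 2)%:E <= 1)%E -> centered mu 1 f.
Proof. by move=> mf f0 f2; exact: centeredI. Qed.

End small_events.

(** * Moments of the Beta(m, m) law *)

Section beta_moments.
Context {R : realType}.
Notation RM := (measurableTypeR R).
Variable a : nat.
Notation m := a.+1.

(** Multiplication by v raises the first parameter by one, so moments are quotients of normalizing
    constants. *)
Lemma bpdf_up k v : v * bpdf (a + k) a v = ((a + k).+1%:R / (a + k + a).+2%:R) * bpdf (a + k).+1 a v :> R.
Proof.
rewrite /bpdf; case: ifP => _; last by rewrite !mulr0.
have f (p : nat) : (p`!%:R : R) != 0 by rewrite pnatr_eq0 -lt0n fact_gt0.
have n0 (p : nat) : (p.+1%:R : R) != 0 by rewrite pnatr_eq0.
rewrite addSn (factS (a + k)) (factS (a + k + a).+1) (natrM _ (a + k).+1) (natrM _ (a + k + a).+2) exprS.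
have h1 := n0 (a + k)%N; have h2 := n0 (a + k + a).+1.
move: (f (a + k)%N) (f a) h1 h2; move: (a + k)`!%:R (a`!%:R) (a + k).+1%:R (a + k + a).+2%:R ((a + k + a).+1`!%:R) => x1 x2 x3 x4 x5 e1 e2 e3 e4.
by field; rewrite e1 e2 e3 e4.
Qed.

Lemma betP_null : @betP R a a (~` `[0, 1]%classic) = 0%E.
Proof.
have mC : measurable (~` `[0, 1]%classic : set RM) by exact: measurableC.
rewrite (pdf_indic (@betP_pdf R a a))// integral0_eq// => t _.
rewrite indicE /bpdf; case: (boolP (t \in _)) => [|_]; last by rewrite mul0e.
rewrite inE/= in_itv/= => /negP/negbTE h; rewrite mul1e; case: ifP => // /andP[t0 t1].
by move: h; rewrite (ltW t0) (ltW t1).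
Qed.

Lemma betP_mean : (\int[@betP R a a]_v v%:E = (2^-1)%:E)%E.
Proof.
have m1 : measurable_fun (setT : set RM) (fun v : RM => `|v|%:E).
 exact: mcomp.
have E : (\int[@betP R a a]_v `|v|%:E = (2^-1)%:E)%E.
 rewrite (pdf_integral (@betP_pdf R a a))//.
 rewrite (eq_integral (fun v : RM => ((m%:R / (a + a).+2%:R)%:E * (bpdf a.+1 a v)%:E)%E)); last first.
  move=> v _; rewrite -!EFinM; congr EFin; have := bpdf_up 0 v; rewrite !addn0 => <-.
  rewrite /bpdf; case: ifP => [/andP[v0 _]|_]; last by rewrite !mulr0.
  by rewrite gtr0_norm.
 rewrite ge0_integralZl//; last 2 first.
 - by apply/measE; exact: meas_bpdf.
 - by move=> v _; rewrite lee_fin bpdf_ge0.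
 rewrite integral_bpdf mule1; congr EFin.
 have -> : (a + a).+2%:R = 2 * m%:R :> R by rewrite -natrM; congr _%:R; lia.
 by field; rewrite nat1r pnatr_eq0.
have m0 : measurable_fun (setT : set RM) (fun v : RM => v%:E) by exact: mcomp.
rewrite -E; apply: ae_eq_integral; [exact: measurableT|exact: m0|exact: m1|].
have [mC N] : measurable (~` `[0, 1]%classic : set RM) /\ @betP R a a (~` `[0, 1]%classic) = 0%E.
 by split; [exact: measurableC|exact: betP_null].
exists (~` `[0, 1]%classic); split => // v /= h; rewrite in_itv/= => /andP[v0 _].
by apply: h => _; rewrite ger0_norm.
Qed.

Lemma betP_sqr : (\int[@betP R a a]_v (v ^+ 2)%:E = (4^-1 + (4 * (2 * m + 1)%:R)^-1)%:E)%E.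
Proof.
rewrite (pdf_integral (@betP_pdf R a a))//; last 2 first.
- by apply/measE; exact: measX.
- by move=> v; rewrite lee_fin sqr_ge0.
pose c : R := (m%:R / (a + a).+2%:R) * (a.+2%:R / (a + a).+3%:R).
rewrite (eq_integral (fun v : RM => (c%:E * (bpdf a.+2 a v)%:E)%E)); last first.
 move=> v _; rewrite -!EFinM; congr EFin; rewrite expr2 -mulrA.
 have := bpdf_up 0 v; rewrite !addn0 => ->; have := bpdf_up 1 v; rewrite !addn1 !addSn => h.
 by rewrite mulrCA h mulrA.
rewrite ge0_integralZl//; last 3 first.
- by apply/measE; exact: meas_bpdf.
- by move=> v _; rewrite lee_fin bpdf_ge0.
- by rewrite lee_fin mulr_ge0// divr_ge0.
rewrite integral_bpdf mule1; congr EFin; rewrite /c.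
have -> : (a + a).+2%:R = 2 * m%:R :> R by rewrite -natrM; congr _%:R; lia.
have -> : (a + a).+3%:R = 2 * m%:R + 1 :> R by rewrite -natrM natr1; congr _%:R; lia.
have -> : (2 * m + 1)%:R = 2 * m%:R + 1 :> R by rewrite natrD natrM.
rewrite -[a.+2%:R]natr1; have m0 : 0 < m%:R :> R by rewrite ltr0n.
by field; rewrite !gt_eqF//; lra.
Qed.

End beta_moments.

(** * Discretization of the V_k into cells *)

Section cells.
Context {R : realType}.
Notation RS := (@rseq R).
Notation RM := (measurableTypeR R).
Implicit Types (v x : R) (K M i k : nat).

(** For x >= 0 the integer part of x capped at K, written as a sum of indicators for the sake of
    measurability. *)
Definition cellR K x : nat := \sum_(i < K) (i.+1%:R <= x)%R.

Lemma cellR_le K x : (cellR K x <= K)%N.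
Proof.
rewrite -[X in (_ <= X)%N]card_ord -sum1_card; apply: leq_sum => i _.
by case: (_ <= _).
Qed.

Lemma cellR_close K x : 0 <= x <= K.+1%:R -> `|x - (cellR K x)%:R| <= 1.
Proof.
move=> /andP[x0 xK].
suff [h1 h2] : (cellR K x)%:R <= x /\ (x <= K.+1%:R -> x <= (cellR K x)%:R + 1).
 by have := h2 xK; rewrite ler_norml; lra.
elim: K {xK} => [|K [IH1 IH2]]; first by rewrite /cellR big_ord0; split => //; rewrite add0r.
rewrite /cellR big_ord_recr/= -/(cellR K x); case: (leP K.+1%:R x) => h.
 have E : cellR K x = K.
  apply/eqP; rewrite eqn_leq cellR_le/= /cellR -[X in (X <= _)%N]card_ord -sum1_card.
  apply: leq_sum => i _; rewrite (le_trans _ h)// ler_nat ltnS ltnW//.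
 rewrite E addn1; split => //; by rewrite natr1.
by rewrite addn0; split => // _; apply: IH2; exact: ltW.
Qed.

Definition cell M v : nat := cellR M (M.+1%:R * v).

Lemma cell_close M v : 0 <= v <= 1 -> `|v - (cell M v)%:R / M.+1%:R| <= M.+1%:R^-1.
Proof.
move=> /andP[v0 v1]; have M0 : 0 < M.+1%:R :> R by [].
have h : 0 <= M.+1%:R * v <= M.+1%:R by rewrite mulr_ge0//= ler_piMr.
have := cellR_close h; rewrite -/(cell M v).
rewrite (_ : v - _ = (M.+1%:R * v - (cell M v)%:R) / M.+1%:R); last by field; rewrite gt_eqF.
move=> h1; rewrite normrM (gtr0_norm (_ : 0 < M.+1%:R^-1)) ?invr_gt0//.
by rewrite ler_piMl// invr_ge0.
Qed.

Lemma meas_cell M : measT (fun v : RM => (cell M v)%:R : RM).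
Proof.
rewrite (_ : (fun v => _) = fun v : RM => \sum_(i < M) (if i.+1%:R <= M.+1%:R * v then 1 else 0 : R)).
 apply: measurable_sum => i; apply: measurable_fun_ifT => //.
 by apply: measurable_fun_ler => //; exact: measM.
by apply/funext => v; rewrite /cell /cellR natr_sum; apply: eq_bigr => i _; case: ifP.
Qed.

(** The pattern of cells has finitely many values, so a function of it and of other variables is
    measurable as soon as it is for each fixed pattern ([meas_fin_family]). *)
Definition cellf n M (V : nat -> R) : {ffun 'I_n -> 'I_M.+1} := [ffun k : 'I_n => inord (cell M (V k))].

Lemma cellfE n M V (k : 'I_n) : cellf n M V k = cell M (V k) :> nat.
Proof. by rewrite ffunE inordK// ltnS cellR_le. Qed.

Lemma meas_cellf n M (f : {ffun 'I_n -> 'I_M.+1}) : measurable [set V : RS | cellf n M V = f].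
Proof.
rewrite (_ : [set V | _] = \bigcap_(k in [set: 'I_n]) [set V : RS | cell M (V k) = f k :> nat]).
 apply: fin_bigcap_measurable; first exact: finite_finset.
 move=> k _; rewrite (_ : [set V | _] = (fun V : RS => (cell M (V k))%:R : RM) @^-1` [set (f k)%:R]).
  apply: meas_preim; last exact: measurable_set1.
  exact: (mcomp (meas_cell M) (meas_coord k)).
 apply/seteqP; split => V /=; first by move=> ->.
 by move=> /eqP; rewrite eqr_nat => /eqP.
apply/seteqP; split => V /=; first by move=> <- k _; rewrite cellfE.
by move=> h; apply/ffunP => k; apply: val_inj; rewrite /= cellfE h.
Qed.

(* Every cell receives one extra index, so that no cell is empty. *)
Definition slot n M (f : {ffun 'I_n -> 'I_M.+1}) (k : nat) : nat := if insub k is Some k' then f k'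
 : nat else (k - n)%N.

Lemma slot_lt n M f k : (k < n + M.+1)%N -> (@slot n M f k < M.+1)%N.
Proof. by move=> kn; rewrite /slot; case: insubP => [k' _ _//|]; rewrite -leqNgt => nk; lia. Qed.

Lemma slot_surj n M f i : (i < M.+1)%N -> exists2 k, (k < n + M.+1)%N & @slot n M f k = i.
Proof.
move=> iM; exists (n + i)%N; first by rewrite ltn_add2l.
rewrite /slot; case: insubP => [k' h _|_]; last by rewrite addKn.
by exfalso; lia.
Qed.

Lemma slot_ord n M f (k : 'I_n) : @slot n M f k = f k.
Proof. by rewrite /slot valK. Qed.

Lemma slot_big n M f k : @slot n M f (n + k)%N = k.
Proof.
by rewrite /slot; case: insubP => [k' h _|_]; [exfalso; lia|rewrite addKn].
Qed.

Definition occ n M f i : nat := \sum_(k < n + M.+1) (@slot n M f k == i).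

Lemma occ_gt0 n M f i : (i < M.+1)%N -> (0 < @occ n M f i)%N.
Proof.
move=> /(slot_surj f)[k kn ki]; rewrite /occ (bigD1 (Ordinal kn))//= ki eqxx.
by rewrite addn_gt0.
Qed.

Lemma sum_slot n M (f : {ffun 'I_n -> 'I_M.+1}) (c S : nat -> R) : \sum_(i < M.+1) c i * \sum_(k < n
 + M.+1) (slot f k == i)%:R * S k = \sum_(k < n + M.+1) c (slot f k) * S k.
Proof.
under eq_bigr => i _ do rewrite mulr_sumr.
rewrite exchange_big/=; apply: eq_bigr => k _.
rewrite (bigD1 (Ordinal (slot_lt f (ltn_ord k))))//= eqxx mul1r big1 ?addr0// => i.
move=> h; rewrite (_ : slot f k == i = false) ?mul0r ?mulr0//.
by apply/negbTE; apply: contra h => /eqP h; apply/eqP/val_inj.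
Qed.

Lemma cell_gauss_ex n M b (f : {ffun 'I_n -> 'I_M.+1}) : exists Z : RS -> RS, mp (pow (gam b)) (pow
 gauss) Z /\ forall S i, (i < M.+1)%N -> Z S i = gz (occ f i * b.+1).-1 (\sum_(k < n + M.+1) (slot
 f k == i)%:R * S k).
Proof.
have [Z h1 h2] := @mp_cells R b (slot f) (n + M.+1) M.+1 (slot_lt f) (slot_surj f).
by exists Z.
Qed.

Definition cell_gauss n M b f : RS -> RS := projT1 (cid (@cell_gauss_ex n M b f)).

Lemma mp_cell_gauss n M b f : mp (pow (gam b)) (pow gauss) (@cell_gauss n M b f).
Proof. by rewrite /cell_gauss; case: cid => Z []. Qed.

Lemma cell_gaussE n M b f S i : (i < M.+1)%N -> @cell_gauss n M b f S i = gz (occ f i * b.+1).-1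
 (\sum_(k < n + M.+1) (slot f k == i)%:R * S k).
Proof. by rewrite /cell_gauss; case: cid => Z [] _ /= h; exact: h. Qed.

End cells.

(** * A normal variable independent of the V_k *)

Section zeta.
Context {R : realType}.
Notation RS := (@rseq R).
Notation RM := (measurableTypeR R).
Variables (b n M r1 r2 : nat) (A a1 a2 : R).
Hypothesis a10 : 0 < a1.
Notation rest := (RS * (RS * RS))%type.
Notation fT := {ffun 'I_n -> 'I_M.+1}.
Implicit Types f : fT.

Definition wt i : R := A * (i%:R / M.+1%:R) - a2.

(** Coordinates 0 and 1 belong to the two leftover sums, coordinate i + 2 to the sum over cell i. Up
    to sign, a coefficient is a weight times the standard deviation of the corresponding sum. *)
Definition zcoef f i : R := match i with | 0%N => a1 * sqrt r1.+1%:R | 1%N => - (a2 * sqrt r2.+1%:R)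
 | i'.+2 => wt i' * sqrt (occ f i' * b.+1)%:R end.

Definition znorm f : R := \sum_(i < M.+3) zcoef f i ^+ 2.

Lemma znorm_gt0 f : 0 < znorm f.
Proof.
rewrite /znorm big_ord_recl ltr_pwDl//.
 by rewrite exprn_gt0// mulr_gt0// sqrtr_gt0.
by apply: sumr_ge0 => i _; exact: sqr_ge0.
Qed.

Definition zseq f (y : rest) : RS := scons (gz r1 (prefix_sum r1.+1 y.2.1)) (scons (gz r2
 (prefix_sum r2.+1 y.2.2)) (cell_gauss b f y.1)).

Lemma mp_zseq f : mp (prodP (pow (gam b)) (prodP (pow expP) (pow expP))) (pow gauss) (zseq f).
Proof.
have g r : mp (pow expP) gauss (fun s : RS => gz r (prefix_sum r.+1 s) : RM).
 have h := mp_comp (@mp_sum_shift R 0 r) (mp_fst _ _); rewrite muln1/= in h.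
 exact: mp_comp h (mp_gz r).
have h1 := mp_comp (mp_swap (pow (gam b)) (prodP (pow (@expP R)) (pow expP))) (mp_assocV _ _ _).
have h2 := mp_comp h1 (mp_prod (g r1) (mp_prod (g r2) (mp_cell_gauss b f))).
have h3 := mp_comp h2 (mp_prod (mp_id _) (mp_cons (powP gauss))).
exact: mp_eqfun (mp_comp h3 (mp_cons (powP gauss))).
Qed.

Definition zeta_of f (y : rest) : R := lincomb M.+3 (fun i => zcoef f i / sqrt (znorm f)) (zseq f
 y).

Lemma mp_zeta_of f : mp (prodP (pow (gam b)) (prodP (pow expP) (pow expP))) gauss (zeta_of f : rest -> RM).
Proof.
apply: mp_comp (mp_zseq f) (mp_lincomb _).
under eq_bigr do rewrite expr_div_n.
by rewrite -mulr_suml sqr_sqrtr ?ltW ?znorm_gt0// divff// gt_eqF// znorm_gt0.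
Qed.

Definition zeta (p : RS * rest) : R := zeta_of (cellf n M p.1) p.2.

Lemma meas_by_cells d' (T' : mtype d') (g : fT -> rest -> T') : (forall f, measT (g f)) -> measT
 (fun p : RS * rest => g (cellf n M p.1) p.2).
Proof.
move=> mg.
apply: (meas_fin_family (k := fun p : RS * rest => cellf n M p.1) (f := fun f p => g f p.2)).
 move=> f; rewrite (_ : [set w | _] = fst @^-1` [set V : RS | cellf n M V = f])//.
 apply: meas_preim; [exact: measurable_fst|exact: meas_cellf].
by move=> f; exact: (mcomp (mg f) measurable_snd).
Qed.

(** For a fixed pattern [zeta_of] is a unit linear form in independent normals; by [mp_fiber] the
    resulting variable is independent of the V_k although its coefficients depend on them. *)
Lemma mp_zeta (Q : prob RS R) : mp (prodP Q (prodP (pow (gam b)) (prodP (pow expP) (pow expP))))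
 (prodP Q gauss) (fun p => (p.1, zeta p : RM)).
Proof.
apply: (@mp_fiber R _ _ _ _ _ _ Q _ _ (fun p => zeta p : RM)).
 by apply: (meas_by_cells (T' := RM)) => f; exact: (mp_zeta_of f).1.
by move=> V; exact: (mp_zeta_of (cellf n M V)).
Qed.

Lemma mp_zcell (Q : prob RS R) : mp (prodP Q (prodP (pow (gam b)) (prodP (pow expP) (pow expP))))
 (pow gauss) (fun p => cell_gauss b (cellf n M p.1) p.2.1).
Proof.
have h : mp (prodP Q (prodP (pow (gam b)) (prodP (pow expP) (pow expP)))) (prodP Q (pow gauss)) (fun
 p => (p.1, cell_gauss b (cellf n M p.1) p.2.1)).
 apply: (@mp_fiber R _ _ _ _ _ _ Q _ _ (fun p : RS * rest => cell_gauss b (cellf n M p.1) p.2.1)).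
  apply: (meas_by_cells (g := fun f y => cell_gauss b f y.1)) => f.
  exact: (mcomp (mp_cell_gauss b f).1 measurable_fst).
 move=> V /=; exact: mp_comp (mp_fst _ _) (mp_cell_gauss b (cellf n M V)).
exact: mp_comp h (mp_snd _ _).
Qed.

(* Rescaling a standard normal by its weight recovers the centered sums, up to
  the quantile-transform residuals and the discretization of the weights. *)
Lemma zeta_lead m (V S lX lY : nat -> R) (f := cellf n M V) : (b.+1 = 2 * m)%N -> let T i := \sum_(k
 < n + M.+1) (slot f k == i)%:R * S k in \sum_(k < n) (S k - (2 * m)%:R) * (A * V k - a2) + a1 *
 (\sum_(l < r1.+1) lX l - r1.+1%:R) - a2 * (\sum_(l < r2.+1) lY l - r2.+1%:R) - sqrt (znorm f) *
 zeta (V, (S, (lX, lY))) = \sum_(k < n + M.+1) ((if (k < n)%N then A * V k - a2 else 0) - wt (slot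
 f k)) * (S k - (2 * m)%:R) + \sum_(i < M.+1) wt i * gz_res (occ f i * b.+1).-1 (T i) + a1 * gz_res
 r1 (\sum_(l < r1.+1) lX l) - a2 * gz_res r2 (\sum_(l < r2.+1) lY l).
Proof.
move=> bm T.
have -> : sqrt (znorm f) * zeta (V, (S, (lX, lY))) = \sum_(i < M.+3) zcoef f i * zseq f (S, (lX,
 lY)) i.
 rewrite /zeta /zeta_of /lincomb mulr_sumr; apply: eq_bigr => i _.
 rewrite -/f; have := znorm_gt0 f; rewrite -sqrtr_gt0 => h.
 by field; rewrite gt_eqF.
set X := \sum_(l < r1.+1) lX l; set Y := \sum_(l < r2.+1) lY l.
pose Q := \sum_(i < M.+1) wt i * sqrt (occ f i * b.+1)%:R * cell_gauss b f S i.
have -> : \sum_(i < M.+3) zcoef f i * zseq f (S, (lX, lY)) i = a1 * sqrt r1.+1%:R * gz r1 X + (- (a2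
 * sqrt r2.+1%:R) * gz r2 Y + Q).
 by rewrite 2!big_ord_recl.
have E1 : \sum_(i < M.+1) wt i * gz_res (occ f i * b.+1).-1 (T i) = \sum_(k < n + M.+1) wt (slot f
 k) * (S k - (2 * m)%:R) - \sum_(i < M.+1) wt i * sqrt (occ f i * b.+1)%:R * cell_gauss b f S i.
 rewrite -(sum_slot f wt (fun k => S k - (2 * m)%:R)) -sumrB; apply: eq_bigr => i _.
 rewrite cell_gaussE// -/(T i) /gz_res prednK; last by rewrite muln_gt0 occ_gt0.
 rewrite -mulrA -mulrBr; congr (_ * (_ - _)).
 under eq_bigr => k _ do rewrite mulrBr.
 rewrite sumrB -/(T i) -mulr_suml -natr_sum -/(occ f i) -natrM bm; congr (_ - _).
have E2 : \sum_(k < n) (S k - (2 * m)%:R) * (A * V k - a2) = \sum_(k < n + M.+1) (if (k < n)%N then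
 A * V k - a2 else 0) * (S k - (2 * m)%:R).
 rewrite big_split_ord/= [X in _ = _ + X]big1 => [|k _]; last by rewrite ltnNge leq_addr/= mul0r.
 by rewrite addr0; apply: eq_bigr => k _; rewrite ltn_ord mulrC.
have E3 : \sum_(k < n + M.+1) ((if (k < n)%N then A * V k - a2 else 0) - wt (slot f k)) * (S k - (2
 * m)%:R) = \sum_(k < n + M.+1) (if (k < n)%N then A * V k - a2 else 0) * (S k - (2 * m)%:R) -
 \sum_(k < n + M.+1) wt (slot f k) * (S k - (2 * m)%:R).
 by rewrite -sumrB; apply: eq_bigr => k _; rewrite mulrBl.
rewrite E1 E2 E3 -/Q /gz_res; ring.
Qed.

End zeta.

Lemma double_succ a : ((a + a).+2 = 2 * a.+1)%N. Proof. lia. Qed.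

Lemma rem_le p q m : (p <= q < p + m)%N -> ((q - p).+1 <= m)%N. Proof. lia. Qed.

Lemma rem_eq p q s r : (s + r = q)%N -> (p <= q)%N -> ((q - p).+1 + p = r.+1 + s)%N.
Proof. lia. Qed.

(** * Algebra of the limiting variance *)

Section lead_algebra.
Context {R : realType}.
Implicit Types x y : R.

(** For x = a1, y = a2, z = n and u = m: subtracting m^2 n [qq] from the variance [znorm] leaves
    error terms only. *)
Lemma norm_identity (x y z u q1 q2 D W E5 E6 : R) : 0 < u -> x * (z * u) - x ^+ 2 * (z * u) + x ^+ 2
 * q1 + (y * (z * u) - y ^+ 2 * (z * u) + y ^+ 2 * q2) + 2 * u * (D + ((x + y) ^+ 2 * E6 + (x + y)
 * (x - y) * E5 + z * ((x + y) ^+ 2 / (4 * (2 * u + 1)) + (x - y) ^+ 2 / 4)) + W) - u ^+ 2 * z *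
 ((x + y) / u - (x + y) ^+ 2 / (2 * u + 1)) = x ^+ 2 * q1 + y ^+ 2 * q2 + 2 * u * (D + W + (x + y)
 ^+ 2 * E6 + (x + y) * (x - y) * E5).
Proof. by move=> u0; field; rewrite !gt_eqF//; lra. Qed.

Lemma sum4_le (D W u1 u2 u3 u4 : R) : `|D| <= 2 * u3 -> 0 <= W <= u3 -> `|u1| <= u4 -> `|u2| <= u4
 -> u3 <= u4 -> `|D + W + u1 + u2| <= 5 * u4.
Proof. by rewrite !ler_norml; lra. Qed.

End lead_algebra.

(** * Bounded functions of beta variables *)

Section clamped_moments.
Context {R : realType}.
Notation RM := (measurableTypeR R).

(** [clamp] changes a beta variable on a null event only, and makes the function bounded
    everywhere. *)
Lemma centered_clamp a (g : R -> R) : measT (g : RM -> RM) -> (forall v, 0 <= v <= 1 -> `|g v| <= 1)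
 -> (\int[@betP R a a]_v (g v)%:E = 0)%E -> centered (@betP R a a) 1 (g \o clamp).
Proof.
move=> mg g1 g0.
have mc : measT (clamp : RM -> RM) := cont_meas (@clamp_continuous R).
have mgc : measT (g \o clamp : RM -> RM) by exact: mcomp.
have g1' v : `|g (clamp v)| <= 1 by apply: g1; exact: clamp01.
apply: centered_bounded => //.
 rewrite -g0; apply: ae_eq_integral; [exact: measurableT| | |].
 - exact/measE.
 - exact/measE.
 exists (~` `[0, 1]%classic); split; [exact: measurableC|exact: betP_null|].
 move=> v /= h; rewrite in_itv/= => v01; apply: h => _; congr EFin; congr g.
 by case: (clampP v) => -[h1 ->]; move: v01; lra.
rewrite -[leRHS](integral_prob_cst (@betP R a a) 1); apply: ge0_le_integral => //.
- by move=> v _; rewrite lee_fin sqr_ge0.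
- by apply/measE; exact: measX.
- by move=> v _; rewrite lee_fin -sqr_normr// exprn_ile1//; exact: g1'.
Qed.

Lemma small_gauss (K : R) : 0 < K -> small (@gauss R) (1 / K ^+ 2) [set z : RM | K <= `|z|].
Proof.
move=> K0; apply: (small_chebyshev (e := fun z : RM => z)) => //.
apply: centeredI; [exact: measurable_id|exact: integral_gauss|].
by rewrite integral_gauss_sqr.
Qed.

End clamped_moments.

(** * Normal approximation of the lead term *)

Section lead_event.
Context {R : realType}.
Notation RS := (@rseq R).
Notation RM := (measurableTypeR R).
Variables (a L N n1 n2 r1 r2 : nat) (t K : R).
Notation m := a.+1.
Notation n := N.+1.
Notation Mn := (2 ^ L)%N.
Notation M := (pow2 L : R).
Notation dl := (Dlev t L : R).
Notation Mc := (2 ^ L./2).-1.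
Notation Mp := (Mc.+1%:R : R).
Notation M1 := (nblocks m n1).+1.
Notation M2 := (nblocks m n2).+1.
Notation a1 := (n%:R / M1%:R : R).
Notation a2 := (n%:R / M2%:R : R).
Notation A := (a1 + a2).
Notation b := (a + a).+1.
Notation f := (cellf n Mc).
Notation w := (wt Mc A a2).
Hypotheses (n_ge : (Mn * Mn <= n)%N) (n_lt : (n < 4 * (Mn * Mn))%N) (t1 : 1 <= t) (K1 : 1 <= K) (nM1
 : (n <= M1)%N) (nM2 : (n <= M2)%N) (n1_blk : (M1 * m <= n1.+1 < M1 * m + m)%N) (n2_blk : (M2 * m
 <= n2.+1 < M2 * m + m)%N) (r1E : (n * m + r1 = n1.+1)%N) (r2E : (n * m + r2 = n2.+1)%N).

Definition bvar : R := (4 * (2 * m + 1)%:R)^-1.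

(** The limiting variance of [lead_term]: the leftover sums contribute (a1 - a1^2 + a2 - a2^2) / m,
    and the S_k contribute 2 / m times the second moment of A V - a2 for V of law Beta(m, m). *)
Definition qq : R := A / m%:R - A ^+ 2 / (2 * m + 1)%:R.

Let M0 : 0 < M := pow2_gt0 L.
Let sn : R := sqrt n%:R.

Lemma cells_gt0 : (0 < 2 ^ L./2)%N. Proof. by rewrite expn_gt0. Qed.

Lemma cells_sq : Mp ^+ 2 <= M /\ M <= 2 * Mp ^+ 2.
Proof.
rewrite prednK ?cells_gt0// -natrX -expnM /pow2 -natrM !ler_nat -expnS !leq_exp2l//.
by have := odd_double_half L; case: (odd L) => /=; lia.
Qed.

Lemma sn_ge : M <= sn.
Proof.
rewrite -[leLHS]ger0_norm ?(ltW M0)// -sqrtr_sqr ler_wsqrtr//.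
by rewrite expr2 /pow2 -natrM ler_nat.
Qed.

Lemma sqrtM_inv : (sqrt M)^-1 <= dl.
Proof. by rewrite /Dlev ler_peMr ?invr_ge0 ?sqrtr_ge0//; exact: kap_ge1. Qed.

Lemma cells_sqrt : Mp <= sqrt M /\ Mp^-1 <= 2 * dl.
Proof.
have [h1 h2] := cells_sq; have s0 : 0 < sqrt M by rewrite sqrtr_gt0.
split.
 by rewrite -[leLHS]ger0_norm// -sqrtr_sqr ler_wsqrtr.
apply: (@le_trans _ _ (2 * (sqrt M)^-1)); last by rewrite ler_wpM2l// sqrtM_inv.
rewrite -[2 * _]invf_div lef_pV2 ?posrE ?divr_gt0// ler_pdivrMr//.
rewrite -[leRHS]ger0_norm ?mulr_ge0// -sqrtr_sqr ler_wsqrtr//.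
have := sqr_ge0 Mp; move: h2; rewrite exprMn; move: (Mp ^+ 2) => p; lra.
Qed.

Lemma a1_itv : 0 < a1 <= 1. Proof. by rewrite divr_gt0//= ler_pdivrMr// mul1r ler_nat. Qed.
Lemma a2_itv : 0 < a2 <= 1. Proof. by rewrite divr_gt0//= ler_pdivrMr// mul1r ler_nat. Qed.

Lemma lin_le v : 0 <= v <= 1 -> `|A * v - a2| <= A.
Proof.
move=> /andP[v0 v1]; have /andP[p1 p1'] := a1_itv; have /andP[p2 p2'] := a2_itv.
move: (a1) (a2) p1 p1' p2 p2' => x y p1 p1' p2 p2'.
have h1 : 0 <= (x + y) * v by rewrite mulr_ge0// addr_ge0// ltW.
have h2 : (x + y) * v <= x + y by rewrite ler_piMr// addr_ge0// ltW.
by rewrite ler_norml; lra.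
Qed.

Lemma A_le2 : 0 < A <= 2.
Proof.
have /andP[p1 p1'] := a1_itv; have /andP[p2 p2'] := a2_itv.
by move: (a1) (a2) p1 p1' p2 p2' => x y *; lra.
Qed.

Lemma wt_le i : (i < Mc.+1)%N -> `|w i| <= A.
Proof.
move=> iM; apply: lin_le; rewrite divr_ge0//= ler_pdivrMr// mul1r ler_nat ltnW//.
Qed.

(** Bounds sqrt qq from below by a multiple of A. The error in the variance is proportional to A^2,
    so dividing it by sqrt qq to compare standard deviations leaves a constant uniform in A, also
    when A is close to 0 because the samples contain many more than N blocks. *)
Lemma qq_ge : (A / (2 * m + 1)%:R) ^+ 2 <= qq.
Proof.
have /andP[A0 A2] := A_le2; rewrite /qq.
have m0 : 0 < m%:R :> R by [].
have m1 : 1 <= m%:R :> R by rewrite ler1n.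
have -> : (2 * m + 1)%:R = 2 * m%:R + 1 :> R by rewrite natrD natrM.
move: (A) (m%:R : R) A0 A2 m0 m1 => x y x0 x2 y0 y1.
have d0 : 0 < 2 * y + 1 by lra.
rewrite -subr_ge0.
have -> : x / y - x ^+ 2 / (2 * y + 1) - (x / (2 * y + 1)) ^+ 2 = x * ((2 * y + 1) ^+ 2 - x * y * (2
 * y + 2)) / (y * (2 * y + 1) ^+ 2).
 by field; rewrite !gt_eqF.
rewrite divr_ge0 ?mulr_ge0 ?sqr_ge0 ?(ltW x0) ?(ltW y0) ?(ltW d0)//.
rewrite subr_ge0; apply: (@le_trans _ _ (2 * y * (2 * y + 2))).
 by rewrite -!mulrA ler_wpM2r// mulr_ge0 ?(ltW y0)//; lra.
by rewrite -subr_ge0 (_ : _ - _ = 1); [exact: ler01|ring].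
Qed.

Lemma qq_ge0 : 0 <= qq.
Proof. by apply: le_trans qq_ge; exact: sqr_ge0. Qed.

Section lead_close.
Variables (V S lX lY : nat -> R).
Hypotheses (V01 : forall k, (k < n)%N -> 0 <= V k <= 1) (mean_le : `|\sum_(k < n) (V k - 2^-1)| <= K
 * sn) (var_le : `|\sum_(k < n) ((V k - 2^-1) ^+ 2 - bvar)| <= K * sn).

Lemma znormE : znorm b r1 r2 A a1 a2 (f V) = a1 ^+ 2 * r1.+1%:R + a2 ^+ 2 * r2.+1%:R + (2 * m)%:R *
 (\sum_(k < n) w (cell Mc (V k)) ^+ 2 + \sum_(i < Mc.+1) w i ^+ 2).
Proof.
rewrite /znorm 2!big_ord_recl /= sqrrN !exprMn !sqr_sqrtr// addrA; congr (_ + _).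
transitivity ((2 * m)%:R * \sum_(k < n + Mc.+1) w (slot (f V) k) ^+ 2 * 1).
 rewrite -(sum_slot (f V) (fun i => w i ^+ 2) (fun=> 1)) mulr_sumr; apply: eq_bigr => i _.
 rewrite /= exprMn sqr_sqrtr// natrM -/(wt Mc A a2 i).
 under [in RHS]eq_bigr => k _ do rewrite mulr1.
 rewrite -natr_sum -/(occ (f V) i) (double_succ a); ring.
congr (_ * _); rewrite big_split_ord/=; congr (_ + _).
 by apply: eq_bigr => k _; rewrite mulr1 slot_ord cellfE.
by apply: eq_bigr => k _; rewrite mulr1 slot_big.
Qed.

Lemma znorm_close : `|znorm b r1 r2 A a1 a2 (f V) - m%:R ^+ 2 * n%:R * qq| <= 11 * m%:R * A ^+ 2 * K
 * (n%:R / Mp).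
Proof.
have /andP[p1 p1'] := a1_itv; have /andP[p2 p2'] := a2_itv.
have /andP[A0 A2] := A_le2.
have m0 : 0 < m%:R :> R by [].
have N0 : 0 < n%:R :> R by [].
pose c k := A * V k - a2.
pose D := \sum_(k < n) (w (cell Mc (V k)) ^+ 2 - c k ^+ 2).
pose W := \sum_(i < Mc.+1) w i ^+ 2.
pose E5 := \sum_(k < n) (V k - 2^-1); pose E6 := \sum_(k < n) ((V k - 2^-1) ^+ 2 - bvar).
have cE : \sum_(k < n) c k ^+ 2 = A ^+ 2 * E6 + A * (a1 - a2) * E5 + n%:R * (A ^+ 2 * bvar + (a1 -
 a2) ^+ 2 / 4).
 rewrite -[n%:R in RHS]/(n%:R) /E5 /E6 !mulr_sumr.
 have -> : n%:R * (A ^+ 2 * bvar + (a1 - a2) ^+ 2 / 4) = \sum_(k < n) (A ^+ 2 * bvar + (a1 - a2) ^+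
  2 / 4).
  by rewrite sumr_const card_ord mulr_natl.
 rewrite -!big_split/=; apply: eq_bigr => k _; rewrite /c.
 by move: (a1) (a2) bvar => x y z; field.
(* r + 1 equals m M' - m n plus a remainder p of at most m, and (n / M')^2 M' m is n / M' times n
   m. *)
have rho r n' M' (e1 : (n * m + r = n'.+1)%N) (e2 : (M'.+1 * m <= n'.+1 < M'.+1 * m + m)%N) :
 exists2 p : R, 0 <= p <= m%:R & (n%:R / M'.+1%:R) ^+ 2 * r.+1%:R = (n%:R / M'.+1%:R) * (n%:R *
 m%:R) - (n%:R / M'.+1%:R) ^+ 2 * (n%:R * m%:R) + (n%:R / M'.+1%:R) ^+ 2 * p.
 exists ((n'.+1 - M'.+1 * m).+1%:R).
  by rewrite ler0n ler_nat; exact: rem_le.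
 have -> : r.+1%:R = (n'.+1 - M'.+1 * m).+1%:R + M'.+1%:R * m%:R - n%:R * m%:R :> R.
  rewrite -!natrM -natrD; apply/eqP; rewrite eq_sym subr_eq -natrD eqr_nat; apply/eqP.
  by apply: rem_eq => //; case/andP: e2.
 by field; rewrite nat1r pnatr_eq0.
have [q1 /andP[q10 q11] E1] := rho _ _ _ r1E n1_blk.
have [q2 /andP[q20 q21] E2] := rho _ _ _ r2E n2_blk.
have -> : znorm b r1 r2 A a1 a2 (f V) - m%:R ^+ 2 * n%:R * qq = (a1 ^+ 2 * q1 + a2 ^+ 2 * q2) + 2 *
 m%:R * (D + W + A ^+ 2 * E6 + A * (a1 - a2) * E5).
 rewrite znormE E1 E2 -/W.
 have -> : \sum_(k < n) w (cell Mc (V k)) ^+ 2 = D + \sum_(k < n) c k ^+ 2.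
  by rewrite /D sumrB subrK.
 rewrite cE natrM /qq /bvar.
 have -> : (2 * m + 1)%:R = 2 * m%:R + 1 :> R by rewrite natrD natrM.
 exact: norm_identity.
have [sq1 sq2] := cells_sq; have Mp0 : 0 < Mp by [].
have snE : sn * sn = n%:R by rewrite -expr2 sqr_sqrtr.
have sM := sn_ge; have M1 : 1 <= M := pow2_ge1 L.
have sn0 : 0 < sn by rewrite sqrtr_gt0.
have Mp1 : 1 <= Mp by rewrite ler1n.
have Mps : Mp <= sn.
 by apply: le_trans sM; apply: le_trans sq1; rewrite expr2 ler_peMr.
pose y := n%:R / Mp.
have y3 : sn <= y by rewrite ler_pdivlMr// -snE ler_wpM2l// ltW.
have y1 : 1 <= y by apply: le_trans y3; apply: le_trans sM.
have y2 : Mp <= y by apply: le_trans y3.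
have K0 : 0 <= K := le_trans ler01 K1.
have Asq : 0 <= A ^+ 2 := sqr_ge0 _.
have b1 : 0 <= a1 ^+ 2 * q1 + a2 ^+ 2 * q2 <= m%:R * A ^+ 2.
 rewrite addr_ge0 ?mulr_ge0 ?sqr_ge0//=.
 apply: (@le_trans _ _ ((a1 ^+ 2 + a2 ^+ 2) * m%:R)).
  by rewrite mulrDl; apply: lerD; rewrite ler_wpM2l ?sqr_ge0.
 rewrite mulrC ler_wpM2l ?(ltW m0)// sqrrD; move: (a1) (a2) p1 p2 => u v u0 v0.
 by have := mulr_gt0 u0 v0; rewrite -mulr_natl; lra.
have b2 : `|D| <= 2 * A ^+ 2 * y.
 apply: (le_trans (ler_norm_sum _ _ _)).
 apply: (@le_trans _ _ (\sum_(k < n) 2 * A ^+ 2 / Mp)); last first.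
  rewrite sumr_const card_ord -(mulr_natl (2 * A ^+ 2 / Mp) n) le_eqVlt; apply/orP; left.
  by apply/eqP; rewrite /y; ring.
 apply: ler_sum => k _; have vk := V01 (ltn_ord k).
 rewrite subr_sqr normrM.
 have -> : 2 * A ^+ 2 / Mp = (A / Mp) * (A + A) by ring.
 apply: ler_pM => //.
  rewrite /c /wt (_ : _ - _ - _ = - (A * (V k - (cell Mc (V k))%:R / Mp))); last by ring.
  by rewrite normrN normrM (gtr0_norm A0) ler_wpM2l ?(ltW A0)// cell_close.
 apply: normD_le; first by apply: wt_le; rewrite ltnS cellR_le.
 exact: lin_le.
have b3 : 0 <= W <= A ^+ 2 * y.
 rewrite sumr_ge0 => [|i _]; last exact: sqr_ge0.
 apply: (@le_trans _ _ (\sum_(i < Mc.+1) A ^+ 2)).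
  apply: ler_sum => i _; rewrite -sqr_normr// lerXn2r ?nnegrE ?(ltW A0)//.
  exact: wt_le.
 by rewrite sumr_const card_ord -(mulr_natl (A ^+ 2) Mc.+1) mulrC ler_wpM2l.
have b4 : `|A ^+ 2 * E6| <= A ^+ 2 * (K * y).
 rewrite normrM (ger0_norm Asq) ler_wpM2l//; apply: (le_trans var_le).
 by rewrite ler_wpM2l.
have b5 : `|A * (a1 - a2) * E5| <= A ^+ 2 * (K * y).
 rewrite normrM; apply: ler_pM => //; last by apply: (le_trans mean_le); rewrite ler_wpM2l.
 rewrite normrM (gtr0_norm A0) expr2 ler_wpM2l ?(ltW A0)//.
 by move: (a1) (a2) p1 p2 => u v u0 v0; rewrite ler_norml; lra.
have k1 : A ^+ 2 * y <= A ^+ 2 * (K * y) by rewrite ler_wpM2l// ler_peMl//; lra.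
have k2 : A ^+ 2 <= A ^+ 2 * (K * y).
 by apply: le_trans k1; rewrite ler_peMr.
have k3 : 2 * A ^+ 2 * y = 2 * (A ^+ 2 * y) by ring.
rewrite k3 in b2.
have T : `|D + W + A ^+ 2 * E6 + A * (a1 - a2) * E5| <= 5 * (A ^+ 2 * (K * y)).
 exact: sum4_le b2 b3 b4 b5 k1.
have -> : 11 * m%:R * A ^+ 2 * K * y = m%:R * (A ^+ 2 * (K * y)) + 2 * m%:R * (5 * (A ^+ 2 * (K * y))) by ring.
apply: normD_le.
 rewrite ger0_norm; last by case/andP: b1.
 by apply: (le_trans (proj2 (andP b1))); rewrite ler_wpM2l// ltW.
by rewrite normrM (ger0_norm (_ : 0 <= 2 * m%:R))// ler_wpM2l.
Qed.

Hypothesis sum_le : `|\sum_(k < n + Mc.+1) ((if (k < n)%N then A * V k - a2 else 0) - w (slot (f V)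
 k)) * (S k - (2 * m)%:R)| <= K * sqrt M.
Hypotheses (cell_le : \sum_(i < Mc.+1) expR (2 * `|cell_gauss b (f V) S i|) <= K * Mp) (resX :
 `|gz_res r1 (\sum_(l < r1.+1) lX l)| <= K) (resY : `|gz_res r2 (\sum_(l < r2.+1) lY l)| <= K)
 (S_gt0 : forall k, 0 < S k).
Notation ze := (zeta b n Mc r1 r2 A a1 a2 (V, (S, (lX, lY)))).
Hypothesis ze_le : `|ze| <= K.

Lemma lead_close : `|lead_term m n A a1 a2 r1 r2 V S lX lY - sqrt qq * ze| <= (11 * K + 44 * (2 * m
 + 1)%:R * K ^+ 2) * dl.
Proof.
have /andP[p1 p1'] := a1_itv; have /andP[p2 p2'] := a2_itv.
have /andP[A0 A2] := A_le2.
have m0 : 0 < m%:R :> R by [].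
have m1 : 1 <= m%:R :> R by rewrite ler1n.
have N0 : 0 < n%:R :> R by [].
have K0 : 0 <= K := le_trans ler01 K1.
have sn0 : 0 < sn by rewrite sqrtr_gt0.
have snE : sn * sn = n%:R by rewrite -expr2 sqr_sqrtr.
have d0 : 0 <= dl := Dlev_ge0 _ _.
have [Mp1 Mp2] := cells_sqrt; have sqM0 : 0 < sqrt M by rewrite sqrtr_gt0.
have sqM1 : 1 <= sqrt M by rewrite -[leLHS]sqrtr1 ler_wsqrtr// pow2_ge1.
pose zn := znorm b r1 r2 A a1 a2 (f V).
have zn0 : 0 < zn by apply: znorm_gt0.
pose nu := sqrt zn / (m%:R * sn).
have E : lead_term m n A a1 a2 r1 r2 V S lX lY - nu * ze = (m%:R * sn)^-1 * (\sum_(k < n + Mc.+1)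
 ((if (k < n)%N then A * V k - a2 else 0) - w (slot (f V) k)) * (S k - (2 * m)%:R) + \sum_(i <
 Mc.+1) w i * gz_res (occ (f V) i * b.+1).-1 (\sum_(k < n + Mc.+1) (slot (f V) k == i)%:R * S k) +
 a1 * gz_res r1 (\sum_(l < r1.+1) lX l) - a2 * gz_res r2 (\sum_(l < r2.+1) lY l)).
 have bm : (b.+1 = 2 * m)%N := double_succ a.
 rewrite -(@zeta_lead R b n Mc r1 r2 A a1 a2 p1 m V S lX lY bm) /lead_term -/zn -/sn /nu.
 by ring.
have B : `|lead_term m n A a1 a2 r1 r2 V S lX lY - nu * ze| <= 11 * K * dl.
 have r0 : 0 <= (m%:R * sn)^-1 by rewrite invr_ge0 mulr_ge0// ltW.
 rewrite E normrM (ger0_norm r0).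
 have h2 : `|\sum_(i < Mc.+1) w i * gz_res (occ (f V) i * b.+1).-1 (\sum_(k < n + Mc.+1) (slot (f
  V) k == i)%:R * S k)| <= 8 * (K * sqrt M).
  apply: (@le_trans _ _ (8 * \sum_(i < Mc.+1) expR (2 * `|cell_gauss b (f V) S i|))).
   rewrite mulr_sumr; apply: (le_trans (ler_norm_sum _ _ _)); apply: ler_sum => i _.
   rewrite normrM (_ : 8 * _ = 2 * (4 * expR (2 * `|cell_gauss b (f V) S i|))); last by ring.
   apply: ler_pM => //; first exact: le_trans (wt_le (ltn_ord i)) A2.
   rewrite cell_gaussE//; apply: gz_err.
   have [k kn ki] := slot_surj (f V) (ltn_ord i).
   rewrite (bigD1 (Ordinal kn))//= ki eqxx mul1r ltr_pwDl//.
   by apply: sumr_ge0 => k' _; rewrite mulr_ge0// ltW.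
  by rewrite ler_wpM2l//; apply: (le_trans cell_le); rewrite ler_wpM2l.
 have h3 : `|a1 * gz_res r1 (\sum_(l < r1.+1) lX l)| <= K * sqrt M.
  rewrite normrM (gtr0_norm p1) mulrC; apply: ler_pM => //; exact: le_trans p1' sqM1.
 have h4 : `|a2 * gz_res r2 (\sum_(l < r2.+1) lY l)| <= K * sqrt M.
  rewrite normrM (gtr0_norm p2) mulrC; apply: ler_pM => //; exact: le_trans p2' sqM1.
 apply: (@le_trans _ _ ((m%:R * sn)^-1 * (11 * (K * sqrt M)))).
  rewrite ler_wpM2l//.
  have -> : 11 * (K * sqrt M) = K * sqrt M + 8 * (K * sqrt M) + K * sqrt M + K * sqrt M by ring.
  apply: (le_trans (ler_normB _ _)); apply: lerD => //.
  apply: normD_le => //.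
  by apply: normD_le.
 rewrite (_ : (m%:R * sn)^-1 * _ = 11 * K * (sqrt M / (m%:R * sn))); last by ring.
 rewrite ler_wpM2l ?mulr_ge0//; apply: le_trans sqrtM_inv.
 rewrite ler_pdivrMr ?mulr_gt0// mulrC ler_pdivlMr// -expr2 sqr_sqrtr ?(ltW M0)//.
 by apply: (le_trans sn_ge); rewrite ler_peMl// ltW.
have Bq : `|nu - sqrt qq| <= 44 * (2 * m + 1)%:R * K * dl.
 have q0 := qq_ge0; have ql : A / (2 * m + 1)%:R <= sqrt qq.
  rewrite -[leLHS]ger0_norm ?divr_ge0 ?(ltW A0)// -sqrtr_sqr ler_wsqrtr//; exact: qq_ge.
 have nu0 : 0 <= nu by rewrite divr_ge0 ?sqrtr_ge0// mulr_ge0// ltW.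
 have w0 : (0 : R) < (2 * m + 1)%:R by rewrite addn1.
 have sum0 : 0 < nu + sqrt qq.
  by apply: (@lt_le_trans _ _ (A / (2 * m + 1)%:R)); [rewrite divr_gt0|rewrite -[leLHS]add0r lerD].
 have nu2 : nu ^+ 2 = zn / (m%:R ^+ 2 * n%:R).
  by rewrite /nu expr_div_n sqr_sqrtr ?ltW// exprMn -snE expr2 [sn ^+ 2]expr2.
 have d2 : `|nu ^+ 2 - qq| <= 11 * A ^+ 2 * K / Mp.
  rewrite nu2 (_ : _ - qq = (zn - m%:R ^+ 2 * n%:R * qq) / (m%:R ^+ 2 * n%:R)); last first.
   by field; rewrite ?nat1r ?pnatr_eq0.
  have den0 : 0 < m%:R ^+ 2 * n%:R :> R by rewrite mulr_gt0// exprn_gt0.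
  rewrite normrM (gtr0_norm (_ : 0 < (m%:R ^+ 2 * n%:R)^-1)) ?invr_gt0// ler_pdivrMr//.
  apply: (le_trans znorm_close).
  have -> : 11 * A ^+ 2 * K / Mp * (m%:R ^+ 2 * n%:R) = m%:R * (11 * m%:R * A ^+ 2 * K * (n%:R / Mp)) by ring.
  by rewrite ler_peMl// !mulr_ge0 ?invr_ge0 ?(ltW A0)//; exact: ltW.
 have F : (nu - sqrt qq) * (nu + sqrt qq) = nu ^+ 2 - qq.
  by rewrite -[in RHS](sqr_sqrtr q0); ring.
 rewrite -(ler_pM2r sum0) -{1}(gtr0_norm sum0) -normrM F; apply: (le_trans d2).
 apply: (@le_trans _ _ (44 * (2 * m + 1)%:R * K * dl * (A / (2 * m + 1)%:R))); last first.
  by rewrite ler_wpM2l ?mulr_ge0// -[leLHS]add0r lerD.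
 have -> : 44 * (2 * m + 1)%:R * K * dl * (A / (2 * m + 1)%:R) = 11 * (2 * A) * K * (2 * dl).
  have h (x w' k d : R) : w' != 0 -> 44 * w' * k * d * (x / w') = 11 * (2 * x) * k * (2 * d).
   by move=> ?; field.
  by apply: h; rewrite gt_eqF.
 apply: ler_pM => //; rewrite ?invr_ge0// ?mulr_ge0 ?(ltW A0) ?sqr_ge0//.
 by rewrite ler_wpM2r// ler_wpM2l// expr2 ler_wpM2r// ltW.
rewrite (_ : _ - _ * ze = (lead_term m n A a1 a2 r1 r2 V S lX lY - nu * ze) + (nu - sqrt qq) * ze); last by ring.
apply: (le_trans (ler_normD _ _)); rewrite [leRHS]mulrDl; apply: lerD => //.
rewrite normrM (_ : 44 * _ * _ * _ = 44 * (2 * m + 1)%:R * K * dl * K); last by ring.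
exact: ler_pM.
Qed.

End lead_close.

Notation rest := (RS * (RS * RS))%type.

Notation expP2 := (prodP (pow (@expP R)) (pow expP)).
Notation gamP := (prodP (pow (@gam R b)) expP2).
Definition cond_law := prodP (pow (@betP R a a)) gamP.

(** One summand for each event of [ev_lead], in the same order; 0 stands for the null event that
    some gamma variable is nonpositive. *)
Definition lead_prob : R := 72 * m%:R + 2 * expR 2 + (gz_var + gz_var) + (1 + 1) + 0 + 1.

(** The error in the weight of S_k. For k < n it comes from the discretization; the extra indices,
    which fill empty cells, do not occur in the lead term and count with their full weight. *)
Definition fluct (V : nat -> R) (k : nat) : R := (if (k < n)%N then A * V k - a2 else 0) - wt Mc A
 a2 (slot (cellf n Mc V) k).

Lemma meas_fluct k : measT (fun p : RS * rest => fluct p.1 k : RM).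
Proof.
rewrite /fluct; apply: measB.
 case: (k < n)%N; last exact: measurable_cst.
 apply: measB => //; apply: measM => //.
 exact: (mcomp (meas_coord k) measurable_fst).
apply: (meas_by_cells (T' := RM) (g := fun f _ => wt Mc A a2 (slot f k) : RM)) => f.
exact: measurable_cst.
Qed.

Lemma fluct_var V : (forall k, (k < n)%N -> 0 <= V k <= 1) -> \sum_(k < n + Mc.+1) fluct V k ^+ 2 *
 b.+1%:R <= 72 * m%:R * M.
Proof.
move=> V01; have /andP[A0 A2] := A_le2.
have [sq1 sq2] := cells_sq.
have Mp0 : 0 < Mp by []. have M1' : 1 <= M := pow2_ge1 L.
rewrite -mulr_suml.
have bE : b.+1%:R = 2 * m%:R :> R by rewrite double_succ natrM.
rewrite bE (_ : 72 * m%:R * M = 36 * M * (2 * m%:R)); last by ring.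
rewrite ler_wpM2r// big_split_ord/=.
have h1 : \sum_(k < n) fluct V k ^+ 2 <= 32 * M.
 apply: (@le_trans _ _ (\sum_(k < n) 4 / Mp ^+ 2)).
  apply: ler_sum => k _; have vk := V01 k (ltn_ord k).
  rewrite /fluct ltn_ord slot_ord cellfE /wt.
  rewrite (_ : _ - _ - _ = A * (V k - (cell Mc (V k))%:R / Mp)); last by ring.
  rewrite -sqr_normr// (_ : 4 / Mp ^+ 2 = (2 / Mp) ^+ 2); last first.
   by rewrite expr_div_n (_ : 2 ^+ 2 = 4 :> R)// -natrX.
  rewrite lerXn2r ?nnegrE ?divr_ge0// normrM (gtr0_norm A0).
  by apply: ler_pM => //; exact: cell_close.
 rewrite sumr_const card_ord -(mulr_natl (4 / Mp ^+ 2) n).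
 rewrite mulrA ler_pdivrMr ?exprn_gt0//.
 have nb : n%:R <= 4 * M ^+ 2 by rewrite -natrX -natrM ler_nat -mulnn ltnW.
 apply: (@le_trans _ _ (16 * M * M)).
  by rewrite (_ : 16 * M * M = 4 * M ^+ 2 * 4); [rewrite ler_wpM2r|ring].
 rewrite (_ : 32 * M * Mp ^+ 2 = 16 * M * (2 * Mp ^+ 2)); last by ring.
 by rewrite ler_wpM2l// mulr_ge0// ltW.
have h2 : \sum_(i < Mc.+1) fluct V (n + i)%N ^+ 2 <= 4 * M.
 apply: (@le_trans _ _ (\sum_(i < Mc.+1) 4)).
  apply: ler_sum => i _; rewrite /fluct ltnNge leq_addr/= slot_big sub0r sqrrN.
  rewrite -sqr_normr// (_ : 4 = 2 ^+ 2); last by rewrite -natrX.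
  by rewrite lerXn2r ?nnegrE//; apply: le_trans (wt_le (ltn_ord i)) A2.
 rewrite sumr_const card_ord -(mulr_natl 4 Mc.+1) mulrC ler_wpM2l//.
 by apply: le_trans sq1; rewrite expr2 ler_peMr// ler1n.
by rewrite (_ : 36 * M = 32 * M + 4 * M); [exact: lerD|ring].
Qed.

Definition ev_fluct : set (RS * rest) := [set p : RS * rest | (forall k, (k < n)%N -> 0 <= p.1 k <=
 1) /\ K * sqrt M <= `|\sum_(k < n + Mc.+1) fluct p.1 k * (p.2.1 k - (2 * m)%:R)|].

(** For fixed V the terms are independent and centered, so Kolmogorov's inequality bounds each
    conditional probability. That V lies in [0, 1] is part of the event, since the variance bound
    [fluct_var] depends on it. *)
Lemma small_fluct : small cond_law (72 * m%:R / K) ev_fluct.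
Proof.
have K0 : 0 < K := lt_le_trans ltr01 K1.
have mS : measT (fun p : RS * rest => \sum_(k < n + Mc.+1) fluct p.1 k * (p.2.1 k - (2 * m)%:R) :
 RM).
 apply: measurable_sum => k; apply: measM; first exact: meas_fluct.
 apply: measB => //.
 exact: (mcomp (meas_coord k) (mcomp measurable_fst measurable_snd)).
have mE : measurable [set p : RS * rest | K * sqrt M <= `|\sum_(k < n + Mc.+1) fluct p.1 k * (p.2.1
 k - (2 * m)%:R)|].
 by apply: meas_ge; exact: mcomp.
have mG : measurable [set p : RS * rest | forall k, (k < n)%N -> 0 <= p.1 k <= 1].
 rewrite (_ : [set p | _] = fst @^-1` (\bigcap_(k in [set k | (k < n)%N]) [set V : RS | V k \in `[0, 1]])).
  apply: meas_preim; first exact: measurable_fst.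
  apply: bigcap_measurableType => k _.
  exact: (meas_preim (meas_coord k) (@measurable_itv R `[0, 1])).
 by apply/seteqP; split => p /= h k kn; have := h k kn; rewrite /= in_itv.
apply: small_prod.
- exact: measurableI.
- by rewrite divr_ge0 ?mulr_ge0// ltW.
move=> V /=; have [V01|nV] := pselect (forall k, (k < n)%N -> 0 <= V k <= 1); last first.
 rewrite (_ : [set y | _] = set0); last by apply/seteqP; split => y //= -[].
 have -> := @measure0 _ _ _ gamP.
 by rewrite lee_fin divr_ge0 ?mulr_ge0// ltW.
have x0 : 0 < K * sqrt M by rewrite mulr_gt0// sqrtr_gt0.
have mk k : measT (fun x : RM => fluct V k * (x - b.+1%:R) : RM).
 by apply: measM => //; exact: measB.
have ck k : (k < n + Mc.+1)%N -> centered (@gam R b) (fluct V k ^+ 2 * b.+1%:R) (fun x : RM => fluct V k * (x - b.+1%:R)).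
 by move=> _; exact: centeredZ (centered_gam b).
have [mB hB] := small_mp (mp_fst (pow (@gam R b)) expP2) (small_kolmogorov x0 mk ck).
apply: (@le_trans _ _ (gamP (fst @^-1` [set S : RS | exists k, (k <= n + Mc.+1)%N /\ K * sqrt M <=
 `|\sum_(i < k) fluct V i * (S i - b.+1%:R)|]))).
 apply: le_measure; rewrite ?inE//.
  exact: (meas_preim (meas_pairl V) (measurableI _ _ mG mE)).
 by move=> y /= [_ h]; exists (n + Mc.+1)%N; split => //; rewrite double_succ.
apply: (le_trans hB); rewrite lee_fin exprMn sqr_sqrtr ?(ltW M0)//.
rewrite ler_pdivrMr ?mulr_gt0 ?exprn_gt0//; apply: (le_trans (fluct_var V01)).
rewrite (_ : 72 * m%:R / K * (K ^+ 2 * M) = 72 * m%:R * M * K); last by field; rewrite gt_eqF.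
by rewrite ler_peMr// !mulr_ge0// ltW.
Qed.

Definition ev_lead : set (RS * rest) := ev_fluct `|` [set p : RS * rest | K * Mp <= \sum_(i < Mc.+1)
 expR (2 * `|cell_gauss b (cellf n Mc p.1) p.2.1 i|)] `|` ([set p : RS * rest | K <= `|gz_res r1
 (prefix_sum r1.+1 p.2.2.1)|] `|` [set p : RS * rest | K <= `|gz_res r2 (prefix_sum r2.+1
 p.2.2.2)|]) `|` ([set p : RS * rest | exists k, (k <= n)%N /\ K * sqrt n%:R <= `|\sum_(i < k)
 (clamp (p.1 i) - 2^-1)|] `|` [set p : RS * rest | exists k, (k <= n)%N /\ K * sqrt n%:R <=
 `|\sum_(i < k) ((clamp (p.1 i) - 2^-1) ^+ 2 - bvar)|]) `|` [set p : RS * rest | exists k, p.2.1 k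
 <= 0] `|` [set p : RS * rest | K <= `|zeta b n Mc r1 r2 A a1 a2 p|].

Lemma invK2 (c : R) : 0 <= c -> c / K ^+ 2 <= c / K.
Proof.
move=> c0; have K0 : 0 < K := lt_le_trans ltr01 K1.
by rewrite ler_wpM2l// lef_pV2 ?posrE ?exprn_gt0// expr2 ler_peMr// ltW.
Qed.

Lemma small_lead : small cond_law (lead_prob / K) ev_lead.
Proof.
have K0 : 0 < K := lt_le_trans ltr01 K1.
have sn0 : 0 < sqrt n%:R :> R by rewrite sqrtr_gt0.
have /andP[p1 _] := a1_itv.
have g0 : 0 <= gz_var :> R by rewrite mulr_ge0// expR_ge0.
have -> : lead_prob / K = 72 * m%:R / K + 2 * expR 2 / K + (gz_var / K + gz_var / K) + (1 / K + 1 / K) + 0 + 1 / K.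
 by rewrite /lead_prob; field; rewrite gt_eqF.
apply: smallU; last first.
 apply: small_le (small_mp (mp_comp (mp_zeta b n Mc r1 r2 A a2 p1 (pow (@betP R a a))) (mp_snd _ _)) (small_gauss K0)).
 exact: invK2.
apply: smallU; last first.
 have h := small_null (measurable_itv _) (@gam_pos R b).
 have := small_mp (mp_comp (mp_snd (pow (@betP R a a)) _) (mp_fst (pow (@gam R b)) expP2)) h.
 rewrite (_ : _ @^-1` _ = [set p : RS * rest | exists k, p.2.1 k <= 0])//.
have mean0 : (\int[@betP R a a]_v (v - 2^-1)%:E = 0)%E.
 have i1 : (@betP R a a).-integrable setT (fun v : RM => v%:E).
  apply: (integrable_of_sqr (C := 4^-1 + (4 * (2 * m + 1)%:R)^-1)) => //.
  by rewrite betP_sqr.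
 under eq_integral => v _ do rewrite EFinB.
 rewrite integralB//; last exact: finite_measure_integrable_cst.
 by rewrite betP_mean (integral_prob_cst (@betP R a a) 2^-1) subee.
have bv0 : 0 <= bvar <= 1.
 rewrite /bvar invr_ge0 mulr_ge0//= invf_le1; last by rewrite mulr_gt0// ltr0n addn1.
 by rewrite -natrM ler1n muln_gt0 addn1.
have var0 : (\int[@betP R a a]_v ((v - 2^-1) ^+ 2 - bvar)%:E = 0)%E.
 have i1 : (@betP R a a).-integrable setT (fun v : RM => v%:E).
  apply: (integrable_of_sqr (C := 4^-1 + (4 * (2 * m + 1)%:R)^-1)) => //.
  by rewrite betP_sqr.
 have m2 : measT (fun v : RM => (v ^+ 2)%:E).
  by apply/measE; exact: measX.
 have i2 : (@betP R a a).-integrable setT (fun v : RM => (v ^+ 2)%:E).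
  apply/integrableP; split => //.
  rewrite (eq_integral (fun v : RM => (v ^+ 2)%:E)) ?betP_sqr ?ltry// => v _.
  by rewrite gee0_abs// lee_fin sqr_ge0.
 transitivity (\int[@betP R a a]_v ((v ^+ 2)%:E - (v%:E + (bvar - 4^-1)%:E)))%E.
  apply: eq_integral => v _.
  by rewrite -[RHS]/((v ^+ 2 - (v + (bvar - 4^-1)))%:E); congr EFin; field.
 have ic : (@betP R a a).-integrable setT (fun v : RM => (bvar - 4^-1)%:E) by exact: finite_measure_integrable_cst.
 rewrite integralB//; last exact: integrableD.
 rewrite integralD// betP_sqr betP_mean (integral_prob_cst (@betP R a a) (bvar - 4^-1)).
 rewrite -[LHS]/((4^-1 + (4 * (2 * m + 1)%:R)^-1 - (2^-1 + (bvar - 4^-1)))%:E).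
 congr EFin; rewrite /bvar; field.
 by rewrite gt_eqF//; have := ler0n R a; lra.
have c1 := centered_clamp (a := a) (g := fun v => v - 2^-1) _ _ mean0.
have c2 := centered_clamp (a := a) (g := fun v => (v - 2^-1) ^+ 2 - bvar) _ _ var0.
have kol (g : R -> R) : measT (g : RM -> RM) -> centered (@betP R a a) 1 g -> small cond_law (1 / K)
 [set p : RS * rest | exists k, (k <= n)%N /\ K * sqrt n%:R <= `|\sum_(i < k) g (p.1 i)|].
 move=> mg cg; have x0 : 0 < K * sqrt n%:R :> R by rewrite mulr_gt0.
 apply: small_le (small_mp (mp_fst _ _) (small_kolmogorov (n := n) (e := fun=> g) (C := fun=> 1) x0 (fun=> mg) (fun _ _ => cg))).
 rewrite sumr_const card_ord exprMn sqr_sqrtr// invfM mulrCA divff ?pnatr_eq0// mulr1.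
 by rewrite -[K ^- 2]mul1r; exact: invK2.
apply: smallU; last first.
 apply: smallU.
  apply: (kol (fun v => clamp v - 2^-1)); last first.
   apply: c1; first exact: measB.
   by move=> v v01; rewrite ler_norml; lra.
  apply: measB => //; exact: cont_meas (@clamp_continuous R).
 apply: (kol (fun v => (clamp v - 2^-1) ^+ 2 - bvar)); last first.
  apply: c2; first by apply: measB => //; apply: measX; exact: measB.
  move=> v v01; have : 0 <= (v - 2^-1) ^+ 2 <= 1.
   by rewrite sqr_ge0/= -sqr_normr// exprn_ile1// ler_norml; lra.
  by move: ((v - 2^-1) ^+ 2) bv0 => q; rewrite ler_norml; lra.
 apply: measB => //; apply: measX; apply: measB => //.
 exact: cont_meas (@clamp_continuous R).
have gzr r (g : RS * rest -> RS) : mp cond_law (pow expP) g -> small cond_law (gz_var / K) [set p :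
 RS * rest | K <= `|gz_res r (prefix_sum r.+1 (g p))|].
 move=> hg; have h := mp_comp (@mp_sum_shift R 0 r) (mp_fst _ _); rewrite muln1/= in h.
 apply: small_le (small_mp (mp_comp hg h) (small_chebyshev K0 (centered_gz_res r))).
 exact: invK2.
apply: smallU; last first.
 have p2 := mp_comp (mp_snd (pow (@betP R a a)) _) (mp_snd (pow (@gam R b)) expP2).
 apply: smallU; apply: gzr; first exact: (mp_comp p2 (mp_fst _ _)).
 exact: (mp_comp p2 (mp_snd _ _)).
apply: smallU; first exact: small_fluct.
have KM : 0 < K * Mp by rewrite mulr_gt0.
have mf : measT (fun z : RM => expR (2 * `|z|) : RM).
 by apply/measE; apply: meas_expRl; apply: measM => //; exact: mcomp.
have h := small_markov_sum Mc.+1 KM mf (fun z => expR_ge0 _) (gauss_exp_abs 2).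
apply: small_le (small_mp (mp_zcell b n Mc (pow (@betP R a a))) h).
rewrite (_ : (2 : R) ^+ 2 / 2 = 2); last by field.
have : Mp != 0 by rewrite pnatr_eq0.
move: (Mp) => x x0; rewrite (_ : _ / _ = 2 * expR 2 / K)//.
by field; rewrite x0 gt_eqF.
Qed.

Lemma lead_event (p : RS * rest) : ~ ev_lead p -> (forall k, (k < n)%N -> 0 <= p.1 k <= 1) ->
 `|lead_term m n A a1 a2 r1 r2 p.1 p.2.1 p.2.2.1 p.2.2.2 - sqrt (qq) * zeta b n Mc r1 r2 A a1 a2 p|
 <= (11 * K + 44 * (2 * m + 1)%:R * K ^+ 2) * dl /\ `|zeta b n Mc r1 r2 A a1 a2 p| <= K.
Proof.
case: p => V [S [lX lY]] /= nB V01.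
have nlt (x y : R) : ~ (x <= y) -> y <= x by move=> h; rewrite leNgt; apply/negP => /ltW.
have clE k : (k < n)%N -> clamp (V k) = V k.
 by move=> /V01; case: (clampP (V k)) => -[h ->]; lra.
move: nB; rewrite /ev_lead => /not_orP[/not_orP[/not_orP[/not_orP[/not_orP[e1 e2] /not_orP[e3 e4]] /not_orP[e5 e6]] e7] e8].
have z8 : `|zeta b n Mc r1 r2 A a1 a2 (V, (S, (lX, lY)))| <= K by apply: nlt.
split => //.
apply: lead_close => //.
- apply: nlt => h; apply: e5; exists n; split => //=; apply: (le_trans h).
 by apply: le_of_eq; congr Num.norm; apply: eq_bigr => k _; rewrite clE.
- apply: nlt => h; apply: e6; exists n; split => //=; apply: (le_trans h).
 by apply: le_of_eq; congr Num.norm; apply: eq_bigr => k _; rewrite clE.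
- by apply: nlt => h; apply: e1.
- exact: nlt.
- exact: nlt.
- exact: nlt.
- by move=> k; rewrite ltNge; apply/negP => h; apply: e7; exists k.
Qed.

End lead_event.

(** * The chain of transformations of the sample *)

Section stages.
Context {R : realType}.
Notation RS := (@rseq R).
Notation RM := (measurableTypeR R).
Variable a : nat.
Notation m := a.+1.

Definition seed : prob (RS * RS)%type R := prodP (pow unif) (pow expP).

(** The auxiliary exponentials [p.2] supply the independent gamma total and the continuation: the
    given uniform sample becomes part of an i.i.d. exponential sequence whose first n + 1 terms are
    proportional to its spacings. *)
Definition spc n (p : RS * RS) : RS := gamma_spacings n ((p.1, prefix_sum n.+1 p.2), shift_by n.+1
 p.2).

Lemma mp_spc n : mp seed (pow expP) (spc n).
Proof.
have h := @mp_sum_shift R 0 n; rewrite muln1/= in h.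
exact: mp_comp (mp_comp (mp_prod (mp_id (pow unif)) h) (mp_assoc _ _ _)) (mp_gamma_spacings n).
Qed.

(** Serves the terms after the last block only, which must have the same gamma law as the block
    sums. *)
Definition exp_to_gam (x : R) : R := quantile (@gam R a) (cdfR (@gam R 0) x).

Lemma mp_exp_to_gam : mp (@gam R 0) (@gam R a) (exp_to_gam : RM -> RM).
Proof.
apply: mp_comp (mp_cdfR _) (mp_quantile (@gam R a)).
exact: gam_cdf_continuous.
Qed.

Definition block_sums n N (al be : nat -> nat) (p : RS * RS) : RS * RS := (blk (fun=> id) exp_to_gam
 (nseq N.+1 m) (fun l => spc n p (al l)), fun l => spc n p (be l)).

Lemma mp_block_sums n N al be : injective al -> injective be -> (forall x y, al x <> be y) -> mp
 seed (prodP (pow (@gam R a)) (pow expP)) (block_sums n N al be).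
Proof.
move=> ia ib dis.
have h : mp (pow expP) (pow (@gam R a)) (blk (fun=> id) exp_to_gam (nseq N.+1 m)).
 apply: (mp_blk (a := 0) (nu := @gam R a)); last exact: mp_exp_to_gam.
  by apply/allP => x; rewrite mem_nseq/= => /eqP ->.
 by move=> x _; rewrite mem_nseq/= => /eqP ->; rewrite muln1; exact: mp_id.
exact: mp_comp (mp_comp (mp_spc n) (mp_split (powP _) ia ib dis)) (mp_prod h (mp_id _)).
Qed.

Definition ratios (p : (RS * RS) * (RS * RS)) : RS * (RS * (RS * RS)) := ((fun k => p.1.1 k / (p.1.1
 k + p.2.1 k)), ((fun k => p.1.1 k + p.2.1 k), (p.1.2, p.2.2))).

Lemma mp_ratios : mp (prodP (prodP (pow (@gam R a)) (pow expP)) (prodP (pow (@gam R a)) (pow expP)))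
 (@cond_law R a) ratios.
Proof.
have h := mp_zip (powP _) (powP _) (powP _) (powP _) (@mp_beta_gamma R a a).
exact: mp_comp (mp_comp (mp_interchange _ _ _ _) (mp_prod h (mp_id (prodP (pow expP) (pow expP))))) (mp_assocV _ _ _).
Qed.

Variables (L N n1 n2 r1 r2 : nat) (al be al' be' : nat -> nat).
Hypotheses (al_inj : injective al) (be_inj : injective be) (al_be : forall x y, al x <> be y)
 (al_inj' : injective al') (be_inj' : injective be') (al_be' : forall x y, al' x <> be' y).
Notation n := N.+1.
Notation Mn := (2 ^ L)%N.
Notation M := (pow2 L : R).
Notation Mc := (2 ^ L./2).-1.
Notation M1 := (nblocks m n1).+1.
Notation M2 := (nblocks m n2).+1.
Notation a1 := (n%:R / M1%:R : R).
Notation a2 := (n%:R / M2%:R : R).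
Notation A := (a1 + a2).
Notation b := (a + a).+1.
Notation H := (@Hc R a).
Hypotheses (Mn_le : (Mn <= n)%N) (M_large : 2 / ssq H <= M).

(** One space for all N: a uniform and an auxiliary exponential sequence for X, the same for Y, then
    exponentials for the sample of the H(V_k) and the normal variable to be exchanged with the
    integral. *)
Definition sample := (((RS * RS) * (RS * RS)) * (RS * RM))%type.

Definition sample_law : prob sample R := prodP (prodP seed seed) (prodP (pow expP) gauss).

Definition vsl (w : sample) : RS * (RS * (RS * RS)) := ratios (block_sums n1 N al be w.1.1,
 block_sums n2 N al' be' w.1.2).

Lemma mp_vsl : mp sample_law (@cond_law R a) vsl.
Proof.
exact: mp_comp (mp_comp (mp_fst _ _) (mp_prod (mp_block_sums n1 N al_inj be_inj al_be)
 (mp_block_sums n2 N al_inj' be_inj' al_be'))) mp_ratios.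
Qed.

(** The device of [spc] a second time, applied to the uniform variables H(V_k) instead of the
    original observations. *)
Definition uspc (w : sample) : RS := spc n ((fun k => H ((vsl w).1 k)) : RS, w.2.1).

Definition zblk (e : RS) : RS := blk (fun c x => - gz c.-1 x) (fun x => - gz 0 x) (nseq Mn (n.+1 %/
 Mn)%N) e.

Lemma mp_zblk : mp (pow expP) (pow (@gauss R)) zblk.
Proof.
have h k : mp (@gam R k) gauss (fun x : RM => - gz k x : RM).
 exact: mp_comp (mp_gz k) (@mp_gauss_opp R).
apply: (mp_blk (a := 0) (nu := @gauss R)); last exact: h.
 apply/allP => x; rewrite mem_nseq => /andP[_ /eqP ->].
 by rewrite divn_gt0 ?expn_gt0// (leq_trans Mn_le).
by move=> x _ _; rewrite muln1; exact: h.
Qed.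

Definition zetaw (w : sample) : R := zeta b n Mc r1 r2 A a1 a2 (vsl w).

Definition noise (w : sample) : RS * RM := swap_dir Mn (dirM L H) (zblk (uspc w), w.2.2).

(** [zetaw] uses the sums and the leftovers but is independent of the V_k; the walk, its integral
    and the fresh normal are functions of the V_k and of other auxiliary variables. All three
    components are therefore independent. *)
Lemma mp_noise : mp sample_law (prodP (prodP (pow gauss) gauss) gauss) (fun w => (noise w, zetaw w :
 RM)).
Proof.
have p1 : 0 < a1 by rewrite divr_gt0.
have h1 : mp sample_law (prodP (@cond_law R a) (prodP (pow expP) gauss)) (fun w => (vsl w, w.2)).
 have hv := mp_comp (mp_prod (mp_block_sums n1 N al_inj be_inj al_be) (mp_block_sums n2 N al_inj'
  be_inj' al_be')) mp_ratios.
 exact: mp_prod hv (mp_id _).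
have h2 := mp_comp h1 (mp_prod (mp_zeta b n Mc r1 r2 A a2 p1 (pow (@betP R a a))) (mp_id (prodP (pow
 expP) gauss))).
have hH : mp (pow (@betP R a a)) (pow unif) (fun V : RS => (fun k => H (V k)) : RS).
 apply: (mp_map (powP _) (powP _) (f := H)); apply: mp_cdfR; exact: Hc_continuous.
have h3 := mp_comp (mp_comp h2 (mp_interchange _ _ _ _)) (mp_prod (mp_comp (mp_comp (mp_prod hH
 (mp_id (pow expP))) (mp_spc n)) mp_zblk) (mp_swap gauss gauss)).
have h4 := mp_comp h3 (mp_assoc _ _ _).
have h5 := mp_swap_dir (dirM_unit (@Hc_continuous R a) (@Hc_le1 R a) (@ssq_Hc_gt0 R a) M_large).
have h6 := mp_comp h4 (mp_prod h5 (mp_id gauss)).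
exact: mp_eqfun h6.
Qed.

End stages.

(** * Rotation of two independent normals *)

Section rotation.
Context {R : realType}.
Notation RM := (measurableTypeR R).

Definition rot (p q : R) (y : RM * RM) : RM := (p * y.1 + q * y.2) / sqrt (p ^+ 2 + q ^+ 2).

Lemma mp_rot p q : 0 < p ^+ 2 + q ^+ 2 -> mp (prodP (@gauss R) gauss) gauss (rot p q).
Proof.
move=> pq; have r0 : 0 < sqrt (p ^+ 2 + q ^+ 2) by rewrite sqrtr_gt0.
have mr : measT (rot p q).
 by apply: measM => //; apply: measD; apply: measM.
have i0 : injective (fun k => k.*2) by move=> x y; lia.
have i1 : injective (fun k => k.*2.+1) by move=> x y; lia.
have dis x y : x.*2 <> y.*2.+1 by lia.
have h := mp_comp (mp_split (powP (@gauss R)) i0 i1 dis) (mp_prod (mp_coord gauss 0) (mp_coord gauss 0)).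
apply: (mp_cancel mr h).
pose c (k : nat) : R := (if k == 0 then p else q) / sqrt (p ^+ 2 + q ^+ 2).
have c1 : \sum_(k < 2) c k ^+ 2 = 1.
 rewrite !big_ord_recl big_ord0 addr0/= /c/= !expr_div_n -mulrDl sqr_sqrtr ?divff ?gt_eqF//.
 exact: ltW.
apply: (mp_eqfun _ (mp_lincomb c1)) => s.
by rewrite /lincomb !big_ord_recl big_ord0 addr0/= /c /rot/= mulrDl; ring.
Qed.

End rotation.

Lemma sum_mul (R : zmodType) p q (F : nat -> R) : \sum_(k < p * q) F k = \sum_(k < p) \sum_(l < q) F
 (k * q + l)%N.
Proof.
elim: p => [|p IH]; first by rewrite !big_ord0.
by rewrite mulSnr big_split_ord big_ord_recr/= IH.
Qed.

Lemma ratio01 (R : realType) (x y : R) : 0 < x -> 0 < y -> 0 <= x / (x + y) <= 1.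
Proof.
move=> x0 y0; have s0 : 0 < x + y by exact: addr_gt0.
apply/andP; split; first by rewrite divr_ge0 ?(ltW x0) ?(ltW s0).
by rewrite ler_pdivrMr// mul1r lerDl ltW.
Qed.

Lemma succ_le5 c q : (c <= 4 * q)%N -> (0 < q)%N -> (c.+1 <= 5 * q)%N. Proof. lia. Qed.
Lemma succ_le2 N : (N.+2 <= 2 * N.+1)%N. Proof. lia. Qed.

(** Lets the factor exp(-2 L) of the Chernoff bound absorb the pairs, of order 4^L in number, in the
    union bound over blocks and lengths. *)
Lemma pow2_sqr_le (R : realType) L : (pow2 L : R) * pow2 L <= expR (2 * L%:R).
Proof.
have h := expR_ge1Dx (1 : R).
have -> : expR (2 * L%:R) = (expR 1 ^+ L) * (expR 1 ^+ L) :> R.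
 by rewrite -!expRM_natr mul1r -expRD; congr expR; ring.
have hL : pow2 L <= expR 1 ^+ L :> R.
 by rewrite /pow2 natrX lerXn2r ?nnegrE ?expR_ge0.
by apply: ler_pM => //; rewrite ler0n.
Qed.

Lemma exp_le_inv (R : realType) (K : R) : 0 < K -> 20 * expR (- (2 * K)) <= 20 / K.
Proof.
move=> K0; rewrite ler_wpM2l// expRN lef_pV2 ?posrE ?expR_gt0//.
by have := expR_ge1Dx (2 * K); lra.
Qed.

(** * Union and maximal bounds over blocks *)

Section small_unions.
Context {R : realType}.
Notation RS := (@rseq R).
Notation RM := (measurableTypeR R).

Lemma small_exists d (T : mtype d) (P : prob T R) k c (B : nat -> set T) : (forall l, (l < k)%N ->
 small P c (B l)) -> small P (k%:R * c) [set w | exists l, (l < k)%N /\ B l w].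
Proof.
elim: k => [_|k IH h].
 rewrite mul0r (_ : [set w | _] = set0); last by apply/seteqP; split => w //= -[l []].
 by split => //; rewrite measure0.
rewrite (_ : [set w | _] = [set w | exists l, (l < k)%N /\ B l w] `|` B k); last first.
 apply/seteqP; split => w /=.
  move=> [l []]; rewrite ltnS leq_eqVlt => /orP[/eqP -> Bk|lk Bl]; first by right.
  by left; exists l.
 by move=> [[l [lk Bl]]|Bk]; [exists l; split => //; exact: ltnW|exists k].
rewrite -natr1 mulrDl mul1r; apply: smallU; last exact: h.
by apply: IH => l lk; apply: h; exact: ltnW.
Qed.

Lemma small_kolmogorov_blk k M0 (e : R -> R) C x : 0 < x -> (0 < k)%N -> centered (@gam R k.-1) C e
 -> small (pow (@expP R)) (M0%:R * C / x ^+ 2) [set S : RS | exists l, (l <= M0)%N /\ x <=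
 `|\sum_(i < l) e (\sum_(j < k) S (i * k + j)%N)|].
Proof.
move=> x0 k0 ce; pose bs := nseq M0 k.
have mE := meas_exceeds (size bs) x (fun=> ce.1) (measurable_cst (0 : RM)) (meas_bsum bs).
have E : [set S : RS | exists l, (l <= M0)%N /\ x <= `|\sum_(i < l) e (\sum_(j < k) S (i * k +
 j)%N)|] = [set S | exceeds (size bs) (fun=> e) x (0, bsum bs S)].
 have sE S l : (l <= M0)%N -> \sum_(i < l) e (bsum bs S i) = \sum_(i < l) e (\sum_(j < k) S (i * k + j)%N).
  move=> lM; apply: eq_bigr => i _; rewrite /bsum blk_nseqE//; exact: leq_trans (ltn_ord i) lM.
 by apply/seteqP; split => S /= -[l [lM h]]; exists l; rewrite size_nseq in lM *; split => //;
  move: h; rewrite add0r sE.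
rewrite E; split; first exact: mE.
have bs1 : all (leq 1) bs by apply/allP => y; rewrite mem_nseq => /andP[_ /eqP ->].
have := @kolmogorov_blk R 0 bs (fun=> e) (fun=> C) 0 x bs1 x0 (fun=> ce.1).
rewrite size_nseq sumr_const card_ord expr0n add0r => h.
rewrite EFinM lee_pdivlMr ?exprn_gt0// muleC mulr_natl; apply: h => i iM.
by rewrite nth_nseq iM muln1.
Qed.

Lemma small_block_dev l k c (x : R) : (k <= c)%N -> 0 <= x <= 2 * c%:R -> small (pow (@expP R)) (2 *
 expR (- (x ^+ 2 / (8 * c%:R)))) [set S : RS | x <= `|\sum_(i < k) (S (l + i)%N - 1)|].
Proof.
move=> kc xc; have il : injective (addn l) by move=> p q; lia.
have mp_l := mp_reindex (powP (@expP R)) il.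
have mB : measurable [set S : RS | x <= `|prefix_sum k S - k%:R|].
 apply: meas_ge; apply: mcomp => //.
 by apply: measB => //; exact: meas_prefix_sum.
have := small_mp mp_l (conj mB (chernoff kc xc)).
rewrite (_ : _ @^-1` _ = [set S : RS | x <= `|\sum_(i < k) (S (l + i)%N - 1)|])//.
by apply/seteqP; split => S /=; rewrite sumrB sumr_const card_ord.
Qed.

End small_unions.

(** * The exceptional event of the coupling *)

Section sample_events.
Context {R : realType}.
Notation RS := (@rseq R).
Notation RM := (measurableTypeR R).
Variables (a L N n1 n2 r1 r2 : nat) (K : R) (i j al be al' be' : nat -> nat).
Notation m := a.+1.
Notation n := N.+1.
Notation Mn := (2 ^ L)%N.
Notation M := (pow2 L : R).
Notation dl := (Dlev K L : R).
Notation M1 := (nblocks m n1).+1.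
Notation M2 := (nblocks m n2).+1.
Notation a1 := (n%:R / M1%:R : R).
Notation a2 := (n%:R / M2%:R : R).
Notation A := (a1 + a2).
Notation H := (@Hc R a).
Notation c := (n.+1 %/ Mn)%N.
Hypotheses (n_ge : (Mn * Mn <= n)%N) (n_lt : (n < 4 * (Mn * Mn))%N) (K1 : 1 <= K) (K24 : 24 * K <=
 M) (dl4 : 4 * dl <= 1) (M_large : 2 / ssq H <= M) (nM1 : (n <= M1)%N) (nM2 : (n <= M2)%N) (n1_blk
 : (M1 * m <= n1.+1 < M1 * m + m)%N) (n2_blk : (M2 * m <= n2.+1 < M2 * m + m)%N) (ij_bnd : forall
 k, (k <= N)%N -> (i k + m <= n1.+1)%N /\ (j k + m <= n2.+1)%N) (r1E : (n * m + r1 = n1.+1)%N) (r2E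
 : (n * m + r2 = n2.+1)%N) (al_inj : injective al) (be_inj : injective be) (al_be : forall x y, al
 x <> be y) (al_inj' : injective al') (be_inj' : injective be') (al_be' : forall x y, al' x <> be'
 y) (al_i : forall k l, (k <= N)%N -> (l < m)%N -> al (k * m + l)%N = (i k + l)%N) (al_j : forall k
 l, (k <= N)%N -> (l < m)%N -> al' (k * m + l)%N = (j k + l)%N).
Hypothesis sum_al : forall e : nat -> R, \sum_(l < n1.+1) e l = \sum_(k < n * m) e (al k) + \sum_(k
 < r1) e (be k).
Hypothesis sum_al' : forall e : nat -> R, \sum_(l < n2.+1) e l = \sum_(k < n * m) e (al' k) +
 \sum_(k < r2) e (be' k).
Notation sample := (@sample R).
Notation sample_law := (@sample_law R).

Let vs (w : sample) := vsl a N n1 n2 al be al' be' w.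
Let us (w : sample) := uspc a N n1 n2 al be al' be' w.
Let ns (w : sample) := noise a L N n1 n2 al be al' be' w.
Let zs (w : sample) := zblk L N (us w).
Let ze (w : sample) := zetaw a L N n1 n2 r1 r2 al be al' be' w.
Let eX (w : sample) := spc n1 w.1.1.
Let eY (w : sample) := spc n2 w.1.2.

Let K0 : 0 < K := lt_le_trans ltr01 K1.
Let M0 : 0 < M := pow2_gt0 L.
Lemma blocks_le : (Mn <= n)%N.
Proof. by apply: leq_trans n_ge; rewrite leq_pmulr// expn_gt0. Qed.

Lemma Dlev_le1 : dl <= 1.
Proof. by have := Dlev_ge0 K L; move: dl4; lra. Qed.

Lemma mp_us : mp sample_law (pow expP) us.
Proof.
have h0 := mp_comp (mp_prod (mp_block_sums a n1 N al_inj be_inj al_be) (mp_block_sums a n2 N al_inj' be_inj' al_be')) (@mp_ratios R a).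
have hH : mp (pow (@betP R a a)) (pow unif) (fun V : RS => (fun k => H (V k)) : RS).
 apply: (mp_map (powP _) (powP _) (f := H)); apply: mp_cdfR; exact: Hc_continuous.
have h1 := mp_prod (mp_comp (mp_comp h0 (mp_fst _ _)) hH) (mp_fst (pow expP) (@gauss R)).
exact: mp_eqfun (mp_comp h1 (mp_spc n)).
Qed.

Lemma mp_zs : mp sample_law (pow gauss) zs.
Proof. exact: mp_comp mp_us (mp_zblk blocks_le). Qed.

Lemma mp_ns : mp sample_law (prodP (pow gauss) gauss) ns.
Proof.
have h := mp_noise n1 n2 r1 r2 al_inj be_inj al_be al_inj' be_inj' al_be' blocks_le M_large.
exact: mp_comp h (mp_fst _ _).
Qed.

Definition ev_dev n0 (e : RS) := exists k, (k <= n0.+1)%N /\ K * sqrt n0.+1%:R <= `|\sum_(l < k) (e l - 1)|.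
Definition ev_neg (e : RS) := exists l, e l <= 0.
Definition ev_spc n0 r (al0 be0 : nat -> nat) (e : RS) := ev_dev n0 e \/ K <= `|e (be0 r) - 1| \/
 ev_neg e.

Lemma inv_sqr_le : 1 / K ^+ 2 <= 1 / K.
Proof. by rewrite ler_wpM2l// lef_pV2 ?posrE ?exprn_gt0// expr2 ler_peMr// ltW. Qed.

Let cexp : centered (@expP R) 1 (fun x : RM => x - 1) := centered_gam 0.

Lemma small_spc n0 r al0 be0 : small (pow expP) (1 / K + (1 / K + 0)) [set e | ev_spc n0 r al0 be0 e].
Proof.
rewrite (_ : [set e | _] = [set e | ev_dev n0 e] `|` ([set e : RS | K <= `|e (be0 r) - 1|] `|` [set e | ev_neg e]))//.
apply: smallU; [|apply: smallU].
- have x0 : 0 < K * sqrt n0.+1%:R :> R by rewrite mulr_gt0// sqrtr_gt0.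
 apply: small_le (small_kolmogorov (n := n0.+1) (e := fun=> fun x => x - 1) (C := fun=> 1) x0 (fun=> cexp.1) (fun _ _ => cexp)).
 rewrite sumr_const card_ord exprMn sqr_sqrtr// invfM mulrCA divff ?pnatr_eq0// mulr1.
 by rewrite -[K ^- 2]div1r; exact: inv_sqr_le.
- exact: small_le inv_sqr_le (small_coord (be0 r) (small_chebyshev K0 cexp)).
- have h := small_null (measurable_itv _) (@gam_pos R 0).
 rewrite (_ : [set e | _] = [set s : RS | exists k, `]-oo, 0]%classic (s k)])//.
Qed.

Definition ev_unif (e : RS) := (exists k, (k <= n.+1)%N /\ K * sqrt n%:R <= `|\sum_(l < k) (e l -
 1)|) \/ (exists l, (l <= Mn)%N /\ K * sqrt M <= `|\sum_(p < l) gz_res c.-1 (\sum_(k < c) e (p * c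
 + k)%N)|) \/ (exists l, (l < Mn.+1)%N /\ exists p, (p < c.+1)%N /\ 8 * (M * dl) <= `|\sum_(k < p)
 (e (l * c + k)%N - 1)|).

Lemma small_unif : small (pow expP) (2 / K + (gz_var / K + 20 / K)) [set e | ev_unif e].
Proof.
have cge := blk_le n_ge; have cle := blk_ub n_lt.
have c0 : (0 < c)%N by rewrite (leq_trans _ cge)// expn_gt0.
have ME : M = Mn%:R by [].
apply: smallU; [|apply: smallU].
- have x0 : 0 < K * sqrt n%:R :> R by rewrite mulr_gt0// sqrtr_gt0.
 apply: small_le (small_kolmogorov (n := n.+1) (e := fun=> fun x => x - 1) (C := fun=> 1) x0 (fun=> cexp.1) (fun _ _ => cexp)).
 rewrite sumr_const card_ord exprMn sqr_sqrtr// ler_pdivrMr ?mulr_gt0 ?exprn_gt0//.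
 rewrite (_ : 2 / K * _ = (2 * n%:R) * K); last by field; rewrite gt_eqF.
 apply: (@le_trans _ _ (2 * n%:R)); last by rewrite ler_peMr.
 by rewrite -natrM ler_nat; exact: succ_le2.
- have x0 : 0 < K * sqrt M by rewrite mulr_gt0// sqrtr_gt0.
 apply: small_le (small_kolmogorov_blk Mn x0 c0 (centered_gz_res c.-1)).
 rewrite exprMn sqr_sqrtr ?(ltW M0)// -/(M) (_ : _ / _ = gz_var * (1 / K ^+ 2)); last first.
  by field; rewrite !gt_eqF.
 apply: (@le_trans _ _ (gz_var * (1 / K))); last by rewrite mulrA mulr1.
 by apply: ler_wpM2l inv_sqr_le; rewrite mulr_ge0// expR_ge0.
(* For x = 8 M dl one has x^2 = 64 M kap, and a block length c <= 4 M makes the Chernoff bound at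
   most 2 exp(-2 kap). Of the exponent, 2 L pays for the union over at most 2 M times 5 M pairs, and
   2 K remains. *)
pose kap := K + L%:R + 3.
have kap0 : 0 < kap by rewrite /kap addr_gt0// ltr_wpDr.
have s0 : 0 < sqrt M by rewrite sqrtr_gt0.
have x2E : (8 * (M * dl)) ^+ 2 = 64 * (M * kap).
 have k2 : sqrt kap ^+ 2 = kap by rewrite sqr_sqrtr// ltW.
 have m2 : sqrt M ^+ 2 = M by rewrite sqr_sqrtr// ltW.
 rewrite dlE -/kap (_ : _ ^+ 2 = 64 * (sqrt M ^+ 2 * sqrt kap ^+ 2)); last by ring.
 by rewrite m2 k2.
have xc : 0 <= 8 * (M * dl) <= 2 * c%:R.
 rewrite mulr_ge0 ?mulr_ge0 ?(ltW M0) ?Dlev_ge0//=.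
 have h1 : M <= c%:R by rewrite ler_nat.
 have h2 : M * (4 * dl) <= M by rewrite ler_piMr// ltW.
 by move: h1 h2; lra.
have q p l : (p <= c)%N -> small (pow expP) (2 * expR (- (2 * kap))) [set e : RS | 8 * (M * dl) <=
 `|\sum_(k < p) (e (l * c + k)%N - 1)|].
 move=> pc; apply: small_le (small_block_dev (l * c) pc xc).
 rewrite ler_wpM2l// ler_expR lerN2 x2E ler_pdivlMr ?mulr_gt0 ?ltr0n//.
 have h1 : c%:R <= 4 * M by rewrite ME -natrM ler_nat.
 rewrite (_ : 64 * (M * kap) = 2 * kap * (8 * (4 * M))); last by ring.
 by rewrite ler_wpM2l ?mulr_ge0 ?(ltW kap0)// ler_wpM2l.
have := small_exists (k := Mn.+1) (fun l _ => small_exists (k := c.+1) (fun p pc => q p l pc)).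
apply: small_le.
have e1 : Mn.+1%:R <= 2 * M by rewrite ME -natrM ler_nat mul2n -addnn -addn1 leq_add2l expn_gt0.
have e2 : c.+1%:R <= 5 * M.
 by rewrite ME -natrM ler_nat; exact: succ_le5 cle (Mn_gt0 L).
apply: (@le_trans _ _ (20 * expR (- (2 * K)))); last exact: exp_le_inv.
have -> : - (2 * kap) = - (2 * K) + - (2 * L%:R) + - 6 by rewrite /kap; ring.
rewrite !expRD.
have e6 : expR (- 6) <= 1 :> R by rewrite -[leRHS]expR0 ler_expR oppr_le0.
have e4 : M * M * expR (- (2 * L%:R)) <= 1.
 by rewrite expRN ler_pdivrMr ?expR_gt0// mul1r; exact: pow2_sqr_le.
have [g1 g2 g3] : [/\ 0 <= expR (- (2 * K)), 0 <= expR (- (2 * L%:R) : R) & 0 <= expR (- 6 : R)] by rewrite !expR_ge0.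
move: (expR (- (2 * K))) (expR (- (2 * L%:R) : R)) (expR (- 6 : R)) g1 g2 g3 e6 e4 => x y z x0 y0 z0 z1 yM.
apply: (@le_trans _ _ ((2 * M) * ((5 * M) * (2 * (x * y * z))))).
 apply: ler_pM => //; first by rewrite !mulr_ge0.
 by rewrite ler_wpM2r// !mulr_ge0.
rewrite (_ : _ * _ = 20 * x * z * (M * M * y)); last by ring.
apply: (@le_trans _ _ (20 * x * z)); first by rewrite ler_piMr// !mulr_ge0.
by rewrite ler_piMr// mulr_ge0.
Qed.

Definition bad (w : sample) := [set e | ev_spc n1 r1 al be e] (eX w) \/ [set e | ev_spc n2 r2 al'
 be' e] (eY w) \/ [set e | ev_unif e] (us w) \/ ~ tame K (zs w) \/ ~ tame K (ns w).1 \/ K <= `|(ns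
 w).2| \/ K <= `|w.2.2| \/ ev_lead a L N n1 n2 r1 r2 K (vs w).

(** Event by event the numerators of the bounds for [bad]; every one of these bounds decays at least
    like 1 / K. *)
Definition bad_prob : R := 2 + 2 + (2 + gz_var + 20) + 4 + 4 + 1 + 1 + lead_prob a.

Lemma small_tame : small (pow (@gauss R)) (4 / K) (~` [set z : RS | tame K z]).
Proof.
split; first by apply: measurableC; exact: meas_tame.
apply: (le_trans (pow_tame (ltW K0))); rewrite lee_fin ler_wpM2l// expRN lef_pV2 ?posrE ?expR_gt0//.
by have := expR_ge1Dx K; lra.
Qed.

Lemma small_bad : small sample_law (bad_prob / K) [set w | bad w].
Proof.
rewrite (_ : bad_prob / K = (1 / K + (1 / K + 0)) + ((1 / K + (1 / K + 0)) + ((2 / K + (gz_var / K +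
 20 / K)) + (4 / K + (4 / K + (1 / K + (1 / K + lead_prob a / K))))))); last first.
 by rewrite /bad_prob; field; rewrite gt_eqF.
have h1 : small (@gauss R) (1 / K) [set z : RM | K <= `|z|] by apply: small_le (small_gauss K0); exact: inv_sqr_le.
apply: smallU; first exact: small_mp (mp_comp (mp_comp (mp_fst _ _) (mp_fst _ _)) (mp_spc n1)) (small_spc n1 r1 al be).
apply: smallU; first exact: small_mp (mp_comp (mp_comp (mp_fst _ _) (mp_snd _ _)) (mp_spc n2)) (small_spc n2 r2 al' be').
apply: smallU; first exact: small_mp mp_us small_unif.
apply: smallU; first exact: small_mp mp_zs small_tame.
apply: smallU; first exact: small_mp (mp_comp mp_ns (mp_fst _ _)) small_tame.
apply: smallU; first exact: small_mp (mp_comp mp_ns (mp_snd _ _)) h1.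
apply: smallU; first exact: small_mp (mp_comp (mp_snd _ _) (mp_snd _ _)) h1.
have hV := @mp_vsl R a N n1 n2 _ _ _ _ al_inj be_inj al_be al_inj' be_inj' al_be'.
exact: small_mp hV (small_lead n_ge n_lt K1 K1 nM1 nM2 n1_blk n2_blk r1E r2E).
Qed.

Lemma block_sumsE n0 al0 be0 (i0 : nat -> nat) (p : RS * RS) k : (k < n)%N -> (forall k l, (k <=
 N)%N -> (l < m)%N -> al0 (k * m + l)%N = (i0 k + l)%N) -> (block_sums a n0 N al0 be0 p).1 k =
 \sum_(l < m) spc n0 p (i0 k + l)%N.
Proof.
move=> kN h; transitivity (blk (fun=> id) (exp_to_gam a) (nseq n m) (fun l => spc n0 p (al0 l)) k); first by [].
by rewrite blk_nseqE//; apply: eq_bigr => l _; rewrite h.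
Qed.

Lemma spcE n0 (p : RS * RS) l : (l <= n0)%N -> spc n0 p l = prefix_sum n0.+1 p.2 * (order_stat p.1
 n0 l.+1 - order_stat p.1 n0 l).
Proof. by move=> ln; rewrite /spc /gamma_spacings ln. Qed.

Lemma sum_blocks (e : nat -> R) al0 i0 : (forall k l, (k <= N)%N -> (l < m)%N -> al0 (k * m + l)%N =
 (i0 k + l)%N) -> \sum_(k < n * m) e (al0 k) = \sum_(k < n) \sum_(l < m) e (i0 k + l)%N.
Proof.
move=> h; rewrite (sum_mul n m (fun k => e (al0 k))); apply: eq_bigr => k _; apply: eq_bigr => l _.
by rewrite h// -ltnS.
Qed.

(** A single parameter K is the tameness level and the bound of all normalized quantities, so that
    the exceptional probability is O(1 / K) while the error is [Dlev K L] times a constant depending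
    on K. *)
Lemma gamma_event w v : ~ bad w -> 0 <= v <= 1 -> `|gamma_process m n1 n2 N i j w.1.1.1 w.1.2.1 v -
 (bridge_core L a v (ns w).1 + phiK a v * ((lam0 a - 2 * A) * sig H * (ns w).2 + sqrt (@qq R a N n1
 n2) * ze w))| <= gamma_const a K (50 * K + 290) (11 * K + 44 * (2 * m + 1)%:R * K ^+ 2) * dl.
Proof.
move=> nB v01.
move/not_orP: nB => [bX] /not_orP[bY] /not_orP[bU] /not_orP[bz] /not_orP[bz'] /not_orP[bn] /not_orP[bg bl].
have nlt (x y : R) : ~ (x <= y) -> y <= x by move=> h; rewrite leNgt; apply/negP => /ltW.
move/not_orP: bX => [x1] /not_orP[x2 x3]; move/not_orP: bY => [y1] /not_orP[y2 y3].
move/not_orP: bU => [u1] /not_orP[u2 u3].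
have eX0 l : 0 < eX w l by rewrite ltNge; apply/negP => h; apply: x3; exists l.
have eY0 l : 0 < eY w l by rewrite ltNge; apply/negP => h; apply: y3; exists l.
have GX k : (k < n)%N -> (block_sums a n1 N al be w.1.1).1 k = \sum_(l < m) eX w (i k + l)%N.
 by move=> kn; exact: block_sumsE.
have GY k : (k < n)%N -> (block_sums a n2 N al' be' w.1.2).1 k = \sum_(l < m) eY w (j k + l)%N.
 by move=> kn; exact: block_sumsE.
have VE k : (k < n)%N -> (vs w).1 k = (\sum_(l < m) eX w (i k + l)%N) / (\sum_(l < m) eX w (i k +
 l)%N + \sum_(l < m) eY w (j k + l)%N).
 by move=> kn; rewrite -GX// -GY.
have SE k : (k < n)%N -> (vs w).2.1 k = \sum_(l < m) eX w (i k + l)%N + \sum_(l < m) eY w (j k + l)%N.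
 by move=> kn; rewrite -GX// -GY.
have V01 k : (k < n)%N -> 0 <= (vs w).1 k <= 1.
 move=> kn; rewrite VE//; apply: ratio01; rewrite big_ord_recl ltr_pwDl// sumr_ge0// => l _; exact: ltW.
have [ld zK] := lead_event n_ge n_lt K1 K1 nM1 nM2 n1_blk n2_blk r1E r2E bl V01.
have al_close : forall h, 0 <= h <= 1 -> `|sqrt n%:R * ((ecount n (H \o (vs w).1) h)%:R / n%:R - h)
 - Sg L L h (zs w)| <= (50 * K + 290) * dl.
 have KM : K <= M by move: K1 K24; lra.
 apply: (@alpha_close R L n K K n_ge n_lt K1 K1 KM Dlev_le1 (us w) (zs w) _ (prefix_sum n.+1 w.2.1)).
 - by move=> k kn; apply: nlt => h; apply: u1; exists k.
 - by move=> l p lM pc; apply: nlt => h; apply: u3; exists l; split; [rewrite ltnS|exists p; split; [rewrite ltnS|]].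
 - by move=> l lM; apply: nlt => h; apply: u2; exists l.
 - by move=> p pM; rewrite /zs /zblk blk_nseqE.
 - exact: contrapT.
 - by move=> l ln; rewrite /us /uspc spcE.
apply: (gamma_close (C1 := 50 * K + 290) (C7 := 11 * K + 44 * (2 * m + 1)%:R * K ^+ 2) n_ge K1 K1
 K24 M_large nM1 nM2 n1_blk n2_blk ij_bnd r1E r2E (eX := eX w) (eY := eY w) (V := (vs w).1) (S :=
 (vs w).2.1) (lX := (vs w).2.2.1) (lY := (vs w).2.2.2) (z := zs w) (TX := prefix_sum n1.+1 w.1.1.2)
 (TY := prefix_sum n2.+1 w.1.2.2) (et' := w.2.2) (zeta := ze w) (q := sqrt (@qq R a N n1 n2))).
- by move=> l; exact: ltW.
- by move=> l; exact: ltW.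
- by move=> l ln; exact: spcE.
- by move=> l ln; exact: spcE.
- by move=> k kN; exact: VE.
- by move=> k kN; exact: SE.
- by rewrite sum_al; congr (_ + _); exact: sum_blocks.
- by rewrite sum_al'; congr (_ + _); exact: sum_blocks.
- by apply: nlt => h; apply: x1; exists n1.+1.
- by apply: nlt => h; apply: y1; exists n2.+1.
- exact: nlt x2.
- exact: nlt y2.
- exact: contrapT bz.
- exact: al_close.
- exact: contrapT bz'.
- exact: nlt bn.
- exact: nlt bg.
- exact: ld.
- exact: v01.
Qed.

End sample_events.

(** 4^L <= N + 1 < 4^(L + 1), so M = 2^L lies between sqrt (N + 1) / 2 and sqrt (N + 1), and the
    number of blocks is comparable to their length. *)
Definition level (N : nat) : nat := trunc_log 4 N.+1.

Lemma level_bounds N (Mn := (2 ^ level N)%N) : (Mn * Mn <= N.+1)%N /\ (N.+1 < 4 * (Mn * Mn))%N.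
Proof.
by rewrite /Mn -expnMn -expnS; have /andP[] := @trunc_log_bounds 4 N.+1 isT isT.
Qed.

Lemma nblocks_bounds m n N : (0 < m)%N -> (1 <= N <= nblocks m n)%N -> (N.+1 <= (nblocks m n).+1)%N
 /\ ((nblocks m n).+1 * m <= n.+1 < (nblocks m n).+1 * m + m)%N.
Proof.
move=> m0 /andP[N1 Nn]; split => //; rewrite /nblocks in Nn *.
have q0 : (0 < n.+1 %/ m)%N by move: Nn; case: (n.+1 %/ m)%N => //=; lia.
by rewrite prednK// leq_divM/= -mulSnr ltn_ceil.
Qed.

Lemma admissible_bound m N n i k : admissible m n N i -> (k <= N)%N -> (i k + m <= n.+1)%N.
Proof.
move=> adm; rewrite leq_eqVlt => /predU1P[->|kN]; first exact: adm.2.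
exact: leq_trans (adm_gap adm kN (leqnn N)) (leq_trans (leq_addr _ _) adm.2).
Qed.

(** * The coupling for a fixed N *)

Section coupling.
Context {R : realType}.
Notation RS := (@rseq R).
Notation RM := (measurableTypeR R).
Variables (a N n1 n2 : nat) (i j : nat -> nat).
Notation m := a.+1.
Notation n := N.+1.
Notation L := (level N).
Notation M := (pow2 L : R).
Notation M1 := (nblocks m n1).+1.
Notation M2 := (nblocks m n2).+1.
Notation a1 := (n%:R / M1%:R : R).
Notation a2 := (n%:R / M2%:R : R).
Notation A := (a1 + a2).
Notation H := (@Hc R a).
Notation Rc := (@Rcoef R m n1 n2 N).
Notation sample := (@sample R).
Notation sample_law := (@sample_law R).
Hypotheses (N1 : (1 <= N)%N) (N_le : (N <= minn (nblocks m n1) (nblocks m n2))%N) (adm_i :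
 admissible m n1 N i) (adm_j : admissible m n2 N j).

Let p : R := (lam0 a - 2 * A) * sig H.
Let q : R := sqrt (@qq R a N n1 n2).

Let b1 : (n <= M1)%N /\ (M1 * m <= n1.+1 < M1 * m + m)%N.
Proof. by apply: nblocks_bounds => //; rewrite N1; move: N_le; rewrite leq_min => /andP[]. Qed.

Let b2 : (n <= M2)%N /\ (M2 * m <= n2.+1 < M2 * m + m)%N.
Proof. by apply: nblocks_bounds => //; rewrite N1; move: N_le; rewrite leq_min => /andP[]. Qed.

Lemma RcoefE : Rc = 1 - m%:R / (2 * m + 1)%:R * A.
Proof. by rewrite Rcoef_nblocks//; move: N_le; rewrite leq_min => /andP[]. Qed.

(** A <= 2 gives R >= 1 / (2 m + 1), so dividing by the norm of (p, q) is legitimate. *)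
Lemma Rcoef_gt0 : 0 < Rc.
Proof.
rewrite RcoefE subr_gt0; have /andP[A0 A2] := @A_le2 R a N n1 n2 b1.1 b2.1.
apply: (@le_lt_trans _ _ (m%:R / (2 * m + 1)%:R * 2)); first by rewrite ler_wpM2l// divr_ge0.
by rewrite mulrAC ltr_pdivrMr ?ltr0n ?addn1// mul1r -natrM ltr_nat; lia.
Qed.

(** This identity is the origin of R: the variance of p et + q zeta is R times that of [lam0] [sig]
    times a standard normal, the contribution of the integral to a bridge. *)
Lemma rot_norm : p ^+ 2 + q ^+ 2 = Rc * (lam0 a * sig H) ^+ 2.
Proof.
rewrite /p /q !exprMn (sigK (@ssq_Hc_gt0 R a)) sqr_sqrtr ?(qq_ge0 b1.1 b2.1)// RcoefE /qq ssq_Hc /lam0.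
have -> : (2 * m + 1)%:R = 2 * m%:R + 1 :> R by rewrite natrD natrM.
have m0 : 0 < m%:R :> R by [].
move: (A) (m%:R : R) m0 => x y y0; field; rewrite !gt_eqF//; lra.
Qed.

Lemma rot_gt0 : 0 < p ^+ 2 + q ^+ 2.
Proof.
rewrite rot_norm mulr_gt0 ?Rcoef_gt0// exprn_gt0// mulr_gt0 ?lam0_gt0//.
by rewrite sqrtr_gt0 ssq_Hc_gt0.
Qed.

Lemma sqrt_rot_norm : sqrt (p ^+ 2 + q ^+ 2) = sqrt Rc * (lam0 a * sig H).
Proof.
rewrite rot_norm sqrtrM ?(ltW Rcoef_gt0)// sqrtr_sqr ger0_norm//.
by rewrite mulr_ge0 ?sqrtr_ge0// ltW// lam0_gt0.
Qed.

(** Rotating with (c p, c q) for c = 1 or c = -1 absorbs the sign of the weight c sqrt R, so that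
    one core serves for both bridges. *)
Lemma rot_corrected v c (y : RM * RM) : 0 <= v <= 1 -> c ^+ 2 = 1 -> c * sqrt Rc * (rho H (H v) *
 sig H * rot (c * p) (c * q) y) = phiK a v * (p * y.1 + q * y.2).
Proof.
move=> v01 c1; rewrite rho_Hc// /rot !(exprMn _ c) c1 !mul1r sqrt_rot_norm.
have r0 : sqrt Rc != 0 by rewrite gt_eqF// sqrtr_gt0 Rcoef_gt0.
have l0 : lam0 a != 0 :> R by rewrite gt_eqF// lam0_gt0.
have s0 : sig H != 0 by rewrite gt_eqF// sqrtr_gt0 ssq_Hc_gt0.
move: (sqrt Rc) (lam0 a : R) (sig H) (phiK a v) r0 l0 s0 => r l s f r0 l0 s0.
transitivity (c ^+ 2 * (f * (p * y.1 + q * y.2))); last by rewrite c1 mul1r.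
by field; rewrite r0 l0 s0.
Qed.

Definition coupling_const (K : R) : R := gamma_const a K (50 * K + 290) (11 * K + 44 * (2 * m +
 1)%:R * K ^+ 2).

Definition close_to (x : R) (pr : sample -> RS * RM) (C : R) (w : sample) : Prop := forall v, v \in
 `[0, 1] -> `|gamma_process m n1 n2 N i j w.1.1.1 w.1.2.1 v - corrected m (4 * x) (fun u w =>
 bridge L H u (pr w)) v w| <= C.

Lemma coupling : exists pp pm : sample -> RS * RM, [/\ mp sample_law (prodP (pow gauss) gauss) pp,
 mp sample_law (prodP (pow gauss) gauss) pm & forall K, 1 <= K -> 24 * K <= M -> 4 * Dlev K L <= 1
 -> 2 / ssq H <= M -> exists B, small sample_law (bad_prob a / K) B /\ forall w, ~ B w -> close_to
 (1 + sqrt Rc) pp (coupling_const K * Dlev K L) w /\ close_to (1 - sqrt Rc) pm (coupling_const K *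
 Dlev K L) w].
Proof.
(* Bridges are due for every N, also when M is too small for [dirM] to be controlled. The
   approximation claim is then void, and any input with the right law will do. *)
have [hM|hM] := leP (2 / ssq H) M; last first.
 pose p0 (w : sample) : RS * RM := ((fun k => gz 0 (w.2.1 k)), w.2.2).
 have h0 : mp sample_law (prodP (pow gauss) gauss) p0.
  have h : mp (pow (@expP R)) (pow gauss) (fun s : RS => (fun k => gz 0 (s k)) : RS).
   by apply: (mp_map (powP _) (powP _) (f := gz 0)); exact: (mp_gz 0).
  exact: mp_comp (mp_snd _ _) (mp_prod h (mp_id gauss)).
 by exists p0, p0; split => // K _ _ _; rewrite leNgt hM.
have [al [be [r1 [ial ibe dis r1E [al_i sal]]]]] := selection (ltn0Sn a) adm_i.
have [al' [be' [r2 [ial' ibe' dis' r2E [al_j sal']]]]] := selection (ltn0Sn a) adm_j.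
have [n_ge n_lt] := level_bounds N.
have Mn_le : (2 ^ L <= n)%N by apply: leq_trans n_ge; rewrite leq_pmulr// expn_gt0.
pose ns (w : sample) := noise a L N n1 n2 al be al' be' w.
pose ze (w : sample) := zetaw a L N n1 n2 r1 r2 al be al' be' w.
pose pr c (w : sample) : RS * RM := ((ns w).1, rot (c * p) (c * q) ((ns w).2, ze w)).
have hn := mp_noise n1 n2 r1 r2 ial ibe dis ial' ibe' dis' Mn_le hM.
have hpr c : c ^+ 2 = 1 -> mp sample_law (prodP (pow gauss) gauss) (pr c).
 move=> c1; have h : 0 < (c * p) ^+ 2 + (c * q) ^+ 2 by rewrite (exprMn _ c p) (exprMn _ c q) c1 !mul1r rot_gt0.
 exact: mp_comp (mp_comp hn (mp_assocV _ _ _)) (mp_prod (mp_id (pow gauss)) (mp_rot h)).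
have c2 : (-1) ^+ 2 = 1 :> R by rewrite sqrrN expr1n.
exists (pr 1), (pr (-1)); split; [by apply: hpr; rewrite expr1n|exact: hpr|].
move=> K K1 K24 dl4 _.
have sb := small_bad n_ge n_lt K1 dl4 hM b1.1 b2.1 b1.2 b2.2 r1E r2E ial ibe dis ial' ibe' dis'.
eexists; split; first exact: sb.
move=> w nB.
have ijb k : (k <= N)%N -> (i k + m <= n1.+1)%N /\ (j k + m <= n2.+1)%N.
 by move=> kN; rewrite (admissible_bound adm_i)// (admissible_bound adm_j).
have main := @gamma_event R a L N n1 n2 r1 r2 K i j al be al' be' n_ge n_lt K1 K24 dl4 hM b1.1 b2.1
 b1.2 b2.2 ijb r1E r2E al_i al_j (sal R) (sal' R) w _ nB.
have fin c : c ^+ 2 = 1 -> close_to (1 + c * sqrt Rc) (pr c) (coupling_const K * Dlev K L) w.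
 move=> c1 v v01; rewrite corrected_bridge//; move: v01; rewrite in_itv/= => v01.
 apply: le_trans (main v v01); apply: le_of_eq; congr `|_ - _|.
 rewrite opprD addNKr mulNr opprK; congr (_ + _).
 exact: (rot_corrected ((ns w).2, ze w) v01 c1).
split; last by have := fin (-1) c2; rewrite mulN1r.
by have := fin 1 (expr1n _ _); rewrite mul1r.
Qed.

End coupling.

(** * From the level L to the rate in N *)

Section rates.
Context {R : realType}.
Notation M L := (pow2 L : R).

Lemma sqrt_pow2_ge N : (1 <= N)%N -> (sqrt (M (level N)))^-1 <= sqrt 2 * N%:R `^ (- 4^-1).
Proof.
move=> N1; have [_ h] := level_bounds N; set q := (2 ^ level N)%N in h.
have N0 : 0 < N%:R :> R by rewrite ltr0n.
have M0 : 0 < M (level N) := pow2_gt0 _.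
have h1 : sqrt N%:R <= 2 * M (level N).
 rewrite -[leRHS]ger0_norm ?mulr_ge0 ?(ltW M0)// -sqrtr_sqr ler_wsqrtr//.
 by rewrite exprMn -!natrX -natrM ler_nat -mulnn; apply: leq_trans (ltnW h); exact: leqnSn.
have h2 : sqrt (sqrt N%:R) <= sqrt 2 * sqrt (M (level N)).
 by rewrite -sqrtrM// ler_wsqrtr.
have -> : N%:R `^ (- 4^-1) = (sqrt (sqrt N%:R))^-1 :> R.
 rewrite powRN; congr (_^-1); rewrite (_ : 4^-1 = 2^-1 * 2^-1 :> R); last by field.
 by rewrite powRrM !powR12_sqrt// ?sqrtr_ge0.
have s0 : 0 < sqrt (sqrt N%:R) :> R by rewrite !sqrtr_gt0.
have m0 : 0 < sqrt (M (level N)) by rewrite sqrtr_gt0.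
by rewrite ler_pdivlMr// mulrC ler_pdivrMr.
Qed.

Lemma level_le_ln N : (2 <= N)%N -> (level N)%:R <= 2 / ln 4 * ln N%:R :> R.
Proof.
move=> N2; have [h _] := level_bounds N; rewrite -expnMn in h.
have l4 : 0 < ln 4 :> R by rewrite ln_gt0// ltr1n.
rewrite mulrAC ler_pdivlMr// mulr_natl -lnXn// mulr_natl -lnXn ?ltr0n 1?ltnW//.
rewrite ler_ln ?posrE ?exprn_gt0 ?ltr0n 1?ltnW//.
by rewrite -!natrX ler_nat; apply: (leq_trans h); rewrite -mulnn; nia.
Qed.

Lemma Dlev_rate K N : 0 <= K -> (2 <= N)%N -> 1 <= ln N%:R :> R -> Dlev K (level N) <= sqrt (2 * (K
 + 2 / ln 4 + 3)) * rate N :> R.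
Proof.
move=> K0 N2 lN; have l4 : 0 < ln 4 :> R by rewrite ln_gt0// ltr1n.
have c0 : 0 <= 2 / ln 4 :> R by rewrite divr_ge0// ltW.
have h1 := sqrt_pow2_ge (ltnW N2); have h2 := level_le_ln N2.
have h3 : K + (level N)%:R + 3 <= (K + 2 / ln 4 + 3) * ln N%:R.
 have : K <= K * ln N%:R by rewrite ler_peMr.
 by move: h2 lN; move: (2 / ln 4) (ln N%:R) c0 => x y x0 h y1 h4; rewrite !mulrDl; lra.
have n0 : 0 <= K + 2 / ln 4 + 3 by rewrite !addr_ge0.
rewrite /Dlev /rate sqrtrM//.
apply: (@le_trans _ _ ((sqrt 2 * N%:R `^ (- 4^-1)) * (sqrt (K + 2 / ln 4 + 3) * sqrt (ln N%:R)))).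
 apply: ler_pM => //; rewrite ?invr_ge0 ?sqrtr_ge0//.
 by rewrite -sqrtrM// ler_wsqrtr.
by apply: le_of_eq; ring.
Qed.

Lemma Dlev_geom K L : 0 <= K -> Dlev K L <= (5 / 6) ^+ L * Dlev K 0 :> R.
Proof.
move=> K0; elim: L => [|L IH]; first by rewrite mul1r.
apply: (le_trans (DlevS L K0)); by rewrite exprS -[leRHS]mulrA ler_wpM2l.
Qed.

Lemma large_level (K X : R) : 0 <= K -> \forall N \near \oo, [/\ (2 <= N)%N, 1 <= ln N%:R :> R, X <=
 M (level N) & 4 * Dlev K (level N) <= 1 :> R].
Proof.
move=> K0; have D0 : 0 <= Dlev K 0 := Dlev_ge0 _ _.
have c5 : (5 / 6 : R) ^+ k @[k --> \oo] --> (0 : R).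
 by apply: cvg_expr; rewrite ger0_norm//; lra.
have e0 : 0 < (4 * (Dlev K 0 + 1))^-1 by rewrite invr_gt0 mulr_gt0// ltr_wpDl.
have [L1 _ hL1] : \forall k \near \oo, `|(0 : R) - (5 / 6) ^+ k| < (4 * (Dlev K 0 + 1))^-1.
 by move/cvgrPdist_lt: c5; apply.
pose L2 := maxn L1 (Num.bound X).
have lev N : (4 ^ L2 <= N)%N -> (L2 <= level N)%N.
 by move=> h; rewrite /level; apply: trunc_log_max => //; exact: leq_trans h (leqnSn _).
exists (maxn 2 (maxn (4 ^ L2) (Num.bound (expR 1 : R)))) => // N /=.
rewrite !geq_max => /andP[N2 /andP[/lev L2N Ne]]; split => //.
- rewrite -[leLHS]expRK ler_ln ?posrE ?expR_gt0 ?ltr0n 1?ltnW//.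
 apply: le_trans (ltW (archi_boundP _)) _; first exact: expR_ge0.
 by rewrite ler_nat.
- have [X0|X0] := ltP X 0; first by apply: ltW; apply: lt_le_trans X0 (ltW (pow2_gt0 _)).
 apply: le_trans (ltW (archi_boundP X0)) _; rewrite ler_nat.
 apply: leq_trans (ltnW (ltn_expl _ _)) => //.
 by apply: leq_trans L2N; exact: leq_maxr.
have := hL1 (level N) (leq_trans (leq_maxl _ _) L2N).
rewrite sub0r normrN ger0_norm ?exprn_ge0// => h.
have := Dlev_geom (level N) K0; have := Dlev_ge0 K (level N).
move: (Dlev K (level N)) ((5 / 6) ^+ level N) h => d x h d0 h1.
have x1 : x * (4 * (Dlev K 0 + 1)) <= 1 by rewrite -ler_pdivlMr ?mulr_gt0 ?ltr_wpDl// div1r ltW.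
have x0 : 0 <= x \/ x < 0 by case: (leP 0 x); [left|right].
case: x0 => x0; last first.
 have : x * Dlev K 0 <= 0 by rewrite mulr_le0_ge0// ltW.
 by lra.
by move: x1 h1 x0; rewrite mulrCA mulrDr mulr1; lra.
Qed.

End rates.

(** * The samples as coordinates of the space *)

Section samples.
Context {R : realType}.
Notation RM := (measurableTypeR R).
Context d (Omega : mtype d) (P : prob Omega R).

Definition coord_rv (f : Omega -> @rseq R) (mf : measT f) k : {RV P >-> R} := HB.pack_for {mfun
 Omega >-> R} (fun w => f w k : R) (isMeasurableFun.Build _ _ _ _ (fun w => f w k : R) (mcomp
 (meas_coord k) mf)).

Lemma iid_coord f (mf : measT f) : mp P (pow unif) f -> iid_uniform01 (coord_rv mf).
Proof.
move=> hf; have hk k (A : set R) : measurable A -> P (coord_rv mf k @^-1` A) = unif A.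
 by move=> mA; exact: (mp_comp hf (mp_coord unif k)).2 A mA.
split; last by move=> k A mA; exact: hk.
move=> s A us mA; have h := pow_seq (powP (@unif R)) us mA.
rewrite (eq_bigr _ (fun k _ => hk k _ (mA k))) -h -hf.2; last first.
 rewrite (_ : [set x | _] = \bigcap_(k in [set` s]) [set x : @rseq R | A k (x k)]).
  apply: fin_bigcap_measurable => [|k _]; first exact: finite_seq.
  exact: meas_preim (meas_coord k) (mA k).
 by apply/seteqP; split => x.
by congr (P _); apply/seteqP; split => w.
Qed.

Lemma sigma_coord f (mf : measT f) A : sigma_of_sequence (coord_rv mf) A -> exists2 B, measurable B
 & A = f @^-1` B.
Proof.
pose G : set (set Omega) := [set A | exists2 B, measurable B & A = f @^-1` B].
apply: (@smallest_sub _ (sigma_algebra setT) _ G).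
 split.
 - by exists set0 => //; rewrite preimage_set0.
 - move=> B [C mC ->]; exists (~` C); first exact: measurableC.
  by rewrite setTD preimage_setC.
 move=> F hF; exists (\bigcup_k projT1 (cid2 (hF k))).
  by apply: bigcup_measurable => k _; case: (cid2 (hF k)).
 rewrite preimage_bigcup; apply: eq_bigcupr => k _; by case: (cid2 (hF k)).
move=> B [k _ [C mC <-]]; exists [set x : @rseq R | C (x k)].
 exact: meas_preim (meas_coord k) mC.
by rewrite setTI.
Qed.

Lemma independent_coord f g (mf : measT f) (mg : measT g) : mp P (prodP (pow unif) (pow unif)) (fun
 w => (f w, g w)) -> independent_sequences (coord_rv mf) (coord_rv mg).
Proof.
move=> h A B /sigma_coord[A' mA' ->] /sigma_coord[B' mB' ->].
have hf : P (f @^-1` A') = pow unif A' := (mp_comp h (mp_fst _ _)).2 A' mA'.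
have hg : P (g @^-1` B') = pow unif B' := (mp_comp h (mp_snd _ _)).2 B' mB'.
rewrite hf hg -prodPX// -h.2; last exact: measurableX.
by congr (P _); apply/seteqP; split => w.
Qed.

End samples.

(** K is fixed from eps so that the exceptional probability is at most eps; the conditions relating
    K to the level then hold for all large N, and the constant may depend on K. *)
Lemma bigO_of_coupling (R : realType) a (n1 n2 : nat -> nat) (i j : nat -> nat -> nat) (x : nat ->
 R) (pr : nat -> @sample R -> @rseq R * measurableTypeR R) : (forall N, (1 <= N)%N -> forall K : R,
 1 <= K -> 24 * K <= pow2 (level N) -> 4 * Dlev K (level N) <= 1 -> 2 / ssq (@Hc R a) <= pow2
 (level N) -> exists B, small (@sample_law R) (bad_prob a / K) B /\ forall w, ~ B w -> @close_to R
 a N (n1 N) (n2 N) (i N) (j N) (x N) (pr N) (coupling_const a K * Dlev K (level N)) w) -> bigO_P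
 (@sample_law R) (fun N => sup_dist01 (fun v (w : @sample R) => gamma_process a.+1 (n1 N) (n2 N) N
 (i N) (j N) w.1.1.1 w.1.2.1 v) (corrected a.+1 (4 * x N) (fun u w => bridge (level N) (@Hc R a) u
 (pr N w)))) rate.
Proof.
move=> h eps e0; pose K : R := Num.max 1 (bad_prob a / eps).
have K1 : 1 <= K by rewrite le_max lexx.
have K0 : 0 < K := lt_le_trans ltr01 K1.
have Ke : bad_prob a / K <= eps.
 by rewrite ler_pdivrMr// mulrC -ler_pdivrMr// le_max lexx orbT.
exists (`|coupling_const a K| * sqrt (2 * (K + 2 / ln 4 + 3))).
have ll := large_level (Num.max (24 * K) (2 / ssq (@Hc R a))) (ltW K0).
apply: filterS ll => N [N2 lN]; rewrite ge_max => /andP[X1 X2] D4.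
have [B [[mB PB] hB]] := h N (ltnW N2) K K1 X1 D4 X2.
exists B; split => //; last by apply: (le_trans PB); rewrite lee_fin.
move=> w /= hw; apply: contrapT => nB; move: hw; apply/negP; rewrite -leNgt.
set Z := sup_dist01 _ _ w.
have Z0 : (0 <= Z)%E.
 apply: le_trans (ereal_sup_ubound _); last by exists 0 => //=; rewrite in_itv/= lexx ler01.
 by rewrite lee_fin.
rewrite gee0_abs//; apply: ge_ereal_sup => _ [v v01 <-]; rewrite lee_fin.
apply: le_trans (hB w nB v v01) _.
apply: (@le_trans _ _ (`|coupling_const a K| * Dlev K (level N))).
 by rewrite ler_wpM2r ?Dlev_ge0 ?ler_norm.
by rewrite -mulrA ler_wpM2l// Dlev_rate// ltW.
Qed.

Theorem mainTheorem2 (R : realType) (m : nat) (m_ge1 : (1 <= m)%N)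
    (n1 n2 : nat -> nat)
    (le_N : forall N, (1 <= N)%N ->
      (N <= minn (nblocks m (n1 N)) (nblocks m (n2 N)))%N)
    (c d : \bar R) (c_ge0 : (0 <= c)%E) (d_ge0 : (0 <= d)%E)
    (cvg_c : ((excess m (n1 N) N)%:R / N.+1%:R)%:E @[N --> \oo] --> c)
    (cvg_d : ((excess m (n2 N) N)%:R / N.+1%:R)%:E @[N --> \oo] --> d)
    (i j : nat -> nat -> nat)
    (adm_i : forall N, (1 <= N)%N -> admissible m (n1 N) N (i N))
    (adm_j : forall N, (1 <= N)%N -> admissible m (n2 N) N (j N)) :
  exists (disp : measure_display) (Omega : measurableType disp)
    (P : probability Omega R) (X Y : nat -> {RV P >-> R})
    (Bplus Bminus : nat -> R -> Omega -> R),
    let gamma N v w :=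
      gamma_process m (n1 N) (n2 N) N (i N) (j N)
        (fun n => X n w) (fun n => Y n w) v in
    let sqrtR N : R := Num.sqrt (Rcoef m (n1 N) (n2 N) N) in
    [/\ iid_uniform01 X, iid_uniform01 Y & independent_sequences X Y] /\
    (forall N, (1 <= N)%N ->
      [/\ brownian_bridge P (Bplus N),
          brownian_bridge P (Bminus N),
          eq_in_law P (time_changed m (Bplus N)) (corrected m 8 (Bplus N)) &
          eq_in_law P (time_changed m (Bminus N)) (corrected m 8 (Bminus N))]) /\
    bigO_P P (fun N => sup_dist01 (gamma N)
                         (corrected m (4 * (1 + sqrtR N)) (Bplus N))) rate /\
    bigO_P P (fun N => sup_dist01 (gamma N)
                         (corrected m (4 * (1 - sqrtR N)) (Bminus N))) rate.
Proof.
case: m m_ge1 le_N cvg_c cvg_d adm_i adm_j => [//|a] _ le_N _ _ adm_i adm_j.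
pose S := @sample R; pose P := @sample_law R.
have hXY : mp P (prodP (pow unif) (pow unif)) (fun w : S => (w.1.1.1, w.1.2.1)).
  exact: mp_comp (mp_fst _ _) (mp_prod (mp_fst _ _) (mp_fst _ _)).
have hX : mp P (pow unif) (fun w : S => w.1.1.1) := mp_comp hXY (mp_fst _ _).
have hY : mp P (pow unif) (fun w : S => w.1.2.1) := mp_comp hXY (mp_snd _ _).
pose sR N : R := Num.sqrt (Rcoef a.+1 (n1 N) (n2 N) N).
pose good N (pq : (S -> @rseq R * measurableTypeR R) * (S -> @rseq R * measurableTypeR R)) :=
  [/\ mp P (prodP (pow gauss) gauss) pq.1, mp P (prodP (pow gauss) gauss) pq.2 &
   forall K : R, 1 <= K -> 24 * K <= pow2 (level N) -> 4 * Dlev K (level N) <= 1 ->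
     2 / ssq (@Hc R a) <= pow2 (level N) ->
   exists B, small P (bad_prob a / K) B /\ forall w, ~ B w ->
     @close_to R a N (n1 N) (n2 N) (i N) (j N) (1 + sR N) pq.1 (coupling_const a K * Dlev K (level N)) w /\
     @close_to R a N (n1 N) (n2 N) (i N) (j N) (1 - sR N) pq.2 (coupling_const a K * Dlev K (level N)) w].
(* For N = 0 nothing is claimed and an arbitrary pair of maps is chosen. *)
have /choice[pq hpq] N : exists pq, (1 <= N)%N -> good N pq.
  have [N1|N0] := boolP (1 <= N)%N; last by exists ((fun w => w.2), (fun w => w.2)).
  have [pp [pm h]] := @coupling R a N (n1 N) (n2 N) (i N) (j N) N1 (le_N N N1) (adm_i N N1) (adm_j N N1).
  by exists (pp, pm).
pose B (pr : nat -> S -> @rseq R * measurableTypeR R) N u w := bridge (level N) (@Hc R a) u (pr N w).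
exists _, S, P, (coord_rv P hX.1), (coord_rv P hY.1), (B (fun N => (pq N).1)), (B (fun N => (pq N).2)).
split; [|split; [|split]].
- split.
  + exact: (@iid_coord R _ S P _ hX.1 hX).
  + exact: (@iid_coord R _ S P _ hY.1 hY).
  exact: (@independent_coord R _ S P _ _ hX.1 hY.1 hXY).
- move=> N N1; have [h1 h2 _] := hpq N N1.
  have cH := @Hc_continuous R a; have H01 := @Hc_le1 R a; have s0 := @ssq_Hc_gt0 R a.
  split.
  + exact: (bridge_brownian (level N) cH H01 s0 h1).
  + exact: (bridge_brownian (level N) cH H01 s0 h2).
  + exact: (@corrected8_law R (level N) a _ S P _ h1).
  exact: (@corrected8_law R (level N) a _ S P _ h2).
- apply: (bigO_of_coupling (x := fun N => 1 + sR N) (pr := fun N => (pq N).1)) => N N1 K K1 h1 h2 h3.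
  have [_ _ /(_ K K1 h1 h2 h3)[E [sE hE]]] := hpq N N1.
  by exists E; split => // w /hE[].
- apply: (bigO_of_coupling (x := fun N => 1 - sR N) (pr := fun N => (pq N).2)) => N N1 K K1 h1 h2 h3.
  have [_ _ /(_ K K1 h1 h2 h3)[E [sE hE]]] := hpq N N1.
  by exists E; split => // w /hE[].
Qed.
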